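(* Let $L_0$ satisfy the standing assumptions below and, for each $n\ge 0$, let $(X^{(n)}_t, L^{(n)}_t(x))_{x\in 2^{-n}\mathbb Z,\,0\le t\le t^{(n)}_{\max}}$ be the rescaled VRJP defined below. Then, as $n\to+\infty$, $t^{(n)}_{\max}\to+\infty$ in probability, and $$\big(X^{(n)}_{t\wedge t^{(n)}_{\max}},\,L^{(n)}_{t\wedge t^{(n)}_{\max}}(x)\big)_{x\in\mathbb R,\,t\ge 0}$$ converges in law to $(X_t,L_t(x))_{x\in\mathbb R,\,t\ge0}$, where $(X_t)_{t\ge0}$ is the Linearly Reinforced Motion started from $0$ with initial occupation profile $L_0$ and $(L_t)_{t\ge0}$ its occupation profiles. The topology is that of uniform convergence on compact subsets of time, resp. of space-time, where $x\mapsto L^{(n)}_t(x)$ is extended from $2^{-n}\mathbb Z$ to $\mathbb R$ by linear interpolation.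
   Context: Standing assumptions: $L_0:\mathbb R\to(0,+\infty)$ is continuous and $\int_0^{+\infty}L_0(x)^{-2}dx=\int_{-\infty}^0L_0(x)^{-2}dx=+\infty$. Rescaled VRJP: for $n\ge0$, $(X^{(n)}_t)$ is a continuous-time nearest-neighbour process on $2^{-n}\mathbb Z$ started at $0$. Set $\ell^{(n)}_t(x)=2^n\int_0^t\mathbf 1_{\{X^{(n)}_s=x\}}ds$ and $L^{(n)}_t(x)=L_0(x)+\ell^{(n)}_t(x)$ for $x\in2^{-n}\mathbb Z$. Conditionally on the past up to time $t$, the process jumps from its current position $x$ to $x+\sigma2^{-n}$, $\sigma\in\{-1,1\}$, at rate $2^{2n-1}L^{(n)}_t(x+\sigma2^{-n})$. (This is the vertex-reinforced jump process on $2^{-n}\mathbb Z$ with conductances $2^{2n-1}$ and initial local times $2^{-n}L_0(x)$.) It is defined up to an explosion time $t^{(n)}_{\max}\in(0,+\infty]$. Bass–Burdzy flow: let $(B_u)_{u\ge0}$ be a standard Brownian motion started at $0$. For each $y\in\mathbb R$ the equation $\frac{dY_u}{du}=-1$ if $Y_u>B_u$, $\frac{dY_u}{du}=+1$ if $Y_u<B_u$, $Y_0=y$, has a.s. a unique Lipschitz solution; these can be realized simultaneously as a jointly continuous flow $(\Psi^B_u(y))_{y\in\mathbb R,u\ge0}$, adapted to the filtration of $B$, such that each $y\mapsto\Psi^B_u(y)$ is an increasing $C^1$ diffeomorphism of $\mathbb R$. The reduced process is $\xi_u=(\Psi^B_u)^{-1}(B_u)$; it has jointly continuous occupation densities $(\Lambda_u(y))$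 with $\int_0^uf(\xi_v)dv=\int_{\mathbb R}f(y)\Lambda_u(y)dy$ for bounded Borel $f$, and $0\le\Lambda_u(y)<1/2$, $\partial_y\Psi^B_u(y)=1-2\Lambda_u(y)$. Linearly Reinforced Motion (LRM) started from $x_0\in\mathbb R$ with initial occupation profile $L_0$: set $S_0(x)=\int_{x_0}^xL_0(r)^{-2}dr$, $t(u)=\int_0^uL_0(S_0^{-1}(\xi_v))^3(1-2\Lambda_v(\xi_v))^{-3/2}dv$, $u(t)$ the inverse of $t(\cdot)$, $X_t=S_0^{-1}(\xi_{u(t)})$, and occupation profile $L_t(x)=L_0(x)(1-2\Lambda_{u(t)}(S_0(x)))^{-1/2}$. $B$ is called the driving Brownian motion. *)

(* Defs.v *)
From HB Require Import structures.
From mathcomp Require Import all_boot all_order all_algebra.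
From mathcomp Require Import all_classical all_reals all_analysis.
Set Implicit Arguments. Unset Strict Implicit. Unset Printing Implicit Defensive.
Import Order.TTheory GRing.Theory Num.Theory.
Import numFieldNormedType.Exports.
Local Open Scope classical_set_scope.
Local Open Scope ring_scope.

Section Defs.
Context {R : realType}.
Notation leb := (@lebesgue_measure R).

Definition mutually_independent {d} {T : measurableType d} {I : eqType}
  (P : probability T R) (Y : I -> T -> R) : Prop :=
  (forall i, measurable_fun setT (Y i)) /\
  forall (s : seq I), uniq s -> forall A : I -> set R, (forall i, measurable (A i)) ->
    P (\bigcap_(i in [set` s]) (Y i @^-1` A i)) = (\prod_(i <- s) P (Y i @^-1` A i))%E.

(** For each scale n, the randomness used to build the VRJP: independent
    variables E_k ~ Exp(1) (holding-time clocks) and U_k ~ Uniform[0,1]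
    (jump directions), k >= 0. *)
Definition clocks {d} {T : measurableType d} (P : probability T R)
  (E U : nat -> T -> R) : Prop :=
  mutually_independent P (fun i : (nat + nat)%type =>
     match i with inl k => E k | inr k => U k end) /\
  (forall k A, measurable A -> P (E k @^-1` A) = exponential_prob 1 A) /\
  (forall k A, measurable A -> P (U k @^-1` A) = uniform_prob (@ltr01 R) A).

Definition brownian_motion {d} {T : measurableType d} (Q : probability T R)
  (B : R -> T -> R) : Prop :=
  (forall t, measurable_fun setT (B t)) /\
  (forall w, B 0 w = 0) /\
  (forall w, continuous (fun t => B t w)) /\
  (forall s t, 0 <= s -> s < t -> forall A, measurable A ->
     Q ((fun w => B t w - B s w) @^-1` A) = normal_prob 0 (Num.sqrt (t - s)) A) /\
  (forall ts : seq R, sorted <%R ts -> all (fun t => 0 <= t) ts ->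
     mutually_independent Q (fun i : 'I_(size ts).-1 =>
        fun w => B (nth 0 ts i.+1) w - B (nth 0 ts i) w)).

Definition adapted_to {d} {T : measurableType d} (B : R -> T -> R)
  (Z : R -> T -> R) : Prop :=
  forall u, 0 <= u -> forall A : set R, measurable A ->
    <<s [set C | exists v (D : set R), [/\ 0 <= v, v <= u, measurable D &
                                           C = B v @^-1` D]] >> (Z u @^-1` A).

(** State after m jumps: (current site k, meaning position k 2^-n;
    accumulated local times ell(j) = 2^n * time spent at site j;
    time of the m-th jump).  From site k, with L(j) = L0(j 2^-n) + ell(j),
    the holding time is Exp of total rate 2^(2n-1)(L(k-1)+L(k+1)), realized as
    E_m / rate, and the jump goes to k+1 with probability
    L(k+1)/(L(k-1)+L(k+1)), realized as U_m (L(k-1)+L(k+1)) < L(k+1). *)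
Fixpoint vrjp_state (n : nat) (L0 : R -> R) (E U : nat -> R) (m : nat)
  : int * (int -> R) * R :=
  match m with
  | 0%N => (0%Z, fun _ => 0, 0)
  | m'.+1 =>
    let: (k, ell, J) := vrjp_state n L0 E U m' in
    let Lat j := L0 (j%:~R / 2 ^+ n) + ell j in
    let lm := Lat (k - 1)%R in
    let lp := Lat (k + 1)%R in
    let tau := E m' / (2 ^+ (2 * n) / 2 * (lm + lp)) in
    ((if U m' * (lm + lp) < lp then k + 1 else k - 1)%R,
     (fun j => if j == k then ell j + 2 ^+ n * tau else ell j),
     J + tau)
  end.

Definition vrjp_site n L0 E U m : int := (vrjp_state n L0 E U m).1.1.
Definition vrjp_jump n L0 E U m : R := (vrjp_state n L0 E U m).2.

Definition vrjp_tmax n L0 E U : \bar R :=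
  ereal_sup (range (fun m => (vrjp_jump n L0 E U m)%:E)).

(** Position X^(n)_{t /\ t_max}.  For t < t_max it is 2^-n times the site
    occupied at time t; convention: 0 for t >= t_max. *)
Definition vrjp_X n L0 E U (t : R) : R :=
  limn (fun M => \sum_(m < M)
    (if (vrjp_jump n L0 E U m <= t) && (t < vrjp_jump n L0 E U m.+1)
     then (vrjp_site n L0 E U m)%:~R / 2 ^+ n else (0 : R))).

(** Local time ell^(n)_{t /\ t_max}(j 2^-n) = 2^n * time spent at site j
    before time t /\ t_max. *)
Definition vrjp_ell n L0 E U (t : R) (j : int) : R :=
  limn (fun M => \sum_(m < M)
    (if vrjp_site n L0 E U m == j
     then 2 ^+ n * (Num.min t (vrjp_jump n L0 E U m.+1)
                    - Num.min t (vrjp_jump n L0 E U m))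
     else (0 : R))).

Definition vrjp_L n L0 E U (t x : R) : R :=
  let Lg (j : int) := L0 (j%:~R / 2 ^+ n) + vrjp_ell n L0 E U t j in
  let k := Num.floor (2 ^+ n * x) in
  let th := 2 ^+ n * x - k%:~R in
  (1 - th) * Lg k + th * Lg (k + 1)%R.

Definition reduced_process (b : R -> R) (Psi : R -> R -> R) (u : R) : R :=
  xget 0 [set y | Psi u y = b u].

Definition bass_burdzy (b : R -> R) (Psi Lam : R -> R -> R) : Prop :=
  {within [set p : R * R | 0 <= p.1], continuous (fun p => Psi p.1 p.2)} /\
  (* each u |-> Psi_u(y) is the Lipschitz solution of the ODE from y *)
  (forall y, Psi 0 y = y) /\
  (forall y, exists K : R, forall u v, 0 <= u -> 0 <= v ->
       `|Psi u y - Psi v y| <= K * `|u - v|) /\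
  (forall y u : R, 0 < u -> b u < Psi u y -> is_derive u 1 (fun s => Psi s y) (-1)) /\
  (forall y u : R, 0 < u -> Psi u y < b u -> is_derive u 1 (fun s => Psi s y) 1) /\
  (forall u : R, 0 <= u -> forall y1 y2, y1 < y2 -> Psi u y1 < Psi u y2) /\
  (forall u : R, 0 <= u -> forall z, exists y, Psi u y = z) /\
  (forall u : R, 0 <= u -> forall y : R, is_derive y 1 (Psi u) (1 - 2 * Lam u y)) /\
  (* Lam: jointly continuous occupation densities of xi_u = Psi_u^-1(B_u) *)
  {within [set p : R * R | 0 <= p.1], continuous (fun p => Lam p.1 p.2)} /\
  (forall u y : R, 0 <= u -> 0 <= Lam u y /\ Lam u y < 1 / 2) /\
  (forall u : R, 0 <= u -> forall f : R -> R, measurable_fun setT f ->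
     (exists M, forall x, `|f x| <= M) ->
     (\int[leb]_(v in `[0%R, u]) (f (reduced_process b Psi v))%:E =
      \int[leb]_y (f y * Lam u y)%:E)%E).

Definition S0 (L0 : R -> R) (x : R) : R :=
  if 0 <= x then Rintegral leb `[0, x] (fun r => (L0 r) ^-2)
  else - Rintegral leb `[x, 0] (fun r => (L0 r) ^-2).

Definition S0inv (L0 : R -> R) (y : R) : R := xget 0 [set x | S0 L0 x = y].

Definition lrm_clock L0 b Psi (Lam : R -> R -> R) (u : R) : R :=
  Rintegral leb `[0, u] (fun v =>
    let xv := reduced_process b Psi v in
    (L0 (S0inv L0 xv)) ^+ 3 * powR (1 - 2 * Lam v xv) (- (3 / 2))).

Definition lrm_time L0 b Psi Lam (t : R) : R :=
  xget 0 [set u | 0 <= u /\ lrm_clock L0 b Psi Lam u = t].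

Definition lrm_X L0 b Psi Lam (t : R) : R :=
  S0inv L0 (reduced_process b Psi (lrm_time L0 b Psi Lam t)).

Definition lrm_L L0 b Psi (Lam : R -> R -> R) (t x : R) : R :=
  L0 x * powR (1 - 2 * Lam (lrm_time L0 b Psi Lam t) (S0 L0 x)) (- (1 / 2)).

Definition pathspace := ((R -> R) * (R -> R -> R))%type.

Definition lu_continuous (F : pathspace -> R) : Prop :=
  forall z (e : R), 0 < e -> exists Tm (dl : R), 0 < Tm /\ 0 < dl /\
    forall z' : pathspace,
      (forall t x, 0 <= t <= Tm -> `|x| <= Tm ->
         `|z.1 t - z'.1 t| < dl /\ `|z.2 t x - z'.2 t x| < dl) ->
      `|F z - F z'| < e.

Definition coord_sets : set (set pathspace) :=
  [set C | exists t (A : set R), [/\ 0 <= t, measurable A &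
           C = [set z | A (z.1 t)]]] `|`
  [set C | exists t x (A : set R), [/\ 0 <= t, measurable A &
           C = [set z | A (z.2 t x)]]].

Definition coord_measurable (F : pathspace -> R) : Prop :=
  forall A : set R, measurable A -> <<s coord_sets >> (F @^-1` A).

(** Convergence in law: E[F(Z_n)] -> E[F(Z)] for every bounded F that is
    continuous for the locally uniform topology and measurable for the
    coordinate (= ball) sigma-algebra. *)
Definition converges_in_law {d d'} {T : measurableType d} {T' : measurableType d'}
  (P : probability T R) (Zn : nat -> T -> pathspace)
  (Q : probability T' R) (Z : T' -> pathspace) : Prop :=
  forall F : pathspace -> R,
    (exists M, forall z, `|F z| <= M) -> lu_continuous F -> coord_measurable F ->
    ((fun n => \int[P]_w (F (Zn n w))%:E) @ \oo --> \int[Q]_w (F (Z w))%:E)%E.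

End Defs.

(* Main.v *)
(** Give the edge {j, j+1} the length h / (L(j) L(j+1)), h = 2^-n, L the current local times. The
    resulting scale function S_k changes while the VRJP waits and makes M_k = S_k(X_k) a martingale
    for a clock W_k. Exponential supermartingales and Ville's inequality give, uniformly in n, moduli
    of continuity for log L in space and for M in the time W, and exclude explosion.

    During a holding time the two sides of S_k are pushed towards the current site, so S_k is
    approximately the Bass-Burdzy flow driven by M. The flow is a contraction with respect to its
    driving path; hence paths with these moduli whose increments of M converge to those of a
    Brownian path converge to the LRM driven by it.

    After averaging over the holding times, the conditional variance of M is exactly the increment
    of W, and Lindeberg replacement with the heat semigroup shows that finitely many increments of M
    are asymptotically Brownian. Convergence in law follows by applying this to Lipschitz upper
    envelopes of the test functional, seen as a function of the dyadic increments of M. *)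
Require Import Defs.
From HB Require Import structures.
From mathcomp Require Import all_boot all_order all_algebra.
From mathcomp Require Import all_classical all_reals all_analysis.
From mathcomp Require Import measurable_realfun.
From mathcomp Require Import ring lra zify.
Set Implicit Arguments. Unset Strict Implicit. Unset Printing Implicit Defensive.
Import Order.TTheory GRing.Theory Num.Theory.
Import numFieldNormedType.Exports.
Local Open Scope classical_set_scope.
Local Open Scope ring_scope.

(** The length of an edge is dictated by the jump rates: the probability of a jump is proportional
    to the local time at its target, and multiplying by the length of the crossed edge gives the
    same value on both sides. The price is a scale function that moves, and its motion is both the
    clock and the flow. The main obstacle is that local times have no a priori bound, while every
    estimate has to be uniform in n. Clipping the martingale between two sites produces, as in
    Tanaka's formula, the logarithms of the local times at these sites; they are compared in pairs,
    and chaining over dyadic levels carries the comparison from an end of the window that has never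
    been visited to all other sites. The chains and the Brownian motion live on unrelated spaces, so
    a deterministic statement is isolated: it concerns arbitrary sequences of sample points, one for
    each scale, and is proved along an ultrafilter, where bounded quantities have limits that only
    need to be identified. The envelope turns this statement into an inequality between
    expectations, which is used for [F] and for [- F]. *)

(** * Independence of a fresh variable from the past *)

Section past.
Context {R : realType} d {T : measurableType d} (P : probability T R).
Context {I : eqType} (Y : I -> T -> R).
Hypothesis indY : mutually_independent P Y.

Let mY i : measurable_fun setT (Y i) := indY.1 i.

Definition past_gen (K : set I) : set (set T) :=
  [set C | exists i (A : set R), [/\ K i, measurable A & C = Y i @^-1` A]].

Definition past_pi (K : set I) : set (set T) :=
  [set C | exists (s : seq I) (A : I -> set R), [/\ uniq s, [set` s] `<=` K,
     (forall i, measurable (A i)) & C = \bigcap_(i in [set` s]) (Y i @^-1` A i)]].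

Local Notation past K := (g_sigma_algebraType (past_gen K)).

Lemma measurable_Y i A : measurable A -> measurable (Y i @^-1` A).
Proof. by move=> mA; rewrite -[_ @^-1` _]setTI; exact: mY. Qed.

Lemma past_pi_setI K : setI_closed (past_pi K).
Proof.
move=> _ _ [s [A [us sK mA ->]]] [t [B [ut tK mB ->]]].
exists (undup (s ++ t)), (fun i => (if i \in s then A i else setT) `&`
  (if i \in t then B i else setT)); split.
- exact: undup_uniq.
- move=> i /=; rewrite mem_undup mem_cat => /orP[|]; [exact: sK|exact: tK].
- by move=> i; apply: measurableI; case: ifP.
apply/seteqP; split=> w /=.
  move=> [h1 h2] i /= _; split; case: ifP => //.
    by move=> si; exact: h1.
  by move=> ti; exact: h2.
move=> h; split=> i /= si.
  by have := h i; rewrite /= mem_undup mem_cat si => /(_ isT)[].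
by have := h i; rewrite /= mem_undup mem_cat si orbT => /(_ isT)[].
Qed.

Lemma past_gen_pi K : past_gen K `<=` past_pi K.
Proof.
move=> _ [i [A [Ki mA ->]]]; exists [:: i], (fun=> A); split => //.
  by move=> j /=; rewrite inE => /eqP ->.
by apply/seteqP; split=> w /= => [Aw j /=|h]; [rewrite inE => /eqP ->|apply: (h i); rewrite /= inE].
Qed.

Lemma past_measurable K : <<s past_gen K >> `<=` @measurable d T.
Proof.
apply: smallest_sub; first exact: sigma_algebra_measurable.
by move=> _ [i [A [Ki mA ->]]]; exact: measurable_Y.
Qed.

Lemma past_pi_measurable K : past_pi K `<=` @measurable d T.
Proof.
move=> _ [s [A [us sK mA ->]]]; apply: fin_bigcap_measurable => //.
by move=> i _; exact: measurable_Y.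
Qed.

(** Dynkin's argument: [mutually_independent] speaks of finite intersections of preimages only.
    These form the pi-system [past_pi], and the events independent of the given event on [Y i] form
    a lambda-system that contains it. *)
Lemma past_indep (K : set I) i C B : ~ K i -> <<s past_gen K >> C ->
  measurable B -> P (C `&` Y i @^-1` B) = (P C * P (Y i @^-1` B))%E.
Proof.
move=> nKi KC mB; set D := Y i @^-1` B.
have mD : measurable D by exact: measurable_Y.
have {}KC : <<s past_pi K >> C.
  by move: C KC; apply: sub_smallest2r => //; exact: past_gen_pi.
suff [] : measurable C /\ P (C `&` D) = (P C * P D)%E by [].
have lam : lambda_system setT [set C | measurable C /\ P (C `&` D) = (P C * P D)%E].
  apply/dynkin_lambda_system; split => /=.
  - by rewrite setTI probability_setT mul1e.
  - move=> A [mA PA]; split; first exact: measurableC.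
    have -> : ~` A `&` D = D `\` (A `&` D).
      by apply/seteqP; split=> x /=; [move=> [? ?]; split => // -[]|
        move=> [Dx h]; split => // Ax; apply: h].
    have E1 : P (D `\` (A `&` D)) = (P D - P (D `&` (A `&` D)))%E.
      rewrite measureD //; last by rewrite ltey_eq fin_num_measure.
      exact: measurableI.
    rewrite E1.
    have -> : D `&` (A `&` D) = A `&` D.
      by apply/seteqP; split=> x /= [] // => [? []|].
    rewrite PA probability_setC// muleBl ?fin_num_measure// ?mul1e//.
  - move=> F tF FF; split; first by apply: bigcup_measurable => k _; case: (FF k).
    have tFD : trivIset setT (fun k => F k `&` D).
      by apply: trivIset_setIr.
    rewrite setI_bigcupl.
    rewrite measure_bigcup//; last by move=> k _; apply: measurableI => //; case: (FF k).
    rewrite measure_bigcup//; last by move=> k _; case: (FF k).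
    transitivity (\sum_(0 <= k <oo | k \in [set: nat]) (P (F k) * P D))%E.
      by apply: eq_eseriesr => k _; exact: (FF k).2.
    rewrite [RHS]muleC -[in RHS](fineK (fin_num_measure P _ mD)) -nneseriesZl//.
    by apply: eq_eseriesr => k _; rewrite fineK ?fin_num_measure// muleC.
have sub : past_pi K `<=` [set C | measurable C /\ P (C `&` D) = (P C * P D)%E].
  move=> A Api; have mA := past_pi_measurable Api; split => //.
  move: Api => [s [A' [us sK mA' AE]]].
  have nis : i \notin s by apply/negP => si; apply: nKi; exact: sK.
  have us' : uniq (i :: s) by rewrite /= nis.
  pose B' j := if j == i then B else A' j.
  have mB' j : measurable (B' j) by rewrite /B'; case: ifP.
  have := indY.2 _ us' _ mB'; rewrite big_cons {2}/B' eqxx.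
  have E1 : \bigcap_(j in [set` (i :: s)]) (Y j @^-1` B' j) = A `&` D.
    rewrite AE; apply/seteqP; split=> w /=.
      move=> h; split; last by have := h i; rewrite /= inE eqxx /B' eqxx; exact.
      move=> j /= js; have := h j; rewrite /= inE js orbT /B'.
      by case: eqP => [ji|_]; [move: nis; rewrite -ji js|apply].
    move=> [hA hD] j /=; rewrite inE /B'; case: eqP => [->//|_ /=]; exact: hA.
  rewrite E1 => ->; rewrite muleC; congr (_ * _)%E.
  rewrite AE (indY.2 _ us _ mA'); apply: eq_big_seq => j js.
  by rewrite /B'; case: eqP => // ji; move: nis; rewrite -ji js.
move: KC; apply: (lambda_system_subset (@past_pi_setI K) lam sub).
by move=> X _.
Qed.

Lemma past_id_measurable K : measurable_fun setT (id : T -> past K).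
Proof. by move=> _ A KA; rewrite setTI preimage_id; exact: past_measurable KA. Qed.

Lemma past_measurable_fun K d' (T' : measurableType d') (f : T -> T') :
  measurable_fun setT (f : past K -> T') -> measurable_fun setT f.
Proof.
move=> mf _ A mA; have := mf measurableT A mA; rewrite !setTI.
exact: past_measurable.
Qed.

Lemma past_mono (K K' : set I) d' (T' : measurableType d') (f : T -> T') :
  K `<=` K' -> measurable_fun setT (f : past K -> T') ->
  measurable_fun setT (f : past K' -> T').
Proof.
move=> KK' mf _ A mA; have := mf measurableT A mA; rewrite !setTI.
apply: sub_smallest2r; last by move=> _ [i [B [Ki mB ->]]]; exists i, B; split => //; exact: KK'.
exact: smallest_sigma_algebra.
Qed.

Lemma past_Y (K : set I) i : K i -> measurable_fun setT (Y i : past K -> R).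
Proof.
move=> Ki _ A mA; rewrite setTI; apply: sub_sigma_algebra; by exists i, A.
Qed.

(** The freezing lemma for conditional expectations. By [past_indep] the pair of the past and [Y i]
    has a product law, so Tonelli integrates the fresh variable out while the past stays fixed;
    viewing [id] as a map into the coarser space [past K] keeps the result measurable with respect
    to the past. *)
Lemma past_step (K : set I) i (nu : probability (measurableTypeR R) R)
  (G : past K * measurableTypeR R -> \bar R) :
  ~ K i -> (forall A, measurable A -> P (Y i @^-1` A) = nu A) ->
  measurable_fun setT G -> (forall z, 0 <= G z)%E ->
  measurable_fun setT (fun w : past K => \int[nu]_y G (w, y))%E /\
  (\int[P]_w G (w, Y i w) = \int[P]_w \int[nu]_y G (w, y))%E.
Proof.
move=> nKi Ynu mG G0.
have mW : measurable_fun setT (fun w : past K => \int[nu]_y G (w, y))%E.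
  by apply: (@measurable_fun_fubini_tonelli_F _ _ _ _ R nu G).
split => //.
pose phi (w : T) : past K * measurableTypeR R := (w, Y i w).
have mphi : measurable_fun setT phi.
  by apply: measurable_fun_pair; [exact: past_id_measurable|exact: mY].
pose m1 := pushforward P (id : T -> past K).
have mid := @past_id_measurable K.
pose idm := isMeasurableFun.Build _ _ _ _ _ mid.
pose idf : {mfun T >-> past K} := HB.pack (id : T -> past K) idm.
pose phim := isMeasurableFun.Build _ _ _ _ _ mphi.
pose phif : {mfun T >-> (past K * measurableTypeR R)%type} := HB.pack phi phim.
pose mm : probability (past K) R := distribution P idf.
pose mp : probability (past K * measurableTypeR R)%type R := distribution P phif.
have mpE A B : measurable A -> measurable B -> mp (A `*` B) = (mm A * nu B)%E.
  move=> mA mB; rewrite -Ynu// /mp /mm /distribution /pushforward /=.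
  by rewrite -(past_indep nKi mA mB).
transitivity (\int[mp]_z G z)%E.
  rewrite /mp /distribution ge0_integral_pushforward//=.
transitivity (\int[mm \x nu]_z G z)%E.
  apply: eq_measure_integral => A mA _; apply/esym.
  by apply: product_measure_unique => // B C mB mC; exact: mpE.
rewrite fubini_tonelli1//= /fubini_F.
rewrite /mm /distribution ge0_integral_pushforward//=.
by move=> w _; apply: integral_ge0.
Qed.

End past.

(** * Integration against the exponential and uniform laws *)

Section density.
Context {R : realType} d (T : measurableType d).
Variables (mu nu : {measure set T -> \bar R}) (p : T -> R).
Hypotheses (mp : measurable_fun setT p) (p0 : forall x, 0 <= p x).
Hypothesis nuE : forall A, measurable A -> nu A = (\int[mu]_(x in A) (p x)%:E)%E.

Import HBNNSimple.

Let density_nnsfun (f : {nnsfun T >-> R}) :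
  (\int[nu]_x (f x)%:E = \int[mu]_x ((f x)%:E * (p x)%:E))%E.
Proof.
under [LHS]eq_integral do rewrite fimfunE -fsumEFin//.
rewrite [LHS]ge0_integral_fsum//; last 2 first.
  - by move=> r; exact/measurable_EFinP/measurableT_comp.
  - by move=> n x _; rewrite EFinM nnfun_muleindic_ge0.
under [RHS]eq_integral.
  move=> x xD; rewrite fimfunE -fsumEFin// ge0_mule_fsuml; last first.
    by move=> r; rewrite EFinM nnfun_muleindic_ge0.
  over.
rewrite [RHS]ge0_integral_fsum//; last 2 first.
  - move=> r; apply: emeasurable_funM; last exact/measurable_EFinP.
    exact/measurable_EFinP/measurableT_comp.
  - move=> n x _; rewrite EFinM mule_ge0//; first by rewrite nnfun_muleindic_ge0.
    by rewrite lee_fin.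
apply: eq_fsbigr => r /[!inE] rf.
rewrite integralZl_indic_nnsfun//= integral_indic// setIT nuE//.
rewrite integral_mkcond -ge0_integralZl//; last 3 first.
  - apply/(measurable_restrictT _ _).1 => //.
    by apply: measurable_funTS; exact/measurable_EFinP.
  - by move=> x _; apply: erestrict_ge0 => y _; rewrite lee_fin.
  - by case: rf => y _ <-; rewrite lee_fin.
apply: eq_integral => x _; rewrite patchE indicE.
by case: ifPn => _; rewrite ?mulr1 ?mulr0// mul0e mule0.
Qed.

(** Simple functions first, then monotone convergence. It serves the exponential law of the holding
    variables and the Gaussian law of the Brownian increments. *)
Lemma density_integral (f : T -> \bar R) :
  measurable_fun setT f -> (forall x, 0 <= f x)%E ->
  (\int[nu]_x f x = \int[mu]_x (f x * (p x)%:E))%E.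
Proof.
move=> mf f0.
pose f_ := nnsfun_approx measurableT mf.
transitivity (lim (\int[nu]_x (f_ n x)%:E @[n --> \oo])%E).
  rewrite -monotone_convergence//=.
  - apply: eq_integral => ? /[!inE] xD; apply/esym/cvg_lim => //=.
    exact: cvg_nnsfun_approx.
  - by move=> n; exact/measurable_EFinP/measurable_funTS.
  - by move=> n ? _; rewrite lee_fin.
  - by move=> ? _ ? ? mn; rewrite lee_fin; exact/lefP/nd_nnsfun_approx.
transitivity (lim (\int[mu]_x ((f_ n x)%:E * (p x)%:E) @[n --> \oo])%E).
  by apply: congr_lim; apply/funext => n /=; exact: density_nnsfun.
rewrite -monotone_convergence//=.
- apply: eq_integral => x /[!inE] xD; apply/cvg_lim => //=.
  by apply: cvgeZr => //; exact: cvg_nnsfun_approx.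
- move=> n; apply: emeasurable_funM; exact/measurable_EFinP.
- by move=> n x _; rewrite mule_ge0// lee_fin.
- move=> x _ m n mn; apply: lee_wpmul2r; rewrite lee_fin//.
  exact/lefP/nd_nnsfun_approx.
Qed.

End density.

Section laws.
Context {R : realType}.
Local Notation leb := (@lebesgue_measure R).


Lemma expo_integral (nu : probability (measurableTypeR R) R) (f : measurableTypeR R -> \bar R) :
  (forall A, measurable A -> nu A = exponential_prob 1 A) ->
  measurable_fun setT f -> (forall x, 0 <= f x)%E ->
  (\int[nu]_x f x = \int[leb]_(x in `[0%R, +oo[) (f x * (expR (- x))%:E))%E.
Proof.
move=> nuE mf f0.
rewrite (density_integral (mu := leb) (p := exponential_pdf 1)) //; last 2 first.
- exact: measurable_exponential_pdf.
- exact: exponential_pdf_ge0.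
rewrite [RHS]integral_mkcond; apply: eq_integral => x _.
rewrite patchE /exponential_pdf patchE.
by case: ifPn => _; rewrite ?mule0// mul1r mulN1r.
Qed.

Lemma unif_integral (nu : probability (measurableTypeR R) R) (lm lp A B : R) :
  (forall S, measurable S -> nu S = uniform_prob (@ltr01 R) S) ->
  0 < lm -> 0 < lp -> 0 <= A -> 0 <= B ->
  (\int[nu]_u (if u * (lm + lp) < lp then A else B)%:E =
    ((lp * A + lm * B) / (lm + lp))%:E)%E.
Proof.
move=> nuE lm0 lp0 A0 B0.
have s0 : 0 < lm + lp by rewrite addr_gt0.
have mf : measurable_fun setT (fun u : measurableTypeR R => (if u * (lm + lp) < lp then A else B)%:E).
  apply/measurable_EFinP; apply: measurable_fun_ifT => //.
  by apply: measurable_fun_ltr => //; exact: mulrr_measurable.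
rewrite (eq_measure_integral (uniform_prob (@ltr01 R))); last by move=> S mS _; exact: nuE.
rewrite integral_uniform //; last by move=> u; rewrite lee_fin; case: ifP.
rewrite subr0 invr1 mul1e.
pose q := lp / (lm + lp).
have q0 : 0 < q by rewrite divr_gt0.
have q1 : q < 1 by rewrite ltr_pdivrMr// mul1r ltrDr.
have -> : `[0%R, 1%R]%classic = `[0%R, q[ `|` `[q, 1%R] :> set R.
  by rewrite -itv_bndbnd_setU // bnd_simp ltW.
rewrite ge0_integral_setU //=; last 3 first.
- exact: measurable_funTS.
- by move=> u _; rewrite lee_fin; case: ifP.
- by apply/disj_set2P; rewrite -subset0 => u [] /=; rewrite !in_itv /= => /andP[_ h1] /andP[h2 _]; have := le_lt_trans h2 h1; rewrite ltxx.
have -> : (\int[leb]_(x in `[0%R, q[) (if x * (lm + lp) < lp then A else B)%:E =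
    \int[leb]_(x in `[0%R, q[) (cst A%:E x))%E.
  apply: eq_integral => u; rewrite inE /= in_itv /= => /andP[_ uq].
  by rewrite ifT // -ltr_pdivlMr.
have -> : (\int[leb]_(x in `[q, 1%R]) (if x * (lm + lp) < lp then A else B)%:E =
    \int[leb]_(x in `[q, 1%R]) (cst B%:E x))%E.
  apply: eq_integral => u; rewrite inE /= in_itv /= => /andP[qu _].
  by rewrite ifF // -ltr_pdivlMr //; apply/negbTE; rewrite -leNgt.
rewrite !integral_cst //= !lebesgue_measure_itv /= !lte_fin q0 q1 oppr0 adde0.
rewrite -EFinB -!EFinM -EFinD; congr EFin; rewrite /q; field; lra.
Qed.

(* [exp(-x)(G - G')] is the derivative of [- exp(-x) G]. *)
Lemma exp_ibp (G G' : R -> R) :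
  (forall x : R, 0 <= x -> is_derive x 1 G (G' x)) ->
  (forall x : R, 0 <= x -> {for x, continuous G'}) ->
  (forall x : R, 0 <= x -> 0 <= G x - G' x) ->
  (fun x => expR (- x) * G x) @ +oo --> (0 : R) ->
  (\int[leb]_(x in `[0%R, +oo[) ((G x - G' x)%:E * (expR (- x))%:E) = (G 0)%:E)%E.
Proof.
move=> dG cG' pos lim0.
have cG (x : R) : 0 <= x -> {for x, continuous G}.
  by move=> x0; apply/differentiable_continuous/derivable1_diffP; case: (dG x x0).
have cE (x : R) : {for x, continuous (fun x : R => expR (- x))}.
  apply: continuous_comp; [exact: opp_continuous|exact: continuous_expR].
pose F x := - (expR (- x) * G x).
pose f x := (G x - G' x) * expR (- x).
have dF (x : R) : 0 <= x -> is_derive x 1 F (f x).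
  move=> x0; have := dG x x0 => dGx.
  have dE : is_derive x 1 (fun x : R => expR (- x)) (- expR (- x)).
    have -> : - expR (- x) = expR (- x) *: (-1 : R) by rewrite /GRing.scale /= mulrN1.
    by apply: (@is_derive1_comp R expR -%R).
  rewrite /F /f; apply: is_derive_eq.
  by rewrite /GRing.scale /=; ring.
have cf (x : R) : 0 <= x -> {for x, continuous f}.
  by move=> x0; apply: continuousM => //; apply: continuousB; [exact: cG|exact: cG'].
rewrite (_ : (G 0)%:E = (0%:E - (F 0)%:E)%E); last first.
  by rewrite /F oppr0 expR0 mul1r -EFinB sub0r opprK.
under eq_integral do rewrite -EFinM.
apply: ge0_continuous_FTC2y.
- by move=> x x0; rewrite mulr_ge0 ?expR_ge0 ?pos.
- apply: continuous_in_subspaceT => x; rewrite inE /= in_itv /= andbT; exact: cf.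
- rewrite /F -oppr0; exact: cvgN.
- by move=> x x0; case: (dF x (ltW x0)).
- apply: cvg_at_right_filter; rewrite /F.
  apply: cvgN; apply: cvgM; [exact: (cE 0)|exact: (cG 0)].
- move=> x; rewrite in_itv /= andbT => x0.
  by rewrite derive1E; have [_ ->] := dF x (ltW x0).
Qed.

End laws.

(** * One step of the VRJP together with its scale function *)

Section vstate.
Context {R : realType}.

(* State of the VRJP before a jump: position, local times, scale function, clock of the martingale
   [sM], real time, and the sum of the (holding variable - ln 2). While the switch [chi m] is on,
   [sA], [sB], [sC] add up the increments of the martingale, those of the clock, and the steps. *)
Record vst := VSt { sX : int; sL : int -> R; sS : int -> R; sW : R; sJ : R;
  sE : R; sA : nat -> R; sB : nat -> R; sC : nat -> R }.

Variable h : R.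

Definition lmv s := sL s (sX s - 1).
Definition lpv s := sL s (sX s + 1).
Definition lcv s := sL s (sX s).
(** Spending the exponential variable x at the current site lasts h x / kap in real time, hence adds
    x / kap to its local time, which is 2^n times the time spent. *)
Definition kap s := (lmv s + lpv s) / (2 * h).
Definition lcn s x := lcv s + x / kap s.
(** [alp] and [alm] are the lengths that the right and the left edge lose during the wait; [ajp] and
    [ajm] below are the lengths that remain and that a jump crosses. *)
Definition alp s x := h / lpv s * ((lcv s)^-1 - (lcn s x)^-1).
Definition alm s x := h / lmv s * ((lcv s)^-1 - (lcn s x)^-1).
Definition dW s x := (alp s x + alm s x) / 2.
Definition ajp s x := h / (lcn s x * lpv s).
Definition ajm s x := h / (lcn s x * lmv s).
Definition dM s x (b : bool) := if b then ajp s x else - ajm s x.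
Definition sM s := sS s (sX s).

Variable chi : nat -> vst -> R.

(** The scale function keeps its value at the current site during a wait: the sites on the right
    move left by [alp], those on the left move right by [alm]. The constant ln 2 fits the mean 1/2
    of exp(-x) under the exponential law, see [F5]. *)
Definition step s x (b : bool) := VSt
  (if b then sX s + 1 else sX s - 1)
  (fun j => if j == sX s then lcn s x else sL s j)
  (fun j => if sX s < j then sS s j - alp s x
            else if j < sX s then sS s j + alm s x else sS s j)
  (sW s + dW s x) (sJ s + h * (lcn s x - lcv s)) (sE s + (x - ln 2))
  (fun m => sA s m + chi m s * dM s x b)
  (fun m => sB s m + chi m s * dW s x)
  (fun m => sC s m + chi m s).

Fixpoint run (s0 : vst) (e u : nat -> R) k : vst :=
  if k is k'.+1 then
    let s := run s0 e u k' in step s (e k') (u k' * (lmv s + lpv s) < lpv s)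
  else s0.

Variable lo : int -> R.

(** [lo] will be the initial profile, a lower bound because local times only grow. The second clause
    is the invariant that ties the scale function to the current local times. *)
Definition valid s := (forall j, 0 < lo j <= sL s j) /\
  (forall j, sS s (j + 1) - sS s j = h / (sL s j * sL s (j + 1))) /\
  (forall m, 0 <= sC s m).

Lemma valid_gt0 s j : valid s -> 0 < sL s j.
Proof. by case=> /(_ j)/andP[l0 lL] _; exact: lt_le_trans lL. Qed.

Hypotheses (h0 : 0 < h) (chi0 : forall m s, 0 <= chi m s).

Section onestep.
Variables (s : vst) (x : R).
Hypotheses (vs : valid s) (x0 : 0 <= x).

Lemma lmv_gt0 : 0 < lmv s. Proof. exact: valid_gt0. Qed.
Lemma lpv_gt0 : 0 < lpv s. Proof. exact: valid_gt0. Qed.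
Lemma lcv_gt0 : 0 < lcv s. Proof. exact: valid_gt0. Qed.
Lemma kap_gt0 : 0 < kap s.
Proof. by rewrite divr_gt0 ?mulr_gt0 // addr_gt0 ?lmv_gt0 ?lpv_gt0. Qed.
Lemma lcn_ge : lcv s <= lcn s x.
Proof. by rewrite lerDl divr_ge0 // ltW // kap_gt0. Qed.
Lemma lcn_gt0 : 0 < lcn s x. Proof. exact: lt_le_trans lcv_gt0 lcn_ge. Qed.

Lemma lcinv_ge0 : 0 <= (lcv s)^-1 - (lcn s x)^-1.
Proof. by rewrite subr_ge0 lef_pV2 ?posrE ?lcv_gt0 ?lcn_gt0 // lcn_ge. Qed.
Lemma alp_ge0 : 0 <= alp s x.
Proof. by rewrite mulr_ge0 ?lcinv_ge0 // divr_ge0 // ltW // lpv_gt0. Qed.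
Lemma alm_ge0 : 0 <= alm s x.
Proof. by rewrite mulr_ge0 ?lcinv_ge0 // divr_ge0 // ltW // lmv_gt0. Qed.
Lemma dW_ge0 : 0 <= dW s x.
Proof. by rewrite divr_ge0 // addr_ge0 ?alp_ge0 ?alm_ge0. Qed.
Lemma ajp_gt0 : 0 < ajp s x.
Proof. by rewrite divr_gt0 // mulr_gt0 ?lcn_gt0 ?lpv_gt0. Qed.
Lemma ajm_gt0 : 0 < ajm s x.
Proof. by rewrite divr_gt0 // mulr_gt0 ?lcn_gt0 ?lmv_gt0. Qed.

(* The jump probabilities are proportional to [lpv] and [lmv], so this centers the jump of [sM]. *)
Lemma dM_center : lpv s * ajp s x = lmv s * ajm s x.
Proof.
rewrite /ajp /ajm; have := lmv_gt0; have := lpv_gt0; have := lcn_gt0.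
by move=> *; field; rewrite ?andbT; do ?[apply/andP; split]; rewrite gt_eqF.
Qed.

Lemma valid_step b : valid (step s x b).
Proof.
have [L0 [SE C0]] := vs; split; [|split; last by move=> m; exact: addr_ge0] => j /=.
  have /andP[-> /= lj] := L0 j; case: eqP => // jX.
  by apply: le_trans lj _; rewrite jX; exact: lcn_ge.
have c0 := lcv_gt0; have n0 := lcn_gt0; have m0 := lmv_gt0; have p0 := lpv_gt0.
have [/eqP jX|jX] := boolP (j == sX s).
  subst j; rewrite ltzD1 lexx ltxx ifF ?gt_eqF ?ltzD1 //.
  have := SE (sX s); rewrite -/(lcv s) -/(lpv s) /alp => E.
  have -> : sS s (sX s + 1) = sS s (sX s) + h / (lcv s * lpv s) by rewrite -E; ring.
  by field; rewrite !gt_eqF.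
have [/eqP jX1|jX1] := boolP (j + 1 == sX s).
  have jE : j = sX s - 1 by rewrite -jX1 addrK.
  rewrite jX1 !ltxx.
  have jl : j < sX s by rewrite -jX1 ltzD1.
  rewrite jl ltNge (ltW jl) /=.
  have := SE j; rewrite jX1 jE -/(lcv s) -/(lmv s) /alm => E.
  have -> : sS s (sX s) = sS s (sX s - 1) + h / (lmv s * lcv s) by rewrite -E; ring.
  by field; rewrite !gt_eqF.
have [jl|jl] := ltP (sX s) j.
  rewrite (lt_trans jl) ?ltzD1 // -SE; ring.
have jl' : j < sX s by rewrite lt_neqAle jX.
have jl1 : j + 1 < sX s by rewrite lt_neqAle jX1 /= lezD1.
rewrite jl' jl1 ltNge (ltW jl1) /= -SE; ring.
Qed.

(** The scale function does not move at the current site while the walk waits, so the martingale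
    changes only by the new length of the edge that is crossed. *)
Lemma sM_step b : sM (step s x b) = sM s + dM s x b.
Proof.
have [_ [SE _]] := valid_step b.
have SX : sS (step s x b) (sX s) = sM s by rewrite /= !ltxx.
have c1 : sL (step s x b) (sX s) = lcn s x by rewrite /= eqxx.
case: b SE SX c1 => SE SX c1; rewrite {1}/sM.
  have c2 : sL (step s x true) (sX s + 1) = lpv s by rewrite /= gt_eqF // ltzD1.
  have /eqP := SE (sX s); rewrite SX c1 c2 subr_eq => /eqP E.
  by rewrite [sX (step s x true)]/= E addrC.
have c2 : sL (step s x false) (sX s - 1) = lmv s.
  by rewrite /= lt_eqF // ltrBlDr ltzD1.
have := SE (sX s - 1); rewrite subrK SX c1 c2 [sX (step s x false)]/= /dM /ajm.
by rewrite (mulrC (lcn _ _)) => <-; ring.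
Qed.

End onestep.

Lemma sS_le s j k : valid s -> j <= k -> sS s j <= sS s k.
Proof.
move=> vs jk; have [n ->] : exists n : nat, k = j + n%:Z.
  by exists `|k - j|%N; rewrite gez0_abs ?subr_ge0 //; lia.
elim: n => [|n IH]; first by rewrite addr0.
apply: le_trans IH _; rewrite -addn1 PoszD addrA -subr_ge0 vs.2.1.
by rewrite divr_ge0 ?(ltW h0) // mulr_ge0 // ltW // valid_gt0.
Qed.

Lemma valid_run s0 e u k : valid s0 -> (forall i, 0 <= e i) -> valid (run s0 e u k).
Proof. by move=> v0 e0; elim: k => //= k IH; exact: valid_step. Qed.

End vstate.

(** * Measurability of functionals of the state *)

Section vmeas.
Context {R : realType}.
Local Notation vst := (@vst R).

Definition mstate d (T : measurableType d) (s : T -> vst) :=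
  (forall j, measurable_fun setT (fun w => sX (s w) == j)) /\
  (forall j, measurable_fun setT (fun w => sL (s w) j)) /\
  (forall j, measurable_fun setT (fun w => sS (s w) j)) /\
  measurable_fun setT (fun w => sW (s w)) /\
  measurable_fun setT (fun w => sJ (s w)) /\
  measurable_fun setT (fun w => sE (s w)) /\
  (forall m, measurable_fun setT (fun w => sA (s w) m)) /\
  (forall m, measurable_fun setT (fun w => sB (s w) m)) /\
  (forall m, measurable_fun setT (fun w => sC (s w) m)).

(** The record of states carries no sigma-algebra; a functional counts as measurable when it is so
    along every measurable family of states. *)
Definition mfunc d' (T' : measurableType d') (F : vst -> T') :=
  forall d (T : measurableType d) (s : T -> vst), mstate s ->
    measurable_fun setT (fun w => F (s w)).

Lemma measurable_site d (T : measurableType d) d' (T' : measurableType d')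
  (X : T -> int) (g : int -> T -> T') :
  (forall j, measurable_fun setT (fun w => X w == j)) ->
  (forall j, measurable_fun setT (g j)) ->
  measurable_fun setT (fun w => g (X w) w).
Proof.
move=> mX mg _ A mA; rewrite setTI.
have -> : (fun w => g (X w) w) @^-1` A =
    \bigcup_(j : int) ((fun w => X w == j) @^-1` [set true] `&` g j @^-1` A).
  apply/seteqP; split=> w /=; first by move=> gA; exists (X w) => //=; rewrite eqxx.
  by move=> [j _ /= [/eqP <-]].
apply: countable_bigcupT_measurable => // j.
apply: measurableI; first by rewrite -[_ @^-1` _]setTI; exact: mX.
by rewrite -[_ @^-1` _]setTI; exact: mg.
Qed.

Lemma mfunc_site d' (T' : measurableType d') (g : int -> vst -> T') :
  (forall j, mfunc (g j)) -> mfunc (fun s => g (sX s) s).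
Proof.
move=> mg d T s ms; apply: (@measurable_site _ _ _ _ (fun w => sX (s w)) (fun j w => g j (s w))).
  exact: ms.1.
by move=> j; exact: mg.
Qed.

Lemma mfunc_sL j : mfunc (fun s : vst => sL s j).
Proof. by move=> d T s ms; exact: ms.2.1. Qed.
Lemma mfunc_sS j : mfunc (fun s : vst => sS s j).
Proof. by move=> d T s ms; exact: ms.2.2.1. Qed.
Lemma mfunc_sLX j : mfunc (fun s : vst => sL s (sX s + j)).
Proof. by apply: (mfunc_site (g := fun i s => sL s (i + j))) => i; exact: mfunc_sL. Qed.
Lemma mfunc_sM : mfunc (@sM R).
Proof. by apply: (mfunc_site (g := fun i s => sS s i)) => i; exact: mfunc_sS. Qed.
Lemma mfunc_lcv : mfunc (@lcv R).
Proof. by apply: (mfunc_site (g := fun i s => sL s i)) => i; exact: mfunc_sL. Qed.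
Lemma mfunc_sXp (p : pred int) : mfunc (fun s : vst => p (sX s)).
Proof. by apply: (mfunc_site (g := fun i s => p i)) => i d T s _. Qed.

Section mstep.
Variables (h : R) (chi : nat -> vst -> R) (mchi : forall m, mfunc (chi m)).
Context d (T : measurableType d) (s : T -> vst) (x : T -> R).
Hypotheses (ms : mstate s) (mx : measurable_fun setT x).

Lemma measurable_invr (f : T -> R) : measurable_fun setT f ->
  measurable_fun setT (fun w => (f w)^-1).
Proof.
(* The inverse is written as a sign times a power, both measurable; at 0 both sides vanish. *)
move=> mf; have -> : (fun w => (f w)^-1) = (fun w => Num.sg (f w) * `|f w| `^ (-1)).
  apply/funext => w; have [->|/eqP f0] := eqVneq (f w) 0.
    by rewrite invr0 sgr0 mul0r.
  by rewrite powR_inv1 // -normfV -(sgrV (f w)) -numEsg.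
apply: measurable_funM.
  have -> : (fun w => Num.sg (f w)) = (fun w => if f w == 0 then 0 else if f w < 0 then -1 else 1).
    by apply/funext => w; rewrite /Num.sg; case: ltgtP.
  apply: measurable_fun_ifT => //; first exact: measurable_fun_eqr.
  by apply: measurable_fun_ifT => //; exact: measurable_fun_ltr.
by apply: (measurableT_comp (measurable_powR (-1))); exact: measurableT_comp.
Qed.

Lemma measurable_lcn : measurable_fun setT (fun w => lcn h (s w) (x w)).
Proof.
apply: measurable_funD; first exact: mfunc_lcv.
apply: measurable_funM => //; apply: measurable_invr; apply: measurable_funM => //.
by apply: measurable_funD; exact: mfunc_sLX.
Qed.

Lemma measurable_alp : measurable_fun setT (fun w => alp h (s w) (x w)).
Proof.
apply: measurable_funM.
  by apply: measurable_funM => //; apply: measurable_invr; exact: mfunc_sLX.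
by apply: measurable_funB; apply: measurable_invr; [exact: mfunc_lcv|exact: measurable_lcn].
Qed.

Lemma measurable_alm : measurable_fun setT (fun w => alm h (s w) (x w)).
Proof.
apply: measurable_funM.
  by apply: measurable_funM => //; apply: measurable_invr; exact: mfunc_sLX.
by apply: measurable_funB; apply: measurable_invr; [exact: mfunc_lcv|exact: measurable_lcn].
Qed.

Lemma measurable_dW : measurable_fun setT (fun w => dW h (s w) (x w)).
Proof.
by apply: measurable_funM => //; apply: measurable_funD; [exact: measurable_alp|exact: measurable_alm].
Qed.

Lemma measurable_dM b : measurable_fun setT (fun w => dM h (s w) (x w) b).
Proof.
case: b; [|apply: measurable_funN]; apply: measurable_funM => //;
  apply: measurable_invr; apply: measurable_funM; try exact: measurable_lcn; exact: mfunc_sLX.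
Qed.

Lemma mstep b : mstate (fun w => step h chi (s w) (x w) b).
Proof.
have [mX [mL [mS [mW [mJ [mE [mA [mB mC]]]]]]]] := ms.
split; [|split; [|split; [|split; [|split; [|split; [|split; [|split]]]]]]] => /=.
- by move=> j; apply: (mfunc_sXp (fun i => (if b then i + 1 else i - 1) == j)).
- move=> j; apply: measurable_fun_ifT => //; last exact: measurable_lcn.
  exact: (mfunc_sXp (fun i => j == i)).
- move=> j; apply: measurable_fun_ifT; first exact: (mfunc_sXp (fun i => i < j)).
    by apply: measurable_funB => //; exact: measurable_alp.
  apply: measurable_fun_ifT => //; first exact: (mfunc_sXp (fun i => j < i)).
  by apply: measurable_funD => //; exact: measurable_alm.
- by apply: measurable_funD => //; exact: measurable_dW.
- apply: measurable_funD => //; apply: measurable_funM => //.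
  by apply: measurable_funB; [exact: measurable_lcn|exact: mfunc_lcv].
- by apply: measurable_funD => //; exact: measurable_funB.
- move=> m; apply: measurable_funD => //; apply: measurable_funM; first exact: mchi.
  exact: measurable_dM.
- move=> m; apply: measurable_funD => //; apply: measurable_funM; first exact: mchi.
  exact: measurable_dW.
- by move=> m; apply: measurable_funD => //; exact: mchi.
Qed.
End mstep.
End vmeas.

(** Both parts of an integral are suprema over simple functions, so monotonicity holds for arbitrary
    functions. Test functionals of the paths are compared in this way later. *)
Lemma le_integralT {R : realType} d (T : measurableType d)
    (mu : {measure set T -> \bar R}) (f g : T -> \bar R) :
  (forall x, f x <= g x)%E -> (\int[mu]_x f x <= \int[mu]_x g x)%E.
Proof.
move=> fg; rewrite /integral !patch_setT.
apply: leeB; apply: ereal_sup_le => _ [k kf <-];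
  (exists k => // x;
   apply: le_trans (kf x) _; rewrite ?funeposE ?funenegE ge_max !le_max lexx ?orbT ?andbT ?leeN2 fg //).
Qed.

Lemma le_integralD {R : realType} d (T : measurableType d)
    (mu : {measure set T -> \bar R}) (D : set T) (f g : T -> \bar R) :
  (forall x, D x -> f x <= g x)%E -> (\int[mu]_(x in D) f x <= \int[mu]_(x in D) g x)%E.
Proof.
move=> fg; rewrite [leLHS]integral_mkcond [leRHS]integral_mkcond.
by apply: le_integralT => x; rewrite !patchE; case: ifPn => // /[!inE] /fg.
Qed.

Ltac split9 := split; [|split; [|split; [|split; [|split; [|split; [|split; [|split]]]]]]].

(** * The chain of states and Ville's inequality *)

Section chain.
Context {R : realType} d {T : measurableType d} (P : probability T R).
Variables (E U : nat -> T -> R).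
Hypothesis cEU : clocks P E U.
Local Notation vst := (@vst R).
Variables (h : R) (lo : int -> R) (chi : nat -> vst -> R) (s0 : vst).
Hypotheses (h0 : 0 < h) (chi0 : forall m s, 0 <= chi m s) (mchi : forall m, mfunc (chi m)) (v0 : valid h lo s0).
Local Notation leb := (@lebesgue_measure R).

Let Y := (fun i : (nat + nat)%type => match i with inl k => E k | inr k => U k end).
Let indY : mutually_independent P Y := cEU.1.

(** Before step k the past consists of both variables of index below k; [past_hold] adds the k-th
    holding variable, since the direction is drawn after the wait. *)
Definition past_jump k : set (nat + nat) :=
  [set i | match i with inl j => (j < k)%N | inr j => (j < k)%N end].
Definition past_hold k : set (nat + nat) :=
  [set i | match i with inl j => (j <= k)%N | inr j => (j < k)%N end].
Local Notation pastj k := (g_sigma_algebraType (past_gen Y (past_jump k))).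
Local Notation pasth k := (g_sigma_algebraType (past_gen Y (past_hold k))).

(** Absolute values make the state valid at every sample point; almost surely they change nothing,
    see [hold_ge0_whp]. *)
Definition st k w := run h chi s0 (fun i => `|E i w|) (fun i => U i w) k.

Lemma stS k w : st k.+1 w = step h chi (st k w) `|E k w|
  (U k w * (lmv (st k w) + lpv (st k w)) < lpv (st k w)).
Proof. by []. Qed.

Lemma valid_st k w : valid h lo (st k w).
Proof. by apply: valid_run => // i; exact: normr_ge0. Qed.

Lemma mstate_if d' (T' : measurableType d') (b : T' -> bool) (s1 s2 : T' -> vst) :
  measurable_fun setT b -> mstate s1 -> mstate s2 ->
  mstate (fun w => if b w then s1 w else s2 w : vst).
Proof.
move=> mb [a1 [a2 [a3 [a4 [a5 [a6 [a7 [a8 a9]]]]]]]] [b1 [b2 [b3 [b4 [b5 [b6 [b7 [b8 b9]]]]]]]].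
have ifm d2 (T2 : measurableType d2) (f : vst -> T2) :
    measurable_fun setT (fun w => f (s1 w)) -> measurable_fun setT (fun w => f (s2 w)) ->
    measurable_fun setT (fun w => f (if b w then s1 w else s2 w)).
  move=> m1 m2; have -> : (fun w => f (if b w then s1 w else s2 w)) =
     (fun w => if b w then f (s1 w) else f (s2 w)) by apply/funext => w; case: (b w).
  exact: measurable_fun_ifT.
split; first by move=> j; apply: (ifm _ _ (fun s => sX s == j)).
split; first by move=> j; apply: (ifm _ _ (fun s => sL s j)).
split; first by move=> j; apply: (ifm _ _ (fun s => sS s j)).
split; first by apply: (ifm _ _ (@sW R)).
split; first by apply: (ifm _ _ (@sJ R)).
split; first by apply: (ifm _ _ (@sE R)).
split; first by move=> j; apply: (ifm _ _ (fun s => sA s j)).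
split; first by move=> j; apply: (ifm _ _ (fun s => sB s j)).
by move=> j; apply: (ifm _ _ (fun s => sC s j)).
Qed.

Lemma mstate_comp d1 d2 (T1 : measurableType d1) (T2 : measurableType d2)
  (f : T1 -> T2) (s : T2 -> vst) :
  measurable_fun setT f -> mstate s -> mstate (fun w => s (f w)).
Proof.
move=> mf [a1 [a2 [a3 [a4 [a5 [a6 [a7 [a8 a9]]]]]]]].
split9; try (move=> j); [exact: (measurableT_comp (a1 j) mf)|exact: (measurableT_comp (a2 j) mf)|exact: (measurableT_comp (a3 j) mf)|exact: (measurableT_comp a4 mf)|exact: (measurableT_comp a5 mf)|exact: (measurableT_comp a6 mf)|exact: (measurableT_comp (a7 j) mf)|exact: (measurableT_comp (a8 j) mf)|exact: (measurableT_comp (a9 j) mf)].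
Qed.

Lemma mstate_cst d1 (T1 : measurableType d1) (s : vst) : mstate (fun _ : T1 => s).
Proof. by split9. Qed.

Lemma mst_mono k (K : set (nat + nat)) : past_jump k `<=` K ->
  mstate (st k : pastj k -> vst) ->
  mstate (st k : g_sigma_algebraType (past_gen Y K) -> vst).
Proof.
move=> sK [a1 [a2 [a3 [a4 [a5 [a6 [a7 [a8 a9]]]]]]]].
split9; try (move=> j);
  [exact: (past_mono sK (a1 j))|exact: (past_mono sK (a2 j))|exact: (past_mono sK (a3 j))|exact: (past_mono sK a4)|exact: (past_mono sK a5)|exact: (past_mono sK a6)|exact: (past_mono sK (a7 j))|exact: (past_mono sK (a8 j))|exact: (past_mono sK (a9 j))].
Qed.

Lemma mst k : mstate (st k : pastj k -> vst).
Proof.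
elim: k => [|k IH]; first exact: mstate_cst.
have jS : past_jump k `<=` past_jump k.+1 by move=> [] j /= /leqW.
have IH' := mst_mono jS IH.
have mE : measurable_fun setT (fun w : pastj k.+1 => `|E k w|).
  have mE0 : measurable_fun setT (Y (inl k) : pastj k.+1 -> R) by apply: past_Y => /=.
  exact: (measurableT_comp _ mE0).
have mU : measurable_fun setT (U k : pastj k.+1 -> R).
  have mU0 : measurable_fun setT (Y (inr k) : pastj k.+1 -> R) by apply: past_Y => /=.
  exact: mU0.
have -> : (st k.+1 : pastj k.+1 -> vst) = (fun w => if U k w * (lmv (st k w) + lpv (st k w)) < lpv (st k w)
   then step h chi (st k w) `|E k w| true else step h chi (st k w) `|E k w| false).
  by apply/funext => w; rewrite stS; case: ifP.
apply: mstate_if; [|exact: mstep|exact: mstep].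
apply: measurable_fun_ltr; last exact: mfunc_sLX.
by apply: measurable_funM => //; apply: measurable_funD; exact: mfunc_sLX.
Qed.

Definition stepavg (F : vst -> R) s x :=
  (lpv s * F (step h chi s x true) + lmv s * F (step h chi s x false)) / (lmv s + lpv s).

Lemma stepavg_ge0 F s x : (forall s, valid h lo s -> 0 <= F s) -> valid h lo s -> 0 <= x ->
  0 <= stepavg F s x.
Proof.
move=> F0 vs x0; have m0 := ltW (lmv_gt0 vs); have p0 := ltW (lpv_gt0 vs).
by rewrite divr_ge0 ?addr_ge0 // mulr_ge0 // F0 //; exact: valid_step.
Qed.

Section onestepF.
Variables (F : vst -> R) (mF : mfunc F) (F0 : forall s, valid h lo s -> 0 <= F s).

(** The uniform variable is integrated out first, given a past that includes the holding variable,
    and then the holding variable itself. The factor [g] is a function of the past, typically the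
    indicator that a level has not been reached. *)
Lemma one_step k (g : T -> R) :
  measurable_fun setT (g : pastj k -> R) -> (forall w, 0 <= g w) ->
  (\int[P]_w (g w * F (st k.+1 w))%:E =
   \int[P]_w \int[leb]_(x in `[0%R, +oo[)
      ((g w * stepavg F (st k w) x)%:E * (expR (- x))%:E))%E.
Proof.
move=> mg g0.
have jh : past_jump k `<=` past_hold k by move=> [] j //= /ltnW.
have mh := mst_mono jh (mst k).
have mEh : measurable_fun setT (fun w : pasth k => `|E k w|).
  have mE0 : measurable_fun setT (Y (inl k) : pasth k -> R) by apply: past_Y => /=.
  exact: (measurableT_comp _ mE0).
have mgh : measurable_fun setT (g : pasth k -> R) by exact: (past_mono jh mg).
pose G1 (z : pasth k * measurableTypeR R) : \bar R :=
  (if z.2 * (lmv (st k z.1) + lpv (st k z.1)) < lpv (st k z.1)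
   then g z.1 * F (step h chi (st k z.1) `|E k z.1| true)
   else g z.1 * F (step h chi (st k z.1) `|E k z.1| false))%:E.
have mf1 : measurable_fun setT (fst : pasth k * measurableTypeR R -> pasth k) by exact: measurable_fst.
have mh1 := mstate_comp mf1 mh.
have mE1 : measurable_fun setT (fun z : pasth k * measurableTypeR R => `|E k z.1|).
  exact: (measurableT_comp mEh mf1).
have mg1 : measurable_fun setT (fun z : pasth k * measurableTypeR R => g z.1).
  exact: (measurableT_comp mgh mf1).
have mG1 : measurable_fun setT G1.
  apply/measurable_EFinP; apply: measurable_fun_ifT.
  - apply: measurable_fun_ltr; last exact: (mfunc_sLX _ mh1).
    apply: measurable_funM; first exact: measurable_snd.
    by apply: measurable_funD; exact: (mfunc_sLX _ mh1).
  - by apply: measurable_funM => //; exact: (mF (mstep h mchi mh1 mE1 true)).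
  - by apply: measurable_funM => //; exact: (mF (mstep h mchi mh1 mE1 false)).
have Fp s x b : valid h lo s -> 0 <= x -> 0 <= F (step h chi s x b).
  by move=> vs x0; apply: F0; exact: valid_step.
have G10 z : (0 <= G1 z)%E.
  by rewrite lee_fin; case: ifP => _; rewrite mulr_ge0 // Fp //; exact: valid_st.
have nK1 : ~ past_hold k (inr k) by rewrite /past_hold /= ltnn.
have law1 A : measurable A -> P (Y (inr k) @^-1` A) = uniform_prob (@ltr01 R) A.
  by move=> mA; exact: cEU.2.2.
have [_ E1] := past_step indY nK1 law1 mG1 G10.
transitivity (\int[P]_w G1 (w, U k w))%E.
  by apply: eq_integral => w _; rewrite /G1 stS /=; case: ifP.
rewrite E1.
transitivity (\int[P]_w (g w * stepavg F (st k w) `|E k w|)%:E)%E.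
  apply: eq_integral => w _; rewrite /G1 /=.
  have vk := valid_st k w.
  rewrite (unif_integral (fun S mS => erefl)) ?lmv_gt0 ?lpv_gt0 ?mulr_ge0 ?Fp //;
    try exact: (lmv_gt0 vk); try exact: (lpv_gt0 vk).
  congr EFin; rewrite /stepavg; ring.
have mfj : measurable_fun setT (fst : pastj k * measurableTypeR R -> pastj k) by exact: measurable_fst.
have mj1 := mstate_comp mfj (mst k).
have mx1 : measurable_fun setT (fun z : pastj k * measurableTypeR R => `|z.2|).
  by apply: measurableT_comp => //; exact: measurable_snd.
pose G2 (z : pastj k * measurableTypeR R) : \bar R := (g z.1 * stepavg F (st k z.1) `|z.2|)%:E.
have mG2 : measurable_fun setT G2.
  apply/measurable_EFinP; apply: measurable_funM; first exact: (measurableT_comp mg mfj).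
  apply: measurable_funM; last first.
    by apply: measurable_invr; apply: measurable_funD; exact: (mfunc_sLX _ mj1).
  apply: measurable_funD; (apply: measurable_funM; first exact: (mfunc_sLX _ mj1)).
    exact: (mF (mstep h mchi mj1 mx1 true)).
  exact: (mF (mstep h mchi mj1 mx1 false)).
have G20 z : (0 <= G2 z)%E.
  by rewrite lee_fin mulr_ge0 // stepavg_ge0 //; exact: valid_st.
have nK2 : ~ past_jump k (inl k) by rewrite /past_jump /= ltnn.
have mEk : measurable_fun setT (E k : T -> measurableTypeR R) by exact: (indY.1 (inl k)).
pose Em := isMeasurableFun.Build _ _ _ _ _ mEk.
pose Ef : {mfun T >-> measurableTypeR R} := HB.pack (E k : T -> measurableTypeR R) Em.
pose nu : probability (measurableTypeR R) R := distribution P Ef.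
have law2 A : measurable A -> P (Y (inl k) @^-1` A) = nu A by [].
have [_ E2] := past_step indY nK2 law2 mG2 G20.
transitivity (\int[P]_w G2 (w, E k w))%E; first by [].
rewrite E2; apply: eq_integral => w _.
have nuE A : measurable A -> nu A = exponential_prob 1 A by exact: cEU.2.1 k A.
rewrite (expo_integral nuE) //; last first.
  by apply: (measurableT_comp mG2); exact: pair1_measurable.
apply: eq_integral => x; rewrite inE /= in_itv /= andbT => x0.
by rewrite /G2 /= ger0_norm.
Qed.

Hypothesis supF : forall k w,
  (\int[leb]_(x in `[0%R, +oo[) ((stepavg F (st k w) x)%:E * (expR (- x))%:E) <= (F (st k w))%:E)%E.

Lemma supermart_le k (g : T -> R) :
  measurable_fun setT (g : pastj k -> R) -> (forall w, 0 <= g w) ->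
  (\int[P]_w (g w * F (st k.+1 w))%:E <= \int[P]_w (g w * F (st k w))%:E)%E.
Proof.
move=> mg g0; rewrite one_step //.
have mgT : measurable_fun setT g by exact: (past_measurable_fun indY mg).
have mstT j : measurable_fun setT (fun w => F (st j w)).
  by apply: (past_measurable_fun indY (K := past_jump j)); apply: mF; exact: mst.
have key w : (\int[leb]_(x in `[0%R, +oo[) ((g w * stepavg F (st k w) x)%:E * (expR (- x))%:E) <=
   (g w * F (st k w))%:E)%E.
  under eq_integral do rewrite EFinM -muleA.
  have mst1 : measurable_fun setT (fun x : measurableTypeR R => stepavg F (st k w) `|x|).
    apply: measurable_funM; last by apply: measurable_invr.
    have mn : measurable_fun setT (fun x : measurableTypeR R => `|x|) by exact: measurableT_comp.
    have mc := @mstate_cst _ (measurableTypeR R) (st k w).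
    apply: measurable_funD; (apply: measurable_funM => //); [exact: (mF (mstep h mchi mc mn true))|exact: (mF (mstep h mchi mc mn false))].
  rewrite ge0_integralZl ?lee_fin //.
  - by rewrite EFinM lee_wpmul2l ?lee_fin // supF.
  - apply: (@eq_measurable_fun _ _ _ _ _ (fun x : measurableTypeR R =>
       (stepavg F (st k w) `|x|)%:E * (expR (- x))%:E)%E).
      by move=> x; rewrite inE /= in_itv /= andbT => x0; rewrite ger0_norm.
    apply: measurable_funTS; apply: emeasurable_funM; apply/measurable_EFinP => //.
    by apply: measurableT_comp => //.
  - move=> x; rewrite /= in_itv /= andbT => x0.
    by rewrite mule_ge0 // lee_fin ?expR_ge0 // stepavg_ge0 //; exact: valid_st.
apply: le_integralT => w; exact: key.
Qed.

(** True as long as [F] has stayed below c at all steps before k; from then on [V] is frozen at the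
    value c. *)
Let hit (c : R) k w := all (fun j => F (st j w) < c) (iota 0 k).

Let mFst k : measurable_fun setT (fun w : pastj k => F (st k w)).
Proof. by apply: mF; exact: mst. Qed.

Let mhit c k : measurable_fun setT (hit c k : pastj k -> bool).
Proof.
elim: k => [|k IH]; first exact: measurable_cst.
have -> : hit c k.+1 = fun w => hit c k w && (F (st k w) < c).
  by apply/funext => w; rewrite /hit -addn1 iotaD all_cat /= andbT.
have jS : past_jump k `<=` past_jump k.+1 by move=> [] j /= /leqW.
apply: measurable_and; first exact: (past_mono jS IH).
by apply: (past_mono jS); apply: measurable_fun_ltr.
Qed.

Let V c k w := if hit c k w then F (st k w) else c.

(** Freezing [F] at the value c when it first reaches c gives a nonnegative process of nonincreasing
    mean, equal to c once the level has been reached. So c times the probability is at most the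
    initial value, and the events increase to the countable union. *)
Lemma ville_reachable (c : R) : 0 < c ->
  let B := \bigcup_k [set w : T | c <= F (st k w)] in
  measurable B /\ (P B <= (F s0 / c)%:E)%E.
Proof.
move=> c0 /=.
have mT k : measurable_fun setT (fun w => F (st k w)).
  by apply: (past_measurable_fun indY (K := past_jump k)); exact: mFst.
have mhT k : measurable_fun setT (hit c k).
  by apply: (past_measurable_fun indY (K := past_jump k)); exact: mhit.
have Fst0 k w : 0 <= F (st k w) by apply: F0; exact: valid_st.
have V0 k w : 0 <= V c k w by rewrite /V; case: ifP => _ //; exact: ltW.
have mV k : measurable_fun setT (V c k).
  by apply: measurable_fun_ifT.
have hitS k w : hit c k.+1 w = hit c k w && (F (st k w) < c).
  by rewrite /hit -addn1 iotaD all_cat /= andbT.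
have dec k : (\int[P]_w (V c k.+1 w)%:E <= \int[P]_w (V c k w)%:E)%E.
  (* [g] marks the paths that are still running after step k; the supermartingale inequality is used
     on these only, the others contribute the constant c. *)
  pose g w : R := (hit c k.+1 w)%:R.
  have jS : past_jump k `<=` past_jump k.+1 by move=> [] j /= /leqW.
  have mg : measurable_fun setT (g : pastj k -> R).
    have -> : g = (fun w => if hit c k w && (F (st k w) < c) then 1 else 0).
      by apply/funext => w; rewrite /g hitS; case: ifP.
    apply: measurable_fun_ifT => //; apply: measurable_and => //.
    exact: measurable_fun_ltr.
  have mgT : measurable_fun setT g.
    by apply: (past_measurable_fun indY (K := past_jump k)); exact: mg.
  have g0 w : 0 <= g w by rewrite ler0n.
  pose r w : R := c * (1 - g w).
  have mr : measurable_fun setT r by apply: measurable_funM => //; exact: measurable_funB.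
  have r0 w : 0 <= r w by rewrite mulr_ge0 ?(ltW c0) // /g; case: (hit _ _ _); rewrite ?subrr ?subr0.
  have mgF j : measurable_fun setT (fun w => (g w * F (st j w))%:E).
    by apply/measurable_EFinP; exact: measurable_funM.
  have mrE : measurable_fun setT (fun w => (r w)%:E) by exact/measurable_EFinP.
  have gF0 j w : [set: T] w -> (0 <= (g w * F (st j w))%:E)%E.
    by move=> _; rewrite lee_fin mulr_ge0.
  have rE0 w : [set: T] w -> (0 <= (r w)%:E)%E by move=> _; rewrite lee_fin.
  have -> : (\int[P]_w (V c k.+1 w)%:E =
      \int[P]_w (g w * F (st k.+1 w))%:E + \int[P]_w (r w)%:E)%E.
    rewrite -ge0_integralD //; last exact: gF0.
    apply: eq_integral => w _; rewrite -EFinD; congr EFin; rewrite /V /r /g.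
    by case: (hit _ _ _); rewrite ?mul1r ?subrr ?mulr0 ?addr0 // mul0r add0r subr0 mulr1.
  apply: (@le_trans _ _ (\int[P]_w (g w * F (st k w))%:E + \int[P]_w (r w)%:E)%E).
    by apply: leeD => //; exact: supermart_le.
  rewrite -ge0_integralD //; last exact: gF0.
  apply: le_integralT => w; rewrite -EFinD lee_fin /V /r /g hitS.
  case: (hit c k w) => /=; last by rewrite mul0r add0r subr0 mulr1.
  by case: ltP => Fc; rewrite ?mul1r ?subrr ?mulr0 ?addr0 // mul0r add0r subr0 mulr1.
have all k : (\int[P]_w (V c k w)%:E <= (F s0)%:E)%E.
  elim: k => [|k IH]; last exact: le_trans (dec k) IH.
  rewrite (_ : (\int[P]_w (V c 0 w)%:E = \int[P]_w (cst (F s0)%:E w))%E) //.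
  by rewrite integral_cst //= probability_setT mule1.
pose B k : set T := [set w | ~~ hit c k w].
have mB k : measurable (B k).
  have -> : B k = hit c k @^-1` [set false].
    by apply/seteqP; split=> w /=; rewrite /B /=; [move/negbTE|move=> ->].
  by rewrite -[_ @^-1` _]setTI; exact: mhT.
have PB k : (P (B k) <= (F s0 / c)%:E)%E.
  have : (\int[P]_w (c%:E * (\1_(B k) w)%:E) <= (F s0)%:E)%E.
    apply: le_trans (all k); apply: le_integralT => w; rewrite -EFinM lee_fin indicE /V.
    case: (boolP (hit c k w)) => hw.
      by rewrite memNset ?mulr0 // /B /= hw.
    by rewrite mem_set ?mulr1.
  rewrite ge0_integralZl ?lee_fin ?(ltW c0) //; last first.
    by apply/measurable_EFinP; exact: measurable_indic.
  rewrite integral_indic // setIT => le1.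
  by rewrite mulrC EFinM lee_pdivlMl.
have UB : \bigcup_k [set w : T | c <= F (st k w)] = \bigcup_k B k.
  apply/seteqP; split=> w [k _ /=] h1.
    exists k.+1 => //; rewrite /B /= hitS negb_and -leNgt h1 orbT //.
  move: h1; rewrite /B /= => /allPn[j _]; rewrite -leNgt => ?.
  by exists j.
rewrite UB; split; first exact: bigcupT_measurable.
have ndB : nondecreasing_seq B.
  apply/nondecreasing_seqP => k; apply/subsetPset => w; rewrite /B /= hitS.
  by rewrite negb_and => ->.
have cv : (P \o B) x @[x --> \oo] --> P (\bigcup_n B n).
  exact: nondecreasing_cvg_mu mB (bigcupT_measurable _ mB) ndB.
rewrite -(cvg_lim _ cv) //; apply: lime_le; first exact: cvgP cv.
by apply: nearW => k; exact: PB.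
Qed.

End onestepF.

Lemma ville (F : vst -> R) : mfunc F -> (forall s, valid h lo s -> 0 <= F s) ->
  (forall s, valid h lo s ->
  (\int[leb]_(x in `[0%R, +oo[) ((stepavg F s x)%:E * (expR (- x))%:E) <= (F s)%:E)%E) ->
  forall c : R, 0 < c ->
  let B := \bigcup_k [set w : T | c <= F (st k w)] in
  measurable B /\ (P B <= (F s0 / c)%:E)%E.
Proof. by move=> mF F0 sF c c0; apply: ville_reachable => // k w; apply: sF; exact: valid_st. Qed.

End chain.

(** * Means over an exponential holding variable *)

Section expbounds.
Context {R : realType}.
Local Notation leb := (@lebesgue_measure R).

Lemma expR_le_quad (z : R) : z <= 1 / 2 -> expR z <= 1 + z + 2 * z ^+ 2.
Proof.
move=> z2; have z1 : 0 < 1 - z by lra.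
have : expR z <= (1 - z)^-1.
  rewrite -[expR z]invrK -expRN lef_pV2 ?posrE ?expR_gt0 //.
  exact: expR_ge1Dx.
move/le_trans; apply; rewrite invf_ple ?posrE //; last by nra.
rewrite -[leLHS]mul1r ler_pdivrMr ?mul1r; last by nra.
rewrite expr2; nra.
Qed.

Lemma expRN_le_half (y : R) : 0 <= y <= 1 -> expR (- y) <= 1 - y / 2.
Proof.
move=> /andP[y0 y1]; have p : 0 < 1 + y by lra.
have : expR (- y) <= (1 + y)^-1.
  by rewrite expRN lef_pV2 ?posrE ?expR_gt0 // expR_ge1Dx.
move/le_trans; apply.
rewrite -[leLHS]mul1r ler_pdivrMr //; nra.
Qed.

Lemma squeeze_exp (G : R -> R) (C : R) :
  (forall x : R, 0 <= x -> 0 <= G x <= C * expR (x / 2)) ->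
  (fun x => expR (- x) * G x) @ +oo --> (0 : R).
Proof.
move=> GC.
have C0 : 0 <= C by have := GC 0 (lexx _); rewrite mul0r expR0 mulr1 => /andP[/le_trans]; exact.
have lim : (fun x : R => C * expR (- (x / 2))) @ +oo --> (0 : R).
  apply/cvgrPdist_le => /= e e0; near=> x.
  have x0 : 0 < x by near: x; exact: nbhs_pinfty_gt.
  have xC : 2 * C / e <= x by near: x; apply: nbhs_pinfty_ge; rewrite num_real.
  rewrite sub0r normrN ger0_norm ?mulr_ge0 ?expR_ge0 //.
  rewrite expRN ler_pdivrMr ?expR_gt0 //.
  apply: le_trans (ler_wpM2l (ltW e0) (expR_ge1Dx (x / 2))).
  by move: xC; rewrite ler_pdivrMr // => xC; lra.
apply: (@squeeze_cvgr _ _ _ _ (fun=> 0) (fun x : R => C * expR (- (x / 2)))) => //; last exact: cvg_cst.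
near=> x; have x0 : 0 <= x by near: x; exact: nbhs_pinfty_ge.
have /andP[g0 gC] := GC x x0; rewrite mulr_ge0 ?expR_ge0 //=.
apply: le_trans (ler_wpM2l (expR_ge0 _) gC) _.
rewrite mulrCA -expRD ler_wpM2l // ler_expR; lra.
Unshelve. all: by end_near. Qed.

(** [exp_ibp] with domination: to bound the mean of f it suffices to find [G] with f <= G - G' whose
    value at 0 is the bound. *)
Lemma le_exp_integral (f G G' : R -> R) (C : R) :
  (forall x : R, 0 <= x -> f x <= G x - G' x) ->
  (forall x : R, 0 <= x -> is_derive x 1 G (G' x)) ->
  (forall x : R, 0 <= x -> {for x, continuous G'}) ->
  (forall x : R, 0 <= x -> 0 <= G x - G' x) ->
  (forall x : R, 0 <= x -> 0 <= G x <= C * expR (x / 2)) ->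
  (\int[leb]_(x in `[0%R, +oo[) ((f x)%:E * (expR (- x))%:E) <= (G 0)%:E)%E.
Proof.
move=> fG dG cG' pos GC; rewrite -(exp_ibp dG cG' pos (squeeze_exp GC)).
apply: le_integralD => x; rewrite /= in_itv /= andbT => x0.
by rewrite -!EFinM lee_fin ler_wpM2r ?expR_ge0 // fG.
Qed.

Section families.
Variable m : R.
Hypothesis m0 : 0 < m.

Let mx0 (x : R) : 0 <= x -> 0 < m + x. Proof. by move=> x0; rewrite ltr_pwDl. Qed.

Let dmx (x : R) : is_derive x 1 (fun x => m + x) 1.
Proof.
rewrite (_ : (fun x => m + x) = cst m + id) //; apply: is_derive_eq.
by rewrite add0r.
Qed.

(** Since m/(m+x)^2 is the derivative of x/(m+x), both have the same exponential mean and the term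
    with K drops out. Up to a common factor they will be the conditional variance of a jump and the
    increment of the clock. *)
Lemma exp_int_mart (f : R -> R) (c K : R) : 0 <= c -> 0 <= K <= 1 ->
  (forall x : R, 0 <= x -> f x <= c * (1 + K * (m / (m + x) ^+ 2 - x / (m + x)))) ->
  (\int[leb]_(x in `[0%R, +oo[) ((f x)%:E * (expR (- x))%:E) <= c%:E)%E.
Proof.
move=> c0 /andP[K0 K1] fle.
pose G x := c * (1 - K) + c * K * m * (m + x)^-1.
pose G' x := - (c * K * m / (m + x) ^+ 2).
have -> : c%:E = (G 0)%:E.
  by rewrite /G addr0; congr EFin; field; rewrite gt_eqF.
have E (x : R) : 0 <= x -> G x - G' x = c * (1 + K * (m / (m + x) ^+ 2 - x / (m + x))).
  by move=> /mx0 p; rewrite /G /G'; field; rewrite gt_eqF.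
have frac (x : R) : 0 <= x -> 0 <= x / (m + x) <= 1.
  move=> x0; rewrite divr_ge0 ?(ltW (mx0 x0)) //=.
  by rewrite ler_pdivrMr ?mx0 // mul1r lerDr ltW.
apply: (@le_exp_integral f G G' c).
- by move=> x x0; rewrite E //; exact: fle.
- move=> x x0; have := dmx x => d1; have nz : m + x != 0 by rewrite gt_eqF ?mx0.
  rewrite /G /G'; apply: is_derive_eq.
  rewrite /GRing.scale /= add0r -exprVn; field; exact: nz.
- move=> x x0; rewrite /G'; apply: continuousN; apply: continuousM; first exact: cst_continuous.
  apply: continuousV; first by rewrite expf_neq0 // gt_eqF ?mx0.
  rewrite (_ : (fun y : R => (m + y) ^+ 2) = (fun y => (m + y) * (m + y))); last first.
    by apply/funext => y; rewrite expr2.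
  by apply: continuousM; apply: continuousD; try exact: cst_continuous; exact: cvg_id.
- move=> x x0; rewrite E // mulr_ge0 //.
  have /andP[f0 f1] := frac x x0.
  have q0 : 0 <= m / (m + x) ^+ 2 by rewrite divr_ge0 ?(ltW m0) // exprn_ge0 // ltW ?mx0.
  nra.
- move=> x x0; have /andP[f0 f1] := frac x x0.
  have -> : G x = c * (1 - K * (x / (m + x))).
    by rewrite /G; field; rewrite gt_eqF ?mx0.
  apply/andP; split; first by rewrite mulr_ge0 //; nra.
  rewrite ler_wpM2l // (@le_trans _ _ 1) //; first nra.
  by rewrite -expR0 ler_expR divr_ge0.
Qed.

(** The bound is G - G' for G(x) = c ((m+x)/m)^(-t). Such powers arise when the logarithm of the
    local time at the current site enters an exponent; for negative t the condition with m/2 keeps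
    the growth below exp(x/2). *)
Lemma exp_int_pow (f : R -> R) (c t : R) : 0 <= c -> - t <= m / 2 ->
  (forall x : R, 0 <= x -> f x <= c * (expR (- t * ln ((m + x) / m)) * (1 + t / (m + x)))) ->
  (\int[leb]_(x in `[0%R, +oo[) ((f x)%:E * (expR (- x))%:E) <= c%:E)%E.
Proof.
move=> c0 tm fle.
pose G x := c * expR (- t * ln (m^-1 * (m + x))).
pose G' x := c * (- t * (m + x)^-1 * expR (- t * ln (m^-1 * (m + x)))).
have -> : c%:E = (G 0)%:E.
  by rewrite /G addr0 mulVf ?gt_eqF // ln1 mulr0 expR0 mulr1.
have q0 (x : R) : 0 <= x -> 0 < m^-1 * (m + x) by move=> x0; rewrite mulr_gt0 ?invr_gt0 ?mx0.
have nz (x : R) : 0 <= x -> m + x != 0 by move=> x0; rewrite gt_eqF ?mx0.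
have E (x : R) : 0 <= x -> G x - G' x = c * (expR (- t * ln ((m + x) / m)) * (1 + t / (m + x))).
  by move=> x0; rewrite /G /G' (mulrC m^-1); field; exact: nz.
apply: (@le_exp_integral f G G' c).
- by move=> x x0; rewrite E //; exact: fle.
- move=> x x0; have := dmx x => d1.
  have dl : is_derive x 1 (fun x => ln (m^-1 * (m + x))) (m + x)^-1.
    have d2 : is_derive x 1 (fun x => m^-1 * (m + x)) m^-1.
      by apply: is_derive_eq; rewrite /GRing.scale /= mulr1.
    have -> : (m + x)^-1 = (m^-1 * (m + x))^-1 * m^-1.
      by field; rewrite (nz x x0) gt_eqF.
    by apply: (@is_derive1_comp R (@ln R) (fun x => m^-1 * (m + x))); exact: is_derive1_ln (q0 x x0).
  have d5 : is_derive x 1 (fun x => - t * ln (m^-1 * (m + x))) (- t * (m + x)^-1).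
    by apply: is_derive_eq.
  have d6 : is_derive x 1 (fun x => expR (- t * ln (m^-1 * (m + x))))
     (expR (- t * ln (m^-1 * (m + x))) * (- t * (m + x)^-1)).
    exact: (@is_derive1_comp R (@expR R) (fun x => - t * ln (m^-1 * (m + x)))).
  rewrite /G /G'; apply: is_derive_eq.
  by rewrite /GRing.scale /=; ring.
- move=> x x0; rewrite /G'.
  have cm : {for x, continuous (fun x => m + x)}.
    by apply: continuousD; [exact: cst_continuous|exact: cvg_id].
  apply: continuousM; first exact: cst_continuous.
  apply: continuousM.
    apply: continuousM; first exact: cst_continuous.
    by apply: continuousV => //; exact: nz.
  apply: continuous_comp; last exact: continuous_expR.
  apply: continuousM; first exact: cst_continuous.
  apply: continuous_comp; last exact: (continuous_ln (q0 x x0)).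
  by apply: continuousM => //; exact: cst_continuous.
- move=> x x0; rewrite E // mulr_ge0 // mulr_ge0 ?expR_ge0 //.
  have m0' : 0 < m by exact: m0.
  rewrite -[1](divff (nz x x0)) -mulrDl divr_ge0 ?(ltW (mx0 x0)) //; lra.
- move=> x x0; rewrite /G mulr_ge0 ?expR_ge0 //= ler_wpM2l // ler_expR.
  have l0 : 0 <= ln (m^-1 * (m + x)).
    by apply: ln_ge0; rewrite mulrDr mulVf ?gt_eqF // lerDl mulr_ge0 // invr_ge0 ltW.
  have l1 : ln (m^-1 * (m + x)) <= x / m.
    have -> : m^-1 * (m + x) = 1 + x / m by field; rewrite gt_eqF.
    apply: le_ln1Dx; apply: (@lt_le_trans _ _ 0); first by lra.
    by rewrite divr_ge0 // ltW.
  have [t0|t0] := leP 0 t; first by nra.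
  have -> : x / 2 = m / 2 * (x / m) by field; rewrite gt_eqF.
  by apply: ler_pM => //; lra.
Qed.

Lemma exp_int_double (f : R -> R) (c : R) : 0 <= c ->
  (forall x : R, 0 <= x -> f x <= c * (2 * expR (- x))) ->
  (\int[leb]_(x in `[0%R, +oo[) ((f x)%:E * (expR (- x))%:E) <= c%:E)%E.
Proof.
move=> c0 fle.
pose G (x : R) := c * expR (- x); pose G' (x : R) := - (c * expR (- x)).
have -> : c%:E = (G 0)%:E by rewrite /G oppr0 expR0 mulr1.
have E (x : R) : G x - G' x = c * (2 * expR (- x)) by rewrite /G /G'; ring.
have dE (x : R) : is_derive x 1 (fun x : R => expR (- x)) (- expR (- x)).
  have -> : - expR (- x) = expR (- x) *: (-1 : R) by rewrite /GRing.scale /= mulrN1.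
  by apply: (@is_derive1_comp R expR -%R).
apply: (@le_exp_integral f G G' c).
- by move=> x x0; rewrite E; exact: fle.
- move=> x x0; have := dE x => d1; rewrite /G /G'; apply: is_derive_eq.
  by rewrite /GRing.scale /= mulrN.
- move=> x x0; rewrite /G'; apply: continuousN; apply: continuousM; first exact: cst_continuous.
  by apply: continuous_comp; [exact: opp_continuous|exact: continuous_expR].
- by move=> x x0; rewrite E !mulr_ge0 ?expR_ge0.
- move=> x x0; rewrite /G mulr_ge0 ?expR_ge0 //= ler_wpM2l // ler_expR; lra.
Qed.

End families.
End expbounds.

Section avg.
Context {R : realType}.
Implicit Types p q a b D A th : R.

(** Only the first moment matters: a jump of size a has probability p/(p+q) and its mean 1/(2D) is
    prescribed; the quadratic part of the exponential is absorbed by the factor 1 + 2 th A. *)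
Lemma avg_up p q a D A th : 0 < p -> 0 < q -> 0 <= a <= A -> 0 < D ->
  p * a / (p + q) = (2 * D)^-1 -> 0 <= th -> th * A <= 1 / 2 ->
  (p * expR (th * a) + q) / (p + q) <= 1 + th / 2 * (1 + 2 * (th * A)) / D.
Proof.
move=> p0 q0 /andP[a0 aA] D0 E th0 thA; have s0 : 0 < p + q by lra.
have ta : th * a <= 1 / 2 by nra.
have e := expR_le_quad ta.
apply: (@le_trans _ _ (1 + p * a / (p + q) * (th * (1 + 2 * (th * a))))).
  rewrite (_ : 1 + _ = (p * (1 + th * a + 2 * (th * a) ^+ 2) + q) / (p + q)); last first.
    by field; rewrite gt_eqF.
  by rewrite ler_pM2r ?invr_gt0 // lerD2r ler_pM2l.
rewrite E (_ : th / 2 * (1 + 2 * (th * A)) / D = (2 * D)^-1 * (th * (1 + 2 * (th * A)))); last first.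
  by field; rewrite gt_eqF.
rewrite lerD2l ler_pM2l ?invr_gt0 ?mulr_gt0 // ler_wpM2l //.
have := ler_wpM2l th0 aA; lra.
Qed.

Lemma avg_down p q a D A th : 0 < p -> 0 < q -> 0 <= a <= A -> 0 < D ->
  p * a / (p + q) = (2 * D)^-1 -> 0 <= th ->
  (p * expR (- (th * a)) + q) / (p + q) <= 1 - th / 2 * (1 - 2 * (th * A)) / D.
Proof.
move=> p0 q0 /andP[a0 aA] D0 E th0; have s0 : 0 < p + q by lra.
have ta : - (th * a) <= 1 / 2 by nra.
have e := expR_le_quad ta.
apply: (@le_trans _ _ (1 - p * a / (p + q) * (th * (1 - 2 * (th * a))))).
  rewrite (_ : 1 - _ = (p * (1 + - (th * a) + 2 * (- (th * a)) ^+ 2) + q) / (p + q)); last first.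
    by field; rewrite gt_eqF.
  by rewrite ler_pM2r ?invr_gt0 // lerD2r ler_pM2l.
rewrite E (_ : th / 2 * (1 - 2 * (th * A)) / D = (2 * D)^-1 * (th * (1 - 2 * (th * A)))); last first.
  by field; rewrite gt_eqF.
rewrite lerD2l lerN2 ler_pM2l ?invr_gt0 ?mulr_gt0 // ler_wpM2l //.
have := ler_wpM2l th0 aA; lra.
Qed.

Lemma avg_both p q a b D A th : 0 < p -> 0 < q -> 0 <= a <= A -> 0 <= b <= A -> 0 < D ->
  p * a / (p + q) = (2 * D)^-1 -> q * b / (p + q) = (2 * D)^-1 ->
  0 <= th -> th * A <= 1 / 2 ->
  (p * expR (th * a) + q * expR (th * b)) / (p + q) <= 1 + th * (1 + 2 * (th * A)) / D.
Proof.
move=> p0 q0 ha hb D0 E1 E2 th0 thA; have s0 : 0 < p + q by lra.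
have := avg_up p0 q0 ha D0 E1 th0 thA.
have := avg_up q0 p0 hb D0 _ th0 thA; rewrite (addrC q) => /(_ E2) i1 i2.
have -> : (p * expR (th * a) + q * expR (th * b)) / (p + q) =
  (p * expR (th * a) + q) / (p + q) + (q * expR (th * b) + p) / (p + q) - 1.
  by field; rewrite gt_eqF.
lra.
Qed.

(** A centred variable with the two values a and -b has variance a b; the linear terms cancel by p a
    = q b. *)
Lemma avg_mart p q a b th : 0 < p -> 0 < q -> 0 <= a -> 0 <= b -> p * a = q * b ->
  th * a <= 1 / 2 -> - (th * b) <= 1 / 2 ->
  (p * expR (th * a) + q * expR (- (th * b))) / (p + q) <= 1 + 2 * th ^+ 2 * (a * b).
Proof.
move=> p0 q0 a0 b0 E ta tb; have s0 : 0 < p + q by lra.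
have e1 := expR_le_quad ta; have e2 := expR_le_quad tb.
apply: (@le_trans _ _ ((p * (1 + th * a + 2 * (th * a) ^+ 2) +
   q * (1 + - (th * b) + 2 * (- (th * b)) ^+ 2)) / (p + q))).
  by rewrite ler_pM2r ?invr_gt0 // lerD // ler_pM2l.
rewrite ler_pdivrMr // le_eqVlt; apply/orP; left; apply/eqP.
have -> : p * (1 + th * a + 2 * (th * a) ^+ 2) + q * (1 + - (th * b) + 2 * (- (th * b)) ^+ 2) =
  p + q + th * (p * a - q * b) + 2 * th ^+ 2 * (p * a * a + q * b * b) by ring.
rewrite E subrr mulr0 addr0 -E.
have -> : p * a * a + p * a * b = a * b * (p + q) + a * (p * a - q * b) by ring.
rewrite E subrr; ring.
Qed.

End avg.

(** * One-step estimates for the martingale and its clock *)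

Section stepfacts.
Context {R : realType} (h : R) (lo : int -> R).
Hypothesis h0 : 0 < h.
Implicit Types c th x : R.
Local Notation valid := (valid h lo).
Local Notation lcn := (lcn h). Local Notation dW := (dW h).
Local Notation ajp := (ajp h). Local Notation ajm := (ajm h).
Local Notation alp := (alp h). Local Notation alm := (alm h).

Variables (s : @vst R) (vs : valid s).
(** With m = [mv s] the wait multiplies the current local time by (m + x)/m. The clock increment and
    the variance of the jump become [k0v s] times x/(m+x) and m/(m+x)^2. *)
Definition mv (s : @vst R) := kap h s * lcv s.
Definition k0v (s : @vst R) := h / 2 * ((lpv s)^-1 + (lmv s)^-1) / lcv s.

Let l0 := lcv_gt0 vs. Let p0 := lpv_gt0 vs. Let q0 := lmv_gt0 vs.

Lemma mv_gt0 : 0 < mv s.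
Proof. by rewrite mulr_gt0 ?(kap_gt0 h0 vs). Qed.

Lemma lcn_mv x : lcn s x = lcv s * ((mv s + x) / mv s).
Proof.
rewrite /lcn /mv /kap; have := l0; have := p0; have := q0; have := h0 => *.
by field; rewrite !gt_eqF // addr_gt0.
Qed.

Lemma dW_mv x : 0 <= x -> dW s x = k0v s * (x / (mv s + x)).
Proof.
move=> x0; have m0 := mv_gt0; have mx : 0 < mv s + x by rewrite ltr_pwDl.
have := l0; have := p0; have := q0 => *.
by rewrite /dW /alp /alm lcn_mv /k0v; field; rewrite !gt_eqF.
Qed.

Lemma aj_mv x : 0 <= x -> ajp s x * ajm s x = k0v s * (mv s / (mv s + x) ^+ 2).
Proof.
move=> x0; have m0 := mv_gt0; have mx : 0 < mv s + x by rewrite ltr_pwDl.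
have := l0; have := p0; have := q0 => *.
have E : mv s = lcv s * (lmv s + lpv s) / (2 * h).
  by rewrite /mv /kap; field; rewrite gt_eqF.
have E2 : h = lcv s * (lmv s + lpv s) / (2 * mv s).
  by rewrite E; field; rewrite !gt_eqF // addr_gt0.
rewrite /ajp /ajm lcn_mv /k0v.
have -> : h / 2 * ((lpv s)^-1 + (lmv s)^-1) / lcv s * (mv s / (mv s + x) ^+ 2) =
  h * (lcv s * (lmv s + lpv s) / (2 * mv s)) * (mv s) ^+ 2 / ((mv s + x) ^+ 2 * lpv s * lmv s * lcv s ^+ 2).
  by field; rewrite !gt_eqF.
by rewrite -E2; field; rewrite !gt_eqF.
Qed.

Lemma ajp_mv x : 0 <= x -> lpv s * ajp s x / (lpv s + lmv s) = (2 * (mv s + x))^-1.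
Proof.
move=> x0; have m0 := mv_gt0; have mx : 0 < mv s + x by rewrite ltr_pwDl.
have := l0; have := p0; have := q0 => *.
rewrite /ajp; have n0 := lcn_gt0 h0 vs x0.
have -> : mv s + x = kap h s * lcn s x.
  by rewrite /mv /lcn; field; rewrite gt_eqF // (kap_gt0 h0 vs).
by rewrite /kap; field; rewrite !gt_eqF // addr_gt0.
Qed.

Lemma ajm_mv x : 0 <= x -> lmv s * ajm s x / (lmv s + lpv s) = (2 * (mv s + x))^-1.
Proof.
move=> x0; rewrite -ajp_mv // -(dM_center h0 vs x0) (addrC (lpv s)).
by [].
Qed.

Lemma ajp_le c x : 0 < c -> c <= lcv s -> c <= lpv s -> 0 <= x -> ajp s x <= h / c ^+ 2.
Proof.
move=> c0 cl cp x0; rewrite /ajp ler_pM2l // lef_pV2 ?posrE ?exprn_gt0 ?mulr_gt0 ?(lcn_gt0 h0 vs) //.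
by rewrite expr2 ler_pM ?(ltW c0) // (le_trans cl) // (lcn_ge h0 vs).
Qed.

Lemma ajm_le c x : 0 < c -> c <= lcv s -> c <= lmv s -> 0 <= x -> ajm s x <= h / c ^+ 2.
Proof.
move=> c0 cl cp x0; rewrite /ajm ler_pM2l // lef_pV2 ?posrE ?exprn_gt0 ?mulr_gt0 ?(lcn_gt0 h0 vs) //.
by rewrite expr2 ler_pM ?(ltW c0) // (le_trans cl) // (lcn_ge h0 vs).
Qed.

Lemma k0v_le c : 0 < c -> c <= lcv s -> c <= lpv s -> c <= lmv s -> 0 <= k0v s <= h / c ^+ 2.
Proof.
move=> c0 cl cp cm; have := l0; have := p0; have := q0; have := h0 => *.
have i1 : (lpv s)^-1 <= c^-1 by rewrite lef_pV2.
have i2 : (lmv s)^-1 <= c^-1 by rewrite lef_pV2.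
have i3 : (lcv s)^-1 <= c^-1 by rewrite lef_pV2.
have j1 : 0 < (lpv s)^-1 by rewrite invr_gt0.
have j2 : 0 < (lmv s)^-1 by rewrite invr_gt0.
have j3 : 0 < (lcv s)^-1 by rewrite invr_gt0.
rewrite /k0v; apply/andP; split; first by rewrite !mulr_ge0 ?addr_ge0 ?ltW.
rewrite (_ : h / c ^+ 2 = h / 2 * (c^-1 + c^-1) / c); last by field; rewrite gt_eqF.
apply: ler_pM; [by rewrite !mulr_ge0 ?addr_ge0 ?ltW|exact: ltW|by rewrite ler_wpM2l ?lerD ?mulr_ge0 ?(ltW h0)|exact: i3].
Qed.

Lemma dW_le c x : 0 < c -> c <= lcv s -> c <= lpv s -> c <= lmv s -> 0 <= x ->
  dW s x <= h / c ^+ 2.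
Proof.
move=> c0 cl cp cm x0; rewrite dW_mv //; have /andP[k0 k1] := k0v_le c0 cl cp cm.
apply: le_trans k1; rewrite ler_piMr // ler_pdivrMr ?mul1r ?lerDr ?(ltW mv_gt0) //.
by rewrite ltr_pwDl // mv_gt0.
Qed.

(** The constant 4 of the compensator is generous: the exponential of the jump costs 2 th^2 times
    the variance, and [expRN_le_half] returns only half of 4 th^2 dW. *)
Lemma mart_step c th x : 0 < c -> c <= lcv s -> c <= lpv s -> c <= lmv s -> 0 <= x ->
  `|th| * (h / c ^+ 2) <= 1 / 2 -> 4 * th ^+ 2 * (h / c ^+ 2) <= 1 ->
  (lpv s * expR (th * ajp s x) + lmv s * expR (- (th * ajm s x))) / (lmv s + lpv s)
     * expR (- (4 * th ^+ 2 * dW s x)) <=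
  1 + 2 * th ^+ 2 * k0v s * (mv s / (mv s + x) ^+ 2 - x / (mv s + x)).
Proof.
move=> c0 cl cp cm x0 t1 t2.
have a0 := ltW (ajp_gt0 h0 vs x0); have b0 := ltW (ajm_gt0 h0 vs x0).
have aA := ajp_le c0 cl cp x0; have bA := ajm_le c0 cl cm x0.
have ta : th * ajp s x <= 1 / 2.
  apply: le_trans t1; apply: le_trans (ler_norm _) _; rewrite normrM ler_wpM2l // ger0_norm //.
have tb : - (th * ajm s x) <= 1 / 2.
  apply: le_trans t1; apply: le_trans (ler_norm _) _; rewrite normrN normrM ler_wpM2l // ger0_norm //.
have := avg_mart p0 q0 a0 b0 (dM_center h0 vs x0) ta tb; rewrite (addrC (lpv s)) => av.
have w0 := dW_ge0 h0 vs x0; have wA := dW_le c0 cl cp cm x0.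
have t0 : 0 <= th ^+ 2 by exact: sqr_ge0.
have ew : expR (- (4 * th ^+ 2 * dW s x)) <= 1 - 2 * th ^+ 2 * dW s x.
  apply: le_trans (expRN_le_half _) _; last by lra.
  apply/andP; split; first by apply: mulr_ge0 => //; apply: mulr_ge0.
  by apply: le_trans t2; rewrite ler_wpM2l //; apply: mulr_ge0.
apply: (@le_trans _ _ ((1 + 2 * th ^+ 2 * (ajp s x * ajm s x)) * (1 - 2 * th ^+ 2 * dW s x))).
  apply: ler_pM; rewrite ?expR_ge0 //.
  by rewrite divr_ge0 ?addr_ge0 ?mulr_ge0 ?expR_ge0 ?(ltW p0) ?(ltW q0).
have ab0 : 0 <= ajp s x * ajm s x by rewrite mulr_ge0.
apply: (@le_trans _ _ (1 + 2 * th ^+ 2 * (ajp s x * ajm s x - dW s x))).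
  have : 0 <= (2 * th ^+ 2 * (ajp s x * ajm s x)) * (2 * th ^+ 2 * dW s x).
    by apply: mulr_ge0; (apply: mulr_ge0 => //; apply: mulr_ge0).
  lra.
rewrite aj_mv // dW_mv // le_eqVlt; apply/orP; left; apply/eqP; ring.
Qed.

End stepfacts.

(** * Integer facts about nearest-neighbour moves *)

Section neighbours.
Implicit Types (X x y : int) (b : bool).
Lemma nbr_lt_le b X x : X < x -> (if b then X + 1 else X - 1) <= x.
Proof. by case: b; lia. Qed.
Lemma nbr_gt_ge b X x : x < X -> x <= (if b then X + 1 else X - 1).
Proof. by case: b; lia. Qed.
Lemma nbr_le_eq b X x : x < X -> (if b then X + 1 else X - 1) <= x ->
  (if b then X + 1 else X - 1) = x.
Proof. by case: b; lia. Qed.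
Lemma nbr_ge_eq b X x : X < x -> x <= (if b then X + 1 else X - 1) ->
  (if b then X + 1 else X - 1) = x.
Proof. by case: b; lia. Qed.
Lemma nbr_gt b X x y : x < y -> y < X -> ((if b then X + 1 else X - 1) <= x) = false.
Proof. by move=> *; apply/negbTE; rewrite -ltNge; case: b; lia. Qed.
Lemma int_mid x y X : x < X -> X < y -> [/\ x <= X <= y, x <= X + 1 <= y & x <= X - 1 <= y].
Proof. by move=> *; split; lia. Qed.
Lemma int_ltP1 x y : x < y -> [/\ x <= x <= y, x <= x + 1 <= y, x <= y <= y & x <= y - 1 <= y].
Proof. by move=> *; split; lia. Qed.
Lemma int_addx X x : x <= X -> (X + 1 <= x) = false /\ X - 1 <= X /\ X <= X + 1 /\ (X <= X - 1) = false.
Proof. by move=> *; split; [apply/negbTE; rewrite -ltNge; lia|split; [|split; [|apply/negbTE; rewrite -ltNge]]; lia]. Qed.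
Lemma int_ge_add1 x y : x < y -> y <= x + 1 -> x + 1 = y. Proof. lia. Qed.
End neighbours.

(** * Exponential supermartingales comparing two local times *)

Section supermartingales.
Context {R : realType} (h : R) (lo : int -> R) (chi : nat -> @vst R -> R).
Hypotheses (h0 : 0 < h) (chi0 : forall m s, 0 <= chi m s).
Implicit Types (s : @vst R) (c th r t x : R).
Local Notation leb := (@lebesgue_measure R).
Local Notation valid := (valid h lo).
Local Notation step := (step h chi).
Local Notation stepavg := (stepavg h chi).
Local Notation supermart F s :=
  (\int[leb]_(x in `[0%R, +oo[) ((stepavg F s x)%:E * (expR (- x))%:E) <= (F s)%:E)%E.

Lemma stepavg_le (F : @vst R -> R) s x (rt rf : R) : valid s ->
  F (step s x true) <= F s * rt -> F (step s x false) <= F s * rf ->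
  stepavg F s x <= F s * ((lpv s * rt + lmv s * rf) / (lmv s + lpv s)).
Proof.
move=> vs it jf; have p0 := lpv_gt0 vs; have q0 := lmv_gt0 vs.
rewrite /stepavg mulrA ler_pM2r ?invr_gt0 ?addr_gt0 //.
have := ler_wpM2l (ltW p0) it; have := ler_wpM2l (ltW q0) jf; lra.
Qed.

Lemma supermart_cst (F : @vst R -> R) s : valid s -> 0 <= F s ->
  (forall x b, 0 <= x -> F (step s x b) <= F s) -> supermart F s.
Proof.
move=> vs Fs0 Fle; have m0 := mv_gt0 h0 vs.
apply: (@exp_int_mart _ (mv h s) m0 _ (F s) 0) => //; first by rewrite lexx ler01.
move=> x x0; rewrite mul0r addr0.
have := @stepavg_le F s x 1 1 vs; rewrite !mulr1 => /(_ (Fle x true x0) (Fle x false x0)).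
by rewrite (addrC (lmv s)) divff ?mulr1 // gt_eqF // addr_gt0 ?lpv_gt0 ?lmv_gt0 //; [exact: (lpv_gt0 vs)|exact: (lmv_gt0 vs)].
Qed.

Lemma supermart_mart (F : @vst R -> R) s c th : valid s -> 0 <= F s ->
  0 < c -> c <= lcv s -> c <= lpv s -> c <= lmv s ->
  `|th| * (h / c ^+ 2) <= 1 / 2 -> 4 * th ^+ 2 * (h / c ^+ 2) <= 1 ->
  (forall x b, 0 <= x ->
     F (step s x b) <= F s * expR (th * dM h s x b - 4 * th ^+ 2 * dW h s x)) ->
  supermart F s.
Proof.
move=> vs Fs0 c0 cl cp cm t1 t2 Fle; have m0 := mv_gt0 h0 vs.
have /andP[k0 k1] := k0v_le h0 vs c0 cl cp cm.
have t0 : 0 <= th ^+ 2 by exact: sqr_ge0.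
apply: (@exp_int_mart _ (mv h s) m0 _ (F s) (2 * th ^+ 2 * k0v h s)) => //.
  apply/andP; split; first by apply: mulr_ge0 => //; apply: mulr_ge0.
  by have := ler_wpM2l t0 k1; lra.
move=> x x0.
apply: le_trans (stepavg_le vs (Fle x true x0) (Fle x false x0)) _.
rewrite ler_wpM2l //; apply: le_trans (mart_step h0 vs c0 cl cp cm x0 t1 t2).
rewrite /dM mulrN !expRD le_eqVlt; apply/orP; left; apply/eqP; ring.
Qed.

(** For a walk sitting at a site whose local time enters the exponent: its own wait then produces
    the power of (m + x)/m. *)
Lemma supermart_pow (F : @vst R -> R) s (t : R) (rt rf : R -> R) : valid s -> 0 <= F s ->
  - t <= mv h s / 2 ->
  (forall x, 0 <= x -> F (step s x true) <= F s * (expR (- t * ln ((mv h s + x) / mv h s)) * rt x)) ->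
  (forall x, 0 <= x -> F (step s x false) <= F s * (expR (- t * ln ((mv h s + x) / mv h s)) * rf x)) ->
  (forall x, 0 <= x -> (lpv s * rt x + lmv s * rf x) / (lmv s + lpv s) <= 1 + t / (mv h s + x)) ->
  supermart F s.
Proof.
move=> vs Fs0 tm it jf av; have m0 := mv_gt0 h0 vs.
apply: (@exp_int_pow _ (mv h s) m0 _ (F s) t) => // x x0.
apply: le_trans (stepavg_le vs (it x x0) (jf x x0)) _.
rewrite ler_wpM2l //; have e0 := expR_ge0 (- t * ln ((mv h s + x) / mv h s)).
apply: le_trans (ler_wpM2l e0 (av x x0)).
rewrite le_eqVlt; apply/orP; left; apply/eqP; ring.
Qed.

Lemma ln_lcn s x l : valid s -> 0 <= x -> 0 < l ->
  ln (lcn h s x / l) = ln (lcv s / l) + ln ((mv h s + x) / mv h s).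
Proof.
move=> vs x0 l0; have m0 := mv_gt0 h0 vs; have c0 := lcv_gt0 vs.
rewrite -lnM ?posrE ?divr_gt0 //; last by rewrite ltr_pwDl.
by rewrite (lcn_mv h0 vs); congr ln; ring.
Qed.

(** The martingale seen from x and clipped to the interval between the two sites, the discrete
    counterpart of the process in Tanaka's formula. *)
Definition phi (x y : int) s := if sX s <= x then 0 else if y <= sX s then sS s y - sS s x
  else sM s - sS s x.

(** The clipped process is pushed up when the walk leaves x to the right and down when it leaves y
    to the left; the logarithms of the two local times compensate these pushes. The term with 4 / 2
    compensates the variance in between, because [sS s y - sS s x] then shrinks at twice the speed
    of the clock. *)
Definition F1 th t t' (x y : int) (lx ly : R) s :=
  expR (th * phi x y s + 4 / 2 * th ^+ 2 * (sS s y - sS s x)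
        - t * ln (sL s x / lx) + t' * ln (sL s y / ly)).

Lemma mfunc_F1 th t t' (x y : int) lx ly : mfunc (F1 th t t' x y lx ly).
Proof.
move=> d T s ms; apply: measurableT_comp => //.
have mS j : measurable_fun setT (fun w => sS (s w) j) by exact: mfunc_sS.
have mln j (l : R) : measurable_fun setT (fun w => ln (sL (s w) j / l)).
  by apply: (measurableT_comp (@measurable_ln R)); apply: measurable_funM => //; exact: mfunc_sL.
apply: measurable_funD; last by apply: measurable_funM.
apply: measurable_funB; last by apply: measurable_funM.
apply: measurable_funD; last by apply: measurable_funM => //; exact: measurable_funB.
apply: measurable_funM => //; apply: measurable_fun_ifT => //.
  exact: (mfunc_sXp (fun i => i <= x)).
apply: measurable_fun_ifT; first exact: (mfunc_sXp (fun i => y <= i)).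
  exact: measurable_funB.
by apply: measurable_funB => //; exact: mfunc_sM.
Qed.

Section F1sup.
Variables (x y : int) (c th lx ly : R).
Hypotheses (xy : x < y) (c0 : 0 < c) (clo : forall j, x <= j <= y -> c <= lo j).
Hypotheses (lx0 : 0 < lx) (ly0 : 0 < ly) (th0 : 0 <= th).
Hypotheses (t1 : th * (h / c ^+ 2) <= 1 / 2) (t2 : 4 * th ^+ 2 * (h / c ^+ 2) <= 1).
Let a := h / c ^+ 2.
Let t := th / 2 * (1 + 2 * (th * a)).
Let t' := th / 2 * (1 - 2 * (th * a)).
Let F := F1 th t t' x y lx ly.

Let a0 : 0 <= a. Proof. by rewrite divr_ge0 ?ltW // exprn_gt0. Qed.
Let F0 s : 0 <= F s. Proof. exact: expR_ge0. Qed.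

Let cL s j : valid s -> x <= j <= y -> c <= sL s j.
Proof. by move=> vs /clo cj; have /andP[_] := vs.1 j; exact: le_trans. Qed.

Let Fstep s u b (dp : R) : sL (step s u b) x = sL s x -> sL (step s u b) y = sL s y ->
  th * phi x y (step s u b) + 2 * th ^+ 2 * (sS (step s u b) y - sS (step s u b) x) <=
    th * phi x y s + 2 * th ^+ 2 * (sS s y - sS s x) + dp ->
  F (step s u b) <= F s * expR dp.
Proof.
move=> e1 e2 le; rewrite /F /F1 -expRD ler_expR e1 e2.
have -> : 4 / 2 = 2 :> R by field.
lra.
Qed.

Let th2 : 0 <= 2 * th ^+ 2. Proof. by rewrite mulr_ge0 // sqr_ge0. Qed.

Lemma F1_super s : valid s -> supermart F s.
Proof.
move=> vs; have th2' := th2.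
(* Five positions of the walk. Outside the interval both ends shift together and the exponent is
   unchanged; strictly inside it follows the martingale; at an end a power of the local time
   enters. *)
have [Xx|xX|Xx] := ltgtP (sX s) x.
- apply: supermart_cst => // u b u0; rewrite -[leRHS]mulr1 -expR0; apply: Fstep.
  + by rewrite /= gt_eqF.
  + by rewrite /= gt_eqF // (lt_trans Xx).
  + have -> : phi x y (step s u b) = 0.
      by rewrite /phi ifT //; exact: nbr_lt_le.
    have -> : phi x y s = 0 by rewrite /phi (ltW Xx).
    by rewrite /= Xx (lt_trans Xx xy) addr0 lerD2l ler_wpM2l //; lra.
- have [Xy|yX|Xy] := ltgtP (sX s) y.
  + have [i1 i2 i3] := int_mid xX Xy.
    have cl : c <= lcv s by exact: cL.
    have cp : c <= lpv s by exact: cL.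
    have cm : c <= lmv s by exact: cL.
    apply: (@supermart_mart F s c th) => //; first by rewrite ger0_norm.
    move=> u b u0; have al := alm_ge0 h0 vs u0; apply: Fstep.
    * by rewrite /= lt_eqF.
    * by rewrite /= gt_eqF.
    have Sx : sS (step s u b) x = sS s x + alm h s u by rewrite /= ltNge (ltW xX) /= xX.
    have Sy : sS (step s u b) y = sS s y - alp h s u by rewrite /= Xy.
    have pE : phi x y s = sM s - sS s x by rewrite /phi leNgt xX /= leNgt Xy.
    have pE' : phi x y (step s u b) = sM (step s u b) - sS (step s u b) x.
      rewrite /phi; case: leP => X1.
        by rewrite {1}/sM (_ : sX (step s u b) = x) ?subrr //; exact: nbr_le_eq X1.
      case: leP => // X2.
      by rewrite /sM (_ : sX (step s u b) = y) //; exact: nbr_ge_eq X2.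
    rewrite pE' pE (sM_step h0 chi0 vs u0 b) Sx Sy /dW.
    have := mulr_ge0 th0 al; lra.
  + apply: supermart_cst => // u b u0; rewrite -[leRHS]mulr1 -expR0; apply: Fstep.
    * by rewrite /= lt_eqF.
    * by rewrite /= lt_eqF.
    have nX' : (sX (step s u b) <= x) = false.
      exact: nbr_gt xy yX.
    have yX' : (y <= sX (step s u b)) by exact: nbr_gt_ge.
    have Sx : sS (step s u b) x = sS s x + alm h s u by rewrite /= ltNge (ltW xX) /= xX.
    have Sy : sS (step s u b) y = sS s y + alm h s u by rewrite /= ltNge (ltW yX) /= yX.
    rewrite /phi nX' yX' Sx Sy (leNgt (sX s)) xX /= (ltW yX) addr0.
    by rewrite le_eqVlt; apply/orP; left; apply/eqP; ring.
  + have [_ _ i1 i2] := int_ltP1 xy.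
    have cl : c <= lcv s by rewrite /lcv Xy; exact: cL.
    have cm : c <= lmv s by rewrite /lmv Xy; exact: cL.
    have E0 : phi x y s = sS s y - sS s x by rewrite /phi leNgt xX /= Xy lexx.
    have Sx u b : sS (step s u b) x = sS s x + alm h s u by rewrite /= ltNge (ltW xX) /= xX.
    have Sy u b : sS (step s u b) y = sS s y by rewrite /= Xy ltxx.
    have key (u : R) b (dp : R) : 0 <= u ->
        th * phi x y (step s u b) <= th * (sS s y - sS s x) + dp ->
        F (step s u b) <= F s * (expR (t' * ln ((mv h s + u) / mv h s)) * expR dp).
      move=> u0 le; have al := alm_ge0 h0 vs u0.
      rewrite /F /F1 -!expRD ler_expR Sx Sy.
      have -> : sL (step s u b) x = sL s x by rewrite /= lt_eqF.
      have -> : sL (step s u b) y = lcn h s u by rewrite /= -Xy eqxx.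
      rewrite (ln_lcn vs u0) // E0.
      have := mulr_ge0 th2' al; have -> : 4 / 2 = 2 :> R by field.
      move: le; rewrite /lcv Xy; lra.
    have kb : 0 < kap h s := kap_gt0 h0 vs.
    apply: (@supermart_pow F s (- t') (fun=> 1) (fun u => expR (- (th * ajm h s u)))) => //.
    (* Only the left neighbour of y is known to lie in the window, whence the factor 2. *)
    * have m1 : (2 * a)^-1 <= mv h s.
        rewrite /mv /kap /a.
        have -> : (2 * (h / c ^+ 2))^-1 = c * c / (2 * h) by field; rewrite !gt_eqF.
        rewrite [leRHS]mulrAC ler_pM2r ?invr_gt0 ?mulr_gt0 //.
        have pp := lpv_gt0 vs; rewrite [leRHS]mulrC; apply: ler_pM; rewrite ?(ltW c0) //; lra.
      have ap : 0 < a by rewrite divr_gt0 ?exprn_gt0.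
      have : 2 * (th / 2) <= (2 * a)^-1.
        have aa : 0 < 2 * a by rewrite mulr_gt0.
        rewrite -[leRHS]mul1r ler_pdivlMr //.
        have t1' : th * a <= 1 / 2 by exact: t1.
        lra.
      have := mulr_ge0 th0 (mulr_ge0 th0 a0); rewrite opprK /t' => *; lra.
    * move=> u u0; rewrite opprK -expR0; apply: key => //.
      have al := alm_ge0 h0 vs u0.
      have [n1 [_ [n2 _]]] := int_addx (ltW xX).
      rewrite addr0 ler_wpM2l // /phi [sX _]/= n1 -{1}Xy n2 Sx Sy; lra.
    * move=> u u0; rewrite opprK; apply: key => //.
      have al := alm_ge0 h0 vs u0.
      have pE' : phi x y (step s u false) = sM (step s u false) - sS (step s u false) x.
        rewrite /phi; case: leP => X1.
          by rewrite {1}/sM (_ : sX (step s u false) = x) ?subrr //; exact: (@nbr_le_eq false (sX s) x xX X1).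
        have [_ [_ [_ n2]]] := int_addx (lexx (sX s)).
        by rewrite [sX _]/= -Xy n2.
      rewrite pE' (sM_step h0 chi0 vs u0) Sx /dM /sM Xy.
      have := mulr_ge0 th0 al; lra.
    * move=> u u0.
      have q0 := lmv_gt0 vs; have p0 := lpv_gt0 vs.
      have mu0 : 0 < mv h s + u by rewrite ltr_pwDl ?mv_gt0 //; exact: (mv_gt0 h0 vs).
      have b0 : 0 <= ajm h s u <= a by rewrite ltW ?(ajm_gt0 h0 vs) //= (ajm_le h0 vs).
      have := avg_down q0 p0 b0 mu0 (ajm_mv h0 vs u0) th0.
      by rewrite mulr1 (addrC (lpv s)) mulNr /t'.
- have [i1 i2 _ _] := int_ltP1 xy.
  have [n1 [n0 [n2 n3]]] := int_addx (lexx (sX s)).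
  have cl : c <= lcv s by rewrite /lcv Xx; exact: cL.
  have cp : c <= lpv s by rewrite /lpv Xx; exact: cL.
  have Sx u b : sS (step s u b) x = sS s x by rewrite /= Xx ltxx.
  have Sy u b : sS (step s u b) y = sS s y - alp h s u by rewrite /= Xx xy.
  have E0 : phi x y s = 0 by rewrite /phi Xx lexx.
  have key (u : R) b (dp : R) : 0 <= u -> th * phi x y (step s u b) <= dp ->
      F (step s u b) <= F s * (expR (- t * ln ((mv h s + u) / mv h s)) * expR dp).
    move=> u0 le; have al := alp_ge0 h0 vs u0.
    rewrite /F /F1 -!expRD ler_expR Sx Sy.
    have -> : sL (step s u b) y = sL s y by rewrite /= Xx gt_eqF.
    have -> : sL (step s u b) x = lcn h s u by rewrite /= -Xx eqxx.
    rewrite (ln_lcn vs u0) // E0.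
    have := mulr_ge0 th2' al; have -> : 4 / 2 = 2 :> R by field.
    move: le; rewrite /lcv Xx; lra.
  have tp : 0 <= t.
    by apply: mulr_ge0; [exact: divr_ge0|apply: addr_ge0 => //; apply: mulr_ge0 => //; exact: mulr_ge0].
  apply: (@supermart_pow F s t (fun u => expR (th * ajp h s u)) (fun=> 1)) => //.
  + have m0 := mv_gt0 h0 vs; apply: (@le_trans _ _ 0); first by rewrite oppr_le0.
    by rewrite divr_ge0 // ltW.
  + move=> u u0; apply: key => //.
    have pE' : phi x y (step s u true) = sM (step s u true) - sS (step s u true) x.
      rewrite /phi -{1}Xx [sX (step _ _ _)]/= n1; case: leP => // X2.
      by rewrite {1}/sM [sX _]/= (_ : sX s + 1 = y) //; move: X2; rewrite Xx; exact: int_ge_add1.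
    by rewrite pE' (sM_step h0 chi0 vs u0) Sx /dM /sM Xx addrAC subrr add0r.
  + move=> u u0; rewrite -expR0; apply: key => //.
    by rewrite /phi [sX _]/= -Xx n0 mulr0.
  + move=> u u0.
    have q0 := lmv_gt0 vs; have p0 := lpv_gt0 vs.
    have mu0 : 0 < mv h s + u by rewrite ltr_pwDl //; exact: (mv_gt0 h0 vs).
    have b0 : 0 <= ajp h s u <= a by rewrite ltW ?(ajp_gt0 h0 vs) //= (ajp_le h0 vs).
    have := avg_up p0 q0 b0 mu0 (ajp_mv h0 vs u0) th0 t1.
    by rewrite mulr1 (addrC (lpv s)) /t.
Qed.

End F1sup.
End supermartingales.

Section mirror.
Context {R : realType} (h : R) (lo : int -> R) (chi : nat -> @vst R -> R).
Hypotheses (h0 : 0 < h) (chi0 : forall m s, 0 <= chi m s).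
Implicit Types (s : @vst R) (c th r t x : R).

(** Reflection of the line exchanges the two ends, so that [F1_super] also bounds the left local
    time by the right one. *)
Definition mir s := VSt (- sX s) (fun j => sL s (- j)) (fun j => - sS s (- j))
  (sW s) (sJ s) (sE s) (sA s) (sB s) (sC s).

Lemma lmv_mir s : lmv (mir s) = lpv s.
Proof. by rewrite /lmv /lpv /= opprB opprK addrC. Qed.
Lemma lpv_mir s : lpv (mir s) = lmv s.
Proof. by rewrite /lmv /lpv /= opprD opprK. Qed.
Lemma lcv_mir s : lcv (mir s) = lcv s.
Proof. by rewrite /lcv /= opprK. Qed.
Lemma lcn_mir s x : lcn h (mir s) x = lcn h s x.
Proof. by rewrite /lcn /kap lcv_mir lmv_mir lpv_mir (addrC (lpv s)). Qed.

Lemma valid_mir s : valid h lo s -> valid h (fun j => lo (- j)) (mir s).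
Proof.
move=> [v1 [v2 v3]]; split; [|split=> //] => j /=; first exact: v1.
have := v2 (- (j + 1)); rewrite (_ : - (j + 1) + 1 = - j); last by ring.
by rewrite (mulrC (sL s _)) => <-; ring.
Qed.

Lemma phi_ext (x y : int) s s' : sX s = sX s' -> sS s = sS s' -> phi x y s = phi x y s'.
Proof. by move=> e1 e2; rewrite /phi /sM e1 e2. Qed.

Lemma F1_ext th t t' (x y : int) lx ly s s' : sX s = sX s' -> sL s = sL s' -> sS s = sS s' ->
  F1 th t t' x y lx ly s = F1 th t t' x y lx ly s'.
Proof. by move=> e1 e2 e3; rewrite /F1 (phi_ext _ _ e1 e3) e2 e3. Qed.

Lemma F1_mir_step th t t' (x y : int) lx ly s u b :
  F1 th t t' x y lx ly (mir (step h chi s u b)) =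
  F1 th t t' x y lx ly (step h chi (mir s) u (~~ b)).
Proof.
apply: F1_ext => /=.
- by case: b; rewrite /= ?opprD ?opprK.
- by apply/funext => j; rewrite lcn_mir eqr_oppLR.
- apply/funext => j; rewrite [in RHS]ltrNl [in RHS]ltrNr /alp /alm lcn_mir lcv_mir lmv_mir lpv_mir.
  by case: ltgtP => _ //; ring.
Qed.

Lemma stepavg_mir th t t' (x y : int) lx ly s u :
  stepavg h chi (fun s => F1 th t t' x y lx ly (mir s)) s u =
  stepavg h chi (F1 th t t' x y lx ly) (mir s) u.
Proof. by rewrite /stepavg !F1_mir_step lmv_mir lpv_mir addrC (addrC (lpv s)). Qed.

Lemma mfunc_mir (F : @vst R -> R) : mfunc F -> mfunc (fun s => F (mir s)).
Proof.
move=> mF d T s [a1 [a2 [a3 [a4 [a5 [a6 [a7 [a8 a9]]]]]]]]; apply: mF.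
split9 => //=.
- by move=> j; have := a1 (- j); under eq_fun do rewrite -eqr_oppLR.
- by move=> j; apply: measurable_funN; exact: a3.
Qed.

End mirror.

(** * Further supermartingales: recorded increments, holding variables, local time at a site *)

Section more.
Context {R : realType} (h : R) (lo : int -> R) (chi : nat -> @vst R -> R).
Hypotheses (h0 : 0 < h) (chi0 : forall m s, 0 <= chi m s) (mchi : forall m, mfunc (chi m)).
Implicit Types (s : @vst R) (c th r t x : R).
Local Notation leb := (@lebesgue_measure R).
Local Notation valid := (valid h lo).
Local Notation step := (step h chi).
Local Notation supermart F s :=
  (\int[leb]_(x in `[0%R, +oo[) ((stepavg h chi F s x)%:E * (expR (- x))%:E) <= (F s)%:E)%E.

Definition F2 th m s := expR (th * sA s m - 4 * th ^+ 2 * sB s m).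

Lemma mfunc_F2 th m : mfunc (F2 th m).
Proof.
move=> d T s [_ [_ [_ [_ [_ [_ [a7 [a8 _]]]]]]]]; apply: measurableT_comp => //.
by apply: measurable_funB; apply: measurable_funM.
Qed.

Lemma F2_super c th m : 0 < c ->
  (forall s, chi m s = 0 \/ [/\ chi m s = 1, c <= lo (sX s), c <= lo (sX s + 1) & c <= lo (sX s - 1)]) ->
  `|th| * (h / c ^+ 2) <= 1 / 2 -> 4 * th ^+ 2 * (h / c ^+ 2) <= 1 ->
  forall s, valid s -> supermart (F2 th m) s.
Proof.
move=> c0 hchi t1 t2 s vs.
have F0 : 0 <= F2 th m s by exact: expR_ge0.
have cl j : c <= lo j -> c <= sL s j.
  by move=> cj; have /andP[_] := vs.1 j; exact: le_trans.
have [e|[e c1 c2 c3]] := hchi s.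
  by apply: (@supermart_cst _ h lo chi h0) => // x b x0; rewrite /F2 /= e !mul0r !addr0.
apply: (@supermart_mart _ h lo chi h0 _ s c th) => //; try exact: cl.
by move=> x b x0; rewrite /F2 /= e !mul1r -expRD ler_expR; lra.
Qed.

(** As exp(-x) has mean 1/2 under the exponential law, adding ln 2 per step makes the mean constant;
    it keeps the sum of k holding variables from lagging far behind k ln 2. *)
Definition F5 s := expR (- sE s).

Lemma mfunc_F5 : mfunc F5.
Proof.
move=> d T s [_ [_ [_ [_ [_ [a6 _]]]]]]; apply: measurableT_comp => //.
exact: measurable_funN.
Qed.

Lemma F5_super s : valid s -> supermart F5 s.
Proof.
move=> vs; apply: exp_int_double; first exact: expR_ge0.
move=> x x0.
have E b : F5 (step s x b) <= F5 s * (2 * expR (- x)).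
  rewrite /F5 /= (_ : - (sE s + (x - ln 2)) = - sE s + (ln 2 + - x)); last by ring.
  by rewrite !expRD lnK ?posrE.
apply: le_trans (stepavg_le vs (E true) (E false)) _.
have p0 := lpv_gt0 vs; have q0 := lmv_gt0 vs.
rewrite -mulrDl (addrC (lmv s)) mulrAC divff ?mul1r //.
by rewrite gt_eqF // addr_gt0.
Qed.

(** Forces the local time at z to grow with the clock. Away from z the scale function contracts
    around the walk, so the distance between the martingale and the image of z drifts towards 0, and
    part of this drift is spent on the clock term. At z the jumps away are paid by the logarithm of
    the local time. Switch 1 kills the process once the walk has been outside the controlled
    region. *)
Definition F3 (z : int) t lz s :=
  if 0 < sC s 1%N then 0 else
  expR (`|sM s - sS s z| / 16 + sB s 0%N / 64 - t * ln (sL s z / lz)).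

Lemma mfunc_F3 z t lz : mfunc (F3 z t lz).
Proof.
move=> d T s ms; have [_ [mL [mS [_ [_ [_ [_ [mB mC]]]]]]]] := ms.
apply: measurable_fun_ifT => //; first exact: measurable_fun_ltr.
apply: measurableT_comp => //; apply: measurable_funB.
  apply: measurable_funD; last by apply: measurable_funM.
  apply: measurable_funM => //; apply: measurableT_comp => //.
  by apply: measurable_funB => //; exact: mfunc_sM.
apply: measurable_funM => //; apply: (measurableT_comp (@measurable_ln R)).
by apply: measurable_funM.
Qed.

Lemma F3_super c (z : int) (lz : R) : 0 < c -> 0 < lz ->
  (forall s, chi 0%N s = (sX s != z)%:R) ->
  (forall s, valid s -> chi 1%N s <= 0 -> [/\ c <= lo (sX s), c <= lo (sX s + 1), c <= lo (sX s - 1),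
     lmv s <= 3 * lpv s & lpv s <= 3 * lmv s]) ->
  h / c ^+ 2 <= 1 ->
  let t := 16^-1 * (1 + 2 * (16^-1 * (h / c ^+ 2))) in
  forall s, valid s -> supermart (F3 z t lz) s.
Proof.
move=> c0 lz0 hchi0 hchi ha t s vs.
have a0 : 0 <= h / c ^+ 2 by rewrite divr_ge0 ?ltW // exprn_gt0.
have F0 : 0 <= F3 z t lz s by rewrite /F3; case: ifP => // _; exact: expR_ge0.
have C00 : 0 <= sC s 1%N by exact: vs.2.2.
have [C0|C0] := ltP 0 (sC s 1%N).
  apply: (@supermart_cst _ h lo chi h0) => // x b x0; rewrite /F3 /= C0 ifT //.
  by rewrite ltr_pwDl.
have [X0|X0] := ltP 0 (chi 1%N s).
  apply: (@supermart_cst _ h lo chi h0) => // x b x0; rewrite {1}/F3 /= ifT //.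
  by rewrite ltr_wpDl.
have [c1 c2 c3 r1 r2] := hchi s vs X0.
have cl j : c <= lo j -> c <= sL s j.
  by move=> cj; have /andP[_] := vs.1 j; exact: le_trans.
have cl1 : c <= lcv s by exact: cl.
have cl2 : c <= lpv s by exact: cl.
have cl3 : c <= lmv s by exact: cl.
have FE : F3 z t lz s = expR (`|sM s - sS s z| / 16 + sB s 0%N / 64 - t * ln (sL s z / lz)).
  by rewrite /F3 ltNge C0.
have FSE u b : 0 <= u -> F3 z t lz (step s u b) <= expR (`|sM s + dM h s u b - sS (step s u b) z| / 16
    + (sB s 0%N + (sX s != z)%:R * dW h s u) / 64 - t * ln (sL (step s u b) z / lz)).
  move=> u0; rewrite /F3; case: ifP => _; first exact: expR_ge0.
  by rewrite (sM_step h0 chi0 vs u0) /= hchi0.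
have q0 := lmv_gt0 vs; have p0 := lpv_gt0 vs; have l0 := lcv_gt0 vs.
have [Xz|Xz] := eqVneq (sX s) z.
  have Mz : sM s = sS s z by rewrite /sM Xz.
  have Sz u b : sS (step s u b) z = sS s z by rewrite /= Xz ltxx.
  have Lz u b : sL (step s u b) z = lcn h s u by rewrite /= -Xz eqxx.
  have tp : 0 <= t by rewrite /t; lra.
  have key (u : R) b (dp : R) : 0 <= u -> `|dM h s u b| / 16 <= dp ->
      F3 z t lz (step s u b) <= F3 z t lz s * (expR (- t * ln ((mv h s + u) / mv h s)) * expR dp).
    move=> u0 le; apply: le_trans (FSE u b u0) _.
    rewrite FE -!expRD ler_expR Sz Lz Mz (_ : sS s z + dM h s u b - sS s z = dM h s u b); last by ring.
    rewrite subrr normr0 (ln_lcn h0 vs u0) // /lcv Xz eqxx /= mul0r addr0.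
    lra.
  apply: (@supermart_pow _ h lo chi h0 (F3 z t lz) s t (fun u => expR (16^-1 * ajp h s u))
     (fun u => expR (16^-1 * ajm h s u))) => //.
  - have m0 := mv_gt0 h0 vs; apply: (@le_trans _ _ 0); first by rewrite oppr_le0.
    by rewrite divr_ge0 // ltW.
  - by move=> u u0; apply: key => //=; rewrite ger0_norm 1?mulrC // ltW // (ajp_gt0 h0 vs).
  - by move=> u u0; apply: key => //=; rewrite normrN ger0_norm 1?mulrC // ltW // (ajm_gt0 h0 vs).
  - move=> u u0.
    have mu0 : 0 < mv h s + u by rewrite ltr_pwDl //; exact: (mv_gt0 h0 vs).
    have b0 : 0 <= ajp h s u <= h / c ^+ 2 by rewrite ltW ?(ajp_gt0 h0 vs) //= (ajp_le h0 vs).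
    have b1 : 0 <= ajm h s u <= h / c ^+ 2 by rewrite ltW ?(ajm_gt0 h0 vs) //= (ajm_le h0 vs).
    have e1 := ajm_mv h0 vs u0; rewrite (addrC (lmv s)) in e1.
    have th0 : 0 <= 16^-1 :> R by rewrite invr_ge0.
    have thA : 16^-1 * (h / c ^+ 2) <= 1 / 2 by lra.
    have := avg_both p0 q0 b0 b1 mu0 (ajp_mv h0 vs u0) e1 th0 thA.
    by rewrite (addrC (lpv s)) /t.
(* The neighbouring local times being comparable within the factor 3, the edge on the side of z
   loses at least dW/2. With th = 1/16 this gains dW/32 in the exponent: half of it is the
   compensator 4 th^2 dW, the other half pays the growth dW/64 of the clock term. *)
have [e he dS] : exists2 e : R, e = 1 \/ e = -1 & forall u b, 0 <= u ->
    `|sM s + dM h s u b - sS (step s u b) z| <= `|sM s - sS s z| + e * dM h s u b - dW h s u / 2.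
  have [zX|zX] : z < sX s \/ sX s < z by move: Xz; rewrite neq_lt => /orP[]; [right|left].
    exists 1; first by left.
    move=> u b u0; have w1 := lcinv_ge0 h0 vs u0.
    have vs' : valid (step s u b) by exact: valid_step.
    have ME := sM_step h0 chi0 vs u0 b.
    have Sz : sS (step s u b) z = sS s z + alm h s u by rewrite /= ltNge (ltW zX) /= zX.
    have i1 : sS s z <= sM s by apply: (sS_le h0 vs); exact: ltW.
    have i2 : sS (step s u b) z <= sM s + dM h s u b.
      by rewrite -ME; apply: (sS_le h0 vs'); exact: nbr_gt_ge.
    rewrite ger0_norm ?subr_ge0 // ger0_norm ?subr_ge0 // Sz mul1r.
    suff : dW h s u / 2 <= alm h s u by lra.
    have : alp h s u <= 3 * alm h s u.
      rewrite /alp /alm mulrA ler_wpM2r // mulrA (mulrC 3) -mulrA ler_pM2l //.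
      by rewrite ler_pdivlMr // mulrC ler_pdivrMr.
    rewrite /dW; lra.
  exists (-1); first by right.
  move=> u b u0; have w1 := lcinv_ge0 h0 vs u0.
  have vs' : valid (step s u b) by exact: valid_step.
  have ME := sM_step h0 chi0 vs u0 b.
  have Sz : sS (step s u b) z = sS s z - alp h s u by rewrite /= zX.
  have i1 : sM s <= sS s z by apply: (sS_le h0 vs); exact: ltW.
  have i2 : sM s + dM h s u b <= sS (step s u b) z.
    by rewrite -ME; apply: (sS_le h0 vs'); exact: nbr_lt_le.
  rewrite ler0_norm ?subr_le0 // ler0_norm ?subr_le0 // Sz mulN1r.
  suff : dW h s u / 2 <= alp h s u by lra.
  have : alm h s u <= 3 * alp h s u.
    rewrite /alp /alm mulrA ler_wpM2r // mulrA (mulrC 3) -mulrA ler_pM2l //.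
    by rewrite ler_pdivlMr // mulrC ler_pdivrMr.
  rewrite /dW; lra.
have e2 : (e / 16) ^+ 2 = 256^-1 by case: he => ->; field.
apply: (@supermart_mart _ h lo chi h0 _ s c (e / 16)) => //.
- have -> : `|e / 16| = 16^-1 by case: he => ->; rewrite ?mulN1r ?normrN ?mul1r ger0_norm // invr_ge0.
  lra.
- by rewrite e2; lra.
- move=> u b u0; apply: le_trans (FSE u b u0) _.
  have -> : sL (step s u b) z = sL s z by rewrite /= eq_sym (negbTE Xz).
  rewrite FE -expRD ler_expR e2 Xz mul1r; have := dS u b u0; lra.
Qed.

End more.

(** * The discrete scale function and comparison of local times at two sites *)

Section scale.
Context {R : realType}.
Implicit Types (n k q : nat).

Definition hn n : R := (2 ^+ n)^-1.

Lemma hn_gt0 n : 0 < hn n. Proof. by rewrite invr_gt0 exprn_gt0. Qed.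

Variables (L0 : R -> R) (L0pos : forall x, 0 < L0 x).

Definition lon n (j : int) : R := L0 (j%:~R / 2 ^+ n).

Lemma lon_gt0 n j : 0 < lon n j. Proof. exact: L0pos. Qed.

(** Edges are summed outwards from site 0; [Negz m] stands for - m - 1, hence m + 1 terms on the
    negative side. *)
Definition S0n n (j : int) : R := match j with
  | Posz m => \sum_(i < m) hn n / (lon n i%:Z * lon n (i%:Z + 1))
  | Negz m => - \sum_(i < m.+1) hn n / (lon n (- i%:Z - 1) * lon n (- i%:Z))
  end.

Lemma S0n_edge n j : S0n n (j + 1) - S0n n j = hn n / (lon n j * lon n (j + 1)).
Proof.
case: j => [m|m].
  by rewrite -PoszD addn1 /S0n big_ord_recr /= addrAC subrr add0r -addn1 PoszD.
have -> : Negz m + 1 = - m%:Z by rewrite NegzE -addn1 PoszD opprD addrNK.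
have E : Negz m = - m%:Z - 1 by rewrite NegzE -addn1 PoszD opprD.
case: m E => [|m] E.
  rewrite (_ : - 0%Z = Posz 0) // /S0n big_ord0 big_ord_recl big_ord0 sub0r opprK addr0 /=.
  by rewrite E oppr0.
have -> : - m.+1%:Z = Negz m by rewrite NegzE.
rewrite {1 2}/S0n [in X in _ - X]big_ord_recr /= opprK addrA addNr add0r -NegzE E.
by rewrite NegzE.
Qed.

Lemma S0n0 n : S0n n 0 = 0. Proof. by rewrite (_ : (0 : int) = Posz 0) // /S0n big_ord0. Qed.

Definition vinit n : @vst R := VSt 0 (lon n) (S0n n) 0 0 0 (fun=> 0) (fun=> 0) (fun=> 0).

Lemma valid_vinit n : valid (hn n) (lon n) (vinit n).
Proof.
split; first by move=> j /=; rewrite lon_gt0 lexx.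
by split=> //= j; exact: S0n_edge.
Qed.

Lemma S0n_diff n (x : int) m (c : R) : 0 < c -> (forall j, x <= j <= x + m%:Z -> c <= lon n j) ->
  0 <= S0n n (x + m%:Z) - S0n n x <= m%:R * (hn n / c ^+ 2).
Proof.
move=> c0; elim: m => [|m IH] cl; first by rewrite addr0 subrr mul0r lexx.
have xm : x + m.+1%:Z = x + m%:Z + 1 by rewrite -addn1 PoszD addrA.
have /andP[i1 i2] : 0 <= S0n n (x + m%:Z) - S0n n x <= m%:R * (hn n / c ^+ 2).
  by apply: IH => j hj; apply: cl; rewrite xm; lia.
rewrite xm; have E := S0n_edge n (x + m%:Z).
have e0 : 0 <= hn n / (lon n (x + m%:Z) * lon n (x + m%:Z + 1)) <= hn n / c ^+ 2.
  have c1 : c <= lon n (x + m%:Z) by apply: cl; lia.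
  have c2 : c <= lon n (x + m%:Z + 1) by apply: cl; lia.
  rewrite divr_ge0 ?(ltW (hn_gt0 n)) ?mulr_ge0 ?(ltW (lon_gt0 _ _)) //=.
  rewrite ler_pM2l ?hn_gt0 // lef_pV2 ?posrE ?exprn_gt0 ?mulr_gt0 ?lon_gt0 //.
  by rewrite expr2 ler_pM // ltW.
rewrite -natr1 mulrDl mul1r.
have -> : S0n n (x + m%:Z + 1) - S0n n x =
  (S0n n (x + m%:Z) - S0n n x) + (S0n n (x + m%:Z + 1) - S0n n (x + m%:Z)) by ring.
by rewrite E; case/andP: e0 => e1 e2; apply/andP; split; lra.
Qed.

End scale.

Section modulus.
Context {R : realType} d {T : measurableType d} (P : probability T R).
Variables (E U : nat -> T -> R) (cEU : clocks P E U).
Variables (L0 : R -> R) (L0pos : forall x, 0 < L0 x).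
Local Notation vst := (@vst R).

Definition chi0 : nat -> vst -> R := fun _ _ => 0.
Definition base n k w := st E U (hn n) chi0 (vinit L0 n) k w.
Definition lgr n k w (j : int) := ln (sL (base n k w) j / lon L0 n j).

Let chi0_ge0 m s : 0 <= chi0 m s. Proof. by []. Qed.
Let mchi0 m : mfunc (chi0 m). Proof. by move=> d' T' s _; exact: measurable_cst. Qed.

Lemma valid_base n k w : valid (hn n) (lon L0 n) (base n k w).
Proof. by apply: valid_st => //; [exact: hn_gt0|exact: valid_vinit]. Qed.

Lemma lgr_ge0 n k w j : 0 <= lgr n k w j.
Proof.
rewrite /lgr ln_ge0 // -[leLHS](divff (lt0r_neq0 (lon_gt0 L0pos n j))).
rewrite ler_pM2r ?invr_gt0 ?lon_gt0 //.
by have /andP[] := (valid_base n k w).1 j.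
Qed.

Section pair.
Variables (n : nat) (x y : int) (c th lam : R).
Hypotheses (xy : x < y) (c0 : 0 < c) (clo : forall j, x <= j <= y -> c <= lon L0 n j).
Let a := hn n / c ^+ 2.
Hypotheses (th0 : 0 < th) (t1 : th * a <= 1 / 4) (t2 : 4 * th ^+ 2 * a <= 1).
Let D0 := S0n L0 n y - S0n L0 n x.
Let t := th / 2 * (1 + 2 * (th * a)).
Let t' := th / 2 * (1 - 2 * (th * a)).

Let D00 : 0 <= D0.
Proof.
rewrite subr_ge0; apply: (sS_le (hn_gt0 n) (valid_vinit L0pos n)).
exact: ltW.
Qed.

Let phi0 s : valid (hn n) (lon L0 n) s -> 0 <= phi x y s <= sS s y - sS s x.
Proof.
move=> vs; have le := sS_le (hn_gt0 n) vs (ltW xy).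
rewrite /phi; case: (leP (sX s) x) => xX; first by rewrite lexx subr_ge0.
case: (leP y (sX s)) => Xy; first by rewrite lexx subr_ge0 le.
by rewrite subr_ge0 lerD2r !(sS_le (hn_gt0 n) vs) // ltW.
Qed.

Let th0' : 0 <= th. Proof. exact: ltW. Qed.
Let t1' : th * (hn n / c ^+ 2) <= 1 / 2. Proof. by apply: le_trans t1 _; lra. Qed.

(** Ville's inequality for [F1] at exp(lam) times its initial value. Dropping nonnegative terms from
    the exponent leaves a comparison of the two logarithmic local times, at the cost of the initial
    distance [D0] in the scale function. *)
Lemma pair_right : exists B : set T, [/\ measurable B, (P B <= (expR (- lam))%:E)%E &
  forall w, ~ B w -> forall k,
    t' * lgr n k w y <= t * lgr n k w x + (th + 2 * th ^+ 2) * D0 + lam].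
Proof.
have sup := F1_super (hn_gt0 n) chi0_ge0 xy c0 clo (lon_gt0 L0pos n x) (lon_gt0 L0pos n y) th0' t1' t2.
pose F := F1 th t t' x y (lon L0 n x) (lon L0 n y).
have Fp' s : 0 <= F s by exact: expR_ge0.
pose C := F (vinit L0 n) * expR lam.
have Fi : 0 < F (vinit L0 n) by exact: expR_gt0.
have C0 : 0 < C by rewrite mulr_gt0 ?expR_gt0.
have [mB PB] := ville cEU (hn_gt0 n) chi0_ge0 mchi0 (valid_vinit L0pos n)
   (@mfunc_F1 R th t t' x y _ _) (fun s _ => Fp' s) sup C0.
eexists; split; [exact: mB| |].
  by apply: le_trans PB _; rewrite lee_fin /C invfM mulrA divff ?gt_eqF // mul1r expRN.
move=> w nB k; have : F (base n k w) < C.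
  by rewrite ltNge; apply/negP => ge; apply: nB; exists k.
rewrite /C /F /F1 -expRD ltr_expR.
rewrite /= !divff ?gt_eqF ?lon_gt0 // ln1 !mulr0 subr0 addr0 -/(lgr n k w x) -/(lgr n k w y).
have /andP[p1 _] := phi0 (valid_base n k w).
have /andP[_ p2] := phi0 (valid_vinit L0pos n).
have le := sS_le (hn_gt0 n) (valid_base n k w) (ltW xy).
have q1 := mulr_ge0 th0' p1; have q2 := ler_wpM2l th0' p2.
have s2 : 0 <= th ^+ 2 by exact: sqr_ge0.
have q3 : 0 <= th ^+ 2 * (sS (base n k w) y - sS (base n k w) x) by rewrite mulr_ge0 // subr_ge0.
rewrite /= -/D0 in q2 *; have -> : 4 / 2 = 2 :> R by field.
move=> lt; lra.
Qed.

Lemma pair_left : exists B : set T, [/\ measurable B, (P B <= (expR (- lam))%:E)%E &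
  forall w, ~ B w -> forall k,
    t' * lgr n k w x <= t * lgr n k w y + (th + 2 * th ^+ 2) * D0 + lam].
Proof.
have xy' : - y < - x by rewrite ltrN2.
have clo' j : - y <= j <= - x -> c <= lon L0 n (- j).
  by move=> /andP[h1 h2]; apply: clo; rewrite lerNr h2 lerNl h1.
pose lo' (j : int) := lon L0 n (- j).
have lx0 : 0 < lo' (- x) by exact: lon_gt0.
have ly0 : 0 < lo' (- y) by exact: lon_gt0.
have sup := @F1_super R (hn n) lo' chi0 (hn_gt0 n) chi0_ge0 _ _ c th _ _ xy' c0 clo' ly0 lx0 th0' t1' t2.
pose F s := F1 th t t' (- y) (- x) (lo' (- y)) (lo' (- x)) (mir s).
have Fp' s : 0 <= F s by exact: expR_ge0.
pose C := F (vinit L0 n) * expR lam.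
have Fi : 0 < F (vinit L0 n) by exact: expR_gt0.
have C0 : 0 < C by rewrite mulr_gt0 ?expR_gt0.
have sup' s : valid (hn n) (lon L0 n) s ->
  (\int[@lebesgue_measure R]_(x in `[0%R, +oo[) ((stepavg (hn n) chi0 F s x)%:E * (expR (- x))%:E) <= (F s)%:E)%E.
  move=> vs; under eq_integral do rewrite stepavg_mir.
  by apply: sup; exact: valid_mir.
have [mB PB] := ville cEU (hn_gt0 n) chi0_ge0 mchi0 (valid_vinit L0pos n)
   (mfunc_mir (@mfunc_F1 R th t t' (- y) (- x) _ _)) (fun s _ => Fp' s) sup' C0.
eexists; split; [exact: mB| |].
  by apply: le_trans PB _; rewrite lee_fin /C invfM mulrA divff ?gt_eqF // mul1r expRN.
move=> w nB k; have : F (base n k w) < C.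
  by rewrite ltNge; apply/negP => ge; apply: nB; exists k.
have phim s : valid (hn n) (lon L0 n) s -> 0 <= phi (- y) (- x) (mir s) <= sS s y - sS s x.
  move=> vs; have le := sS_le (hn_gt0 n) vs (ltW xy).
  rewrite /phi /= !lerN2 /sM /= !opprK.
  case: (leP y (sX s)) => xX; first by rewrite lexx subr_ge0.
  case: (leP (sX s) x) => Xy; first by rewrite (addrC (- _)) lexx subr_ge0 le.
  by rewrite (addrC (- _)) subr_ge0 lerD2l lerN2 !(sS_le (hn_gt0 n) vs) // ltW.
rewrite /C /F /F1 -expRD ltr_expR /lo' /= !opprK.
rewrite !divff ?gt_eqF ?lon_gt0 // ln1 !mulr0 subr0 addr0 -/(lgr n k w x) -/(lgr n k w y).
have /andP[p1 _] := phim _ (valid_base n k w).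
have /andP[_ p2] := phim _ (valid_vinit L0pos n).
have le := sS_le (hn_gt0 n) (valid_base n k w) (ltW xy).
have q1 := mulr_ge0 th0' p1; have q2 := ler_wpM2l th0' p2.
have s2 : 0 <= th ^+ 2 by exact: sqr_ge0.
have q3 : 0 <= th ^+ 2 * (sS (base n k w) y - sS (base n k w) x) by rewrite mulr_ge0 // subr_ge0.
rewrite /= -/D0 in q2 *; have -> : 4 / 2 = 2 :> R by field.
have -> : - S0n L0 n x + S0n L0 n y = D0 by rewrite addrC.
move=> lt; lra.
Qed.

End pair.
End modulus.

(** * Dyadic chaining and the spatial modulus of the local times *)

Section chaining.
Context {R : realType}.

Let near (ka u v : R) := u <= (1 + ka) * v /\ v <= (1 + ka) * u.

Let near_exp (ka u v : R) : 0 <= ka -> 0 <= v -> near ka u v -> u <= expR ka * v.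
Proof. by move=> k0 v0 [h _]; apply: le_trans h _; rewrite ler_wpM2r // expR_ge1Dx. Qed.

Let near_sym ka u v : near ka u v -> near ka v u. Proof. by case. Qed.

(** Induction on the number of levels: a site is at most one finest edge away from an even site, and
    the even sites pose the same problem with one level less. The levels are crossed once for each
    of the two points, whence the factor 2. [B] is the half-width of the window in units of the
    coarsest mesh. *)
Lemma dyadic_chain e (f : int -> R) (ka : nat -> R) (B : nat) :
  (forall j, 0 <= f j) -> (forall d, 0 <= ka d) ->
  (forall d (i : int), (d <= e)%N -> - (B * 2 ^ (e - d))%N%:Z <= i < (B * 2 ^ (e - d))%N%:Z ->
     near (ka d) (f ((2 ^ d)%N%:Z * i)) (f ((2 ^ d)%N%:Z * (i + 1)))) ->
  forall x y : int, `|x| <= (B * 2 ^ e)%N%:Z -> `|y| <= (B * 2 ^ e)%N%:Z ->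
    `|x - y| <= (2 ^ e)%N%:Z ->
    f y <= expR (2 * \sum_(d < e.+1) ka d) * f x.
Proof.
elim: e f ka => [|e IH] f ka f0 k0 adj x y xB yB xy.
  have adj1 (i : int) : - B%:Z <= i < B%:Z -> near (ka 0%N) (f i) (f (i + 1)).
    by move=> hi; have := adj 0%N i isT; rewrite subn0 expn0 muln1 !mul1r; exact.
  rewrite expn0 ?muln1 in xB yB xy.
  have k2 : expR (ka 0%N) <= expR (2 * \sum_(d < 1) ka d).
    by rewrite big_ord_recl big_ord0 addr0 ler_expR; have := k0 0%N; lra.
  have key : near (ka 0%N) (f y) (f x) -> f y <= expR (2 * \sum_(d < 1) ka d) * f x.
    by move=> nr; apply: le_trans (near_exp _ _ nr) _ => //; rewrite ler_wpM2r.
  have [->|[h|h]] : y = x \/ (y = x + 1 \/ x = y + 1) by lia.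
  - by rewrite ler_peMl // -expR0 ler_expR mulr_ge0 // sumr_ge0.
  - by apply: key; rewrite h; apply/near_sym/adj1; lia.
  - by apply: key; rewrite h; apply: adj1; lia.
have adj0 (i : int) : - (B * 2 ^ e.+1)%N%:Z <= i < (B * 2 ^ e.+1)%N%:Z -> near (ka 0%N) (f i) (f (i + 1)).
  by move=> hi; have := adj 0%N i isT; rewrite subn0 expn0 !mul1r; exact.
have E2 : (2 ^ e.+1 = 2 * 2 ^ e)%N by rewrite expnS.
have E3 : (B * 2 ^ e.+1 = 2 * (B * 2 ^ e))%N by rewrite expnS; lia.
pose x' := (x %/ 2)%Z; pose y' := (y %/ 2)%Z.
have half z : `|z| <= (B * 2 ^ e.+1)%N%:Z -> near (ka 0%N) (f z) (f (2 * (z %/ 2)%Z)) \/ f z = f (2 * (z %/ 2)%Z).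
  move=> zB; have [h|h] : z = 2 * (z %/ 2)%Z \/ z = 2 * (z %/ 2)%Z + 1 by lia.
    by right; rewrite -h.
  left; rewrite {1}h; apply/near_sym/adj0; rewrite E3 in zB *; lia.
have halfle z : `|z| <= (B * 2 ^ e.+1)%N%:Z -> f z <= expR (ka 0%N) * f (2 * (z %/ 2)%Z) /\
    f (2 * (z %/ 2)%Z) <= expR (ka 0%N) * f z.
  move=> /half [nr|->]; first by split; apply: near_exp => //; exact: near_sym.
  by split; rewrite ler_peMl // -expR0 ler_expR.
have [hx1 hx2] := halfle x xB; have [hy1 hy2] := halfle y yB.
have := IH (fun i => f (2 * i)) (fun d => ka d.+1) (fun i => f0 _) (fun d => k0 _) _ x' y' _ _ _.
move=> /(_ _ _ _ _)/wrap[] //.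
- move=> d i de hi; have := adj d.+1 i de; rewrite subSS => /(_ hi).
  by rewrite expnS PoszM !mulrA.
- by rewrite E3 in xB; rewrite /x'; lia.
- by rewrite E3 in yB; rewrite /y'; lia.
- by rewrite E2 in xy; rewrite /x' /y'; lia.
move=> IHxy.
rewrite big_ord_recl mulrDr.
rewrite (_ : \sum_(i < e.+1) ka (lift ord0 i) = \sum_(i < e.+1) ka i.+1) // [nat_of_ord _]/=.
set Sg := \sum_(i < e.+1) ka i.+1.
rewrite (_ : 2 * ka 0%N + 2 * Sg = ka 0%N + (2 * Sg + ka 0%N)); last by ring.
rewrite !expRD -!mulrA; apply: le_trans hy1 _; rewrite ler_wpM2l ?expR_ge0 //.
by apply: le_trans IHxy _; rewrite ler_wpM2l ?expR_ge0.
Qed.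

Lemma geo_tail (n e : nat) : (e <= n)%N ->
  \sum_(d < e.+1) (9 / 10 : R) ^+ (n - d) <= 10 * (9 / 10) ^+ (n - e).
Proof.
have r0 k : 0 <= (9 / 10 : R) ^+ k by rewrite exprn_ge0 //; lra.
elim: e => [|e IH] en.
  by rewrite big_ord_recl big_ord0 addr0 subn0; have := r0 n; lra.
rewrite big_ord_recr /=; have := IH (ltnW en).
have -> : (n - e = (n - e.+1).+1)%N by lia.
by rewrite exprS; lra.
Qed.

End chaining.

Section whp.
Context {R : realType} d {T : measurableType d} (P : probability T R).

(** Stated through a measurable exceptional set, so that path properties can be combined as they
    are. *)
Definition whp (p : R) (good : T -> Prop) :=
  exists B : set T, [/\ measurable B, (P B <= p%:E)%E & forall w, ~ B w -> good w].

Lemma whp_le p p' (g g' : T -> Prop) : p <= p' -> (forall w, g w -> g' w) ->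
  whp p g -> whp p' g'.
Proof.
move=> pp gg [B [mB PB h]]; exists B; split => //; last by move=> w /h; exact: gg.
by apply: le_trans PB _; rewrite lee_fin.
Qed.

Lemma whpI p p' (g g' : T -> Prop) : whp p g -> whp p' g' ->
  whp (p + p') (fun w => g w /\ g' w).
Proof.
move=> [B [mB PB h]] [B' [mB' PB' h']]; exists (B `|` B'); split.
- exact: measurableU.
- by apply: le_trans (measureU2 _ mB mB') _; rewrite EFinD leeD.
- by move=> w nB; split; [apply: h|apply: h'] => ?; apply: nB; [left|right].
Qed.

Lemma whp_all (N : nat) (p : nat -> R) (g : nat -> T -> Prop) :
  (forall i, (i < N)%N -> whp (p i) (g i)) ->
  whp (\sum_(i < N) p i) (fun w => forall i, (i < N)%N -> g i w).
Proof.
elim: N => [|N IH] hg.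
  by exists set0; split => //; rewrite ?measure0 big_ord0.
rewrite big_ord_recr /=.
apply: whp_le (whpI (IH (fun i iN => hg i (ltnW iN))) (hg N (ltnSn N))) => //.
move=> w [h1 h2] i; rewrite ltnS leq_eqVlt => /orP[/eqP ->//|]; exact: h1.
Qed.

End whp.

Section modulusL.
Context {R : realType} d {T : measurableType d} (P : probability T R).
Variables (E U : nat -> T -> R) (cEU : clocks P E U).
Variables (L0 : R -> R) (L0pos : forall x, 0 < L0 x).
Local Notation lgr := (lgr E U L0).

Lemma bernoulli8 (j : nat) : j%:R <= 8 * (9 / 8 : R) ^+ j.
Proof.
elim: j => [|j IH]; first by rewrite expr0; lra.
rewrite -natr1 exprS; have : 1 <= (9 / 8 : R) ^+ j by apply: exprn_ege1; lra.
lra.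
Qed.

Section lvl.
Variables (n j : nat) (i : int) (c : R).
Hypotheses (jn : (j <= n)%N) (c0 : 0 < c) (c1 : c <= 1).
Let dd := (2 ^ (n - j))%N.
Let x := dd%:Z * i.
Let y := dd%:Z * (i + 1).
Hypothesis clo : forall z, x <= z <= y -> c <= lon L0 n z.
(** Level j compares sites at distance 2^-j. The rate 5/4 leaves room on both sides: th^2 2^-j stays
    bounded because (5/4)^2 < 2, while j / th decays, and j <= 8 (9/8)^j turns (9/8)(4/5) into the
    rate 9/10 of [ka]. The Ville level 2 j costs 4^-j in probability. *)
Let th := c ^+ 2 / 4 * (5 / 4) ^+ j.
Let ka := 264 / c ^+ 2 * (9 / 10) ^+ j.

Let c2 : 0 < c ^+ 2 <= 1.
Proof. by rewrite exprn_gt0 //= exprn_ile1 ?(ltW c0). Qed.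

Let hnj : hn n * dd%:R = (2 ^+ j)^-1 :> R.
Proof.
rewrite /hn /dd natrX -[in 2 ^+ n](subnK jn) exprD.
by field; rewrite !expf_neq0.
Qed.

Let hnle : hn n <= (2 ^+ j)^-1 :> R.
Proof.
rewrite -hnj ler_peMr ?(ltW (hn_gt0 n)) // ler1n expn_gt0 //.
Qed.

Let tha : th * (hn n / c ^+ 2) <= 1 / 4 * (5 / 8) ^+ j.
Proof.
have /andP[cc _] := c2.
have -> : th * (hn n / c ^+ 2) = 1 / 4 * ((5 / 4) ^+ j * hn n).
  by rewrite /th; field; rewrite gt_eqF.
rewrite ler_pM2l; last by lra.
have -> : (5 / 8 : R) ^+ j = (5 / 4) ^+ j * (2 ^+ j)^-1.
  by rewrite -exprVn -exprMn; congr (_ ^+ _); field.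
by rewrite ler_pM2l // exprn_gt0 //; lra.
Qed.

(** The comparison of a pair carries a factor close to 1 in front of an unbounded logarithm besides
    its additive error; a ratio of the quantities 1 + [lgr] absorbs both. *)
Lemma level_pair : whp P (2 / 4 ^+ j) (fun w => forall k,
   1 + lgr n k w x <= (1 + ka) * (1 + lgr n k w y) /\
   1 + lgr n k w y <= (1 + ka) * (1 + lgr n k w x)).
Proof.
have /andP[cc cc1] := c2.
have p54 : 0 < (5 / 4 : R) ^+ j by rewrite exprn_gt0 //; lra.
have p58 : 0 <= (5 / 8 : R) ^+ j <= 1 by rewrite exprn_ge0 ?exprn_ile1 //; lra.
have th0 : 0 < th by rewrite mulr_gt0 // divr_gt0.
have xy : x < y by rewrite /x /y mulrDr mulr1 ltrDl ltz_nat expn_gt0.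
have t1 : th * (hn n / c ^+ 2) <= 1 / 4 by have := tha; case/andP: p58; lra.
have t2 : 4 * th ^+ 2 * (hn n / c ^+ 2) <= 1.
  have -> : 4 * th ^+ 2 * (hn n / c ^+ 2) = c ^+ 2 / 4 * ((5 / 4) ^+ j * ((5 / 4) ^+ j * hn n)).
    by rewrite /th; field; rewrite gt_eqF.
  have : (5 / 4 : R) ^+ j * ((5 / 4) ^+ j * hn n) <= 1.
    apply: (@le_trans _ _ ((25 / 32) ^+ j)); last by rewrite exprn_ile1 //; lra.
    have -> : (25 / 32 : R) ^+ j = (5 / 4) ^+ j * ((5 / 4) ^+ j * (2 ^+ j)^-1).
      by rewrite -exprVn -!exprMn; congr (_ ^+ _); field.
    by rewrite !ler_pM2l.
  have : 0 <= (5 / 4 : R) ^+ j * ((5 / 4) ^+ j * hn n) by rewrite !mulr_ge0 ?(ltW p54) ?(ltW (hn_gt0 n)).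
  nra.
have D0 : S0n L0 n y - S0n L0 n x <= (2 ^+ j)^-1 / c ^+ 2.
  have yE : y = x + dd%:Z by rewrite /y mulrDr mulr1.
  have := @S0n_diff R L0 L0pos n x dd c c0; rewrite -yE => /(_ clo)/andP[_].
  by rewrite mulrA (mulrC dd%:R) hnj.
have lamP : expR (- (2 * j%:R)) <= ((4 : R) ^+ j)^-1.
  rewrite expRN lef_pV2 ?posrE ?expR_gt0 ?exprn_gt0 //.

  rewrite expRM_natr lerXn2r ?nnegrE ?expR_ge0 //.
  have -> : 2 = 1 + 1 :> R by [].
  have := expR_ge1Dx (1 : R); rewrite expRD; have -> : 4 = 2 * 2 :> R by ring.
  by move=> e1; rewrite ler_pM.
have W := whpI (pair_right cEU L0pos (2 * j%:R) xy c0 clo th0 t1 t2)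
  (pair_left cEU L0pos (2 * j%:R) xy c0 clo th0 t1 t2).
apply: (whp_le _ _ W); first by lra.
move=> w [r l] k; have := r k; have := l k.
set u := lgr n k w x; set v := lgr n k w y.
have u0 : 0 <= u by exact: lgr_ge0.
have v0 : 0 <= v by exact: lgr_ge0.
have tha' := tha; set de := th * (hn n / c ^+ 2) in t1 tha' *.
have de0 : 0 <= de by rewrite mulr_ge0 ?(ltW th0) // divr_ge0 ?(ltW cc) // ltW // hn_gt0.
set D := S0n L0 n y - S0n L0 n x in D0 *.
have ka1 : 8 * de <= 2 * (9 / 10) ^+ j.
  have : (5 / 8 : R) ^+ j <= (9 / 10) ^+ j by rewrite lerXn2r ?nnegrE //; lra.
  have := tha'; lra.
have r0 : 0 <= (9 / 10 : R) ^+ j by rewrite exprn_ge0 //; lra.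
have ic : 1 <= (c ^+ 2)^-1 by rewrite invf_ge1.
have kab : 4 * (1 + 2 * th) * D + 4 * (2 * j%:R) / th <= (260 / c ^+ 2 + 2) * (9 / 10) ^+ j.
  have h1 : (2 ^+ j)^-1 <= (9 / 10 : R) ^+ j.
    by rewrite -exprVn lerXn2r ?nnegrE ?invr_ge0 //; lra.
  have h2 : (5 / 8 : R) ^+ j <= (9 / 10) ^+ j by rewrite lerXn2r ?nnegrE //; lra.
  have d1 : 4 * (1 + 2 * th) * D <= 4 / c ^+ 2 * (2 ^+ j)^-1 + 2 * (5 / 8) ^+ j.
    have -> : 4 / c ^+ 2 * (2 ^+ j)^-1 + 2 * (5 / 8) ^+ j = 4 * (1 + 2 * th) * ((2 ^+ j)^-1 / c ^+ 2).
      have -> : (5 / 8 : R) ^+ j = (5 / 4) ^+ j * (2 ^+ j)^-1.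
        by rewrite -exprVn -exprMn; congr (_ ^+ _); field.
      by rewrite /th; field; rewrite gt_eqF // expf_neq0.
    by rewrite ler_pM2l // mulr_gt0 //; lra.
  have d2 : 4 * (2 * j%:R) / th <= 256 / c ^+ 2 * (9 / 10) ^+ j.
    rewrite ler_pdivrMr //.
    have -> : 256 / c ^+ 2 * (9 / 10) ^+ j * th = 64 * (9 / 8) ^+ j.
      have -> : (9 / 8 : R) ^+ j = (9 / 10) ^+ j * (5 / 4) ^+ j.
        by rewrite -exprMn; congr (_ ^+ _); field.
      by rewrite /th; field; rewrite gt_eqF.
    by have := bernoulli8 j; lra.
  have d3 : 4 / c ^+ 2 * (2 ^+ j)^-1 <= 4 / c ^+ 2 * (9 / 10) ^+ j.
    by rewrite ler_wpM2l // divr_ge0 // ltW.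
  have -> : 260 / c ^+ 2 = 4 / c ^+ 2 + 256 / c ^+ 2 by field; rewrite gt_eqF.
  lra.
have main (a b : R) : 0 <= a -> 0 <= b ->
    th / 2 * (1 - 2 * de) * b <= th / 2 * (1 + 2 * de) * a + (th + 2 * th ^+ 2) * D + 2 * j%:R ->
    1 + b <= (1 + ka) * (1 + a).
  move=> a0 b0 h.
  have h' : (1 - 2 * de) * b <= (1 + 2 * de) * a + (2 * (1 + 2 * th) * D + 2 * (2 * j%:R) / th).
    rewrite -(ler_pM2l (divr_gt0 th0 (ltr0Sn R 1))).
    have -> : th / 2 * ((1 + 2 * de) * a + (2 * (1 + 2 * th) * D + 2 * (2 * j%:R) / th)) =
      th / 2 * (1 + 2 * de) * a + (th + 2 * th ^+ 2) * D + 2 * j%:R.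
      by field; rewrite gt_eqF.
    by rewrite mulrA.
  set Q := 2 * (1 + 2 * th) * D + 2 * (2 * j%:R) / th in h'.
  have Q2 : 2 * Q <= (260 / c ^+ 2 + 2) * (9 / 10) ^+ j.
    by apply: le_trans kab; rewrite /Q; lra.
  have b1 : b <= (1 + 8 * de) * a + 2 * `|Q|.
    have Qn := ler_norm Q; have Q0 := normr_ge0 Q.
    have : (1 - 2 * de) * b <= (1 - 2 * de) * ((1 + 8 * de) * a + 2 * `|Q|).
      have q1 : 0 <= de * (1 / 4 - de) * a by rewrite mulr_ge0 // mulr_ge0 // subr_ge0.
      have q2 : 0 <= (1 / 4 - de) * `|Q| by rewrite mulr_ge0 // subr_ge0.
      apply: le_trans h' _; lra.
    by rewrite ler_pM2l //; lra.
  have Q0 : 0 <= Q.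
    rewrite /Q addr_ge0 //.
      apply: mulr_ge0; first by apply: mulr_ge0 => //; lra.
      rewrite subr_ge0; apply: (sS_le (hn_gt0 n) (valid_vinit L0pos n)); exact: ltW.
    by rewrite divr_ge0 ?(ltW th0) // mulr_ge0 // mulr_ge0.
  rewrite ger0_norm // in b1.
  have kaE : ka = (260 / c ^+ 2 + 4 / c ^+ 2) * (9 / 10) ^+ j.
    by rewrite /ka; field; rewrite gt_eqF.
  have : 4 * (9 / 10) ^+ j <= 4 / c ^+ 2 * (9 / 10) ^+ j by rewrite ler_wpM2r //; lra.
  have ka0 : 0 <= (260 / c ^+ 2) * (9 / 10) ^+ j.
    exact: mulr_ge0 (divr_ge0 (ler0n R 260) (sqr_ge0 c)) (exprn_ge0 j (divr_ge0 (ler0n R 9) (ler0n R 10))).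
  move=> h4; have k1 : 8 * de <= ka by rewrite kaE; lra.
  have k2 : 2 * Q <= ka by rewrite kaE; lra.
  nra.
by move=> hl hr; split; apply: main.
Qed.

End lvl.
End modulusL.

Section window_modulus.
Context {R : realType} d {T : measurableType d} (P : probability T R).
Variables (E U : nat -> T -> R) (cEU : clocks P E U).
Variables (L0 : R -> R) (L0pos : forall x, 0 < L0 x).
Local Notation lgr := (lgr E U L0).

Lemma lon_window (A n : nat) (c : R) (z : int) : (forall x : R, `|x| <= A%:R -> c <= L0 x) ->
  `|z| <= (A * 2 ^ n)%N%:Z -> c <= lon L0 n z.
Proof.
move=> cL zA; apply: cL; rewrite normrM normfV normrX (ger0_norm (ler0n R 2)).
rewrite ler_pdivrMr ?exprn_gt0 // -intr_norm -natrX -natrM.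
by rewrite -[X in _ <= X]/((A * 2 ^ n)%N%:Z%:~R) ler_int.
Qed.

Lemma half_sum N : \sum_(t < N) (2 ^+ t)^-1 <= 2 :> R.
Proof.
suff -> : \sum_(t < N) (2 ^+ t)^-1 = 2 - 2 / 2 ^+ N :> R.
  by rewrite gerBl divr_ge0 // exprn_ge0.
elim: N => [|N IH]; first by rewrite big_ord0 expr0 divr1 subrr.
by rewrite big_ord_recr /= IH exprS; field; rewrite expf_neq0.
Qed.

(** 5280 is the product of 2 for the two sides of the chain, 264 for one level and 10 for the
    geometric sum of [geo_tail]. *)
Definition modK (c : R) : R := 5280 / c ^+ 2.

(** Level j has 2 A 2^j edges, each failing with probability at most 2/4^j; summing over the levels
    from m to n gives 8 A/2^m, whatever n. *)
Lemma modulus_whp (A m n : nat) (c : R) : 0 < c -> c <= 1 ->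
  (forall x : R, `|x| <= A%:R -> c <= L0 x) -> (m <= n)%N ->
  whp P (8 * A%:R / 2 ^+ m) (fun w => forall k (x y : int),
    `|x| <= (A * 2 ^ n)%N%:Z -> `|y| <= (A * 2 ^ n)%N%:Z -> `|x - y| <= (2 ^ (n - m))%N%:Z ->
    1 + lgr n k w y <= expR (modK c * (9 / 10) ^+ m) * (1 + lgr n k w x)).
Proof.
move=> c0 c1 cL mn.
pose ka (j : nat) : R := 264 / c ^+ 2 * (9 / 10) ^+ j.
have ka0 j : 0 <= ka j.
  by apply: mulr_ge0; [rewrite divr_ge0 ?exprn_ge0 ?(ltW c0)|rewrite exprn_ge0].
pose site (j i : nat) : int := i%:Z - (A * 2 ^ j)%N%:Z.
pose good j w := forall i, (i < 2 * (A * 2 ^ j))%N -> forall k,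
  let x := (2 ^ (n - j))%N%:Z * site j i in
  let y := (2 ^ (n - j))%N%:Z * (site j i + 1) in
  1 + lgr n k w x <= (1 + ka j) * (1 + lgr n k w y) /\
  1 + lgr n k w y <= (1 + ka j) * (1 + lgr n k w x).
have lvl j : (j <= n)%N -> whp P (4 * A%:R / 2 ^+ j) (good j).
  move=> jn; have := @whp_all R _ _ P (2 * (A * 2 ^ j)) (fun=> 2 / 4 ^+ j) (fun i w => forall k,
    let x := (2 ^ (n - j))%N%:Z * site j i in
    let y := (2 ^ (n - j))%N%:Z * (site j i + 1) in
    1 + lgr n k w x <= (1 + ka j) * (1 + lgr n k w y) /\
    1 + lgr n k w y <= (1 + ka j) * (1 + lgr n k w x)).
  move=> /(_ _)/wrap[].
    move=> i iA; apply: (level_pair cEU L0pos jn c0 c1) => z hz.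
    apply: (lon_window cL).
    have dj : (2 ^ n = 2 ^ (n - j) * 2 ^ j)%N by rewrite -expnD subnK.
    rewrite dj; move: hz; rewrite /site.
    move: (2 ^ (n - j))%N (2 ^ j)%N iA => a b iA hz.
    rewrite ler_norml; apply/andP; split; nia.
  apply: whp_le => //.
  rewrite sumr_const card_ord -[X in X <= _]mulr_natr !natrM natrX.
  have -> : (4 : R) ^+ j = 2 ^+ j * 2 ^+ j by rewrite -exprMn; congr (_ ^+ _); ring.
  by rewrite le_eqVlt; apply/orP; left; apply/eqP; field; rewrite expf_neq0.
have := @whp_all R _ _ P (n - m).+1 (fun t => 4 * A%:R / 2 ^+ (m + t)) (fun t => good (m + t)%N).
move=> /(_ _)/wrap[]; first by move=> t tn; apply: lvl; lia.
apply: whp_le.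
  have -> : \sum_(t < (n - m).+1) 4 * A%:R / 2 ^+ (m + t) =
      4 * A%:R / 2 ^+ m * \sum_(t < (n - m).+1) (2 ^+ t)^-1 :> R.
    by rewrite mulr_sumr; apply: eq_bigr => t _; rewrite exprD invfM; ring.
  apply: le_trans (ler_wpM2l _ (half_sum _)) _; first by rewrite divr_ge0 ?exprn_ge0 // mulr_ge0.
  by rewrite le_eqVlt; apply/orP; left; apply/eqP; field; rewrite expf_neq0.
move=> w gw k x y xA yA xy.
have En : (2 ^ n = 2 ^ m * 2 ^ (n - m))%N by rewrite -expnD subnKC.
have := @dyadic_chain R (n - m) (fun j => 1 + lgr n k w j) (fun dd => ka (n - dd)%N) (A * 2 ^ m) _ _ _ x y.
move=> /(_ _ _ _ _ _ _)/wrap[].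
- by move=> j; rewrite addr_ge0 // lgr_ge0.
- by move=> j; exact: ka0.
- move=> dd i dn hi; have dn' : (dd <= n)%N by lia.
  pose t := (n - m - dd)%N.
  have tj : (m + t = n - dd)%N by rewrite /t; lia.
  have e1 : (A * 2 ^ m * 2 ^ (n - m - dd) = A * 2 ^ (n - dd))%N.
    by rewrite -mulnA -expnD -tj.
  rewrite e1 in hi.
  have := gw t; rewrite /good tj => /(_ _)/wrap[]; first by rewrite /t; lia.
  move=> /(_ (absz (i + (A * 2 ^ (n - dd))%N%:Z))).
  have -> : site (n - dd)%N (absz (i + (A * 2 ^ (n - dd))%N%:Z)) = i.
    by rewrite /site; move: (A * 2 ^ (n - dd))%N hi => a hi; lia.
  rewrite subKn // => /(_ _)/wrap[].
    by move: (A * 2 ^ (n - dd))%N hi => a hi; lia.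
  by move=> /(_ k).
- by move: xA; rewrite En mulnA.
- by move: yA; rewrite En mulnA.
- exact: xy.
move=> h; apply: le_trans h _; rewrite ler_wpM2r ?addr_ge0 ?lgr_ge0 // ler_expR.
rewrite -mulr_sumr.
have := @geo_tail R n (n - m) (leq_subr m n); rewrite subKn // => gt.
have -> : modK c * (9 / 10) ^+ m = 2 * (264 / c ^+ 2 * (10 * (9 / 10) ^+ m)).
  by rewrite /modK; field; rewrite gt_eqF.
apply: (ler_wpM2l (ler0n R 2)); exact: (ler_wpM2l (divr_ge0 (ler0n R 264) (sqr_ge0 c))).
Qed.

End window_modulus.

(** * Primitives, and convergence of the discrete scale function *)

Section primitive.
Context {R : realType}.
Notation leb := (@lebesgue_measure R).

Lemma unif_cont (f : R -> R) (A e : R) : continuous f -> 0 < e ->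
  exists2 dl : R, 0 < dl & forall x y : R, `|x| <= A -> `|x - y| < dl -> `|f x - f y| < e.
Proof.
move=> cf e0.
have /compact_near_coveringP/(_ _ (0^'+) (fun dl x => forall y : R, `|x - y| < dl -> `|f x - f y| < e)) :=
  @segment_compact R (- A) A.
move=> /(_ _ _)/wrap[] // => [x xA|].
  have /cvgrPdist_lt/(_ (e / 2))/(_ (divr_gt0 e0 (ltr0Sn R 1)))/nbhs_ballP[r /= r0 hr] := cf x.
  exists (ball x (r / 2), [set dl | 0 < dl < r / 2]).
    split; first by apply: nbhsx_ballx; rewrite divr_gt0.
    near=> dl; apply/andP; split; first by near: dl; exact: nbhs_right_gt.
    by near: dl; apply: nbhs_right_lt; rewrite divr_gt0.
  move=> [x' dl] /= [bx /andP[d0 dr]] y xy.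
  have h1 : `|f x - f x'| < e / 2.
    by apply: hr; rewrite /ball /= (lt_trans bx) // ltr_pdivrMr // ltr_pMr // ltr1n.
  have h2 : `|f x - f y| < e / 2.
    apply: hr; rewrite /ball /=; have := ler_distD x' x y; move: bx; rewrite /ball /=; lra.
  by have := ler_distD (f x) (f x') (f y) => h3; apply: le_lt_trans h3 _; rewrite [e]splitr; apply: ltrD => //; rewrite distrC.
move=> H; near (0 : R)^'+ => dl; exists dl => // x y xA; apply: (near H dl) => //=.
by rewrite in_itv /= -ler_norml.
Unshelve. all: by end_near. Qed.

Definition prim (f : R -> R) (x : R) : R :=
  if 0 <= x then Rintegral leb `[0, x] f else - Rintegral leb `[x, 0] f.

Lemma prim0 f : prim f 0 = 0.
Proof. by rewrite /prim lexx set_itv1 Rintegral_set1. Qed.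

Lemma integrable_cont (f : R -> R) (a b : R) : continuous f ->
  leb.-integrable `[a, b] (EFin \o f).
Proof.
move=> cf; apply: continuous_compact_integrable; first exact: segment_compact.
exact: continuous_subspaceT.
Qed.

Lemma Rint_split (f : R -> R) (a b c : R) : continuous f -> a <= b -> b <= c ->
  Rintegral leb `[a, c] f = Rintegral leb `[a, b] f + Rintegral leb `[b, c] f.
Proof.
move=> cf ab bc.
have := @Rintegral_itvB R f (BLeft a) (BRight c) b (integrable_cont _ _ cf).
rewrite !bnd_simp => /(_ ab bc) E.
rewrite -[Rintegral leb `[b, c] f]Rintegral_itv_obnd_cbnd -?E; first by rewrite addrC subrK.
by apply: integrableS (integrable_cont b c cf) => //; apply: subset_itvr; rewrite bnd_simp.
Qed.

Lemma primB (f : R -> R) (a b : R) : continuous f -> a <= b ->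
  prim f b - prim f a = Rintegral leb `[a, b] f.
Proof.
move=> cf ab; rewrite /prim; case: (leP 0 b) => b0; case: (leP 0 a) => a0.
- by rewrite (Rint_split cf a0 ab) addrAC subrr add0r.
- by rewrite opprK addrC -(Rint_split cf (ltW a0) b0).
- by have := le_trans a0 ab; rewrite leNgt b0.
- by rewrite opprK addrC (Rint_split cf ab (ltW b0)) addrK.
Qed.

(** This quantitative form serves three times: for the derivative of a primitive, for Riemann sums
    of the scale function, and for the real-time clock. *)
Lemma Rint_dist (f : R -> R) (a b v e : R) : continuous f -> a <= b ->
  (forall z : R, a <= z <= b -> `|f z - v| <= e) ->
  `|Rintegral leb `[a, b] f - v * (b - a)| <= e * (b - a).
Proof.
move=> cf ab fe.
have mu : fine (leb `[a, b]) = b - a.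
  rewrite lebesgue_measure_itv /= lte_fin.
  by case: ltP => // ba; rewrite (le_anti (_ : a <= b <= a)) ?ab ?ba // subrr.
have mI : measurable `[a, b]%classic by exact: measurable_itv.
have ci (r : R) : leb.-integrable `[a, b] (EFin \o cst r).
  exact: (integrable_cont _ _ (@cst_continuous _ _ r)).
have ic := integrable_cont a b cf.
have u : Rintegral leb `[a, b] f <= Rintegral leb `[a, b] (cst (v + e)).
  apply: le_Rintegral => //; [try exact: ci|] => z; rewrite /= in_itv /= => /fe.
  by rewrite ler_norml => /andP[_]; rewrite lerBlDl.
have l : Rintegral leb `[a, b] (cst (v - e)) <= Rintegral leb `[a, b] f.
  apply: le_Rintegral => //; [try exact: ci|] => z; rewrite /= in_itv /= => /fe.
  by rewrite ler_norml => /andP[+ _]; rewrite lerBrDl.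
rewrite !Rintegral_cst // mu in u l; move: (Rintegral _ _ _) u l => I u l.
by rewrite ler_norml; apply/andP; split; lra.
Qed.

Lemma prim_dist (f : R -> R) (a b v e : R) : continuous f -> a <= b ->
  (forall z : R, a <= z <= b -> `|f z - v| <= e) ->
  `|prim f b - prim f a - v * (b - a)| <= e * (b - a).
Proof. by move=> cf ab fe; rewrite primB //; exact: Rint_dist. Qed.

Lemma prim_derive (f : R -> R) (x : R) : continuous f -> is_derive x 1 (prim f) (f x).
Proof.
move=> cf; have H : prim f (x + t) - prim f x @[t --> 0^'] --> (0 : R) -> True by [].
have : t^-1 *: (prim f (t *: 1 + x) - prim f x) @[t --> 0^'] --> f x.
  apply/cvgrPdist_le => e e0.
  have [dl d0 hd] := unif_cont `|x| cf e0.
  near=> t; have t0 : t != 0 by near: t; exact: nbhs_dnbhs_neq.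
  have td : `|t| < dl.
    near: t; apply/nbhs_dnbhs; exists dl => //= y; rewrite /= sub0r normrN //.
  rewrite [t *: 1](_ : _ = t); last by rewrite /GRing.scale /= mulr1.
  have nt : 0 < `|t| by rewrite normr_gt0.
  have -> : f x - t^-1 *: (prim f (t + x) - prim f x) =
     - t^-1 * (prim f (t + x) - prim f x - f x * t).
    by rewrite /GRing.scale /=; field.
  rewrite normrM normrN normfV mulrC ler_pdivrMr //.
  case: (leP 0 t) => tt.
    have := @prim_dist f x (t + x) (f x) e cf; rewrite addrK (ger0_norm tt); apply.
      by rewrite lerDr.
    move=> z /andP[z1 z2]; rewrite distrC ltW // hd //.
    by rewrite distrC ger0_norm ?subr_ge0 //; move: td; rewrite (ger0_norm tt); lra.
  have := @prim_dist f (t + x) x (f x) e cf.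
  rewrite (ltr0_norm tt) opprD addrCA subrr addr0 => /(_ _ _)/wrap[].
  - by rewrite gerDr ltW.
  - move=> z /andP[z1 z2]; rewrite distrC ltW // hd //.
    by rewrite ger0_norm ?subr_ge0 //; move: td; rewrite (ltr0_norm tt); lra.
  by rewrite -normrN; congr (`|_| <= _); ring.
move=> C; split; first by apply/cvg_ex; exists (f x).
exact: (cvg_lim _ C).
Unshelve. all: by end_near. Qed.

End primitive.

Section scale_limit.
Context {R : realType} (L0 : R -> R).
Hypotheses (L0pos : forall x, 0 < L0 x) (L0c : continuous L0).

Lemma cont_invsq : continuous (fun r : R => L0 r ^- 2).
Proof.
move=> x; apply: cvgV; first by rewrite expf_neq0 // gt_eqF.
rewrite -[L0 x ^+ 2]/(L0 x * L0 x).
by apply: (@cvgM _ _ _ _ L0 L0); exact: L0c.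
Qed.

Lemma S0_prim : S0 L0 = prim (fun r => L0 r ^- 2).
Proof. by []. Qed.

Lemma window_lb (A : nat) : exists2 c : R, 0 < c <= 1 & forall x : R, `|x| <= A%:R -> c <= L0 x.
Proof.
have [x0 _ hx] : exists2 x0 : R, x0 \in `[- A%:R, A%:R]%R & forall t : R, t \in `[- A%:R, A%:R]%R -> L0 x0 <= L0 t.
  by apply: EVT_min; [have := ler0n R A; lra|exact: continuous_subspaceT].
exists (Num.min 1 (L0 x0)); first by rewrite lt_min ltr01 L0pos ge_min lexx.
by move=> x xA; rewrite ge_min hx ?orbT // in_itv /= -ler_norml.
Qed.

Lemma hn_small (dl : R) : 0 < dl -> exists N, forall n, (N <= n)%N -> (hn n : R) < dl.
Proof.
move=> d0; exists (Num.bound dl^-1) => n nN.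
rewrite /hn invf_plt ?posrE ?exprn_gt0 //.
apply: lt_trans (archi_boundP (ltW _)) _; first by rewrite invr_gt0.
by rewrite -natrX ltr_nat (leq_ltn_trans nN) // ltn_expl.
Qed.

(** The weight 1/(L0(x) L0(x+h)) of an edge lies between the values of L0^-2 at its ends, so the
    discrete scale function is a Riemann sum; an error [e1] per unit length adds up to at most e
    over the window. *)
Lemma S0n_cvg (A : nat) (e : R) : 0 < e -> exists N, forall n, (N <= n)%N ->
  forall j : int, `|j| <= (A * 2 ^ n)%N%:Z -> `|S0n L0 n j - S0 L0 (j%:~R / 2 ^+ n)| <= e.
Proof.
move=> e0.
have [c /andP[c0 c1] cL] := window_lb A.+1.
pose e1 := e / A.+1%:R.
have e10 : 0 < e1 by rewrite divr_gt0.
have [dl d0 hd] := unif_cont A.+1%:R cont_invsq e10.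
have [N hN] := hn_small d0; exists N => n nN.
have h0 : 0 < hn n :> R := hn_gt0 n.
have h1 : hn n <= 1 :> R by rewrite invf_le1 ?exprn_gt0 // exprn_ege1 // ler1n.
have xj (j : int) : (j + 1)%:~R / 2 ^+ n - j%:~R / 2 ^+ n = hn n :> R.
  by rewrite rmorphD /= /hn; field; rewrite expf_neq0.
have edge (j : int) : `|j| <= (A * 2 ^ n)%N%:Z ->
   `|S0n L0 n (j + 1) - S0n L0 n j - (S0 L0 ((j + 1)%:~R / 2 ^+ n) - S0 L0 (j%:~R / 2 ^+ n))| <= e1 * hn n.
  move=> jA; rewrite S0n_edge S0_prim distrC.
  have xA : `|j%:~R / 2 ^+ n : R| <= A%:R.
    rewrite normrM normfV normrX (ger0_norm (ler0n R 2)).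
    rewrite ler_pdivrMr ?exprn_gt0 // -intr_norm -natrX -natrM.
    by rewrite -[X in _ <= X]/((A * 2 ^ n)%N%:Z%:~R) ler_int.
  set x := j%:~R / 2 ^+ n in xA *.
  have y_ : (j + 1)%:~R / 2 ^+ n = x + hn n by rewrite -(xj j) [RHS]addrC subrK.
  have l0 := L0pos x; have l'0 := L0pos (x + hn n).
  rewrite /lon y_ -/x [hn n / _]mulrC.
  have := @prim_dist R (fun r => L0 r ^- 2) x (x + hn n) (L0 x * L0 (x + hn n))^-1 e1 cont_invsq.
  rewrite (addrC x) addrK; apply; first by rewrite lerDr ltW.
  move=> z /andP[z1 z2].
  have zx : `|z - x| < dl by rewrite ger0_norm ?subr_ge0 //; have := hN n nN; lra.
  have zy : `|z - (hn n + x)| < dl by rewrite distrC ger0_norm ?subr_ge0 //; have := hN n nN; lra.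
  have zA : `|z| <= A.+1%:R.
    have -> : z = x + (z - x) by ring.
    by apply: le_trans (ler_normD _ _) _; rewrite -natr1 (ger0_norm (_ : 0 <= z - x)) ?subr_ge0 //; lra.
  have a1 := hd _ _ zA zx; have a2 := hd _ _ zA zy.
  rewrite (addrC (hn n)) in a2.
  move: (L0 z ^- 2) a1 a2 => u; rewrite !ltr_norml => /andP[a1 a2] /andP[a3 a4].
  rewrite (addrC (hn n)) ler_norml.
  have g1 (p q : R) : 0 < p -> p <= q -> q ^- 2 <= (p * q)^-1 <= p ^- 2.
    move=> p0 pq; have q0 := lt_le_trans p0 pq.
    rewrite !lef_pV2 ?posrE ?mulr_gt0 ?exprn_gt0 // !expr2.
    by rewrite (ler_pM2r q0) (ler_pM2l p0) pq.
  case: (leP (L0 x) (L0 (x + hn n))) => ll.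
    by have /andP[g2 g3] := g1 _ _ l0 ll; apply/andP; split; lra.
  by have := g1 _ _ l'0 (ltW ll); rewrite mulrC => /andP[g2 g3]; apply/andP; split; lra.
have S00 : S0 L0 0 = 0 by rewrite S0_prim prim0.
have pos (m : nat) : (m <= A * 2 ^ n)%N -> 
   `|S0n L0 n m%:Z - S0 L0 (m%:Z%:~R / 2 ^+ n)| <= e1 * hn n * m%:R /\
   `|S0n L0 n (- m%:Z) - S0 L0 ((- m%:Z)%:~R / 2 ^+ n)| <= e1 * hn n * m%:R.
  elim: m => [|m IH] mA; first by rewrite oppr0 S0n0 mul0r S00 subrr normr0 mulr0.
  have [i1 i2] := IH (ltnW mA).
  have := edge m%:Z; have := edge (- m.+1%:Z).
  have -> : - m.+1%:Z + 1 = - m%:Z by lia.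
  rewrite -[m%:Z + 1]/((m + 1)%N%:Z) addn1.
  move=> /(_ _)/wrap[]; first by lia.
  move=> s2 /(_ _)/wrap[]; first by lia.
  move=> s1; move: i1 i2 s1 s2; rewrite (_ : m.+1%:R = m%:R + 1 :> R) ?natr1 // !ler_norml.
  move=> /andP[p1 p2] /andP[p3 p4] /andP[p5 p6] /andP[p7 p8].
  move: p1 p2 p3 p4 p5 p6 p7 p8; clear.
  move: (S0 L0 _) (S0 L0 _) (S0 L0 _) (S0 L0 _) (S0n L0 n m.+1%:Z) (S0n L0 n (- m.+1%:Z)) (S0n L0 n m%:Z) (S0n L0 n (- m%:Z)).
  by move=> *; split; apply/andP; split; lra.
have fin (m : nat) : (m <= A * 2 ^ n)%N -> e1 * hn n * m%:R <= e.
  move=> mA; rewrite /e1 -mulrA mulrAC ler_pdivrMr // ler_pM2l //.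
  apply: (@le_trans _ _ A%:R); last by rewrite ler_nat.
  by rewrite mulrC ler_pdivrMr ?exprn_gt0 // -natrX -natrM ler_nat.
case=> m jA; first by apply: le_trans (pos m _).1 (fin m _); lia.
rewrite NegzE; apply: le_trans (pos m.+1 _).2 (fin m.+1 _); lia.
Qed.

End scale_limit.

(** * Auxiliary facts: integer moves, and independence of the dynamics from the switches *)

Section integer_steps.

Lemma int_next (y M D : int) : `|y| <= M -> 0 < D ->
  let y' := if y + D <= M then y + D else M in
  [/\ `|y'| <= M, `|y' - y| <= D & forall z : int, 0 <= z -> M - y <= D + z -> M - y' <= z].
Proof. by move=> yM D0 /=; case: ifP => h; split; lia. Qed.

Lemma int_nbr (X M : int) : `|X| < M -> [/\ `|X| <= M, `|X + 1| <= M & `|X - 1| <= M].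
Proof. by move=> h; split; lia. Qed.

Lemma int_exit (b : bool) (X M : int) : `|X| < M -> M <= `|if b then X + 1 else X - 1| ->
  (if b then X + 1 else X - 1) = M \/ (if b then X + 1 else X - 1) = - M.
Proof. by case: b; lia. Qed.

End integer_steps.

Section core_state.
Context {R : realType} (h : R).
Local Notation vst := (@vst R).

(** The coordinates that drive the chain. The recordings [sA], [sB], [sC] never feed back, so events
    found with different switches can be read on the same [base] path. *)
Definition core (s : vst) := (sX s, sL s, sS s, sW s, sJ s, sE s).

Lemma core_step chi chi' (s s' : vst) x b : core s = core s' ->
  core (step h chi s x b) = core (step h chi' s' x b).
Proof.
by case: s => ? ? ? ? ? ? ? ? ?; case: s' => ? ? ? ? ? ? ? ? ?; rewrite /core /= => -[] -> -> -> -> -> ->.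
Qed.

Lemma core_run chi chi' (s : vst) e u k :
  core (run h chi s e u k) = core (run h chi' s e u k).
Proof.
elim: k => //= k IH.
have E : (lmv (run h chi s e u k) = lmv (run h chi' s e u k)) /\
         (lpv (run h chi s e u k) = lpv (run h chi' s e u k)).
  by move: IH; rewrite /core /lmv /lpv => -[] -> ->.
by rewrite E.1 E.2; exact: core_step.
Qed.

Variables (lo : int -> R) (chi : nat -> vst -> R).
Hypotheses (h0 : 0 < h) (chi0 : forall m s, 0 <= chi m s).

Lemma alp_le (s : vst) x : valid h lo s -> 0 <= x -> 0 <= alp h s x <= 2 * dW h s x.
Proof.
move=> vs x0; rewrite (alp_ge0 h0 vs x0) /dW.
by have := alm_ge0 h0 vs x0; lra.
Qed.

Lemma alm_le (s : vst) x : valid h lo s -> 0 <= x -> 0 <= alm h s x <= 2 * dW h s x.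
Proof.
move=> vs x0; rewrite (alm_ge0 h0 vs x0) /dW.
by have := alp_ge0 h0 vs x0; lra.
Qed.

Lemma sS_step (s : vst) x b j : valid h lo s -> 0 <= x ->
  `|sS (step h chi s x b) j - sS s j| <= 2 * dW h s x.
Proof.
move=> vs x0; have /andP[p1 p2] := alp_le vs x0; have /andP[m1 m2] := alm_le vs x0.
rewrite /=; case: ltP => _; first by rewrite addrAC subrr add0r normrN ger0_norm.
case: ltP => _; first by rewrite addrAC subrr add0r ger0_norm.
by rewrite subrr normr0; lra.
Qed.

End core_state.

(** * Confinement to a window, modulus of the martingale, sum of the holding variables *)

Section good_events.
Context {R : realType} d {T : measurableType d} (P : probability T R).
Variables (E U : nat -> T -> R) (cEU : clocks P E U).
Variables (L0 : R -> R) (L0pos : forall x, 0 < L0 x).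
Local Notation base := (base E U L0).
Local Notation lgr := (lgr E U L0).
Local Notation vst := (@vst R).
Implicit Types (n k m : nat).

Lemma baseS n k w : exists b : bool, base n k.+1 w = step (hn n) (@chi0 R) (base n k w) `|E k w| b.
Proof. by eexists. Qed.

Let dWb n k w := dW (hn n) (base n k w) `|E k w|.

Lemma sW_S n k w : sW (base n k.+1 w) = sW (base n k w) + dWb n k w.
Proof. by []. Qed.

Lemma dWb_ge0 n k w : 0 <= dW (hn n) (base n k w) `|E k w|.
Proof. exact: (dW_ge0 (hn_gt0 n) (valid_base E U L0pos n k w) (normr_ge0 _)). Qed.

Lemma sW_le n k1 k2 w : (k1 <= k2)%N -> sW (base n k1 w) <= sW (base n k2 w).
Proof.
elim: k2 => [|k IH]; first by rewrite leqn0 => /eqP ->.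
rewrite leq_eqVlt ltnS => /orP[/eqP ->//|/IH]; move/le_trans; apply.
by rewrite sW_S lerDl dWb_ge0.
Qed.

Lemma sW_ge0 n k w : 0 <= sW (base n k w).
Proof. exact: (sW_le n w (leq0n k)). Qed.

(** The clock increment is the mean of the two shrinkages, so either of them is at most twice that
    increment. *)
Lemma sS_drift n k w j : `|sS (base n k w) j - S0n L0 n j| <= 2 * sW (base n k w).
Proof.
elim: k => [|k IH]; first by rewrite /= subrr normr0 mulr0.
have [b Eb] := baseS n k w.
have := sS_step (@chi0 R) (hn_gt0 n) b j (valid_base E U L0pos n k w) (normr_ge0 (E k w)).
rewrite -Eb sW_S /dWb => st1.
have := ler_distD (sS (base n k w) j) (sS (base n k.+1 w) j) (S0n L0 n j); lra.
Qed.

Lemma sM_S n k w : exists b : bool, [/\ base n k.+1 w = step (hn n) (@chi0 R) (base n k w) `|E k w| b,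
  b = (U k w * (lmv (base n k w) + lpv (base n k w)) < lpv (base n k w)) &
  sM (base n k.+1 w) = sM (base n k w) + dM (hn n) (base n k w) `|E k w| b].
Proof.
eexists; split; [reflexivity|reflexivity|].
exact: (sM_step (hn_gt0 n) (fun _ _ => lexx 0) (valid_base E U L0pos n k w) (normr_ge0 _)).
Qed.

Lemma st_core n (chi : nat -> vst -> R) k w :
  core (st E U (hn n) chi (vinit L0 n) k w) = core (base n k w).
Proof. exact: core_run. Qed.

Lemma st_S n (chi : nat -> vst -> R) k w m :
  (forall m s s', core s = core s' -> chi m s = chi m s') -> exists2 b : bool,
  [/\ sA (st E U (hn n) chi (vinit L0 n) k.+1 w) m =
       sA (st E U (hn n) chi (vinit L0 n) k w) m + chi m (base n k w) * dM (hn n) (base n k w) `|E k w| b,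
   sB (st E U (hn n) chi (vinit L0 n) k.+1 w) m =
       sB (st E U (hn n) chi (vinit L0 n) k w) m + chi m (base n k w) * dW (hn n) (base n k w) `|E k w| &
   sC (st E U (hn n) chi (vinit L0 n) k.+1 w) m =
       sC (st E U (hn n) chi (vinit L0 n) k w) m + chi m (base n k w)] &
   sM (base n k.+1 w) = sM (base n k w) + dM (hn n) (base n k w) `|E k w| b.
Proof.
move=> cc; have [b [_ bE mE]] := sM_S n k w; exists b => //.
have := st_core n chi k w; rewrite stS /=; move: (st _ _ _ _ _ k w) => s ce.
rewrite (cc m _ _ ce) bE; move: ce; case: (base n k w) => ? ? ? ? ? ? ? ? ?; case: s => ? ? ? ? ? ? ? ? ?.
by rewrite /core /= => -[] -> -> -> -> -> ->; split.
Qed.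

Section switched.
Variables (n : nat) (a : nat -> R -> bool) (Wd : int).
Hypothesis ma : forall m, measurable_fun setT (a m : measurableTypeR R -> bool).

(** Recording stops outside the window, where no uniform lower bound on the local times is at
    hand. *)
Definition chib m (s : vst) : R := (a m (sW s) && (`|sX s| < Wd))%:R.

Lemma chib_ge0 m s : 0 <= chib m s. Proof. by rewrite ler0n. Qed.

Lemma mfunc_chib m : mfunc (chib m).
Proof.
move=> d' T' s ms.
have -> : (fun w => chib m (s w)) = (fun w => if a m (sW (s w)) && (`|sX (s w)| < Wd) then 1 else 0 : R).
  by apply/funext => w; rewrite /chib; case: (_ && _).
apply: measurable_fun_ifT => //; apply: measurable_and.
  by apply: (measurableT_comp (ma m)); exact: ms.2.2.2.1.
exact: (mfunc_sXp (fun i => `|i| < Wd)).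
Qed.

Local Notation sts := (st E U (hn n) chib (vinit L0 n)).

Lemma sts_valid k w : valid (hn n) (lon L0 n) (sts k w).
Proof. by apply: valid_st; [exact: hn_gt0|exact: chib_ge0|exact: valid_vinit]. Qed.

Lemma chib_core m s s' : core s = core s' -> chib m s = chib m s'.
Proof. by rewrite /core /chib => -[] -> _ _ -> _ _. Qed.

Lemma sts_S k w m : exists2 b : bool,
  [/\ sA (sts k.+1 w) m = sA (sts k w) m + chib m (base n k w) * dM (hn n) (base n k w) `|E k w| b,
   sB (sts k.+1 w) m = sB (sts k w) m + chib m (base n k w) * dW (hn n) (base n k w) `|E k w| &
   sC (sts k.+1 w) m = sC (sts k w) m + chib m (base n k w)] &
   sM (base n k.+1 w) = sM (base n k w) + dM (hn n) (base n k w) `|E k w| b.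
Proof. exact: (st_S n k w m chib_core). Qed.

Lemma sAB_on k1 k2 w m : (k1 <= k2)%N ->
  (forall j, (k1 <= j < k2)%N -> chib m (base n j w) = 1) ->
  sA (sts k2 w) m - sA (sts k1 w) m = sM (base n k2 w) - sM (base n k1 w) /\
  sB (sts k2 w) m - sB (sts k1 w) m = sW (base n k2 w) - sW (base n k1 w).
Proof.
elim: k2 => [|k IH]; first by rewrite leqn0 => /eqP ->; rewrite !subrr.
rewrite leq_eqVlt => /orP[/eqP -> _|]; first by rewrite !subrr.
rewrite ltnS => k1k on1.
have [|IA IB] := IH k1k; first by move=> j /andP[? ?]; apply: on1; apply/andP; split; lia.
have c1 : chib m (base n k w) = 1 by apply: on1; rewrite k1k ltnS leqnn.
have [b [-> -> _] ->] := sts_S k w m; rewrite c1 !mul1r sW_S /dWb.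
by split; lra.
Qed.

Variables (A : nat) (c : R).
Hypotheses (WdA : Wd <= (A * 2 ^ n)%N%:Z) (c0 : 0 < c).
Hypothesis cL : forall x : R, `|x| <= A%:R -> c <= L0 x.

Lemma chib_window m s : chib m s = 0 \/
  [/\ chib m s = 1, c <= lon L0 n (sX s), c <= lon L0 n (sX s + 1) & c <= lon L0 n (sX s - 1)].
Proof.
rewrite /chib; case: (boolP (_ && _)) => [/andP[_ w]|]; last by left.
by right; split => //; apply: (lon_window cL); move: WdA w; move: (A * 2 ^ n)%N (sX s) => M X; lia.
Qed.

Lemma mart_whp m (th lam : R) : 0 < th ->
  th * (hn n / c ^+ 2) <= 1 / 2 -> 4 * th ^+ 2 * (hn n / c ^+ 2) <= 1 ->
  whp P (2 * expR (- lam)) (fun w => forall k,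
    th * `|sA (sts k w) m| <= 4 * th ^+ 2 * sB (sts k w) m + lam).
Proof.
move=> th0 t1 t2.
have one t : `|t| = th -> whp P (expR (- lam)) (fun w => forall k,
    t * sA (sts k w) m <= 4 * th ^+ 2 * sB (sts k w) m + lam).
  move=> tE.
  have tt : t ^+ 2 = th ^+ 2 by rewrite -(real_normK (num_real t)) tE.
  have sup := @F2_super R (hn n) (lon L0 n) chib (hn_gt0 n) c t m c0 (chib_window m).
  rewrite tE tt in sup.
  have [mB PB] := ville cEU (hn_gt0 n) chib_ge0 mfunc_chib (valid_vinit L0pos n)
   (@mfunc_F2 R t m) (fun s _ => expR_ge0 _) (sup t1 t2) (expR_gt0 lam).
  eexists; split; [exact: mB| |].
    apply: le_trans PB _; rewrite lee_fin /F2 /= !mulr0 subrr expR0 mul1r expRN //.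
  move=> w nB k; have : F2 t m (sts k w) < expR lam.
    by rewrite ltNge; apply/negP => ge; apply: nB; exists k.
  by rewrite /F2 ltr_expR tt; lra.
have W := whpI (one th (gtr0_norm th0)) (one (- th) (etrans (normrN th) (gtr0_norm th0))).
apply: (whp_le _ _ W); first by lra.
move=> w [w1 w2] k; have := w1 k; have := w2 k.
by case: (leP 0 (sA (sts k w) m)) => s0; rewrite ?(ger0_norm s0) ?(ltr0_norm s0); lra.
Qed.

End switched.

Lemma dW_small n s x (c : R) : 0 < c -> valid (hn n) (lon L0 n) s -> 0 <= x ->
  c <= lon L0 n (sX s) -> c <= lon L0 n (sX s + 1) -> c <= lon L0 n (sX s - 1) ->
  dW (hn n) s x <= hn n / c ^+ 2.
Proof.
move=> c0 vs x0 c1 c2 c3.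
have l1 : c <= lcv s by apply: le_trans c1 _; have /andP[] := vs.1 (sX s).
have l2 : c <= lpv s by apply: le_trans c2 _; have /andP[] := vs.1 (sX s + 1).
have l3 : c <= lmv s by apply: le_trans c3 _; have /andP[] := vs.1 (sX s - 1).
have n0 := lcn_gt0 (hn_gt0 n) vs x0.
have inv : (lcv s)^-1 - (lcn (hn n) s x)^-1 <= c^-1.
  have : 0 <= (lcn (hn n) s x)^-1 by rewrite invr_ge0 ltW.
  have : (lcv s)^-1 <= c^-1 by rewrite lef_pV2 ?posrE // (lt_le_trans c0).
  lra.
have i0 := lcinv_ge0 (hn_gt0 n) vs x0.
have hh := hn_gt0 (R := R) n.
have key l : c <= l -> hn n / l * ((lcv s)^-1 - (lcn (hn n) s x)^-1) <= hn n / c ^+ 2.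
  move=> cl; rewrite expr2 invfM mulrA.
  apply: ler_pM => //; first by rewrite divr_ge0 ?(ltW hh) // (le_trans (ltW c0)).
  by rewrite ler_pM2l // lef_pV2 ?posrE // (lt_le_trans c0).
by rewrite /dW /alp /alm; have := key _ l2; have := key _ l3; lra.
Qed.

(** With th = 1 the martingale stays below 4 V + lam, and the scale function moves by at most 2 V.
    Leaving the window would require the initial scale function at its end to be at most 6 V + lam
    in absolute value. *)
Lemma window_whp n (A : nat) (c V lam : R) : 0 < c ->
  (forall x : R, `|x| <= A%:R -> c <= L0 x) -> 4 * (hn n / c ^+ 2) <= 1 -> (0 < A)%N ->
  6 * V + lam < S0n L0 n (A * 2 ^ n)%N%:Z -> S0n L0 n (- (A * 2 ^ n)%N%:Z) < - (6 * V + lam) ->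
  whp P (2 * expR (- lam)) (fun w => forall k, sW (base n k w) <= V ->
    `|sX (base n k w)| < (A * 2 ^ n)%N%:Z /\ `|sM (base n k w)| <= 4 * V + lam).
Proof.
move=> c0 cL hc A0 SA SmA.
pose a (_ : nat) (_ : R) := true.
have W := @mart_whp n a (A * 2 ^ n)%N%:Z (fun=> @measurable_cst _ _ _ _ _ _) A c (lexx _) c0 cL 0%N 1 lam ltr01 _ _.
apply: (whp_le _ _ (W _ _)) => //; [|by rewrite mul1r; lra|by rewrite expr1n mulr1].
move=> w Hw.
have P0 : 0 < (A * 2 ^ n)%N%:Z by rewrite ltz_nat muln_gt0 A0 expn_gt0.
pose sts k := st E U (hn n) (chib a (A * 2 ^ n)%N%:Z) (vinit L0 n) k w.
suff main k : sW (base n k w) <= V -> [/\ `|sX (base n k w)| < (A * 2 ^ n)%N%:Z,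
    sA (sts k) 0%N = sM (base n k w) & sB (sts k) 0%N = sW (base n k w)].
  move=> k kV; have [x1 x2 x3] := main k kV; split => //.
  by have := Hw k; rewrite -/(sts k) x2 x3 mul1r expr1n; lra.
(* As long as the walk is inside, the recordings are the martingale and the clock themselves; the
   induction carries this along with the confinement, up to the step of a possible exit. *)
elim: k => [|k IH] kV; first by split => //; first [exact/esym/S0n0|rewrite /= normr0].
have [x1 x2 x3] := IH (le_trans (sW_le n w (leqnSn k)) kV).
have [b [Eb bE ME]] := sM_S n k w.
have [b' [A1 B1 _] ME'] := @sts_S n a (A * 2 ^ n)%N%:Z k w 0%N.
have c1 : chib a (A * 2 ^ n)%N%:Z 0%N (base n k w) = 1 by rewrite /chib x1.
rewrite c1 !mul1r -!/(sts _) x2 x3 -ME' in A1 B1.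
split; [|exact: A1|exact: B1].
have Mb : `|sM (base n k.+1 w)| <= 4 * V + lam.
  by have := Hw k.+1; rewrite -/(sts k.+1) A1 B1 -sW_S mul1r expr1n; lra.
have XE : sX (base n k.+1 w) = if b then sX (base n k w) + 1 else sX (base n k w) - 1 by rewrite Eb.
rewrite ltNge; apply/negP => bad.
have dr := sS_drift n k.+1 w (sX (base n k.+1 w)).
have XX : sX (base n k.+1 w) = (A * 2 ^ n)%N%:Z \/ sX (base n k.+1 w) = - (A * 2 ^ n)%N%:Z.
  by move: bad; rewrite XE; exact: int_exit.
move: dr Mb; rewrite -/(sM (base n k.+1 w)) !ler_norml => /andP[d1 d2] /andP[m1 m2].
by case: XX => XX; rewrite XX in d1 d2; lra.
Qed.

(** One switch for each grid point m dl of the clock, on from that point for ever. An increment of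
    clock length at most dl is read from the switch at the grid point below its start, which has
    recorded at most 2 dl at either end, so a union bound over N switches is enough. *)
Lemma modM_whp n (A N : nat) (c V dl th lam : R) : 0 < c ->
  (forall x : R, `|x| <= A%:R -> c <= L0 x) ->
  0 < th -> 0 < dl -> V <= N%:R * dl ->
  th * (hn n / c ^+ 2) <= 1 / 2 -> 4 * th ^+ 2 * (hn n / c ^+ 2) <= 1 ->
  whp P (N%:R * (2 * expR (- lam))) (fun w =>
    (forall k, sW (base n k w) <= V -> `|sX (base n k w)| < (A * 2 ^ n)%N%:Z) ->
    forall k1 k2, (k1 <= k2)%N -> sW (base n k2 w) < V ->
     sW (base n k2 w) - sW (base n k1 w) <= dl ->
     `|sM (base n k2 w) - sM (base n k1 w)| <= 2 * (8 * th * dl + lam / th)).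
Proof.
move=> c0 cL th0 dl0 VN t1 t2.
pose a (m : nat) (x : R) := m%:R * dl <= x.
have ma m : measurable_fun setT (a m : measurableTypeR R -> bool).
  by apply: measurable_fun_ler.
pose Wd := (A * 2 ^ n)%N%:Z.
have W := @whp_all R _ _ P N (fun=> 2 * expR (- lam)) (fun m w => forall k,
   th * `|sA (st E U (hn n) (chib a Wd) (vinit L0 n) k w) m| <=
   4 * th ^+ 2 * sB (st E U (hn n) (chib a Wd) (vinit L0 n) k w) m + lam) _.
apply: (whp_le _ _ (W _)) => //; last by move=> m _; exact: (mart_whp ma (lexx _) c0 cL).
  by rewrite sumr_const card_ord -[X in X <= _]mulr_natl.
move=> w Hw win k1 k2 k12 kV k21.
pose sts k := st E U (hn n) (chib a Wd) (vinit L0 n) k w.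
have W10 := sW_ge0 n k1 w.
pose m := `|Num.floor (sW (base n k1 w) / dl)|%N.
have fl0 : 0 <= Num.floor (sW (base n k1 w) / dl) by rewrite floor_ge0 divr_ge0 // ltW.
have mE : m%:R = (Num.floor (sW (base n k1 w) / dl))%:~R :> R.
  by rewrite /m -[in RHS](gez0_abs fl0).
have m1 : m%:R * dl <= sW (base n k1 w) by rewrite mE -ler_pdivlMr // floor_le_tmp.
have m2 : sW (base n k1 w) < (m%:R + 1) * dl.
  by rewrite mE -ltr_pdivrMr // -intrD1 floorD1_gt.
have mN : (m < N)%N.
  rewrite -(ltr_nat R) -(ltr_pM2r dl0); apply: le_lt_trans m1 (lt_le_trans _ VN).
  exact: le_lt_trans (sW_le n w k12) kV.
have sBm k : sB (sts k) m <= Num.max 0 (sW (base n k w) - m%:R * dl).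
  elim: k => [|k IH]; first by rewrite /= le_max lexx.
  have [b [_ -> _] _] := @sts_S n a Wd k w m; rewrite -/(sts k) sW_S /dWb.
  have d0 := dWb_ge0 n k w; rewrite le_max; apply/orP.
  rewrite /chib /a; case: (leP (m%:R * dl) (sW (base n k w))) => h1.
    move: IH; rewrite (max_idPr _); last by lra.
    move=> IH; right; case: (_ < _) => /=; rewrite ?mul1r ?mul0r; lra.
  by left; move: IH; rewrite (max_idPl _) ?mul0r ?addr0 //; lra.
have on1 j : (k1 <= j < k2)%N -> chib a Wd m (base n j w) = 1.
  move=> /andP[j1 j2]; rewrite /chib /a (le_trans m1) ?sW_le // win //.
  by apply: le_trans (ltW kV); apply: sW_le; exact: ltnW.
have [EA _] := sAB_on k12 on1; rewrite -EA -!/(sts _).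
have bnd k : (k <= k2)%N -> `|sA (sts k) m| <= 8 * th * dl + lam / th.
  move=> kk; have := Hw m mN k; rewrite -/(sts k) => h1.
  have h2 : sB (sts k) m <= 2 * dl.
    apply: le_trans (sBm k) _; rewrite ge_max; apply/andP; split; first by lra.
    by have := sW_le n w kk; lra.
  rewrite -(ler_pM2l th0); apply: le_trans h1 _.
  have -> : th * (8 * th * dl + lam / th) = 4 * th ^+ 2 * (2 * dl) + lam by field; rewrite gt_eqF.
  by rewrite lerD2r ler_wpM2l // mulr_ge0 // sqr_ge0.
have := bnd k1 k12; have := bnd k2 (leqnn _).
have := ler_normB (sA (sts k2) m) (sA (sts k1) m); lra.
Qed.

Lemma clock_whp n (lam : R) : whp P (expR (- lam)) (fun w => forall k, - lam <= sE (base n k w)).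
Proof.
have ch0 m (s : vst) : 0 <= @chi0 R m s by [].
have mch0 m : mfunc (@chi0 R m) by move=> d' T' s _; exact: measurable_cst.
have [mB PB] := ville cEU (hn_gt0 n) ch0 mch0 (valid_vinit L0pos n)
   (@mfunc_F5 R) (fun s _ => expR_ge0 _) (fun s vs => F5_super (@chi0 R) vs) (expR_gt0 lam).
eexists; split; [exact: mB| |].
  by apply: le_trans PB _; rewrite lee_fin /F5 /= oppr0 expR0 mul1r expRN.
move=> w nB k; have : F5 (base n k w) < expR lam.
  by rewrite ltNge; apply/negP => ge; apply: nB; exists k.
by rewrite /F5 ltr_expR; lra.
Qed.

Lemma hold_ge0_whp : whp P 0 (fun w => forall k, 0 <= E k w).
Proof.
pose N k := E k @^-1` `]-oo, (0 : R)[.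
have mN k : measurable (N k).
  by rewrite -[N k]setTI; apply: (cEU.1.1 (inl k)) => //; exact: measurable_itv.
have PN k : P (N k) = 0.
  rewrite /N (cEU.2.1 k _ (measurable_itv _)).
  rewrite /exponential_prob; apply: integral0_eq => x.
  by rewrite /= in_itv /= => x0; rewrite /exponential_pdf patchE memNset //= in_itv /= andbT; apply/negP; rewrite -ltNge.
exists (\bigcup_k N k); split.
- exact: bigcupT_measurable.
- have : P.-negligible (\bigcup_k N k).
    by apply: negligible_bigcup => k; exists (N k); split; [exact: mN|exact: PN|exact: subset_refl].
  have mU : measurable (\bigcup_k N k) by exact: bigcupT_measurable.
  by move=> ng; rewrite (measure_negligible mU ng).
- move=> w nB k; rewrite leNgt; apply/negP => lt; by apply: nB; exists k.
Qed.

End good_events.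

(** * Bounds on the local times and growth of the clock *)

Section pathwise.
Context {R : realType} d {T : measurableType d}.
Variables (E U : nat -> T -> R).
Variables (L0 : R -> R) (L0pos : forall x, 0 < L0 x).
Local Notation base := (base E U L0).
Local Notation lgr := (lgr E U L0).
Local Notation vst := (@vst R).
Implicit Types (n k m : nat).

Lemma unvisited n k w (z : int) : (forall j, (j < k)%N -> sX (base n j w) != z) ->
  sL (base n k w) z = lon L0 n z.
Proof.
elim: k => [//|k IH] hz; have [b ->] := baseS E U L0 n k w.
rewrite /= ifF ?IH // => [j jk|]; first by apply: hz; exact: leqW.
by rewrite eq_sym; apply/negbTE/hz.
Qed.

Lemma sL_lgr n k w (z : int) : sL (base n k w) z = lon L0 n z * expR (lgr n k w z).
Proof.
have l0 := lon_gt0 L0pos n z; have L1 := valid_gt0 z (valid_base E U L0pos n k w).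
by rewrite /lgr lnK ?posrE ?divr_gt0 // mulrC divfK // gt_eqF.
Qed.

(** The walk has never been at the right end of the window, so [lgr] vanishes there. Hops of length
    2^(n-m) lead from there to every site in 2 A 2^m moves, each of which at most doubles 1 +
    [lgr]. *)
Lemma lgr_bound n k w (A m : nat) : (m <= n)%N ->
  (forall x y : int, `|x| <= (A * 2 ^ n)%N%:Z -> `|y| <= (A * 2 ^ n)%N%:Z ->
     `|x - y| <= (2 ^ (n - m))%N%:Z -> 1 + lgr n k w y <= 2 * (1 + lgr n k w x)) ->
  (forall j, (j < k)%N -> `|sX (base n j w)| < (A * 2 ^ n)%N%:Z) ->
  forall x : int, `|x| <= (A * 2 ^ n)%N%:Z -> lgr n k w x <= 2 ^+ (2 * A * 2 ^ m).
Proof.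
move=> mn md win x xA.
pose M := (A * 2 ^ n)%N; pose D := (2 ^ (n - m))%N.
have D0 : (0 < D)%N by rewrite expn_gt0.
have key i (y : int) : `|y| <= M%:Z -> M%:Z - y <= (i * D)%N%:Z -> 1 + lgr n k w y <= 2 ^+ i.
  elim: i y => [|i IH] y yM yi.
    have -> : y = M%:Z by move: yM yi; lia.
    rewrite /lgr unvisited ?divff ?gt_eqF ?lon_gt0 // ?ln1 ?addr0 ?expr0 //.
    by move=> j /win; apply: contraTneq => ->; rewrite -leNgt ler_norm.
  have [] := @int_next y M%:Z D%:Z yM D0; set y' := if _ then _ else _ => y'M yy yi'.
  have {}yi' : M%:Z - y' <= (i * D)%N%:Z by apply: yi' => //; rewrite mulSn in yi.
  rewrite exprS; apply: le_trans (md y' y y'M yM yy) _.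
  by rewrite ler_pM2l // IH.
have : 1 + lgr n k w x <= 2 ^+ (2 * A * 2 ^ m).
  apply: key => //.
  have -> : (2 * A * 2 ^ m * D = 2 * M)%N by rewrite /M /D -!mulnA -expnD subnKC.
  by rewrite -/M in xA; lia.
lra.
Qed.

Lemma dWE n (s : vst) x : valid (hn n) (lon L0 n) s -> 0 <= x ->
  dW (hn n) s x = hn n ^+ 2 * x / (lpv s * lmv s * (lcv s * lcn (hn n) s x)).
Proof.
move=> vs x0; have p0 := lpv_gt0 vs; have m0 := lmv_gt0 vs; have c0 := lcv_gt0 vs.
have n0 := lcn_gt0 (hn_gt0 n) vs x0; have h0 := hn_gt0 (R := R) n.
have nE : lcn (hn n) s x = lcv s + x * (2 * hn n) / (lmv s + lpv s).
  by rewrite /lcn /kap invf_div mulrA.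
rewrite /dW /alp /alm.
have xE : x = (lcn (hn n) s x - lcv s) * (lmv s + lpv s) / (2 * hn n).
  by rewrite nE; field; rewrite !gt_eqF ?addr_gt0.
rewrite {3}xE; move: (lcn (hn n) s x) n0 => l l0.
by field; rewrite !gt_eqF.
Qed.

(** With local times bounded by [Lm], a step advances the clock by at least [q] times its holding
    variable, and k holding variables sum up to at least k ln 2 - lam. A clock that stays below V
    for ever contradicts this. *)
Lemma reach_level n w (A : nat) (V B Cm lam : R) :
  (forall x : R, `|x| <= A%:R -> L0 x <= Cm) ->
  (forall k, sW (base n k w) <= V -> `|sX (base n k w)| < (A * 2 ^ n)%N%:Z) ->
  (forall k, sW (base n k w) <= V -> forall x : int, `|x| <= (A * 2 ^ n)%N%:Z -> lgr n k w x <= B) ->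
  (forall k, - lam <= sE (base n k w)) ->
  exists k, V < sW (base n k w).
Proof.
move=> LC win lb sEl; apply: contrapT => /forallNP noV.
have WV k : sW (base n k w) <= V by rewrite leNgt; apply/negP; exact: noV.
pose Lm := Cm * expR B.
have Cm0 : 0 < Cm by apply: lt_le_trans (L0pos 0) (LC 0 _); rewrite normr0.
have Lm0 : 0 < Lm by rewrite mulr_gt0 ?expR_gt0.
have Lb k (x : int) : `|x| <= (A * 2 ^ n)%N%:Z -> sL (base n k w) x <= Lm.
  move=> xA; rewrite sL_lgr; apply: ler_pM; rewrite ?expR_ge0 ?(ltW (lon_gt0 L0pos _ _)) //.
    have := @lon_window _ (fun x => - L0 x) A n (- Cm) x; rewrite /lon lerN2; apply => //.
    by move=> y yA; rewrite lerN2; exact: LC.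
  by rewrite ler_expR; exact: lb.
pose q := hn n ^+ 2 / Lm ^+ 4.
have q0 : 0 < q by rewrite divr_gt0 ?exprn_gt0 ?hn_gt0.
have key k : q * (sE (base n k w) + k%:R * ln 2) <= sW (base n k w).
  elim: k => [|k IH]; first by rewrite /= mul0r addr0 mulr0.
  have [b Eb] := baseS E U L0 n k w.
  have E1 : sE (base n k.+1 w) = sE (base n k w) + (`|E k w| - ln 2) by rewrite Eb.
  have vs := valid_base E U L0pos n k w; have x0 := normr_ge0 (E k w).
  rewrite E1 sW_S (dWE vs x0) (_ : k.+1%:R = k%:R + 1 :> R) ?natr1 //.
  have p0 := lpv_gt0 vs; have m0 := lmv_gt0 vs; have c0 := lcv_gt0 vs.
  have n0 := lcn_gt0 (hn_gt0 n) vs x0.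
  have nL : lcn (hn n) (base n k w) `|E k w| <= Lm.
    have := Lb k.+1 (sX (base n k w)); rewrite Eb /= eqxx; apply.
    exact: ltW (win k (WV k)).
  have Xw := win k (WV k).
  have cL : lcv (base n k w) <= Lm by apply: Lb; have [] := int_nbr Xw.
  have pL : lpv (base n k w) <= Lm by apply: Lb; have [] := int_nbr Xw.
  have mL : lmv (base n k w) <= Lm by apply: Lb; have [] := int_nbr Xw.
  have qE : q * `|E k w| <= hn n ^+ 2 * `|E k w| / (lpv (base n k w) * lmv (base n k w) *
        (lcv (base n k w) * lcn (hn n) (base n k w) `|E k w|)).
    have -> : q * `|E k w| = hn n ^+ 2 * `|E k w| / Lm ^+ 4 by rewrite /q mulrAC.
    rewrite ler_wpM2l ?(mulr_ge0 (sqr_ge0 _)) // lef_pV2 ?posrE ?exprn_gt0 ?mulr_gt0 ?expR_gt0 //.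
    have -> : Lm ^+ 4 = Lm * Lm * (Lm * Lm) by ring.
    by rewrite !ler_pM // ?mulr_ge0 // ltW.
  move: IH qE; move: (hn n ^+ 2 * _ / _) => D IH qE; lra.
have V0 : 0 <= V by have := WV 0%N.
have l2 : 0 < ln (2 : R) by rewrite ln_gt0 // ltr1n.
pose k := Num.bound ((V / q + lam) / ln 2).
have := archi_boundP (normr_ge0 ((V / q + lam) / ln 2)).
pose k' := Num.bound `|(V / q + lam) / ln 2|; rewrite -/k' => kb.
have {}kb : (V / q + lam) / ln 2 < k'%:R by apply: le_lt_trans (ler_norm _) kb.
rewrite ltr_pdivrMr // in kb.
have := le_trans (key k') (WV k'); rewrite mulrC -ler_pdivlMr //.
by have := sEl k'; lra.
Qed.

(** Real time is h times the total local time gained; only the sites 0 to N - 1 are counted. *)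
Lemma sJ_ge n k w N : \sum_(j < N) hn n * (sL (base n k w) j%:Z - lon L0 n j%:Z) <= sJ (base n k w).
Proof.
elim: k => [|k IH].
  by rewrite big1 // => i _; rewrite subrr mulr0.
have [b Eb] := baseS E U L0 n k w.
have vs := valid_base E U L0pos n k w; have x0 := normr_ge0 (E k w).
have := lcn_ge (hn_gt0 n) vs x0; rewrite Eb /=.
set l := lcn _ _ _ => lge; set s := base n k w in IH lge *.
have hh := hn_gt0 (R := R) n.
suff key : \sum_(j < N) hn n * ((if j%:Z == sX s then l else sL s j%:Z) - lon L0 n j%:Z) <=
   \sum_(j < N) hn n * (sL s j%:Z - lon L0 n j%:Z) + hn n * (l - lcv s) by lra.
have gap0 : 0 <= hn n * (l - lcv s) by rewrite mulr_ge0 ?(ltW hh) // subr_ge0.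
elim: N {IH} => [|N IH]; first by rewrite !big_ord0 add0r.
rewrite !big_ord_recr /=; case: eqP => [NX|_]; last by lra.
have -> : \sum_(j < N) hn n * ((if j%:Z == sX s then l else sL s j%:Z) - lon L0 n j%:Z) =
          \sum_(j < N) hn n * (sL s j%:Z - lon L0 n j%:Z).
  apply: eq_bigr => j _; rewrite ifF //; apply/negbTE; rewrite -NX eqz_nat.
  by rewrite neq_ltn ltn_ord.
rewrite NX /lcv; lra.
Qed.

Definition okst n (A : nat) (s : vst) :=
  [&& `|sX s| < (A * 2 ^ n)%N%:Z, lmv s <= 3 * lpv s & lpv s <= 3 * lmv s].

Definition chi3 n (A : nat) m (s : vst) : R :=
  if m == 0%N then (sX s != 0)%:R else if m == 1%N then (~~ okst n A s)%:R else 0.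

Variable (P : probability T R).
Hypothesis cEU : clocks P E U.

(** [F3] at the site 0 bounds the clock spent away from 0; t <= 1/8 and the weight 1/64 give the
    constants 8 and 64. The clock spent at 0 telescopes to h/c times a difference of inverse local
    times, which is at most 1. *)
Lemma local_time_whp n (A : nat) (c lam : R) : 0 < c ->
  (forall x : R, `|x| <= A%:R -> c <= L0 x) -> (0 < A)%N -> hn n / c ^+ 2 <= 1 ->
  whp P (expR (- lam)) (fun w => forall k, (forall j, (j < k)%N -> okst n A (base n j w)) ->
    sW (base n k w) <= 8 * lgr n k w 0 + 64 * lam + 1).
Proof.
move=> c0 cL A0 hc.
have ch0 m s : 0 <= chi3 n A m s by rewrite /chi3; case: ifP => _; [|case: ifP => _]; rewrite ?ler0n.
have chc m s s' : core s = core s' -> chi3 n A m s = chi3 n A m s'.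
  by rewrite /core /chi3 /okst /lmv /lpv => -[] -> -> _ _ _ _.
have mb (p : vst -> bool) : mfunc p -> mfunc (fun s => (p s)%:R : R).
  move=> mp d' T' s ms.
  have -> : (fun w => (p (s w))%:R : R) = (fun w => if p (s w) then 1 else 0).
    by apply/funext => w; case: (p _).
  by apply: measurable_fun_ifT => //; exact: mp.
have mch m : mfunc (chi3 n A m).
  case: m => [|[|m]].
  - by apply: (mb (fun s => sX s != 0)); exact: (mfunc_sXp (fun i => i != 0)).
  - apply: (mb (fun s => ~~ okst n A s)) => d' T' s ms.
    apply: measurable_neg; apply: measurable_and; first exact: (mfunc_sXp (fun i => `|i| < _)).
    apply: measurable_and; apply: measurable_fun_ler; try (by exact: mfunc_sLX);
      by apply: measurable_funM => //; exact: mfunc_sLX.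
  - by move=> d' T' s _; exact: measurable_cst.
have ok1 s : valid (hn n) (lon L0 n) s -> chi3 n A 1%N s <= 0 ->
  [/\ c <= lon L0 n (sX s), c <= lon L0 n (sX s + 1), c <= lon L0 n (sX s - 1),
     lmv s <= 3 * lpv s & lpv s <= 3 * lmv s].
  move=> vs; rewrite /chi3 /=; case: (boolP (okst n A s)); last by rewrite ler10.
  move=> /and3P[xA l1 l2] _; split => //; apply: (lon_window cL); (by have [] := int_nbr xA).
have sup := @F3_super R (hn n) (lon L0 n) (chi3 n A) (hn_gt0 n) ch0 c 0 (lon L0 n 0) c0 (lon_gt0 L0pos n 0) (fun s => erefl) ok1 hc.
set t := 16^-1 * _ in sup.
have F30 s : 0 <= F3 0 t (lon L0 n 0) s by rewrite /F3; case: ifP => // _; exact: expR_ge0.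
have [mB PB] := ville cEU (hn_gt0 n) ch0 mch (valid_vinit L0pos n)
   (@mfunc_F3 R 0 t (lon L0 n 0)) (fun s _ => F30 s) sup (expR_gt0 lam).
eexists; split; [exact: mB| |].
  apply: le_trans PB _; rewrite lee_fin /F3 /= ltxx /sM /= subrr normr0 divff ?gt_eqF ?lon_gt0 //.
  by rewrite ln1 !mul0r mulr0 oppr0 !addr0 expR0 mul1r expRN.
move=> w nB k ok.
pose sts k := st E U (hn n) (chi3 n A) (vinit L0 n) k w.
have l00 := lon_gt0 L0pos n 0.
have cl0 : c <= lon L0 n 0 by apply: (lon_window cL); rewrite normr0.
have inv k1 : (k1 <= k)%N -> sC (sts k1) 1%N = 0 /\
   sW (base n k1 w) - sB (sts k1) 0%N <= hn n / c * ((lon L0 n 0)^-1 - (sL (base n k1 w) 0)^-1).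
  elim: k1 => [|k1 IH] kk; first by rewrite /= !subrr mulr0.
  have [C0 WB] := IH (ltnW kk).
  have okk := ok k1 kk.
  have [b [_ _ C1] _] := st_S E U L0pos n k1 w 1%N chc.
  have [b' [_ B1 _] _] := st_S E U L0pos n k1 w 0%N chc.
  rewrite -!/(sts _) in C1 B1; rewrite C1 B1 C0 add0r sW_S.
  split; first by rewrite /chi3 /= okk.
  have [b2 Eb] := baseS E U L0 n k1 w.
  have vs := valid_base E U L0pos n k1 w; have x0 := normr_ge0 (E k1 w).
  have L1 : sL (base n k1.+1 w) 0 = if 0 == sX (base n k1 w) then lcn (hn n) (base n k1 w) `|E k1 w|
     else sL (base n k1 w) 0 by rewrite Eb.
  rewrite L1 /chi3 /= eq_sym; case: (eqVneq (sX (base n k1 w)) 0) => X0 /=; last by rewrite mul1r; lra.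
  rewrite mul0r addr0.
  have dWl : dW (hn n) (base n k1 w) `|E k1 w| <=
     hn n / c * ((lcv (base n k1 w))^-1 - (lcn (hn n) (base n k1 w) `|E k1 w|)^-1).
    have i0 := lcinv_ge0 (hn_gt0 n) vs x0; have hh := hn_gt0 (R := R) n.
    have key (l : R) : c <= l -> hn n / l * ((lcv (base n k1 w))^-1 - (lcn (hn n) (base n k1 w) `|E k1 w|)^-1)
       <= hn n / c * ((lcv (base n k1 w))^-1 - (lcn (hn n) (base n k1 w) `|E k1 w|)^-1).
      by move=> cl; rewrite ler_wpM2r // ler_pM2l // lef_pV2 ?posrE // (lt_le_trans c0).
    have [_ r2 r3 _ _] : [/\ c <= lon L0 n (sX (base n k1 w)), c <= lon L0 n (sX (base n k1 w) + 1),
       c <= lon L0 n (sX (base n k1 w) - 1), true & true].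
      have /and3P[xA _ _] := okk.
      by split => //; apply: (lon_window cL); (by have [] := int_nbr xA).
    have l2 : c <= lpv (base n k1 w) by apply: le_trans r2 _; have /andP[] := vs.1 (sX (base n k1 w) + 1).
    have l3 : c <= lmv (base n k1 w) by apply: le_trans r3 _; have /andP[] := vs.1 (sX (base n k1 w) - 1).
    by rewrite /dW /alp /alm; have := key _ l2; have := key _ l3; lra.
  rewrite /lcv X0 in dWl; lra.
have [Ck WBk] := inv k (leqnn k).
have : F3 0 t (lon L0 n 0) (sts k) < expR lam.
  by rewrite ltNge; apply/negP => ge; apply: nB; exists k.
have LE : sL (sts k) = sL (base n k w) by have := st_core E U L0 n (chi3 n A) k w; rewrite -/(sts k) => -[].
rewrite /F3 Ck ltxx ltr_expR LE -/(lgr n k w 0).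
have : 0 <= `|sM (sts k) - sS (sts k) 0| by [].
have g0 := lgr_ge0 E U L0pos n k w 0.
have tb : t <= 8^-1 by rewrite /t; lra.
have tl := ler_wpM2r g0 tb.
have : hn n / c * ((lon L0 n 0)^-1 - (sL (base n k w) 0)^-1) <= 1.
  apply: le_trans hc; rewrite expr2 invfM mulrA ler_pM2l ?divr_gt0 ?hn_gt0 //.
  have : 0 <= (sL (base n k w) 0)^-1 by rewrite invr_ge0 ltW // (valid_gt0 0 (valid_base E U L0pos n k w)).
  have : (lon L0 n 0)^-1 <= c^-1 by rewrite lef_pV2.
  lra.
lra.
Qed.

End pathwise.

Section small.
Context {R : realType}.

(** The rate of the spatial modulus, used also as a common bound for 2^-j and j 2^-j. *)
Definition rho (m : nat) : R := (9 / 10) ^+ m.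

Lemma rho_gt0 m : 0 < rho m. Proof. by rewrite exprn_gt0. Qed.

Lemma rho_small (K e : R) : 0 <= K -> 0 < e -> exists m, K * rho m <= e.
Proof.
move=> K0 e0; have K1 : 0 < K + 1 by lra.
have : (fun m => rho m) @ \oo --> (0 : R).
  by apply: cvg_expr; rewrite ger0_norm //; lra.
move/cvgrPdist_le/(_ (e / (K + 1)) (divr_gt0 e0 K1)) => [m _ /(_ m (leqnn m))].
rewrite sub0r normrN ger0_norm ?(ltW (rho_gt0 _)) // ler_pdivlMr // => h.
by exists m; have := rho_gt0 m; nra.
Qed.

Lemma half_rho j : (2 ^+ j)^-1 <= rho j :> R.
Proof. by rewrite -exprVn lerXn2r ?nnegrE ?invr_ge0 //; lra. Qed.

Lemma nat_half_rho j : j%:R / 2 ^+ j <= 8 * rho j :> R.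
Proof.
rewrite ler_pdivrMr ?exprn_gt0 // -mulrA -exprMn.
apply: le_trans (@bernoulli8 R j) _; rewrite ler_pM2l //.
by rewrite lerXn2r ?nnegrE //; lra.
Qed.

Lemma exp3_le (j : nat) : expR (- (3 * j%:R)) <= (8 ^+ j)^-1 :> R.
Proof.
rewrite expRN lef_pV2 ?posrE ?expR_gt0 ?exprn_gt0 // expRM_natr lerXn2r ?nnegrE ?expR_ge0 //.
have -> : 3 = 1 + 1 + 1 :> R by ring.
have := expR_ge1Dx (1 : R); rewrite !expRD; have -> : 8 = 2 * 2 * 2 :> R by ring.
by move=> e1; rewrite !ler_pM // mulr_ge0.
Qed.

Lemma expR_small (z e : R) : 0 <= z -> z <= 1 / 2 -> 2 * z <= e -> expR z <= 1 + e.
Proof. by move=> z0 z1 ze; apply: le_trans (expR_le_quad z1) _; nra. Qed.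

End small.

Section packaged_arith.
Context {R : realType}.

Lemma site_window (A n : nat) (z : int) : `|z| <= (A * 2 ^ n)%N%:Z -> `|z%:~R / 2 ^+ n : R| <= A%:R.
Proof.
move=> zA; rewrite normrM normfV normrX (ger0_norm (ler0n R 2)).
rewrite ler_pdivrMr ?exprn_gt0 // -intr_norm -natrX -natrM.
by rewrite -[X in _ <= X]/((A * 2 ^ n)%N%:Z%:~R) ler_int.
Qed.

Lemma ratio_diff (z eta g v B t : R) : z <= (1 + eta) * (1 + g) -> 1 + v <= z ->
  eta * (1 + g) <= eta * (1 + B) -> eta * (1 + B) = t -> v - g <= t.
Proof. lra. Qed.

Lemma mod_bound (a b t r : R) : a <= r -> b / t <= 8 * r -> 2 * (8 * a + 3 * b / t) <= 64 * r.
Proof. by rewrite -mulrA; lra. Qed.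

Lemma level_arith (ls lam W g : R) : 8 * ls + 64 * lam + 2 <= W -> W <= 8 * g + 64 * lam + 1 -> ls <= g.
Proof. lra. Qed.

Lemma clock_arith (c q t : R) : 0 < c -> t != 0 -> c * (1 + 2 * q * t / c - 1) / 2 / t = q.
Proof. by move=> c0 t0; field; rewrite t0 (gt_eqF c0). Qed.

Lemma eight_ninths_le (e : R) : 0 < e ->
  e / 9 + e / 9 + (e / 9 + e / 9) + (e / 9 + e / 9 + (e / 9 + e / 9)) <= e.
Proof. by lra. Qed.

End packaged_arith.

(** * All path estimates at once, with high probability *)

Section packaged.
Context {R : realType} d {T : measurableType d} (P : probability T R).
Variables (L0 : R -> R).
Implicit Types (n k m q : nat) (E U : nat -> T -> R).

(** What the limit argument takes from a sample path at accuracy q: up to the clock level V the walk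
    stays in the window A and log(L/L0) is bounded by B; 2^-m and dl are moduli for the accuracy
    1/(q+1); the level V is passed, and only at a real time of at least q. *)
Definition goodp E U q (V : R) (A m : nat) (B dl : R) n w :=
  let base := base E U L0 in let lgr := lgr E U L0 in
  [/\ forall k, 0 <= E k w,
   forall k, sW (base n k w) <= V -> `|sX (base n k w)| < (A * 2 ^ n)%N%:Z,
   forall k, sW (base n k w) <= V -> forall x : int, `|x| <= (A * 2 ^ n)%N%:Z -> lgr n k w x <= B &
   [/\ forall k, sW (base n k w) <= V -> forall x y : int, `|x| <= (A * 2 ^ n)%N%:Z ->
     `|y| <= (A * 2 ^ n)%N%:Z -> `|x - y| <= (2 ^ (n - m))%N%:Z -> `|lgr n k w x - lgr n k w y| <= q.+1%:R^-1,
   forall k1 k2, (k1 <= k2)%N -> sW (base n k2 w) < V -> sW (base n k2 w) - sW (base n k1 w) <= dl ->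
     `|sM (base n k2 w) - sM (base n k1 w)| <= q.+1%:R^-1,
   exists k, V < sW (base n k w) &
   forall k, V <= sW (base n k w) -> q%:R <= sJ (base n k w)]].

Hypotheses (L0pos : forall x, 0 < L0 x) (L0c : continuous L0).
Hypothesis S0y : forall C : R, exists A0 : nat, forall A : nat, (A0 <= A)%N -> C <= S0 L0 A%:R.
Hypothesis S0Ny : forall C : R, exists A0 : nat, forall A : nat, (A0 <= A)%N -> S0 L0 (- A%:R) <= C.

Lemma window_ub (A : nat) : exists2 C : R, 0 < C & forall x : R, `|x| <= A%:R -> L0 x <= C.
Proof.
have [x0 _ hx] : exists2 x0 : R, x0 \in `[- A%:R, A%:R]%R & forall t : R, t \in `[- A%:R, A%:R]%R -> L0 t <= L0 x0.
  by apply: EVT_max; [have := ler0n R A; lra|exact: continuous_subspaceT].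
by exists (L0 x0) => // x xA; apply: hx; rewrite in_itv /= -ler_norml.
Qed.

Lemma sJ_le E U n k1 k2 w : (k1 <= k2)%N -> sJ (base E U L0 n k1 w) <= sJ (base E U L0 n k2 w).
Proof.
elim: k2 => [|k IH]; first by rewrite leqn0 => /eqP ->.
rewrite leq_eqVlt ltnS => /orP[/eqP ->//|/IH]; move/le_trans; apply.
have [b ->] := baseS E U L0 n k w.
rewrite /= lerDl mulr_ge0 ?(ltW (hn_gt0 _)) // subr_ge0.
exact: (lcn_ge (hn_gt0 n) (valid_base E U L0pos n k w) (normr_ge0 _)).
Qed.

(** A large local time at 0 spreads by the spatial modulus to all sites within distance 2^-m, and
    the time spent there is h times the local time gained. *)
Lemma local_time_clock E U n k w m (c l : R) : 0 < c -> (m <= n)%N ->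
  (forall x : R, `|x| <= 1%:R -> c <= L0 x) ->
  (forall x y : int, `|x| <= (1 * 2 ^ n)%N%:Z -> `|y| <= (1 * 2 ^ n)%N%:Z ->
     `|x - y| <= (2 ^ (n - m))%N%:Z -> 1 + lgr E U L0 n k w y <= 2 * (1 + lgr E U L0 n k w x)) ->
  l <= lgr E U L0 n k w 0 -> c * (l - 1) / 2 / 2 ^+ m <= sJ (base E U L0 n k w).
Proof.
move=> c0 mn cL md ll; set D := (2 ^ (n - m))%N.
have Dn : (D <= 2 ^ n)%N by rewrite leq_exp2l // leq_subr.
apply: le_trans (sJ_ge E U L0pos n k w D).
have term (j : 'I_D) : hn n * (c * (l - 1) / 2) <= hn n * (sL (base E U L0 n k w) j%:Z - lon L0 n j%:Z).
  rewrite ler_pM2l ?hn_gt0 // sL_lgr //.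
  have jn : `|j%:Z| <= (1 * 2 ^ n)%N%:Z by have := ltn_ord j; rewrite mul1n; lia.
  have jD : `|j%:Z - 0| <= (2 ^ (n - m))%N%:Z by rewrite subr0; have := ltn_ord j; rewrite -/D; lia.
  have cj := lon_window cL jn.
  have := md _ _ jn _ jD; rewrite normr0 => /(_ isT) h.
  move: cj h; set g := lgr E U L0 n k w j%:Z; set lo := lon L0 n j%:Z => cj h.
  have g0 : 0 <= g by exact: lgr_ge0.
  have e1 := expR_ge1Dx g.
  have gl : (l - 1) / 2 <= g by lra.
  have t1 : c * ((l - 1) / 2) <= c * g by rewrite ler_pM2l.
  have t2 : c * g <= lo * g by rewrite ler_wpM2r.
  have t3 : lo * (1 + g) <= lo * expR g by rewrite ler_pM2l // lon_gt0.
  lra.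
apply: (@le_trans _ _ (\sum_(j < D) hn n * (c * (l - 1) / 2))).
  rewrite sumr_const card_ord -[X in _ <= X]mulr_natl mulrA.
  have -> : D%:R * hn n = (2 ^+ m)^-1 :> R.
    rewrite /D natrX /hn -[in 2 ^+ n](subnKC mn) exprD.
    by field; rewrite !expf_neq0.
  by rewrite mulrC.
by apply: ler_sum => j _; exact: term.
Qed.

(** The factor 3 is the product of 2 and 3/2: the initial profile varies by less than its lower
    bound c between the two neighbours, and the logarithms contribute exp(1/4) <= 3/2. *)
Lemma okst_neighbours E U n k w (A : nat) (c dc : R) : 0 < c ->
  (forall x : R, `|x| <= A%:R -> c <= L0 x) ->
  (forall x y : R, `|x| <= A%:R -> `|x - y| < dc -> `|L0 x - L0 y| < c) -> 2 * (hn n : R) < dc ->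
  let X := sX (base E U L0 n k w) in `|X| < (A * 2 ^ n)%N%:Z ->
  `|lgr E U L0 n k w (X + 1) - lgr E U L0 n k w (X - 1)| <= 4^-1 ->
  okst n A (base E U L0 n k w).
Proof.
move=> c0 cL hdc hdn X Xw; have [X0 X1 X2] := int_nbr Xw.
rewrite /okst Xw /= /lmv /lpv !sL_lgr // -/X.
rewrite ler_norml => /andP[f1 f2].
have lo2 (x y : int) : `|x| <= (A * 2 ^ n)%N%:Z -> `|y| <= (A * 2 ^ n)%N%:Z -> `|x - y| <= 2 ->
    lon L0 n x <= 2 * lon L0 n y.
  move=> xA yA xy; have cy := lon_window cL yA.
  have : `|L0 (x%:~R / 2 ^+ n) - L0 (y%:~R / 2 ^+ n)| < c.
    apply: hdc; first exact: site_window.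
    rewrite -mulrBl normrM normfV (ger0_norm (exprn_ge0 _ _)) // -rmorphB /= -intr_norm.
    apply: le_lt_trans hdn; rewrite ler_pM2r ?invr_gt0 ?exprn_gt0 //.
    by rewrite -[X in _ <= X]/((2 : int)%:~R) ler_int.
  rewrite -!/(lon L0 n _) ltr_norml => /andP[_]; lra.
have ex (u v : R) : u - v <= 4^-1 -> expR u <= 3 / 2 * expR v.
  move=> uv; have -> : u = (u - v) + v by ring.
  rewrite expRD ler_pM2r ?expR_gt0 //; apply: (@le_trans _ _ (expR 4^-1)); first by rewrite ler_expR.
  by apply: le_trans (@expR_le_quad R 4^-1 _) _; lra.
have fin (x y : int) (u v : R) : lon L0 n x <= 2 * lon L0 n y -> u - v <= 4^-1 ->
   lon L0 n x * expR u <= 3 * (lon L0 n y * expR v).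
  move=> h1 h2; have -> : 3 * (lon L0 n y * expR v) = (2 * lon L0 n y) * (3 / 2 * expR v) by field.
  by apply: ler_pM; rewrite ?expR_ge0 ?(ltW (lon_gt0 L0pos _ _)) // ex.
have d1 : X - 1 - (X + 1) = - 2 by ring.
have d2 : X + 1 - (X - 1) = 2 by ring.
apply/andP; split; apply: fin.
- by apply: lo2; rewrite // d1.
- by move: f1; lra.
- by apply: lo2; rewrite // d2.
- exact: f2.
Qed.

(** The order of choices is the content: the clock level, then the window, then the bound on log L,
    then the moduli, each depending on the previous ones, and all fixed before the threshold on n,
    so that they serve every fine scale. *)
Lemma good_whp q (e : R) : 0 < e -> exists (V B dl : R) (A m N : nat),
  [/\ q%:R <= V, (q <= A)%N, 0 < dl, (0 < A)%N &
   forall n, (N <= n)%N -> (m < n)%N /\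
     forall E U, clocks P E U -> whp P e (goodp E U q V A m B dl n)].
Proof.
(* Eight events will be intersected, each at a cost of at most e / 9. *)
move=> e0; pose e9 := e / 9; have e90 : 0 < e9 by rewrite divr_gt0.
pose lam := 2 / e9; have lam0 : 0 < lam by rewrite divr_gt0.
have lamP : 2 * expR (- lam) <= e9.
  rewrite expRN ler_pdivrMr ?expR_gt0 //.
  have := expR_ge1Dx lam; rewrite -(ler_pM2l e90).
  have -> : e9 * (1 + lam) = e9 + 2 by rewrite /lam; field; rewrite gt_eqF.
  lra.
have lamP1 : expR (- lam) <= e9 by have := expR_gt0 (- lam); lra.
have scale (A : nat) (c eta : R) : 0 < c -> 0 < eta -> exists m,
    8 * A%:R / 2 ^+ m <= e9 /\ expR (modK c * (9 / 10) ^+ m) <= 1 + eta.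
  move=> c0 eta0.
  have [K KE] : exists K : R, K = modK c by exists (modK c).
  have Kp : 0 <= K by rewrite KE /modK; apply: divr_ge0; [exact: ler0n|exact: sqr_ge0].
  have K0 : 0 <= 8 * A%:R + K by rewrite addr_ge0 // mulr_ge0.
  rewrite -KE {KE}.
  pose mm := Num.min e9 (Num.min (1 / 2) (eta / 2)).
  have mm0 : 0 < mm by rewrite !lt_min e90 /= !divr_gt0.
  have [m hm] := rho_small K0 mm0; exists m.
  move: hm; rewrite /mm !le_min mulrDl => /and3P[h1 h2 h3].
  have r0 := rho_gt0 (R := R) m.
  have a0 : 0 <= 8 * A%:R * rho m :> R by rewrite mulr_ge0 ?(ltW r0) // mulr_ge0.
  have b0 : 0 <= K * rho m by rewrite mulr_ge0 ?(ltW r0).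
  split; last by apply: expR_small; rewrite -/(rho m); lra.
  apply: (@le_trans _ _ (8 * A%:R * rho m)); last by lra.
  by rewrite ler_wpM2l ?half_rho // mulr_ge0.
have [c1 /andP[c10 c11] cL1] := window_lb L0pos L0c 1.
have [m1 [m1p m1e]] := scale 1%N c1 1 c10 ltr01.
(* Once [lgr] at 0 reaches [ls], [local_time_clock] yields a real time of at least q. *)
pose ls : R := 1 + 2 * q%:R * 2 ^+ m1 / c1.
(* The clock level at which [local_time_whp] forces [lgr] at 0 up to [ls]. V exceeds it by at least
   1, which leaves room for the overshoot of one step. *)
pose V' : R := 8 * ls + 64 * lam + 2.
have ls0 : 0 <= ls by rewrite addr_ge0 // divr_ge0 ?(ltW c10) // mulr_ge0 ?exprn_ge0 // mulr_ge0.
pose V : R := V' + 1 + q%:R.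
have V1 : V' + 1 <= V by rewrite lerDl.
have V'V : V' <= V by apply: le_trans V1; rewrite lerDl.
have q0 : 0 <= q%:R :> R by [].
have V'0 : 0 <= V' by rewrite /V'; lra.
have V0 : 0 <= V by rewrite /V; lra.
(* The margin 2 pays for the distance, at most 1, between the discrete and the continuous scale
   function, and for strictness. *)
have [A1 hA1] := S0y (6 * V + lam + 2); have [A2 hA2] := S0Ny (- (6 * V + lam + 2)).
have [A [Aa Ab Aq A0]] : exists A, [/\ (A1 <= A)%N, (A2 <= A)%N, (q <= A)%N & (0 < A)%N].
  by exists (maxn A1 (maxn A2 q)).+1; split => //; rewrite leqW // !leq_max leqnn ?orbT.
have SA : 6 * V + lam + 2 <= S0 L0 A%:R by apply: hA1.
have SmA : S0 L0 (- A%:R) <= - (6 * V + lam + 2) by apply: hA2.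
have [c /andP[c0 cc1] cL] := window_lb L0pos L0c A.
have [Cm Cm0 LC] := window_ub A.
have [m2 [m2p m2e]] := scale A c 1 c0 ltr01.
pose B : R := 2 ^+ (2 * A * 2 ^ m2).
have B0 : 0 <= B by rewrite exprn_ge0.
(* Turns the ratio bound on 1 + [lgr] into the additive bound 1/(4(q+1)), since [lgr] is at most B;
   the 4 also provides the 1/4 of [okst_neighbours]. *)
pose eta := (4 * q.+1%:R * (1 + B))^-1.
have eta0 : 0 < eta by rewrite invr_gt0 !mulr_gt0 // ltr_wpDr.
have [m3 [m3p m3e]] := scale A c eta c0 eta0.
pose NV := Num.bound V.
have VN : V < NV%:R by exact: archi_boundP.
have K1 : 0 <= 64 * q.+1%:R + 2 * NV%:R / e9 :> R by rewrite addr_ge0 ?mulr_ge0 // invr_ge0 ltW.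
have [j hj] := rho_small K1 ltr01.
have rj0 := rho_gt0 (R := R) j.
have hj1 : 64 * q.+1%:R * rho j <= 1 :> R.
  have : 0 <= 2 * NV%:R / e9 * rho j by rewrite mulr_ge0 ?(ltW rj0) // mulr_ge0 ?mulr_ge0 // invr_ge0 ltW.
  by move: hj; rewrite mulrDl; lra.
have hj2 : 2 * NV%:R * rho j <= e9.
  have t : 0 <= 64 * q.+1%:R * rho j :> R by rewrite mulr_ge0 ?(ltW rj0) // mulr_ge0.
  have : 2 * NV%:R / e9 * rho j <= 1 by move: hj; rewrite mulrDl; lra.
  by rewrite mulrAC ler_pdivrMr // mul1r.
(* Both terms of the modulus, 8 th dl = 8/2^j and 3 j/2^j, are of order [rho j], while NV 4^j grid
   points at the level 3 j cost at most 2 NV/2^j in probability. *)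
pose th : R := 2 ^+ j; pose dl : R := (4 ^+ j)^-1.
have th0 : 0 < th by rewrite exprn_gt0.
have dl0 : 0 < dl by rewrite invr_gt0 exprn_gt0.
have dlE : dl = (th * th)^-1 by rewrite /dl /th -exprMn; congr (_ ^+ _)^-1; ring.
have [N1 hN1] := S0n_cvg L0pos L0c A ltr01.
have [N2 hN2] : exists N, forall n, (N <= n)%N -> 4 * th ^+ 2 * (hn n / c ^+ 2) <= 1.
  have p : 0 < c ^+ 2 / (4 * th ^+ 2) by rewrite divr_gt0 ?exprn_gt0 ?mulr_gt0 ?exprn_gt0.
  have [N hN] := hn_small p; exists N => n /hN.
  rewrite ltr_pdivlMr ?mulr_gt0 ?exprn_gt0 // => hh.
  rewrite mulrA ler_pdivrMr ?exprn_gt0 // mul1r mulrC; exact: ltW.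
have [dc dc0 hdc] := unif_cont A%:R L0c c0.
have [N3 hN3] : exists N, forall n, (N <= n)%N -> 2 * (hn n : R) < dc.
  have p : 0 < dc / 2 by rewrite divr_gt0.
  by have [N hN] := hn_small p; exists N => n /hN; rewrite ltr_pdivlMr // mulrC.
exists V, B, dl, A, m3, (maxn N1 (maxn N2 (maxn N3 (maxn m1 (maxn m2 m3.+1))))).
split => //; first by rewrite /V; lra.
move=> n; rewrite !geq_max => /and5P[n1 n2 n3 nm1 /andP[nm2 nm3]]; split => // E U cEU.
have th1 : 1 <= th by rewrite exprn_ege1 // ler1n.
have hc2 := hN2 n n2.
have hc0 : 0 <= hn n / c ^+ 2 by rewrite divr_ge0 ?sqr_ge0 // ltW // hn_gt0.
have hc4 : 4 * (hn n / c ^+ 2) <= 1.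
  by apply: le_trans hc2; rewrite ler_wpM2r // ler_peMr // exprn_ege1.
have hcth : th * (hn n / c ^+ 2) <= 1 / 2 by move: hc2 th1 hc0; move: (hn n / c ^+ 2) => z; nra.
have ApR : (A * 2 ^ n)%N%:Z%:~R / 2 ^+ n = A%:R :> R.
  by rewrite -[(_%:Z)%:~R]/((A * 2 ^ n)%N%:R) natrM natrX mulfK // expf_neq0.
have ev1 := window_whp cEU L0pos c0 cL hc4 A0.
have ev1' : whp P e9 (fun w => forall k, sW (base E U L0 n k w) <= V ->
    `|sX (base E U L0 n k w)| < (A * 2 ^ n)%N%:Z /\ `|sM (base E U L0 n k w)| <= 4 * V + lam).
  apply: (whp_le lamP _ (ev1 V lam _ _)) => //.
    have := hN1 n n1 (A * 2 ^ n)%N%:Z; rewrite ApR => /(_ _)/wrap[]; first by rewrite ger0_norm.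
    by rewrite ler_norml => /andP[h1 _]; lra.
  have := hN1 n n1 (- (A * 2 ^ n)%N%:Z); rewrite rmorphN mulNr ApR => /(_ _)/wrap[]; first by rewrite normrN ger0_norm.
  by rewrite ler_norml => /andP[_ h1]; lra.
have ev2 := whp_le m1p (fun w h => h) (modulus_whp cEU L0pos c10 c11 cL1 nm1).
have ev3 := whp_le m2p (fun w h => h) (modulus_whp cEU L0pos c0 cc1 cL nm2).
have ev4 := whp_le m3p (fun w h => h) (modulus_whp cEU L0pos c0 cc1 cL (ltnW nm3)).
have VNd : V <= (NV * 4 ^ j)%N%:R * dl.
  rewrite natrM natrX /dl mulfK ?expf_neq0 //; exact: ltW.
have ev5 := modM_whp cEU L0pos (3 * j%:R) c0 cL th0 dl0 VNd hcth hc2.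
have {}ev5 := whp_le _ (fun w h => h) ev5.
have p5 : (NV * 4 ^ j)%N%:R * (2 * expR (- (3 * j%:R))) <= e9.
  apply: le_trans hj2.
  have -> : (NV * 4 ^ j)%N%:R * (2 * expR (- (3 * j%:R))) = 2 * NV%:R * (4 ^+ j * expR (- (3 * j%:R))) :> R.
    by rewrite natrM natrX; ring.
  rewrite ler_wpM2l ?mulr_ge0 //; apply: le_trans (@half_rho R j).
  apply: (@le_trans _ _ (4 ^+ j * (8 ^+ j)^-1)); first by rewrite ler_wpM2l ?exp3_le // exprn_ge0.
  have -> : (8 : R) ^+ j = 4 ^+ j * 2 ^+ j by rewrite -exprMn; congr (_ ^+ _); ring.
  by rewrite invfM mulrA divff ?mul1r // expf_neq0.
have {}ev5 := ev5 _ p5.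
have ev6 := whp_le lamP1 (fun w h => h) (clock_whp cEU L0pos n lam).
have ev7 := whp_le (ltW e90) (fun w h => h) (hold_ge0_whp cEU).
have ev8 := whp_le lamP1 (fun w h => h) (local_time_whp L0pos cEU lam c0 cL A0 (le_trans (_ : _ <= 1 / 4) (_ : _ <= 1))).
have {}ev8 := ev8 n _ _.
apply: (whp_le _ _ (whpI (whpI (whpI ev1' ev2) (whpI ev3 ev4)) (whpI (whpI ev5 ev6) (whpI ev7 (ev8 _ _))))); [|
  |by rewrite ler_pdivlMr // mulrC|by rewrite ler_pdivrMr // mul1r ler1n].
  exact: eight_ninths_le.
move=> w [[[win md1] [md2 md3]] [[mM sEl] [E0 lt]]].
have win' k : sW (base E U L0 n k w) <= V -> `|sX (base E U L0 n k w)| < (A * 2 ^ n)%N%:Z by move=> /win[].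
have lb k : sW (base E U L0 n k w) <= V -> forall x : int, `|x| <= (A * 2 ^ n)%N%:Z -> lgr E U L0 n k w x <= B.
  move=> kV; apply: (lgr_bound L0pos nm2).
    move=> x y xA yA xy; apply: le_trans (md2 k x y xA yA xy) _.
    by rewrite ler_wpM2r // addr_ge0 // lgr_ge0.
  by move=> i ik; apply: win'; apply: le_trans kV; apply: sW_le => //; exact: ltnW.
have fine k : sW (base E U L0 n k w) <= V -> forall x y : int, `|x| <= (A * 2 ^ n)%N%:Z ->
     `|y| <= (A * 2 ^ n)%N%:Z -> `|x - y| <= (2 ^ (n - m3))%N%:Z ->
     `|lgr E U L0 n k w x - lgr E U L0 n k w y| <= (4 * q.+1%:R)^-1.
  move=> kV x y xA yA xy.
  have step1 u v : `|u| <= (A * 2 ^ n)%N%:Z -> `|v| <= (A * 2 ^ n)%N%:Z -> `|u - v| <= (2 ^ (n - m3))%N%:Z ->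
     lgr E U L0 n k w v - lgr E U L0 n k w u <= (4 * q.+1%:R)^-1.
    move=> uA vA uv; have := md3 k u v uA vA uv.
    have g0 := lgr_ge0 E U L0pos n k w u; have gB := lb k kV u uA.
    have := ler_wpM2r (_ : 0 <= 1 + lgr E U L0 n k w u) m3e => /(_ (addr_ge0 ler01 g0)) h1 h2.
    have h3 : eta * (1 + lgr E U L0 n k w u) <= eta * (1 + B) by rewrite ler_pM2l // lerD2l.
    have h4 : eta * (1 + B) = (4 * q.+1%:R)^-1.
      by rewrite /eta invfM -mulrA mulVf ?mulr1 // gt_eqF // ltr_wpDr.
    exact: ratio_diff h1 h2 h3 h4.
  by rewrite ler_norml lerNl opprB !step1 // distrC.
have q41 : (4 * q.+1%:R)^-1 <= q.+1%:R^-1 :> R.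
  by rewrite lef_pV2 ?posrE ?mulr_gt0 // ler_peMl // ler1n.
have q44 : (4 * q.+1%:R)^-1 <= 4^-1 :> R.
  by rewrite lef_pV2 ?posrE ?mulr_gt0 // ler_peMr // ler1n.
have ok k : sW (base E U L0 n k w) <= V -> okst n A (base E U L0 n k w).
  move=> kV; have Xw := win' k kV; have [X0 X1 X2] := int_nbr Xw.
  apply: (okst_neighbours c0 cL hdc (hN3 n n3) Xw); apply: le_trans q44; apply: fine => //.
  have -> : sX (base E U L0 n k w) + 1 - (sX (base E U L0 n k w) - 1) = 2 by ring.
  have : (1 < 2 ^ (n - m3))%N by rewrite -[1%N](expn0 2) ltn_exp2l // subn_gt0.
  by rewrite ger0_norm.
have [kV hkV] := reach_level L0pos LC win' lb sEl.
split => //; split.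
- by move=> k kV' x y xA yA xy; apply: le_trans (fine k kV' x y xA yA xy) q41.
- move=> k1 k2 k12 kk dd; apply: le_trans (mM win' k1 k2 k12 kk dd) _.
  rewrite -[leRHS]mul1r ler_pdivlMr //; apply: le_trans hj1.
  have -> : 64 * q.+1%:R * rho j = 64 * rho j * q.+1%:R :> R by rewrite mulrAC.
  rewrite ler_pM2r //.
  have -> : 8 * th * dl = 8 * (2 ^+ j)^-1 by rewrite dlE /th; field; rewrite expf_neq0.
  exact: mod_bound (@half_rho R j) (@nat_half_rho R j).
- by exists kV.
- move=> k Vk.
  (* The first step at which the clock passes V': it overshoots by at most 1, so all the estimates
     up to V apply there. *)
  pose p i := V' <= sW (base E U L0 n i w).
  have exp : exists i, p i by exists k; exact: le_trans Vk.
  have [i pi mini] := ex_minnP exp.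
  have ik : (i <= k)%N by apply: mini; exact: le_trans Vk.
  have iV : sW (base E U L0 n i w) <= V.
    case: i pi mini {ik} => [|i] pi mini; first by [].
    have iV' : sW (base E U L0 n i w) < V' by rewrite ltNge; apply/negP => /mini; rewrite ltnn.
    have iV : sW (base E U L0 n i w) <= V by exact: le_trans (ltW iV') V'V.
    have [X0 X1 X2] := int_nbr (win' i iV).
    have := dW_small c0 (valid_base E U L0pos n i w) (normr_ge0 (E i w)) (lon_window cL X0) (lon_window cL X1) (lon_window cL X2).
    by rewrite sW_S => h1; apply: le_trans V1; apply: lerD (ltW iV') (le_trans h1 (le_trans _ hc4)); rewrite ler_peMl // ler1n.
  apply: le_trans (sJ_le E U n w ik).
  have lti : sW (base E U L0 n i w) <= 8 * lgr E U L0 n i w 0 + 64 * lam + 1.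
    by apply: lt => jj ji; apply: ok; apply: le_trans iV; apply: sW_le => //; exact: ltnW.
  have lsi : ls <= lgr E U L0 n i w 0 := level_arith pi lti.
  apply: le_trans (local_time_clock c10 nm1 cL1 _ lsi).
    by rewrite /ls clock_arith // ?expf_neq0.
  move=> x y xA yA xy; apply: le_trans (md1 i x y xA yA xy) _.
  by rewrite ler_wpM2r // addr_ge0 // lgr_ge0.
Qed.

End packaged.

(** * The Bass-Burdzy flow from its defining properties *)

Section bass_burdzy_flow.
Context {R : realType}.
Notation leb := (@lebesgue_measure R).
Implicit Types (u v s t y z e x : R).

Lemma within_prod_eps (f : R -> R -> R) :
  {within [set p : R * R | 0 <= p.1], continuous (fun p => f p.1 p.2)} ->
  forall u y e : R, 0 <= u -> 0 < e -> exists2 dl : R, 0 < dl &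
   forall u' y' : R, 0 <= u' -> `|u - u'| < dl -> `|y - y'| < dl -> `|f u y - f u' y'| < e.
Proof.
move=> cf u y e u0 e0.
have /subspace_continuousP/(_ (u, y) u0)/cvgrPdist_lt/(_ e e0) := cf.
move=> /nbhs_ballP[dl /= dl0 hd]; exists dl => // u' y' u'0 uu yy.
by have := hd (u', y'); apply.
Qed.

(** Applied to the first time at which a flow line meets the driving path. *)
Lemma inf_closed (A : set R) (g : R -> R) : continuous g -> A !=set0 -> has_lbound A ->
  (forall v, A v -> 0 <= g v) -> 0 <= g (inf A).
Proof.
move=> cg A0 lA gA; rewrite leNgt; apply/negP => gneg.
have e0 : 0 < - g (inf A) by lra.
have /cvgrPdist_lt/(_ _ e0)/nbhs_ballP[dl /= dl0 hd] := cg (inf A).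
have [v Av vl] : exists2 v, A v & v < inf A + dl.
  by apply: inf_adherent.
have lv : inf A <= v by apply: ge_inf.
have := hd v; rewrite /ball /= distrC ger0_norm ?subr_ge0 // => /(_ _)/wrap[]; first by lra.
rewrite ltr_norml => /andP[h _]; have := gA v Av; lra.
Qed.

Variables (b : R -> R) (Psi Lam : R -> R -> R).
Hypotheses (cb : continuous b) (bb : bass_burdzy b Psi Lam).

Let Psic := within_prod_eps bb.1.
Let Psi0 y : Psi 0 y = y. Proof. exact: bb.2.1. Qed.
Let PsiU y u : 0 < u -> Psi u y < b u -> is_derive u 1 (fun s => Psi s y) 1.
Proof. exact: bb.2.2.2.2.1. Qed.
Lemma Psi_mono u y1 y2 : 0 <= u -> y1 < y2 -> Psi u y1 < Psi u y2.
Proof. by move=> u0; exact: bb.2.2.2.2.2.1. Qed.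
Let Psi_surj u z : 0 <= u -> exists y, Psi u y = z.
Proof. by move=> u0; exact: bb.2.2.2.2.2.2.1. Qed.
Lemma Psi_derive u y : 0 <= u -> is_derive y 1 (Psi u) (1 - 2 * Lam u y).
Proof. by move=> u0; exact: bb.2.2.2.2.2.2.2.1. Qed.
Lemma Lam_cont : forall u y e : R, 0 <= u -> 0 < e -> exists2 dl : R, 0 < dl &
   forall u' y' : R, 0 <= u' -> `|u - u'| < dl -> `|y - y'| < dl -> `|Lam u y - Lam u' y'| < e.
Proof. exact: (within_prod_eps bb.2.2.2.2.2.2.2.2.1). Qed.
Lemma Lam_bnd u y : 0 <= u -> 0 <= Lam u y /\ Lam u y < 1 / 2.
Proof. exact: bb.2.2.2.2.2.2.2.2.2.1. Qed.
Let occ u (f : R -> R) : 0 <= u -> measurable_fun setT f -> (exists M : R, forall x : R, `|f x| <= M) ->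
  (\int[leb]_(v in `[0%R, u]) (f (reduced_process b Psi v))%:E = \int[leb]_y (f y * Lam u y)%:E)%E.
Proof. by move=> u0; exact: bb.2.2.2.2.2.2.2.2.2.2. Qed.

Local Notation xi := (reduced_process b Psi).

Lemma xiP u : 0 <= u -> Psi u (xi u) = b u.
Proof. by move=> u0; have := xgetPex 0 (Psi_surj (b u) u0). Qed.

Lemma Psi_inj u y1 y2 : 0 <= u -> Psi u y1 = Psi u y2 -> y1 = y2.
Proof.
move=> u0 E; case: (ltgtP y1 y2) => // /(Psi_mono u0); rewrite E ltxx //.
Qed.

Lemma xi_le u y : 0 <= u -> (xi u <= y) = (b u <= Psi u y).
Proof.
move=> u0; rewrite -(xiP u0); apply/idP/idP.
  by rewrite le_eqVlt => /orP[/eqP ->//|/(Psi_mono u0)/ltW].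
by apply: contraTT; rewrite -!ltNge => /(Psi_mono u0).
Qed.

(** Time is extended by [Num.max v 0], because the flow is continuous only within u >= 0. *)
Let gg y (v : R) := Psi (Num.max v 0) y - b v.

Let pm_cont y : continuous (fun v : R => Psi (Num.max v 0) y).
Proof.
move=> v; apply/cvgrPdist_lt => e e0.
have m0 : 0 <= Num.max v 0 by rewrite le_max lexx orbT.
have [dl dl0 hd] := Psic y m0 e0.
apply/nbhs_ballP; exists dl => //= v' vv; apply: hd; rewrite ?le_max ?lexx ?orbT ?subrr ?normr0 //.
apply: le_lt_trans vv.
have [h1|h1] := leP v 0; have [h2|h2] := leP v' 0; rewrite ?subrr ?normr0 //.
- rewrite sub0r normrN gtr0_norm // ltr0_norm ?subr_lt0 //; last by lra.
  by lra.
- by rewrite subr0 !gtr0_norm ?subr_gt0 //; lra.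
Qed.

Let gg_cont y : continuous (gg y).
Proof. by move=> v; apply: cvgB; [exact: pm_cont|exact: cb]. Qed.

(** By monotonicity of the flow these are the times with [xi v <= y], whose measure the occupation
    densities compute. *)
Let Cs u y := [set v : R | 0 <= v <= u /\ b v <= Psi v y].

Let CsE u y : Cs u y = `[0, u]%classic `&` (gg y @^-1` `[0, +oo[%classic).
Proof.
apply/seteqP; split=> v /=; rewrite /gg !in_itv /= ?andbT.
  by move=> [/andP[v0 vu] h]; rewrite v0 vu (max_idPl v0) subr_ge0.
by move=> [/andP[v0 vu]]; rewrite (max_idPl v0) subr_ge0 => h; split => //; rewrite v0 vu.
Qed.

Let mCs u y : measurable (Cs u y : set (measurableTypeR R)).
Proof.
rewrite CsE; apply: measurableI; first exact: measurable_itv.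
rewrite -[X in measurable X]setTI; by apply: (continuous_measurable_fun (@gg_cont y)).
Qed.

Let lebI (u v : R) : u <= v -> leb `[u, v] = (v - u)%:E.
Proof.
move=> uv; rewrite lebesgue_measure_itv /= lte_fin; case: ltP => // vu.
by rewrite (le_anti (_ : u <= v <= u)) ?uv ?vu // subrr.
Qed.

Let CsF u y : 0 <= u -> leb (Cs u y) \is a fin_num.
Proof.
move=> u0; rewrite ge0_fin_numE //; apply: (@le_lt_trans _ _ (leb `[0, u])).
  by apply: le_measure; rewrite ?inE; [exact: mCs|exact: measurable_itv|rewrite CsE; exact: subIsetl].
by rewrite lebI // ltry.
Qed.

Let mm u y : R := fine (leb (Cs u y)).

Let mmE u y : 0 <= u -> leb (Cs u y) = (mm u y)%:E.
Proof. by move=> u0; rewrite /mm fineK // CsF. Qed.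

Let FTC u (y' y : R) : 0 <= u -> y' < y ->
  (\int[leb]_(z in `[y', y]) (Lam u z)%:E = ((y - Psi u y) / 2 - (y' - Psi u y') / 2)%:E)%E.
Proof.
move=> u0 yy.
pose F z := (z - Psi u z) / 2.
have dF z : is_derive z (1 : R) F (Lam u z).
  have := Psi_derive z u0 => dP.
  have dB : is_derive z (1 : R) (id - Psi u) (1 - (1 - 2 * Lam u z)) by apply: is_deriveB.
  have dZ : is_derive z (1 : R) (2^-1 *: (id - Psi u)) (2^-1 *: (1 - (1 - 2 * Lam u z))) by apply: is_deriveZ.
  have -> : F = 2^-1 *: (id - Psi u) by apply/funext => t; rewrite /F mulrC.
  by apply: is_derive_eq; rewrite /GRing.scale /=; field.
have cF : continuous F by move=> z; apply: differentiable_continuous; apply/derivable1_diffP; apply: ex_derive.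
rewrite (@continuous_FTC2 R (Lam u) F) //.
- apply: continuous_subspaceT => z; apply/cvgrPdist_lt => e e0.
  have [dl dl0 hd] := Lam_cont z u0 e0.
  by apply/nbhs_ballP; exists dl => //= z' zz; apply: hd; rewrite ?subrr ?normr0.
- split; [by move=> z _; exact: ex_derive|apply: cvg_at_right_filter; exact: cF|apply: cvg_at_left_filter; exact: cF].
- by move=> z _; rewrite derive1E; exact: derive_val.
Qed.

(** Two readings of the integral of [Lam u] from y' to y: by the occupation formula it is the time
    that [xi] spends there, by the derivative of the flow it is a difference of values of (y - Psi u
    y)/2. *)
Let mm_diff u (y' y : R) : 0 <= u -> y' < y ->
  mm u y - mm u y' = (y - Psi u y) / 2 - (y' - Psi u y') / 2.
Proof.
move=> u0 yy.
pose I := `]y', y]%classic : set (measurableTypeR R).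
have mI : measurable I by exact: measurable_itv.
have := @occ u (\1_I) u0 _ _ => /(_ _ _)/wrap[].
- exact: measurable_indic.
- by exists 1 => x; rewrite indicE; case: (_ \in _); rewrite ?normr1 ?normr0.
have -> : (\int[leb]_y0 (\1_I y0 * Lam u y0)%:E = \int[leb]_(z in `[y', y]) (Lam u z)%:E)%E.
  rewrite -[RHS]integral_itv_obnd_cbnd; last first.
    apply/measurable_EFinP; apply: measurable_funTS; apply: continuous_measurable_fun => z.
    apply/cvgrPdist_lt => e e0; have [dl dl0 hd] := Lam_cont z u0 e0.
    by apply/nbhs_ballP; exists dl => //= z' zz; apply: hd; rewrite ?subrr ?normr0.
  rewrite [RHS]integral_mkcond; apply: eq_integral => z _.
  by rewrite patchE indicE /I; case: ifP => _; rewrite ?mul1r ?mul0r.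
rewrite FTC //.
have -> : (\int[leb]_(v in `[0%R, u]) (\1_I (xi v))%:E = leb (Cs u y `\` Cs u y'))%E.
  have mD : measurable (Cs u y `\` Cs u y' : set (measurableTypeR R)) by exact: measurableD.
  have -> : (\int[leb]_(v in `[0%R, u]) (\1_I (xi v))%:E =
      \int[leb]_(v in `[0%R, u]) (\1_(Cs u y `\` Cs u y') v)%:E)%E.
    apply: eq_integral => v; rewrite inE /= in_itv /= => /andP[v0 vu].
    congr EFin; rewrite !indicE; congr (_%:R); congr nat_of_bool.
    apply/idP/idP; rewrite !inE /I /= in_itv /= xi_le // ltNge xi_le //.
      by move=> /andP[n1 n2]; split; [split => //; rewrite v0|move=> [_ n3]; rewrite n3 in n1].
    by move=> [[_ h1] h2]; rewrite h1 andbT; apply/negP => h3; apply: h2; split; rewrite ?v0.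
  rewrite integral_indic //.
  by congr (leb _); apply/seteqP; split=> v /= [] // [h1 h2] h3; split => //; rewrite in_itv.
have sub : Cs u y' `<=` Cs u y.
  move=> v [vu h]; split => //; case/andP: vu => v0 vu.
  exact: le_trans h (ltW (Psi_mono v0 yy)).
rewrite measureD ?setIidr //; last by rewrite -ge0_fin_numE // CsF.
move=> H; have : (leb (Cs u y) - leb (Cs u y'))%E = _ := H.
by rewrite !mmE // -EFinB => -[].
Qed.

(** A line starting so low that y' + u stays under the path rises with slope 1 and never meets it:
    at a first contact time v it would still have the value y' + v. *)
Let below u y' : 0 < u -> (forall v : R, 0 <= v <= u -> y' + u < b v) ->
  Psi u y' = y' + u /\ Cs u y' = set0.
Proof.
move=> u0 yb.
have lin v : 0 < v -> (forall s : R, 0 < s < v -> Psi s y' < b s) -> Psi v y' = y' + v.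
  move=> v0 hs.
  have [c _] : exists2 c : R, c \in `]0, v[%R & Psi v y' - Psi 0 y' = 1 * (v - 0).
    apply: (@MVT R (fun s => Psi s y') (fun=> 1)) => //.
      by move=> s; rewrite in_itv /= => /andP[s0 sv]; apply: PsiU => //; apply: hs; rewrite s0.
    have := @continuous_subspaceT _ _ `[0, v]%classic _ (@pm_cont y').
    apply: subspace_eq_continuous => s; rewrite inE /= in_itv /= => /andP[s0 _].
    by rewrite /from_subspace /= (max_idPl s0).
  by rewrite Psi0 mul1r subr0 => /eqP; rewrite subr_eq addrC => /eqP.
have C0 : Cs u y' = set0.
  apply/eqP/negPn/negP => /set0P ne.
  have lb : has_lbound (Cs u y') by exists 0 => v [/andP[]].
  have gi : 0 <= gg y' (inf (Cs u y')).
    apply: (inf_closed (@gg_cont y') ne lb) => v [/andP[v0 _] h].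
    by rewrite /gg (max_idPl v0) subr_ge0.
  set v := inf (Cs u y') in gi.
  have v0 : 0 <= v by apply: lb_le_inf => // s [/andP[]].
  have vu : v <= u by have [s Ss] := ne; apply: le_trans (_ : s <= u); [apply: ge_inf|case: Ss => /andP[]].
  have bv : y' + u < b v by apply: yb; rewrite v0.
  move: gi; rewrite /gg (max_idPl v0) subr_ge0; apply/negP; rewrite -ltNge.
  have [v00|vp] : v = 0 \/ 0 < v by move: v0; rewrite le_eqVlt => /orP[/eqP|]; [left|right].
    by rewrite v00 Psi0; rewrite v00 in bv; lra.
  rewrite lin //; first by lra.
  move=> s /andP[s0 sv]; rewrite ltNge; apply/negP => h.
  have : v <= s by apply: ge_inf => //; split => //; rewrite (ltW s0) /= (le_trans (ltW sv)).
  by rewrite leNgt sv.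
split => //; apply: lin => // s /andP[s0 su]; rewrite ltNge; apply/negP => h.
have : Cs u y' s by split => //; rewrite !ltW.
by rewrite C0.
Qed.

(* The flow is expressed by the time it spends above the driving path. *)
Let Psi_formula u y : 0 <= u -> Psi u y = y + u - 2 * mm u y.
Proof.
rewrite le_eqVlt => /orP[/eqP <-|u0].
  rewrite Psi0 /mm; have -> : leb (Cs 0 y) = 0.
    apply/eqP; rewrite -measure_le0; apply: (@le_trans _ _ (leb `[0%R, (0 : R)])).
      by apply: le_measure; rewrite ?inE; [exact: mCs|exact: measurable_itv|rewrite CsE; exact: subIsetl].
    by rewrite lebI // subrr.
  by rewrite mulr0 subr0 addr0.
have [x0 _ hx] : exists2 x0 : R, x0 \in `[0, u]%R & forall t : R, t \in `[0, u]%R -> b x0 <= b t.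
  by apply: EVT_min; [exact: ltW|exact: continuous_subspaceT].
(* A starting point low enough for [below]; there both sides of the formula are known, and [mm_diff]
   transports it to y. *)
pose y' := Num.min (y - 1) (b x0 - u - 1).
have yy : y' < y by rewrite gt_min; apply/orP; left; lra.
have yb : y' <= b x0 - u - 1 by rewrite ge_min lexx orbT.
have [P1 C0] : Psi u y' = y' + u /\ Cs u y' = set0.
  by apply: below => // v vu; have := hx v; rewrite in_itv /= => /(_ vu); lra.
have := mm_diff (ltW u0) yy; rewrite {2}/mm C0 measure0 /= P1; lra.
Qed.

(** The hypotheses on the flow give derivatives off the driving path only, and a Lipschitz constant
    that may depend on y. The formula with [mm] gives the constant 1 for all lines. *)
Lemma Psi_lip u u' y : 0 <= u' -> u' <= u -> `|Psi u y - Psi u' y| <= u - u'.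
Proof.
move=> u'0 uu; have u0 := le_trans u'0 uu.
have s1 : mm u' y <= mm u y.
  rewrite -lee_fin -!mmE //; apply: le_measure; rewrite ?inE //.
  by move=> v [/andP[v0 vu] h]; split; rewrite ?v0 ?(le_trans vu).
have s2 : mm u y <= mm u' y + (u - u').
  rewrite -lee_fin EFinD -!mmE // -(lebI uu).
  apply: (@le_trans _ _ (leb (Cs u' y `|` `[u', u]))); last first.
    by apply: measureU2 => //; exact: measurable_itv.
  apply: le_measure; rewrite ?inE //; first by apply: measurableU => //; exact: measurable_itv.
  move=> v [/andP[v0 vu] h] /=; rewrite in_itv /=; case: (leP v u') => vu'; first by left; split; rewrite ?v0.
  by right; rewrite vu ltW.
by rewrite !Psi_formula // ler_norml; apply/andP; split; lra.
Qed.

Lemma Psi_up u u' y : 0 <= u' -> u' <= u -> (forall v, u' <= v <= u -> Psi v y < b v) ->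
  Psi u y = Psi u' y + (u - u').
Proof.
move=> u'0 uu h; have u0 := le_trans u'0 uu.
have -> : Psi u y = y + u - 2 * mm u' y; last by rewrite (Psi_formula _ u'0); ring.
rewrite Psi_formula //; congr (_ - 2 * fine (leb _)); apply/seteqP; split=> v [/andP[v0 vu] bv].
  split => //; rewrite v0 /= leNgt; apply/negP => vu'.
  by have := h v; rewrite vu ltW // => /(_ isT); rewrite ltNge bv.
by split; rewrite ?v0 ?(le_trans vu).
Qed.

Lemma Psi_down u u' y : 0 <= u' -> u' <= u -> (forall v, u' <= v <= u -> b v < Psi v y) ->
  Psi u y = Psi u' y - (u - u').
Proof.
move=> u'0 uu h; have u0 := le_trans u'0 uu.
suff E : mm u y = mm u' y + (u - u') by rewrite !Psi_formula // E; ring.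
apply/eqP; rewrite eq_le; apply/andP; split.
  have := Psi_lip y u'0 uu; rewrite !Psi_formula // ler_norml => /andP[]; lra.
rewrite -lee_fin EFinD -!mmE //.
have -> : (u - u')%:E = leb `]u', u].
  rewrite lebesgue_measure_itv /= lte_fin; case: ltP => // vu.
  by rewrite (le_anti (_ : u' <= u <= u')) ?uu ?vu // subrr.
have dj : Cs u' y `&` `]u', u] = set0.
  by apply/seteqP; split=> v //= [[/andP[v0 vu] _]]; rewrite in_itv /= ltNge vu.
rewrite -measureU //.
apply: le_measure; rewrite ?inE //; first by apply: measurableU => //; exact: measurable_itv.
move=> v [[/andP[v0 vu] bv]|]; first by split; rewrite ?v0 ?(le_trans vu).
rewrite /= in_itv /= => /andP[v1 v2]; split; first by rewrite v2 andbT (le_trans u'0 (ltW v1)).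
by apply: ltW; apply: h; rewrite v2 ltW.
Qed.

Lemma Psi_dist u y : 0 <= u -> `|Psi u y - y| <= u.
Proof. by move=> u0; have := Psi_lip y (lexx 0) u0; rewrite Psi0 subr0. Qed.

Lemma Psi_cont : forall u y e : R, 0 <= u -> 0 < e -> exists2 dl : R, 0 < dl &
   forall u' y' : R, 0 <= u' -> `|u - u'| < dl -> `|y - y'| < dl -> `|Psi u y - Psi u' y'| < e.
Proof. exact: Psic. Qed.

(** At time u the driving path separates the flow lines from xi u - e and xi u + e, and by
    continuity it does so at nearby times. *)
Lemma xi_cont u e : 0 <= u -> 0 < e -> exists2 dl : R, 0 < dl &
  forall u' : R, 0 <= u' -> `|u - u'| < dl -> `|xi u - xi u'| < e.
Proof.
move=> u0 e0.
have lo : Psi u (xi u - e) < b u by rewrite -(xiP u0); apply: Psi_mono => //; lra.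
have hi : b u < Psi u (xi u + e) by rewrite -(xiP u0); apply: Psi_mono => //; lra.
have e1 : 0 < (b u - Psi u (xi u - e)) / 2 by rewrite divr_gt0 // subr_gt0.
have e2 : 0 < (Psi u (xi u + e) - b u) / 2 by rewrite divr_gt0 // subr_gt0.
have [d1 d10 h1] := Psic (xi u - e) u0 e1.
have [d2 d20 h2] := Psic (xi u + e) u0 e2.
have /(_ u)/cvgrPdist_lt/(_ _ e1)/nbhs_ballP[d3 /= d30 h3] := cb.
have /(_ u)/cvgrPdist_lt/(_ _ e2)/nbhs_ballP[d4 /= d40 h4] := cb.
exists (Num.min (Num.min d1 d2) (Num.min d3 d4)); first by rewrite !lt_min d10 d20 d30.
move=> u' u'0; rewrite !lt_min => /andP[/andP[l1 l2] /andP[l3 l4]].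
have := h1 u' (xi u - e) u'0 l1; rewrite subrr normr0 => /(_ d10).
have := h2 u' (xi u + e) u'0 l2; rewrite subrr normr0 => /(_ d20).
have := h3 u' l3; have := h4 u' l4; rewrite !ltr_norml.
move=> /andP[a1 a2] /andP[a3 a4] /andP[a5 a6] /andP[a7 a8].
have x1 : xi u' < xi u + e.
  case: (ltP (xi u') (xi u + e)) => // h; exfalso.
  have : Psi u' (xi u + e) <= Psi u' (xi u').
    by move: h; rewrite le_eqVlt => /orP[/eqP ->//|/(Psi_mono u'0)/ltW].
  by rewrite xiP //; lra.
have x2 : xi u - e < xi u'.
  rewrite ltNge xi_le //; apply/negP; lra.
by apply/andP; split; lra.
Qed.

End bass_burdzy_flow.

(** * Limits along an ultrafilter *)

Section ultralimits.
Context {R : realType} (FU : set_system nat) {UF : UltraFilter FU}.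

Lemma ulim_ex (a : nat -> R) (C : R) : (\forall i \near FU, `|a i| <= C) ->
  exists2 l : R, a @ FU --> l & `|l| <= C.
Proof.
move=> aC.
pose S := [set r : R | \forall i \near FU, r <= a i].
have SC : S (- C) by apply: filterS aC => i; rewrite ler_norml => /andP[].
have ubS : ubound S C.
  move=> r Sr; have [i [h1 h2]] := filter_ex (filterI Sr aC).
  by move: h2; rewrite ler_norml => /andP[_]; exact: le_trans.
have hS : has_sup S by split; [exists (- C)|exists C].
exists (sup S).
  apply/cvgrPdist_le => e e0.
  have lo : \forall i \near FU, sup S - e <= a i.
    have [r Sr re] := sup_adherent e0 hS.
    by apply: filterS Sr => i; apply: le_trans; exact: ltW.
  have hi : \forall i \near FU, ~ (sup S + e <= a i).
    have [h|h] := in_ultra_setVsetC [set i | sup S + e <= a i] _ => //.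
    have := sup_upper_bound hS h; lra.
  apply: filterS (filterI lo hi) => i [h1 /negP]; rewrite -ltNge => h2.
  by rewrite ler_norml; apply/andP; split; lra.
rewrite ler_norml; apply/andP; split; first exact: sup_upper_bound.
by apply: sup_le_ub => //; exists (- C).
Qed.

(** If the uniform statement failed along the ultrafilter, a choice of failing indices would fail
    along it too. Uniform statements thus reduce to a single sequence, on which the bounded
    quantities have limits. *)
Lemma ev_uniform (I : choiceType) (i0 : I) (Q : nat -> I -> Prop) :
  (forall k : nat -> I, ~ \forall i \near FU, ~ Q i (k i)) ->
  \forall i \near FU, forall k, Q i k.
Proof.
move=> H; have [//|h] := in_ultra_setVsetC [set i | forall k, Q i k] _.
exfalso; pose k i := xget i0 [set k | ~ Q i k].
apply: (H k); apply: filterS h => i /existsNP ex.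
exact: (xgetPex i0 ex).
Qed.

Lemma cvg_dist (a : nat -> R) (l e : R) : a @ FU --> l -> 0 < e -> \forall i \near FU, `|a i - l| <= e.
Proof.
by move=> /cvgrPdist_le/(_ e) h e0; apply: filterS (h e0) => i; rewrite distrC.
Qed.

Lemma ulim_unique (a : nat -> R) (l l' : R) : a @ FU --> l -> a @ FU --> l' -> l = l'.
Proof. by move=> h h'; exact: (cvg_unique _ h h'). Qed.

Lemma ulim_le (a : nat -> R) (l C : R) : a @ FU --> l -> (\forall i \near FU, a i <= C) -> l <= C.
Proof.
move=> al aC; rewrite leNgt; apply/negP => lC.
have e0 : 0 < (l - C) / 2 by rewrite divr_gt0 // subr_gt0.
have [i [h1 h2]] := filter_ex (filterI (cvg_dist al e0) aC).
by move: h1; rewrite ler_norml => /andP[h1 _]; lra.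
Qed.

Lemma ulim_ge (a : nat -> R) (l C : R) : a @ FU --> l -> (\forall i \near FU, C <= a i) -> C <= l.
Proof.
move=> al aC; rewrite leNgt; apply/negP => lC.
have e0 : 0 < (C - l) / 2 by rewrite divr_gt0 // subr_gt0.
have [i [h1 h2]] := filter_ex (filterI (cvg_dist al e0) aC).
by move: h1; rewrite ler_norml => /andP[_ h1]; lra.
Qed.

Lemma ulim_eps (a : nat -> R) (l : R) : (forall e : R, 0 < e -> \forall i \near FU, `|a i - l| <= e) -> a @ FU --> l.
Proof. by move=> h; apply/cvgrPdist_le => e e0; apply: filterS (h e e0) => i; rewrite distrC. Qed.

Lemma ulim_comp (f : R -> R) (a : nat -> R) (l : R) : {for l, continuous f} -> a @ FU --> l ->
  (fun i => f (a i)) @ FU --> f l.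
Proof. by move=> cf al; exact: (cvg_comp _ _ al cf). Qed.

Lemma ulim_two (f : R -> R -> R) (u y : R) (a c : nat -> R) :
  (forall e : R, 0 < e -> exists2 dl : R, 0 < dl &
   forall u' y' : R, 0 <= u' -> `|u - u'| < dl -> `|y - y'| < dl -> `|f u y - f u' y'| < e) ->
  (forall i, 0 <= a i) -> a @ FU --> u -> c @ FU --> y -> (fun i => f (a i) (c i)) @ FU --> f u y.
Proof.
move=> hf a0 au cy; apply/cvgrPdist_lt => e e0; have [dl dl0 hd] := hf e e0.
move/cvgrPdist_lt/(_ dl dl0) : au => au; move/cvgrPdist_lt/(_ dl dl0) : cy => cy.
by apply: filterS (filterI au cy) => i [h1 h2]; exact: hd.
Qed.

End ultralimits.

(** * The continuous scale function and its divergence at both ends *)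

Section spatial_scale.
Context {R : realType} (L0 : R -> R).
Hypotheses (L0pos : forall x, 0 < L0 x) (L0c : continuous L0).
Hypothesis S0y : forall C : R, exists A0 : nat, forall A : nat, (A0 <= A)%N -> C <= S0 L0 A%:R.
Hypothesis S0Ny : forall C : R, exists A0 : nat, forall A : nat, (A0 <= A)%N -> S0 L0 (- A%:R) <= C.
Implicit Types (x y z : R).

Lemma S0_derive x : is_derive x 1 (S0 L0) (L0 x ^- 2).
Proof. by rewrite S0_prim; apply: prim_derive; exact: cont_invsq. Qed.

Lemma S0_cont : continuous (S0 L0).
Proof.
move=> x; apply: differentiable_continuous; apply/derivable1_diffP.
by have D := S0_derive x; exact: ex_derive.
Qed.

Lemma S0_mono x y : x < y -> S0 L0 x < S0 L0 y.
Proof.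
move=> xy; have [c _ E] : exists2 c : R, c \in `]x, y[%R & S0 L0 y - S0 L0 x = L0 c ^- 2 * (y - x).
  apply: (@MVT R (S0 L0) (fun z => L0 z ^- 2)) => //; first by move=> z _; exact: S0_derive.
  by apply: continuous_subspaceT; exact: S0_cont.
by rewrite -subr_gt0 E mulr_gt0 ?subr_gt0 // invr_gt0 exprn_gt0.
Qed.

Lemma S0_inj x y : S0 L0 x = S0 L0 y -> x = y.
Proof. by move=> E; case: (ltgtP x y) => // /S0_mono; rewrite E ltxx. Qed.

Lemma S0_surj z : exists x, S0 L0 x = z.
Proof.
have [A1 h1] := S0y z; have [A2 h2] := S0Ny z.
have a1 := h1 A1 (leqnn _); have a2 := h2 A2 (leqnn _).
have le : - A2%:R <= A1%:R :> R by have := ler0n R A1; have := ler0n R A2; lra.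
have [x _ xE] : exists2 c : R, c \in `[- A2%:R, A1%:R]%R & S0 L0 c = z.
  apply: IVT => //; first by apply: continuous_subspaceT; exact: S0_cont.
  by rewrite ge_min a2 /= le_max a1 orbT.
by exists x.
Qed.

Lemma S0invK x : S0inv L0 (S0 L0 x) = x.
Proof.
apply: S0_inj.
exact: (xgetPex 0 (ex_intro (fun y => S0 L0 y = S0 L0 x) x erefl)).
Qed.

Lemma S0Kinv z : S0 L0 (S0inv L0 z) = z.
Proof. by have [x <-] := S0_surj z; rewrite S0invK. Qed.

Lemma S0inv_cont : continuous (S0inv L0).
Proof.
move=> z; apply/cvgrPdist_lt => e e0; set x := S0inv L0 z.
have xz : S0 L0 x = z by exact: S0Kinv.
have lo : S0 L0 (x - e) < z by rewrite -xz; apply: S0_mono; lra.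
have hi : z < S0 L0 (x + e) by rewrite -xz; apply: S0_mono; lra.
have d0 : 0 < Num.min (z - S0 L0 (x - e)) (S0 L0 (x + e) - z) by rewrite lt_min !subr_gt0 lo.
apply/nbhs_ballP; exists (Num.min (z - S0 L0 (x - e)) (S0 L0 (x + e) - z)) => //= z'.
rewrite /ball /= lt_min !ltr_norml => /andP[/andP[a1 a2] /andP[a3 a4]].
have z'E := S0Kinv z'; set x' := S0inv L0 z' in z'E *.
have x1 : x' < x + e.
  rewrite ltNge; apply/negP; rewrite le_eqVlt => /orP[/eqP E|/S0_mono]; last by lra.
  by rewrite -E in z'E; lra.
have x2 : x - e < x'.
  rewrite ltNge; apply/negP; rewrite le_eqVlt => /orP[/eqP E|/S0_mono]; last by lra.
  by rewrite E in z'E; lra.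
by apply/andP; split; lra.
Qed.

End spatial_scale.

Section divergence.
Context {R : realType} (L0 : R -> R).
Hypotheses (L0pos : forall x, 0 < L0 x) (L0c : continuous L0).
Notation leb := (@lebesgue_measure R).

(** A bounded monotone primitive would converge, and the fundamental theorem would make the improper
    integral finite. *)
Lemma prim_unbounded (f : R -> R) : continuous f -> (forall x, 0 <= f x) ->
  (\int[leb]_(x in `[0%R, +oo[) (f x)%:E = +oo)%E ->
  forall C : R, exists A0 : nat, forall A : nat, (A0 <= A)%N -> C <= prim f A%:R.
Proof.
move=> cf f0 fy C.
have mono : nondecreasing_fun (prim f).
  move=> x y xy; rewrite -subr_ge0 primB //; apply: Rintegral_ge0 => z _; exact: f0.
have [bd|nb] := pselect (has_ubound (range (prim f))).
  have lim := nondecreasing_cvgr mono bd.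
  have := @ge0_continuous_FTC2y R f (prim f) 0 _ (fun x _ => f0 x) (continuous_subspaceT cf) lim.
  rewrite fy => /(_ _ _ _)/wrap[] //.
  - by move=> x _; have D := prim_derive x cf; exact: ex_derive.
  - apply: cvg_at_right_filter; apply: differentiable_continuous; apply/derivable1_diffP.
    by have D := prim_derive 0 cf; exact: ex_derive.
  - by move=> x _; rewrite derive1E; have D := prim_derive x cf; exact: derive_val.
have [x xC] : exists x, C <= prim f x.
  apply: contrapT => /forallNP h; apply: nb; exists C => _ [x _ <-].
  by apply: ltW; rewrite ltNge; apply/negP; exact: h.
exists (Num.bound `|x|) => A xA; apply: le_trans xC _; apply: mono.
apply: le_trans (ler_norm _) _; apply: ltW; apply: lt_le_trans (archi_boundP (normr_ge0 x)) _.
by rewrite ler_nat.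
Qed.

Lemma S0_pinfty : (\int[leb]_(x in `[0%R, +oo[) ((L0 x) ^-2)%:E = +oo)%E ->
  forall C : R, exists A0 : nat, forall A : nat, (A0 <= A)%N -> C <= S0 L0 A%:R.
Proof.
move=> h; rewrite S0_prim; apply: prim_unbounded => //; first exact: cont_invsq.
by move=> x; rewrite invr_ge0 sqr_ge0.
Qed.

Lemma S0_ninfty : (\int[leb]_(x in `]-oo, 0%R]) ((L0 x) ^-2)%:E = +oo)%E ->
  forall C : R, exists A0 : nat, forall A : nat, (A0 <= A)%N -> S0 L0 (- A%:R) <= C.
Proof.
move=> h C; pose f (r : R) := L0 (- r) ^- 2.
have cf0 := cont_invsq L0pos L0c.
have cf : continuous f.
  move=> x; apply: (@continuous_comp _ _ _ (fun r : R => - r) (fun r => L0 r ^- 2)); first exact: oppr_continuous.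
  exact: cf0.
have := @prim_unbounded f cf _ _ (- C) => /(_ _ _)/wrap[].
- by move=> x; rewrite invr_ge0 sqr_ge0.
- have := @ge0_integration_by_substitutionNy R (fun r => L0 r ^- 2) 0.
  rewrite oppr0 h => /(_ _ _)/wrap[].
  + exact: continuous_subspaceT.
  + by move=> x _; rewrite invr_ge0 sqr_ge0.
  by move=> <-.
move=> [A0 hA]; exists A0 => A /hA.
(* The primitive of the reflected integrand and the reflected scale function have the same
   derivative and both vanish at 0. *)
suff -> : prim f A%:R = - S0 L0 (- A%:R) by rewrite lerN2.
have dG x : is_derive x (1 : R) (fun r => - S0 L0 (- r)) (f x).
  have D := S0_derive L0pos L0c (- x).
  have D2 : is_derive x (1 : R) (S0 L0 \o -%R) (L0 (- x) ^- 2 * -1).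
    apply: is_derive1_comp; apply: is_derive_eq.
  have D3 : is_derive x (1 : R) (- (S0 L0 \o -%R)) (- (L0 (- x) ^- 2 * -1)) by apply: is_deriveN.
  have -> : (fun r => - S0 L0 (- r)) = - (S0 L0 \o -%R) by [].
  by apply: is_derive_eq; rewrite mulrN1 opprK.
have := @MVT_segment R (prim f - (fun r => - S0 L0 (- r))) (fun=> 0) 0 A%:R (ler0n R A) _ _.
move=> /(_ _ _)/wrap[].
- move=> x _; have D1 := prim_derive x cf; have D2 := dG x.
  by apply: is_derive_eq; rewrite subrr.
- apply: continuous_subspaceT => x; apply: differentiable_continuous; apply/derivable1_diffP.
  have D1 := prim_derive x cf; have D2 := dG x; apply: derivableB; exact: ex_derive.
by move=> [c _]; rewrite mul0r !fctE prim0 oppr0 S0_prim prim0 => ?; lra.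
Qed.

End divergence.

(** * Arithmetic of the flow contraction and of difference quotients *)

Section flow_arith.
Context {R : realType}.
Implicit Types (al am dW e : R).

Lemma alpha_ratio al am e : 0 <= e -> al <= (1 + e) * am -> am <= (1 + e) * al -> 0 <= al -> 0 <= am ->
  `|al - (al + am) / 2| <= e * ((al + am) / 2).
Proof.
move=> e0 h1 h2 a0 b0; have p1 := mulr_ge0 e0 a0; have p2 := mulr_ge0 e0 b0.
by rewrite ler_norml; apply/andP; split; lra.
Qed.

Lemma site_le (A n : nat) (z : int) : `|z%:~R / 2 ^+ n : R| <= A%:R -> `|z| <= (A * 2 ^ n)%N%:Z.
Proof.
rewrite normrM normfV normrX (ger0_norm (ler0n R 2)).
rewrite ler_pdivrMr ?exprn_gt0 // -intr_norm -natrX -natrM.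
by rewrite -[X in _ <= X -> _]/((A * 2 ^ n)%N%:Z%:~R) ler_int.
Qed.

Lemma norm_add_split (a a' c c' t e : R) : `|c - c'| <= e -> `|a - a'| < t / 2 -> e <= t / 2 ->
  `|a + c - (a' + c')| <= t.
Proof. by rewrite !ler_norml ltr_norml => /andP[? ?] /andP[? ?] ?; apply/andP; split; lra. Qed.

Lemma inv_ratio (hI lp lm ep : R) : 0 <= hI -> 0 < lp -> 0 < lm -> lm <= (1 + ep) * lp ->
  hI / lp <= (1 + ep) * (hI / lm).
Proof.
move=> h0 p0 m0 le; rewrite mulrCA ler_wpM2l // ler_pdivlMr // mulrC ler_pdivrMr //.
Qed.

Lemma flow_budget (e eta ka z : R) : eta = e / 8 -> ka <= eta / 2 -> z <= e / 4 -> 0 < e ->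
  2 * eta + 3 * ka + z <= e.
Proof. by move=> ->; lra. Qed.

Lemma near_dd (v w1 w0 dw ka dd : R) : v <= w1 -> w1 - w0 = dw -> dw <= ka -> ka <= dd / 2 -> 0 < dd -> v - w0 < dd.
Proof. lra. Qed.

Lemma below_arith (bw bv e2 p pv ka : R) : - e2 < bw - bv -> bw - bv < e2 -> - ka <= pv - p -> pv - p <= ka ->
  p + ka + e2 < bw -> pv < bv.
Proof. lra. Qed.

Lemma above_arith (bw bv e2 p pv ka : R) : - e2 < bw - bv -> bw - bv < e2 -> - ka <= pv - p -> pv - p <= ka ->
  bw < p - ka - e2 -> bv < pv.
Proof. lra. Qed.

(** One step of the contraction, S being the discrete and P the limiting flow line, ep the error
    from unequal edges. If S - P <= 2 eta, a step adds at most 3 dw. Otherwise either S moves down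
    at almost full speed, or S <= M, and then P lies far enough below the driving path to move up at
    full speed. In both cases the gap grows by at most ep dw. *)
Lemma flow_step_up (S S1 P P1 M bW dw eta ka ep W : R) : 0 <= dw -> dw <= ka -> 0 <= ep -> 0 <= eta -> 0 <= W ->
  `|P1 - P| <= dw -> `|M - bW| <= eta -> `|S1 - S| <= 2 * dw -> ka <= eta / 2 ->
  S - P <= 2 * eta + 3 * ka + ep * W ->
  (S1 - S <= - (dw - ep * dw)) \/ (S <= M /\ S1 - S <= dw + ep * dw /\ (P + ka + eta / 2 < bW -> P1 = P + dw)) ->
  S1 - P1 <= 2 * eta + 3 * ka + ep * (W + dw).
Proof.
move=> d0 dk ep0 eta0 W0; rewrite !ler_norml => /andP[p1 p2] /andP[m1 m2] /andP[s1 s2] ke D hc.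
have e1 := mulr_ge0 ep0 W0; have e2 := mulr_ge0 ep0 d0.
have [h|h] := leP (S - P) (2 * eta); first by rewrite mulrDr; lra.
case: hc => [c1|[c1 [c2 c3]]]; first by rewrite mulrDr; lra.
have := c3 _ => /(_ _)/wrap[]; first by lra.
by move=> E; rewrite mulrDr; lra.
Qed.

Lemma flow_step_down (S S1 P P1 M bW dw eta ka ep W : R) : 0 <= dw -> dw <= ka -> 0 <= ep -> 0 <= eta -> 0 <= W ->
  `|P1 - P| <= dw -> `|M - bW| <= eta -> `|S1 - S| <= 2 * dw -> ka <= eta / 2 ->
  - (2 * eta + 3 * ka + ep * W) <= S - P ->
  (dw - ep * dw <= S1 - S) \/ (M <= S /\ - (dw + ep * dw) <= S1 - S /\ (bW < P - ka - eta / 2 -> P1 = P - dw)) ->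
  - (2 * eta + 3 * ka + ep * (W + dw)) <= S1 - P1.
Proof.
move=> d0 dk ep0 eta0 W0 hP hM hS ke D hc.
have := @flow_step_up (- S) (- S1) (- P) (- P1) (- M) (- bW) dw eta ka ep W d0 dk ep0 eta0 W0.
rewrite -!opprD !normrN => /(_ hP hM hS ke); rewrite lerNl => /(_ D) H.
rewrite lerNl; apply: H; case: hc => [c1|[c1 [c2 c3]]]; [left|right]; first by rewrite lerN2.
split; first by rewrite lerN2.
by split; [rewrite lerNl|move=> h; rewrite (c3 _) ?opprB //; lra].
Qed.

Lemma edge_ratio (A B C tau : R) : 0 < A -> 0 < B -> 0 < C -> 0 <= tau -> tau <= 1 / 4 ->
  `|ln A - ln C| <= tau -> `|ln B - ln C| <= tau -> `|(A * B)^-1 - C ^- 2| <= C ^- 2 * (4 * tau).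
Proof.
move=> A0 B0 C0 t0 t1 hA hB.
have /andP[a1 a2] : - tau <= ln A - ln C <= tau by rewrite -ler_norml.
have /andP[b1 b2] : - tau <= ln B - ln C <= tau by rewrite -ler_norml.
pose r := expR (2 * ln C - ln A - ln B).
have rE : (A * B)^-1 = C ^- 2 * r.
  have -> : r = C * C / A / B.
    rewrite /r -addrA expRD -opprD expRN expRD !lnK ?posrE // -[2]/(1 + 1) mulrDl mul1r expRD lnK ?posrE //.
    by rewrite invfM mulrA.
  by field; rewrite !gt_eqF.
have i0 : 0 < C ^- 2 by rewrite invr_gt0 exprn_gt0.
rewrite rE -{2}[C ^- 2]mulr1 -mulrBr normrM (gtr0_norm i0) ler_pM2l //.
have r1 : r <= 1 + 4 * tau.
  apply: (@le_trans _ _ (expR (2 * tau))); first by rewrite ler_expR; lra.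
  by apply: expR_small; lra.
have r2 : 1 - 2 * tau <= r.
  apply: (@le_trans _ _ (expR (- (2 * tau)))); last by rewrite ler_expR; lra.
  exact: expR_ge1Dx.
by rewrite ler_norml; apply/andP; split; lra.
Qed.

Lemma edge_sum (S1 S2 S3 h D P I tau : R) : 0 < h -> S1 - S2 = h / P ->
  `|S2 - S3 - D * h * I| <= D * h * I * (4 * tau) -> `|P^-1 - I| <= I * (4 * tau) ->
  `|S1 - S3 - (D + 1) * h * I| <= (D + 1) * h * I * (4 * tau).
Proof.
move=> h0 E IH er.
have -> : S1 - S3 - (D + 1) * h * I = (S2 - S3 - D * h * I) + h * (P^-1 - I).
  have -> : S1 = S2 + h / P by rewrite -E; ring.
  by ring.
apply: le_trans (ler_normD _ _) _.
have -> : (D + 1) * h * I * (4 * tau) = D * h * I * (4 * tau) + h * (I * (4 * tau)) by ring.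
by rewrite lerD // normrM (gtr0_norm h0) ler_pM2l.
Qed.

Lemma derive_eps (f : R -> R) (x f' e : R) : is_derive x (1 : R) f f' -> 0 < e ->
  exists2 dl : R, 0 < dl & forall t : R, t != 0 -> `|t| < dl -> `|f (x + t) - f x - f' * t| <= e * `|t|.
Proof.
move=> [df fE] e0.
have : (fun t => t^-1 *: (f (t *: 1 + x) - f x)) @ 0^' --> f'.
  by rewrite -fE; exact: df.
move/cvgrPdist_le/(_ e e0); rewrite /dnbhs => /nbhs_ballP[dl /= dl0 hd].
exists dl => // t t0 td; have := hd t; rewrite /ball /= sub0r normrN => /(_ td t0).
rewrite [t *: 1](_ : _ = t); last by rewrite /GRing.scale /= mulr1.
rewrite /GRing.scale /= (addrC t x) => h.
have -> : f (x + t) - f x - f' * t = - t * (f' - t^-1 * (f (x + t) - f x)) by field.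
by rewrite normrM normrN mulrC ler_pM2r ?normr_gt0.
Qed.

Lemma quotient_arith (h a f' I e dlt : R) : 0 < h -> `|a - f' * h| <= e * h ->
  `|a - h * I| <= h * I * dlt -> `|f' - I| <= I * dlt + e.
Proof.
move=> h0 q1 q2; rewrite -(ler_pM2l h0).
have -> : h * `|f' - I| = `|h * (f' - I)| by rewrite normrM (gtr0_norm h0).
have -> : h * (f' - I) = (a - h * I) - (a - f' * h) by ring.
apply: le_trans (ler_normB _ _) _; rewrite mulrDr (mulrC h e) mulrA; exact: lerD.
Qed.

Lemma powR_mhalf (a : R) : 0 < a -> powR a (- (1 / 2)) = (Num.sqrt a)^-1.
Proof. by move=> a0; rewrite powRN div1r powR12_sqrt // ltW. Qed.

(** Recovers the occupation profile from the slope of the flow, with a = 1 - 2 Lam and L the initial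
    profile. *)
Lemma sqrt_profile (L a l : R) : 0 < L -> 0 < l -> 0 < a -> a * L ^- 2 = l ^- 2 ->
  L * powR a (- (1 / 2)) = l.
Proof.
move=> L0 l0 a0 E; rewrite powR_mhalf //.
have s0 : 0 < Num.sqrt a by rewrite sqrtr_gt0.
have E2 : l ^+ 2 = L ^+ 2 / a by rewrite -[l ^+ 2]invrK -E invfM invrK mulrC.
apply/eqP; rewrite -(@eqrXn2 _ 2) ?ltW ?divr_gt0 //.
by rewrite E2 exprMn exprVn sqr_sqrtr // ltW.
Qed.

Lemma clock_arith2 (J J1 p p1 r dw e W : R) : `|J - p| <= 2 * e * W -> `|J1 - J - r * dw| <= e * dw ->
  `|p1 - p - r * dw| <= e * dw -> `|J1 - p1| <= 2 * e * (W + dw).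
Proof.
move=> h1 h2 h3; have -> : J1 - p1 = (J - p) + (J1 - J - r * dw) - (p1 - p - r * dw) by ring.
apply: le_trans (ler_normB _ _) _; apply: le_trans (lerD (ler_normD _ _) (lexx _)) _.
by rewrite mulrDr; lra.
Qed.

Lemma half_arith (z a : R) : 0 < a -> a * (z / a / 2) = z / 2.
Proof. by move=> a0; field; rewrite gt_eqF. Qed.

End flow_arith.

Lemma convex_dist {R : realType} (th l1 l2 l e : R) : 0 <= th -> 0 <= 1 - th ->
  `|l1 - l| <= e -> `|l2 - l| <= e -> `|(1 - th) * l1 + th * l2 - l| <= e.
Proof.
move=> t0 t1 h1 h2; have -> : (1 - th) * l1 + th * l2 - l = (1 - th) * (l1 - l) + th * (l2 - l) by ring.
apply: le_trans (ler_normD _ _) _; rewrite !normrM (ger0_norm t0) (ger0_norm t1).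
have -> : e = (1 - th) * e + th * e by ring.
by apply: lerD; rewrite ler_wpM2l.
Qed.

(** * From steps of the chain to real time *)

Section real_time.
Context {R : realType} (L0 : R -> R) (n : nat).
Context d {T : measurableType d} (E U : nat -> T -> R) (w : T).
Hypotheses (L0pos : forall x, 0 < L0 x) (E0 : forall k, 0 <= E k w).
Local Notation s k := (base E U L0 n k w).
Local Notation e := (fun k => E k w).
Local Notation uu := (fun k => U k w).

(** The definition of the process and [step] differ in the bookkeeping only: 2^n times a holding
    time is the exponential variable divided by [kap]. *)
Lemma vrjp_run (a u : nat -> R) k : let: (x, l, J) := vrjp_state n L0 a u k in
  let s := run (hn n) (@chi0 R) (vinit L0 n) a u k in
  [/\ x = sX s, forall j, L0 (j%:~R / 2 ^+ n) + l j = sL s j & J = sJ s].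
Proof.
elim: k => [|k]; first by split => // j; rewrite addr0.
have -> : run (hn n) (@chi0 R) (vinit L0 n) a u k.+1 = let s := run (hn n) (@chi0 R) (vinit L0 n) a u k in
   step (hn n) (@chi0 R) s (a k) (u k * (lmv s + lpv s) < lpv s) by [].
move: (run _ _ _ _ _ k) => sk.
rewrite [vrjp_state _ _ _ _ k.+1]/=; case: (vrjp_state n L0 a u k) => -[x l] J [-> lE ->].
rewrite !lE -/(lmv sk) -/(lpv sk).
have tE : 2 ^+ n * (a k / (2 ^+ (2 * n) / 2 * (lmv sk + lpv sk))) = a k / kap (hn n) sk.
  rewrite /kap /hn mulnC exprM expr2; have [->|nz] := eqVneq (lmv sk + lpv sk) 0.
    by rewrite mulr0 !mul0r invr0 !mulr0.
  by field; rewrite nz expf_neq0.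
split => //=.
- by move=> j; case: eqP => [->|//]; rewrite tE addrA lE.
- rewrite /lcn addrAC subrr add0r -tE /hn mulrA mulVf ?mul1r // expf_neq0 //.
Qed.

Lemma vrjp_base k : let: (x, l, J) := vrjp_state n L0 e uu k in
  [/\ x = sX (s k), forall j, L0 (j%:~R / 2 ^+ n) + l j = sL (s k) j & J = sJ (s k)].
Proof.
have := vrjp_run e uu k; rewrite (_ : run _ _ _ e uu k = s k) // /base /st.
by congr run; apply/funext => i; rewrite ger0_norm.
Qed.

Lemma vrjp_siteE k : vrjp_site n L0 e uu k = sX (s k).
Proof. by rewrite /vrjp_site; have := vrjp_base k; case: vrjp_state => -[x l] J []. Qed.

Lemma vrjp_jumpE k : vrjp_jump n L0 e uu k = sJ (s k).
Proof. by rewrite /vrjp_jump; have := vrjp_base k; case: vrjp_state => -[x l] J []. Qed.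

Lemma sJ_mono k1 k2 : (k1 <= k2)%N -> sJ (s k1) <= sJ (s k2).
Proof. exact: sJ_le. Qed.

Lemma limn_eventually (u : nat -> R) N (l : R) : (forall M, (N <= M)%N -> u M = l) -> limn u = l.
Proof.
move=> h; apply: cvg_lim => //; apply: cvg_near_cst.
by exists N => // M /= NM; apply: h.
Qed.

Variables (k : nat) (t : R).
Hypotheses (tk : sJ (s k) <= t) (tk1 : t < sJ (s k.+1)).

Lemma vrjp_X_at : vrjp_X n L0 e uu t = (sX (s k))%:~R / 2 ^+ n.
Proof.
apply: (@limn_eventually _ k.+1) => M kM.
rewrite (bigD1 (Ordinal kM)) //= !vrjp_jumpE tk tk1 /= vrjp_siteE big1 ?addr0 // => i /eqP ik.
have {}ik : (i : nat) <> k by move=> h; apply: ik; apply: val_inj.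
rewrite !vrjp_jumpE ifF //; apply/negP => /andP[i1 i2].
have [h|h|//] := ltngtP i k.
  by have := le_lt_trans (le_trans (sJ_mono h) tk) i2; rewrite ltxx.
by have := lt_le_trans tk1 (le_trans (sJ_mono h) i1); rewrite ltxx.
Qed.

Lemma sL_sum m j : sL (s m) j = lon L0 n j +
  \sum_(i < m) (if sX (s i) == j then 2 ^+ n * (sJ (s i.+1) - sJ (s i)) else 0).
Proof.
elim: m => [|m IH]; first by rewrite big_ord0 addr0.
have [b Eb] := baseS E U L0 n m w.
have JE : sJ (s m.+1) - sJ (s m) = hn n * (lcn (hn n) (s m) `|E m w| - lcv (s m)).
  by rewrite Eb /= addrAC subrr add0r.
rewrite big_ord_recr addrA [nat_of_ord _]/= -IH JE mulrA /hn divff ?expf_neq0 // mul1r Eb.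
move: (s m) => sm /=; rewrite eq_sym.
by case: eqP => [<-|_]; rewrite ?addr0 // addrC subrK.
Qed.

(** Local times are monotone, so in the middle of a wait they are squeezed between their values at
    the two surrounding steps; the clocks of these two steps will have the same limit. *)
Lemma vrjp_L_at j : sL (s k) j <= L0 (j%:~R / 2 ^+ n) + vrjp_ell n L0 e uu t j <= sL (s k.+1) j.
Proof.
have -> : vrjp_ell n L0 e uu t j =
  \sum_(i < k) (if sX (s i) == j then 2 ^+ n * (sJ (s i.+1) - sJ (s i)) else 0) +
  (if sX (s k) == j then 2 ^+ n * (t - sJ (s k)) else 0).
  apply: (@limn_eventually _ k.+1) => M kM.
  rewrite -(subnKC kM) big_split_ord /= big_ord_recr /= [X in _ + X]big1 ?addr0.
    rewrite !vrjp_jumpE vrjp_siteE (min_idPl (ltW tk1)) (min_idPr tk); congr (_ + _).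
    apply: eq_bigr => i _; rewrite !vrjp_jumpE vrjp_siteE.
    by rewrite !(min_idPr _) // (le_trans _ tk) // sJ_mono // ltnW.
  move=> i _; rewrite !vrjp_jumpE !(min_idPl _) ?subrr ?mulr0 ?if_same //.
    by apply: le_trans (ltW tk1) _; apply: sJ_mono; rewrite leq_addr.
  by apply: le_trans (ltW tk1) _; apply: sJ_mono; rewrite -addnS leq_addr.
rewrite (sL_sum k j) (sL_sum k.+1 j) big_ord_recr [nat_of_ord _]/=.
move: tk tk1 (\sum_(i < k) _); rewrite -/(lon L0 n j); move: (sJ _) (sJ _) (_ == _) => J1 J2 [] h1 h2 Sm.
  have p : 0 < 2 ^+ n :> R by rewrite exprn_gt0.
  rewrite [lon L0 n j + (_ + _)]addrA lerDl mulr_ge0 ?subr_ge0 ?(ltW p) //=.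
  by rewrite -!addrA !lerD2l ler_pM2l // lerD2r ltW.
by rewrite /= !addr0 !lexx.
Qed.

End real_time.

(** * Deterministic limit of good paths driven by converging martingales *)

Section identification.
Context {R : realType} (L0 : R -> R).
Hypotheses (L0pos : forall x, 0 < L0 x) (L0c : continuous L0).
Hypothesis S0y : forall C : R, exists A0 : nat, forall A : nat, (A0 <= A)%N -> C <= S0 L0 A%:R.
Hypothesis S0Ny : forall C : R, exists A0 : nat, forall A : nat, (A0 <= A)%N -> S0 L0 (- A%:R) <= C.
Variables (b : R -> R) (Psi Lam : R -> R -> R).
Hypotheses (cb : continuous b) (bb : bass_burdzy b Psi Lam).
Context d {T : measurableType d} (E U : nat -> nat -> T -> R) (nn : nat -> nat) (w : nat -> T).
Context (FU : set_system nat) {UF : UltraFilter FU}.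
(** Scales [nn i] and sample points [w i] vary freely with i, and no probability is left in this
    section; [HM] below will come from [driving_limit]. *)
Hypothesis nny : forall N, \forall i \near FU, (N <= nn i)%N.
Hypothesis good : forall q : nat, exists (V B dl : R) (A m : nat),
  [/\ q%:R <= V, (q <= A)%N, 0 < dl, (0 < A)%N &
   \forall i \near FU, (m < nn i)%N /\ goodp L0 (E (nn i)) (U (nn i)) q V A m B dl (nn i) (w i)].

Definition tst i k := base (E (nn i)) (U (nn i)) L0 (nn i) k (w i).
Local Notation s := tst.
Local Notation lg i k x := (lgr (E (nn i)) (U (nn i)) L0 (nn i) k (w i) x).
Local Notation W i k := (sW (s i k)).

Hypothesis HM : forall (k : nat -> nat) (u : R), 0 <= u ->
  (fun i => W i (k i)) @ FU --> u -> (fun i => sM (s i (k i))) @ FU --> b u.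

Local Notation hh i := (hn (nn i) : R).
Definition spos i (j : int) : R := j%:~R / 2 ^+ (nn i).

Let vs i k : valid (hh i) (lon L0 (nn i)) (s i k). Proof. exact: valid_base. Qed.
Let W0 i k : 0 <= W i k. Proof. exact: sW_ge0. Qed.
Let stepE i k : exists bo : bool, s i k.+1 = step (hh i) (@chi0 R) (s i k) `|E (nn i) k (w i)| bo.
Proof. exact: baseS. Qed.
Let dw i k := dW (hh i) (s i k) `|E (nn i) k (w i)|.
Let WS i k : W i k.+1 = W i k + dw i k. Proof. by []. Qed.
Let dw0 i k : 0 <= dw i k. Proof. exact: dWb_ge0. Qed.
Let Wmono i k1 k2 : (k1 <= k2)%N -> W i k1 <= W i k2. Proof. exact: sW_le. Qed.

Lemma hn_lim : (fun i => hh i) @ FU --> (0 : R).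
Proof.
apply: ulim_eps => e e0; have [N hN] := hn_small e0.
apply: filterS (nny N) => i /hN hi; rewrite subr0 gtr0_norm ?hn_gt0 //; exact: ltW.
Qed.

(** Passes from [lgr] to log L itself, whose modulus also involves that of log [L0]; the accuracy q
    is taken beyond V0, A' and 2/tau at once. *)
Lemma window_pkg (V0 tau : R) (A' : nat) : 0 < tau -> exists (A m : nat) (B : R), (A' <= A)%N /\
  \forall i \near FU, [/\ (m < nn i)%N,
   forall k, W i k <= V0 -> `|sX (s i k)| < (A * 2 ^ nn i)%N%:Z,
   forall k, W i k <= V0 -> forall x : int, `|x| <= (A * 2 ^ nn i)%N%:Z -> lg i k x <= B &
   forall k, W i k <= V0 -> forall x y : int, `|x| <= (A * 2 ^ nn i)%N%:Z -> `|y| <= (A * 2 ^ nn i)%N%:Z ->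
    `|x - y| <= (2 ^ (nn i - m))%N%:Z -> `|ln (sL (s i k) x) - ln (sL (s i k) y)| <= tau].
Proof.
move=> tau0.
pose q := maxn (Num.bound `|V0|) (maxn A' (Num.bound (2 / tau))).
have qV : V0 <= q%:R.
  apply: le_trans (ler_norm _) _; apply: ltW; apply: lt_le_trans (archi_boundP (normr_ge0 _)) _.
  by rewrite ler_nat leq_maxl.
have qA : (A' <= q)%N by rewrite /q !leq_max leqnn orbT.
have qt : q.+1%:R^-1 <= tau / 2.
  rewrite -[tau / 2]invrK lef_pV2 ?posrE ?invr_gt0 ?divr_gt0 // invf_div.
  apply: ltW; apply: lt_le_trans (archi_boundP (divr_ge0 (ler0n R 2) (ltW tau0))) _.
  by rewrite ler_nat leqW // /q !leq_max leqnn !orbT.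
have [V [B [dl [A [m [Vq Aq dl0 A0 ev]]]]]] := good q.
have cl : continuous (fun x : R => ln (L0 x)).
  by move=> x; apply: (@continuous_comp _ _ _ L0 (@ln R)); [exact: L0c|exact: continuous_ln].
have [dd dd0 hd] := unif_cont A%:R cl (divr_gt0 tau0 (ltr0Sn R 1)).
have [m' hm'] := hn_small dd0.
exists A, (maxn m m'), B; split; first exact: leq_trans Aq.
apply: filterS (filterI ev (nny m'.+1)) => i [[mi [g1 g2 g3 [g4 _ _ _]]] m'i].
have VV k : W i k <= V0 -> W i k <= V by move/le_trans; apply; exact: le_trans Vq.
split; first by rewrite gtn_max mi.
- by move=> k /VV; exact: g2.
- by move=> k /VV; exact: g3.
move=> k kV x y xA yA xy.
have lnL z : ln (sL (s i k) z) = ln (lon L0 (nn i) z) + lg i k z.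
  by rewrite /tst sL_lgr // lnM ?posrE ?expR_gt0 ?lon_gt0 // expRK.
have ge : (nn i - maxn m m' <= nn i - m)%N by rewrite leq_sub2l // leq_maxl.
have h1 := g4 k (VV k kV) x y xA yA (le_trans xy _).
have {}h1 : `|lg i k x - lg i k y| <= q.+1%:R^-1.
  by apply: h1; rewrite lez_nat leq_exp2l.
have h2 : `|ln (lon L0 (nn i) x) - ln (lon L0 (nn i) y)| < tau / 2.
  apply: hd; first exact: site_window.
  apply: le_lt_trans (hm' m' (leqnn _)).
  rewrite -mulrBl normrM normfV (ger0_norm (exprn_ge0 _ _)) // -rmorphB /= -intr_norm.
  rewrite ler_pdivrMr ?exprn_gt0 // /hn.
  apply: (@le_trans _ _ ((2 ^ (nn i - m'))%N%:Z%:~R)).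
    rewrite ler_int; apply: le_trans xy _.
    by rewrite lez_nat leq_exp2l // leq_sub2l // leq_maxr.
  rewrite -[(_%:Z)%:~R]/((2 ^ (nn i - m'))%N%:R) natrX -[X in _ * 2 ^+ X](subnKC (ltnW m'i)) exprD mulrA mulVf ?mul1r // expf_neq0.
by rewrite !lnL; apply: (norm_add_split h1 h2 qt).
Qed.

Lemma dw_small (V0 ka : R) : 0 < ka -> \forall i \near FU, forall k, W i k <= V0 -> dw i k <= ka.
Proof.
move=> ka0; have [A [m [B [_ ev]]]] := window_pkg V0 0 ltr01.
have [c /andP[c0 c1] cL] := window_lb L0pos L0c A.
have p : 0 < ka * c ^+ 2 by rewrite mulr_gt0 // exprn_gt0.
have [N hN] := hn_small p.
apply: filterS (filterI ev (nny N)) => i [[_ win _ _] /hN hi] k kV.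
have [X0 X1 X2] := int_nbr (win k kV).
apply: le_trans (dW_small c0 (vs i k) (normr_ge0 _) (lon_window cL X0) (lon_window cL X1) (lon_window cL X2)) _.
by rewrite ler_pdivrMr ?exprn_gt0 // ltW.
Qed.

Lemma M_unif (V0 eta : R) : 0 < eta -> \forall i \near FU, forall k, W i k <= V0 -> `|sM (s i k) - b (W i k)| <= eta.
Proof.
move=> eta0; apply: (ev_uniform 0%N) => k bad.
have bd : \forall i \near FU, `|W i (k i)| <= V0.
  by apply: filterS bad => i /not_implyP[h _]; rewrite ger0_norm.
have [u Wu _] := ulim_ex bd.
have u0 : 0 <= u by apply: (ulim_ge Wu); apply: filterS bad => i _.
have h1 := HM u0 Wu; have h2 : (fun i => b (W i (k i))) @ FU --> b u by apply: ulim_comp Wu; exact: cb.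
have h3 : (fun i => sM (s i (k i)) - b (W i (k i))) @ FU --> b u - b u by apply: cvgB.
rewrite subrr in h3.
have [i [/not_implyP[_ h4]]] := filter_ex (filterI bad (cvg_dist h3 eta0)).
by rewrite subr0.
Qed.

(* Contraction: where the two trajectories differ by more than the distance of the driving
   paths, both move in the same direction or towards each other. *)
Lemma flow_unif (V0 e : R) : 0 <= V0 -> 0 < e -> \forall i \near FU, forall k, W i k <= V0 ->
  forall j : int, `|sS (s i k) j - Psi (W i k) (S0n L0 (nn i) j)| <= e.
Proof.
move=> V00 e0.
(* The error 2 eta + 3 ka + ep W is at most e, because ka <= eta / 2 and ep V0 <= e / 4. *)
pose eta := e / 8; have eta0 : 0 < eta by rewrite divr_gt0.
pose ep := e / (4 * (V0 + 1)); have ep0 : 0 < ep by rewrite divr_gt0 // mulr_gt0 //; lra.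
have epV (v : R) : 0 <= v -> v <= V0 -> ep * v <= e / 4.
  move=> v0 vV; rewrite /ep mulrAC ler_pdivrMr; last by rewrite mulr_gt0 //; lra.
  have -> : e / 4 * (4 * (V0 + 1)) = e * (V0 + 1) by field.
  by rewrite ler_pM2l //; lra.
pose tau := Num.min (1 / 2) (ep / 2).
have tau0 : 0 < tau by rewrite lt_min (divr_gt0 ltr01 (ltr0Sn R 1)) (divr_gt0 ep0 (ltr0Sn R 1)).
have [t1 t2] : tau <= 1 / 2 /\ tau <= ep / 2 by split; rewrite ge_min lexx ?orbT.
have eta2 : 0 < eta / 2 by rewrite divr_gt0.
have [dd dd0 hd] := unif_cont V0 cb eta2.
pose ka := Num.min (eta / 2) (dd / 2).
have ka0 : 0 < ka by rewrite lt_min !divr_gt0.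
have [k1 k2] : ka <= eta / 2 /\ ka <= dd / 2 by split; rewrite ge_min lexx ?orbT.
have [A [m [B [_ ev]]]] := window_pkg V0 0 tau0.
apply: filterS (filterI (filterI ev (nny m.+2)) (filterI (dw_small V0 ka0) (M_unif V0 eta0))) => i.
move=> [[[mi win _ lnd] mi2] [dwk Mk]].
have al k : W i k <= V0 -> let x := `|E (nn i) k (w i)| in
   [/\ `|alp (hh i) (s i k) x - dw i k| <= ep * dw i k, `|alm (hh i) (s i k) x - dw i k| <= ep * dw i k,
     0 <= alp (hh i) (s i k) x <= 2 * dw i k & 0 <= alm (hh i) (s i k) x <= 2 * dw i k].
  move=> kV x; have x0 : 0 <= x by exact: normr_ge0.
  have p1 := alp_le (hn_gt0 (nn i)) (vs i k) x0; have p2 := alm_le (hn_gt0 (nn i)) (vs i k) x0.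
  have lp := lpv_gt0 (vs i k); have lm := lmv_gt0 (vs i k).
  have [X0 X1 X2] := int_nbr (win k kV).
  have d2 : `|sX (s i k) + 1 - (sX (s i k) - 1)| <= (2 ^ (nn i - m))%N%:Z.
    have -> : sX (s i k) + 1 - (sX (s i k) - 1) = 2 by ring.
    have : (1 < 2 ^ (nn i - m))%N by rewrite -[1%N](expn0 2) ltn_exp2l // subn_gt0.
    by rewrite ger0_norm.
  have := lnd k kV _ _ X1 X2 d2; rewrite -/(lpv (s i k)) -/(lmv (s i k)) ler_norml => /andP[l1 l2].
  have ex : expR tau <= 1 + ep by apply: expR_small; rewrite ?(ltW tau0) //; lra.
  have r1 : lpv (s i k) <= (1 + ep) * lmv (s i k).
    apply: le_trans (ler_wpM2r (ltW lm) ex); rewrite -[lmv _ in leRHS]lnK ?posrE // -expRD.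
    by rewrite -[leLHS]lnK ?posrE // ler_expR; lra.
  have r2 : lmv (s i k) <= (1 + ep) * lpv (s i k).
    apply: le_trans (ler_wpM2r (ltW lp) ex); rewrite -[lpv _ in leRHS]lnK ?posrE // -expRD.
    by rewrite -[leLHS]lnK ?posrE // ler_expR; lra.
  have i0 := lcinv_ge0 (hn_gt0 (nn i)) (vs i k) x0.
  have hI : 0 <= hh i * ((lcv (s i k))^-1 - (lcn (hh i) (s i k) x)^-1) by rewrite mulr_ge0 // ltW // hn_gt0.
  have apE : alp (hh i) (s i k) x = hh i * ((lcv (s i k))^-1 - (lcn (hh i) (s i k) x)^-1) / lpv (s i k) by rewrite /alp mulrAC.
  have amE : alm (hh i) (s i k) x = hh i * ((lcv (s i k))^-1 - (lcn (hh i) (s i k) x)^-1) / lmv (s i k) by rewrite /alm mulrAC.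
  have q1 : alp (hh i) (s i k) x <= (1 + ep) * alm (hh i) (s i k) x.
    by rewrite apE amE; exact: inv_ratio.
  have q2 : alm (hh i) (s i k) x <= (1 + ep) * alp (hh i) (s i k) x.
    by rewrite apE amE; exact: inv_ratio.
  case/andP: (p1) => p10 _; case/andP: (p2) => p20 _.
  split => //; first exact: (alpha_ratio (ltW ep0) q1 q2 p10 p20).
  by have := alpha_ratio (ltW ep0) q2 q1 p20 p10; rewrite /dw /dW (addrC (alp _ _ _)).
move=> k kV j.
suff : `|sS (s i k) j - Psi (W i k) (S0n L0 (nn i) j)| <= 2 * eta + 3 * ka + ep * W i k.
  move=> h; exact: le_trans h (flow_budget erefl k1 (epV _ (W0 i k) kV) e0).
set y := S0n L0 (nn i) j.
elim: k kV => [|k IH] kV.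
  have -> : W i 0%N = 0 by [].
  have := Psi_dist cb bb y (lexx 0); rewrite normr_le0 subr_eq0 => /eqP ->.
  by rewrite subrr normr0 mulr0 addr0 addr_ge0 // mulr_ge0 // ltW.
have kV' : W i k <= V0 := le_trans (Wmono i (leqnSn k)) kV.
have {}IH := IH kV'; have [a1 a2 /andP[a3 a4] /andP[a5 a6]] := al k kV'.
have [bo Eb] := stepE i k.
have dk := dwk k kV'; have mk := Mk k kV'; have d0 := dw0 i k.
have PL := Psi_lip cb bb y (W0 i k) (Wmono i (leqnSn k)).
have wE : W i k.+1 - W i k = dw i k by rewrite WS addrAC subrr add0r.
rewrite wE in PL.
have bnear v : W i k <= v <= W i k.+1 -> `|b (W i k) - b v| < eta / 2.
  move=> /andP[v1 v2]; apply: hd; first by rewrite ger0_norm.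
  rewrite distrC ger0_norm ?subr_ge0 //; apply: (near_dd v2 wE dk k2 dd0).
have Pv v : W i k <= v <= W i k.+1 -> `|Psi v y - Psi (W i k) y| <= ka.
  move=> /andP[v1 v2]; apply: le_trans (Psi_lip cb bb y (W0 i k) v1) _.
  by apply: le_trans dk; rewrite -wE lerD2r.
have up : Psi (W i k) y + ka + eta / 2 < b (W i k) -> Psi (W i k.+1) y = Psi (W i k) y + dw i k.
  move=> h; rewrite -wE; apply: (Psi_up cb bb (W0 i k) (Wmono i (leqnSn k))) => v hv.
  by move: (bnear v hv) (Pv v hv) h; rewrite ltr_norml ler_norml => /andP[? ?] /andP[? ?]; exact: below_arith.
have down : b (W i k) < Psi (W i k) y - ka - eta / 2 -> Psi (W i k.+1) y = Psi (W i k) y - dw i k.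
  move=> h; rewrite -wE; apply: (Psi_down cb bb (W0 i k) (Wmono i (leqnSn k))) => v hv.
  by move: (bnear v hv) (Pv v hv) h; rewrite ltr_norml ler_norml => /andP[? ?] /andP[? ?]; exact: above_arith.
have S1 : sS (s i k.+1) j = if sX (s i k) < j then sS (s i k) j - alp (hh i) (s i k) `|E (nn i) k (w i)|
            else if j < sX (s i k) then sS (s i k) j + alm (hh i) (s i k) `|E (nn i) k (w i)| else sS (s i k) j.
  by rewrite Eb.
move: a1 a2 a3 a4 a5 a6 S1; move: (alp _ _ _) (alm _ _ _) => ap am a1 a2 a3 a4 a5 a6 S1.
have Sle := @sS_le R (hh i) (lon L0 (nn i)) (hn_gt0 (nn i)) (s i k).
have S2 : `|sS (s i k.+1) j - sS (s i k) j| <= 2 * dw i k.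
  rewrite S1; case: ltP => _; first by rewrite addrAC subrr add0r normrN ger0_norm.
  case: ltP => _; first by rewrite addrAC subrr add0r ger0_norm.
  by rewrite subrr normr0 mulr_ge0.
rewrite WS ler_norml; apply/andP; split.
  apply: (@flow_step_down R _ _ _ _ _ _ _ _ _ _ _ d0 dk (ltW ep0) (ltW eta0) (W0 i k) PL mk S2 k1).
    by move: IH; rewrite ler_norml => /andP[].
  rewrite S1; case: (ltgtP (sX (s i k)) j) => Xj.
  - right; split; [exact: Sle (vs i k) (ltW Xj)|split => //].
    by rewrite addrAC subrr add0r lerN2; move: a1; rewrite ler_norml lerBlDl => /andP[].
  - left; rewrite addrAC subrr add0r; move: a2; rewrite ler_norml => /andP[+ _].
    by rewrite lerBrDl.
  - right; split; [by rewrite -Xj|split => //].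
    by rewrite subrr oppr_le0 addr_ge0 // mulr_ge0 // ltW.
apply: (@flow_step_up R _ _ _ _ _ _ _ _ _ _ _ d0 dk (ltW ep0) (ltW eta0) (W0 i k) PL mk S2 k1).
  by move: IH; rewrite ler_norml => /andP[].
rewrite S1; case: (ltgtP (sX (s i k)) j) => Xj.
- left; rewrite addrAC subrr add0r lerN2; move: a1; rewrite ler_norml => /andP[+ _].
  by rewrite lerBrDl.
- right; split; [exact: Sle (vs i k) (ltW Xj)|split => //].
  by rewrite addrAC subrr add0r; move: a2; rewrite ler_norml lerBlDl => /andP[].
- right; split; [by rewrite -Xj|split => //].
  by rewrite subrr addr_ge0 // mulr_ge0 // ltW.
Qed.

Lemma spos_window (j : nat -> int) (x : R) (A' : nat) : (fun i => spos i (j i)) @ FU --> x -> `|x| + 1 <= A'%:R ->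
  \forall i \near FU, `|j i| <= (A' * 2 ^ nn i)%N%:Z.
Proof.
move=> jx xA; apply: filterS (cvg_dist jx ltr01) => i h; apply: (@site_le R); rewrite -/(spos i (j i)).
have -> : spos i (j i) = x + (spos i (j i) - x) by ring.
by apply: le_trans (ler_normD _ _) (le_trans _ xA); rewrite lerD2l.
Qed.

Lemma nat_above (x : R) : exists A : nat, x <= A%:R.
Proof.
exists (Num.bound `|x|); apply: le_trans (ler_norm _) _; apply: ltW; exact: archi_boundP.
Qed.

Lemma S0n_lim (j : nat -> int) (x : R) : (fun i => spos i (j i)) @ FU --> x ->
  (fun i => S0n L0 (nn i) (j i)) @ FU --> S0 L0 x.
Proof.
move=> jx; have [A' hA] := nat_above (`|x| + 1).
have jA := spos_window jx hA.
have h1 : (fun i => S0 L0 (spos i (j i))) @ FU --> S0 L0 x.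
  by apply: ulim_comp jx; exact: S0_cont.
apply: ulim_eps => e e0; have e2 : 0 < e / 2 by rewrite divr_gt0.
have [N hN] := S0n_cvg L0pos L0c A' e2.
apply: filterS (filterI (filterI jA (nny N)) (cvg_dist h1 e2)) => i [[ji ni] h2].
have := hN _ ni _ ji; rewrite -/(spos i (j i)) => h3.
by have := ler_distD (S0 L0 (spos i (j i))) (S0n L0 (nn i) (j i)) (S0 L0 x); lra.
Qed.

Lemma Wlim_bound (k : nat -> nat) (u : R) : (fun i => W i (k i)) @ FU --> u ->
  0 <= u /\ \forall i \near FU, W i (k i) <= u + 1.
Proof.
move=> Wu; split; first by apply: (ulim_ge Wu); apply: filterS (nny 0) => i _.
by apply: filterS (cvg_dist Wu ltr01) => i; rewrite ler_norml lerBlDl => /andP[].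
Qed.

Lemma flow_lim (k : nat -> nat) (j : nat -> int) (u x : R) :
  (fun i => W i (k i)) @ FU --> u -> (fun i => spos i (j i)) @ FU --> x ->
  (fun i => sS (s i (k i)) (j i)) @ FU --> Psi u (S0 L0 x).
Proof.
move=> Wu jx; have [u0 Wb] := Wlim_bound Wu.
have h1 : (fun i => Psi (W i (k i)) (S0n L0 (nn i) (j i))) @ FU --> Psi u (S0 L0 x).
  by apply: (ulim_two _ _ Wu (S0n_lim jx)) => // e e0; exact: (Psi_cont bb).
have u1 : 0 <= u + 1 by rewrite addr_ge0.
apply: ulim_eps => e e0; have e2 : 0 < e / 2 by rewrite divr_gt0.
apply: filterS (filterI (filterI Wb (flow_unif u1 e2)) (cvg_dist h1 e2)) => i [[wb fl] h2].
have h3 := fl (k i) wb (j i).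
have := ler_distD (Psi (W i (k i)) (S0n L0 (nn i) (j i))) (sS (s i (k i)) (j i)) (Psi u (S0 L0 x)).
by move: h2 h3; move: (`|_ - Psi u _|) => z; lra.
Qed.

Local Notation xi := (reduced_process b Psi).

(** A limit x of the positions satisfies Psi_u(S0 x) = b u, because the martingale is the scale
    function at the walk; injectivity of the flow identifies S0 x with xi u. *)
Lemma X_lim (k : nat -> nat) (u : R) : (fun i => W i (k i)) @ FU --> u ->
  (fun i => spos i (sX (s i (k i)))) @ FU --> S0inv L0 (xi u).
Proof.
move=> Wu; have [u0 Wb] := Wlim_bound Wu.
have [A [m [B [_ ev]]]] := window_pkg (u + 1) 0 ltr01.
have bd : \forall i \near FU, `|spos i (sX (s i (k i)))| <= A%:R.
  apply: filterS (filterI Wb ev) => i [wb [_ win _ _]]; apply: site_window; apply: ltW; exact: win.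
have [x Xx _] := ulim_ex bd.
have h1 := flow_lim Wu Xx; have h2 := HM u0 Wu.
have E1 : Psi u (S0 L0 x) = b u by exact: (ulim_unique h1 h2).
have E2 : S0 L0 x = xi u by apply: (Psi_inj bb u0); rewrite E1 (xiP bb u0).
by rewrite -E2 S0invK.
Qed.

Lemma S_diff i k (j : int) (D : nat) (tau : R) : 0 <= tau -> tau <= 1 / 4 ->
  (forall t : nat, (t <= D)%N -> `|ln (sL (s i k) (j + t%:Z)) - ln (sL (s i k) j)| <= tau) ->
  `|sS (s i k) (j + D%:Z) - sS (s i k) j - D%:R * hh i * (sL (s i k) j) ^- 2| <=
  D%:R * hh i * (sL (s i k) j) ^- 2 * (4 * tau).
Proof.
move=> t0 t1; elim: D => [|D IH] ht; first by rewrite addr0 subrr !mul0r subrr normr0.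
have {}IH := IH (fun t tD => ht t (leqW tD)).
have jE : j + D.+1%:Z = j + D%:Z + 1 by rewrite -addn1 PoszD addrA.
have [_ [ed _]] := vs i k; have := ed (j + D%:Z); rewrite -jE => eD.
have pz z : 0 < sL (s i k) z by exact: (valid_gt0 z (vs i k)).
have := @edge_ratio R _ _ _ tau (pz (j + D%:Z)) (pz (j + D.+1%:Z)) (pz j) t0 t1 (ht D (leqnSn D)) (ht D.+1 (leqnn _)).
move: eD IH; rewrite (_ : D.+1%:R = D%:R + 1 :> R); last by rewrite natr1.
move: (sS _ (j + D.+1%:Z)) (sS _ (j + D%:Z)) (sS _ j) => S1 S2 S3 eD IH er.
apply: (edge_sum (hn_gt0 (nn i)) eD IH er).
Qed.

(** The occupation profile of the limit as a function of the flow time u. *)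
Definition ell u x := L0 x * powR (1 - 2 * Lam u (S0 L0 x)) (- (1 / 2)).

(** Along the ultrafilter the local times have some limit l. Near the site the discrete scale
    functions have slope about L^-2 uniformly in i, so the limiting flow has difference quotients
    close to l^-2; its derivative (1 - 2 Lam)/L0^2 must equal l^-2, and [ell] is the solution l. *)
Lemma L_lim (k : nat -> nat) (j : nat -> int) (u x : R) :
  (fun i => W i (k i)) @ FU --> u -> (fun i => spos i (j i)) @ FU --> x ->
  (fun i => sL (s i (k i)) (j i)) @ FU --> ell u x.
Proof.
move=> Wu jx; have [u0 Wb] := Wlim_bound Wu.
have [A' hA] := nat_above (`|x| + 1); have jA := spos_window jx hA.
have [A [m [B [AA ev]]]] := window_pkg (u + 1) A' ltr01.
have wide (n A1 A2 : nat) (z : int) : (A1 <= A2)%N -> `|z| <= (A1 * 2 ^ n)%N%:Z -> `|z| <= (A2 * 2 ^ n)%N%:Z.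
  by move=> le /le_trans; apply; rewrite lez_nat leq_mul2r le orbT.
have bd : \forall i \near FU, `|lg i (k i) (j i)| <= B.
  apply: filterS (filterI (filterI Wb jA) ev) => i [[wb ja] [_ _ lb _]].
  by rewrite ger0_norm ?lgr_ge0 //; apply: lb => //; exact: (wide _ _ _ _ AA).
have [g gl _] := ulim_ex bd.
pose l := L0 x * expR g; have l0 : 0 < l by rewrite mulr_gt0 ?expR_gt0.
have Ll : (fun i => sL (s i (k i)) (j i)) @ FU --> l.
  have -> : (fun i => sL (s i (k i)) (j i)) = (fun i => L0 (spos i (j i)) * expR (lg i (k i) (j i))).
    by apply/funext => i; rewrite /tst sL_lgr.
  apply: cvgM; first by apply: ulim_comp jx; exact: L0c.
  by apply: ulim_comp gl; exact: continuous_expR.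
pose f y := Psi u (S0 L0 y).
pose f' := (1 - 2 * Lam u (S0 L0 x)) * L0 x ^- 2.
have df : is_derive x (1 : R) f f'.
  have D1 := S0_derive L0pos L0c x; have D2 := Psi_derive bb (S0 L0 x) u0.
  by have := is_derive1_comp D2 D1.
have key dlt : 0 < dlt -> dlt <= 1 -> `|f' - l ^- 2| <= l ^- 2 * dlt.
  move=> d0 d1.
  have tau0 : 0 < dlt / 4 by rewrite divr_gt0.
  have [A2 [m2 [B2 [AA2 ev2]]]] := window_pkg (u + 1) A'.+1 tau0.
  (* The quotient of the flow over the fixed distance 2^-m', obtained as a limit over 2^(nn i - m')
     edges of scale [nn i]. *)
  have quot m' : (m2 <= m')%N -> `|f (x + hn m') - f x - hn m' * l ^- 2| <= hn m' * l ^- 2 * dlt.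
    move=> mm.
    have jx' : (fun i => spos i (j i + (2 ^ (nn i - m'))%N%:Z)) @ FU --> x + hn m'.
      have h1 : (fun i => spos i (j i) + hn m') @ FU --> x + hn m' by apply: cvgD => //; exact: cvg_cst.
      apply: cvg_trans h1; apply: near_eq_cvg; apply: filterS (nny m') => i ni.
      rewrite /spos rmorphD /= mulrDl; congr (_ + _).
      rewrite -[(_%:Z)%:~R]/((2 ^ (nn i - m'))%N%:R) natrX -[X in _ / 2 ^+ X](subnKC ni) exprD /hn.
      by field; rewrite !expf_neq0.
    have h1 := flow_lim Wu jx'; have h2 := flow_lim Wu jx.
    have il : (fun i => (sL (s i (k i)) (j i)) ^- 2) @ FU --> l ^- 2.
      apply: cvgV; first by rewrite expf_neq0 // gt_eqF.
      rewrite -[l ^+ 2]/(l * l).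
      exact: (@cvgM _ _ _ _ (fun i => sL (s i (k i)) (j i)) (fun i => sL (s i (k i)) (j i))).
    have h3 : (fun i => sS (s i (k i)) (j i + (2 ^ (nn i - m'))%N%:Z) - sS (s i (k i)) (j i) -
        hn m' * (sL (s i (k i)) (j i)) ^- 2) @ FU --> f (x + hn m') - f x - hn m' * l ^- 2.
      by apply: cvgB; [exact: cvgB|apply: cvgM => //; exact: cvg_cst].
    have h4 : (fun i => hn m' * (sL (s i (k i)) (j i)) ^- 2 * dlt) @ FU --> hn m' * l ^- 2 * dlt.
      by apply: cvgM; [apply: cvgM => //; exact: cvg_cst|exact: cvg_cst].
    have h6 : (fun i => `|sS (s i (k i)) (j i + (2 ^ (nn i - m'))%N%:Z) - sS (s i (k i)) (j i) -
        hn m' * (sL (s i (k i)) (j i)) ^- 2| - hn m' * (sL (s i (k i)) (j i)) ^- 2 * dlt) @ FU -->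
        `|f (x + hn m') - f x - hn m' * l ^- 2| - hn m' * l ^- 2 * dlt by apply: cvgB => //; exact: cvg_norm h3.
    rewrite -subr_le0; apply: (ulim_le h6).
    apply: filterS (filterI (filterI Wb jA) (filterI ev2 (nny m'))) => i [[wb ja] [[m2i _ _ lnd] ni]].
    have De : (2 ^ (nn i - m'))%N%:R * hn (nn i) = hn m' :> R.
      by rewrite natrX /hn -[X in (2 ^+ X)^-1](subnKC ni) exprD; field; rewrite !expf_neq0.
    rewrite subr_le0.
    have := @S_diff i (k i) (j i) (2 ^ (nn i - m')) (dlt / 4) (ltW tau0) _ _.
    rewrite De (_ : 4 * (dlt / 4) = dlt); last by field.
    apply; first by rewrite ler_pM2r.
    move=> t tD; apply: lnd => //.
    - apply: (wide _ _ _ _ AA2); rewrite mulSn.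
      have : (2 ^ (nn i - m') <= 2 ^ nn i)%N by rewrite leq_exp2l // leq_subr.
      move: (2 ^ nn i)%N (A' * 2 ^ nn i)%N (2 ^ (nn i - m'))%N ja tD => a1 a2 a3 ja tD le.
      apply: le_trans (ler_normD _ _) _; rewrite PoszD addrC lerD // ger0_norm //.
      by rewrite lez_nat (leq_trans tD).
    - by apply: (wide _ _ _ _ AA2); apply: (wide _ _ _ _ (leqnSn A')).
    - rewrite addrAC subrr add0r ger0_norm // lez_nat (leq_trans tD) // leq_exp2l // leq_sub2l //.
  apply/ler_addgt0Pr => e e0.
  have [dd dd0 hd] := derive_eps df e0.
  have [N hN] := hn_small dd0.
  pose m' := maxn m2 N.
  have hp : 0 < hn m' :> R by exact: hn_gt0.
  have := hd (hn m') _ _; rewrite gt_eqF // gtr0_norm // => /(_ isT (hN m' (leq_maxr _ _))) q1.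
  have q2 := quot m' (leq_maxl _ _).
  exact: (quotient_arith hp q1 q2).
have : f' = l ^- 2.
  apply/eqP; rewrite -subr_eq0 -normr_le0 leNgt; apply/negP => pos.
  have li : 0 < l ^- 2 by rewrite invr_gt0 exprn_gt0.
  pose dlt := Num.min 1 (`|f' - l ^- 2| / l ^- 2 / 2).
  have d0 : 0 < dlt by rewrite lt_min ltr01 !divr_gt0.
  have d1 : dlt <= 1 by rewrite ge_min lexx.
  have d2 : dlt <= `|f' - l ^- 2| / l ^- 2 / 2 by rewrite ge_min lexx orbT.
  have := key dlt d0 d1; apply/negP; rewrite -ltNge.
  apply: (@le_lt_trans _ _ (l ^- 2 * (`|f' - l ^- 2| / l ^- 2 / 2))); first by rewrite ler_pM2l.
  have -> : l ^- 2 * (`|f' - l ^- 2| / l ^- 2 / 2) = `|f' - l ^- 2| / 2.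
    exact: half_arith.
  by rewrite ltr_pdivrMr // ltr_pMr // ltr1n.
move=> fE; have [_ Lb] := Lam_bnd bb (S0 L0 x) u0.
suff -> : ell u x = l by [].
by rewrite /ell; apply: (sqrt_profile (L0pos x) l0 _ fE); lra.
Qed.

(** The density of real time with respect to flow time, that is, the integrand of [lrm_clock]; see
    [rhocE]. *)
Definition rhoc (v : R) : R := ell v (S0inv L0 (xi v)) ^+ 3.

Lemma rhocE v : 0 <= v ->
  rhoc v = L0 (S0inv L0 (xi v)) ^+ 3 * powR (1 - 2 * Lam v (xi v)) (- (3 / 2)).
Proof.
move=> v0; rewrite /rhoc /ell S0Kinv // exprMn; congr (_ * _).
by rewrite -powR_mulrn ?powR_ge0 // -powRrM; congr (powR _ _); field.
Qed.

Let rr (v : R) := rhoc (Num.max v 0).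

Let max0 (v : R) : 0 <= Num.max v 0. Proof. by rewrite le_max lexx orbT. Qed.

Let max_near (v v' dl : R) : `|v - v'| < dl -> `|Num.max v 0 - Num.max v' 0| < dl.
Proof.
apply: le_lt_trans.
have [h1|h1] := leP v 0; have [h2|h2] := leP v' 0; rewrite ?subrr ?normr0 //.
- rewrite sub0r normrN gtr0_norm // ltr0_norm ?subr_lt0 //; last by lra.
  by lra.
- by rewrite subr0 !gtr0_norm ?subr_gt0 //; lra.
Qed.

Lemma rr_cont : continuous rr.
Proof.
move=> v0; pose v : R := v0.
have xc : (fun t : R => xi (Num.max t 0)) @ v --> xi (Num.max v 0).
  apply/cvgrPdist_lt => e e0; have [dl dl0 hd] := xi_cont cb bb (max0 v) e0.
  by apply/nbhs_ballP; exists dl => //= t tv; apply: hd => //; exact: max_near.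
have Lc : (fun t : R => Lam (Num.max t 0) (xi (Num.max t 0))) @ v --> Lam (Num.max v 0) (xi (Num.max v 0)).
  apply/cvgrPdist_lt => e e0; have [dl dl0 hd] := Lam_cont bb (xi (Num.max v 0)) (max0 v) e0.
  have /cvgrPdist_lt/(_ dl dl0) xn := xc.
  have /nbhs_ballP[dl' /= dl'0 hd'] := xn.
  apply/nbhs_ballP; exists (Num.min dl dl') => /=; first by rewrite lt_min dl0.
  move=> t; rewrite /ball /= lt_min => /andP[t1 t2]; apply: hd => //; first exact: max_near.
  exact: hd'.
have [_ Lb] := Lam_bnd bb (xi (Num.max v 0)) (max0 v).
have c1 : (fun t : R => L0 (S0inv L0 (xi (Num.max t 0)))) @ v --> L0 (S0inv L0 (xi (Num.max v 0))).
  by apply: continuous_cvg; [exact: L0c|apply: continuous_cvg; [exact: S0inv_cont|exact: xc]].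
have c2 : (fun t : R => (Num.sqrt (1 - 2 * Lam (Num.max t 0) (xi (Num.max t 0))))^-1) @ v -->
   (Num.sqrt (1 - 2 * Lam (Num.max v 0) (xi (Num.max v 0))))^-1.
  apply: cvgV; first by rewrite gt_eqF // sqrtr_gt0; lra.
  have c3 : (fun t : R => 1 - 2 * Lam (Num.max t 0) (xi (Num.max t 0))) @ v --> 1 - 2 * Lam (Num.max v 0) (xi (Num.max v 0)).
    by apply: cvgB; [exact: cvg_cst|apply: cvgM => //; exact: cvg_cst].
  exact: (cvg_comp _ _ c3 (@sqrt_continuous R _)).
have rE : rr = (fun t => let z := L0 (S0inv L0 (xi (Num.max t 0))) * (Num.sqrt (1 - 2 * Lam (Num.max t 0) (xi (Num.max t 0))))^-1 in z * (z * z)).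
  apply/funext => t; have [_ Lt] := Lam_bnd bb (xi (Num.max t 0)) (max0 t).
  by rewrite /rr /rhoc /ell S0Kinv // powR_mhalf; [rewrite !exprS expr0 mulr1|lra].
pose z (t : R) : R := L0 (S0inv L0 (xi (Num.max t 0))) * (Num.sqrt (1 - 2 * Lam (Num.max t 0) (xi (Num.max t 0))))^-1.
have c4 : z @ v --> z v by apply: cvgM.
have c5 : (fun t => z t * (z t * z t)) @ v --> z v * (z v * z v) by apply: cvgM => //; apply: cvgM.
by rewrite rE; exact: c5.
Qed.

Let xs i k := `|E (nn i) k (w i)|.
(** Real time per unit of clock, see [sJS]. The last factor is the harmonic mean of the two
    neighbouring local times, so the limit is the cube of the profile. *)
Let gain i k := lcv (s i k) * lcn (hh i) (s i k) (xs i k) * (2 * lpv (s i k) * lmv (s i k) / (lpv (s i k) + lmv (s i k))).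

Let sJS i k : sJ (s i k.+1) - sJ (s i k) = gain i k * dw i k.
Proof.
have [bo ->] := stepE i k.
have x0 : 0 <= xs i k by exact: normr_ge0.
have p0 := lpv_gt0 (vs i k); have m0 := lmv_gt0 (vs i k); have c0 := lcv_gt0 (vs i k).
have n0 := lcn_gt0 (hn_gt0 (nn i)) (vs i k) x0; have h0 := hn_gt0 (R := R) (nn i).
rewrite /= addrAC subrr add0r /dw (dWE (vs i k) x0) -/(xs i k) /gain.
have nE : lcn (hh i) (s i k) (xs i k) - lcv (s i k) = xs i k * (2 * hh i) / (lmv (s i k) + lpv (s i k)).
  by rewrite /lcn /kap invf_div mulrA addrAC subrr add0r.
rewrite nE; move: (lcn _ _ _) n0 => l l0.
by field; rewrite !gt_eqF // ?addr_gt0.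
Qed.

Lemma dw_lim (k : nat -> nat) (u : R) : (fun i => W i (k i)) @ FU --> u -> (fun i => W i (k i).+1) @ FU --> u.
Proof.
move=> Wu; have [u0 Wb] := Wlim_bound Wu.
have d0 : (fun i => dw i (k i)) @ FU --> (0 : R).
  apply: ulim_eps => e e0; apply: filterS (filterI Wb (dw_small (u + 1) e0)) => i [wb dk].
  by rewrite subr0 ger0_norm // dk.
have -> : (fun i => W i (k i).+1) = (fun i => W i (k i) + dw i (k i)) by [].
by rewrite -[u in _ --> u]addr0; apply: cvgD.
Qed.

Lemma gain_lim (k : nat -> nat) (u : R) : (fun i => W i (k i)) @ FU --> u ->
  (fun i => gain i (k i)) @ FU --> rhoc u.
Proof.
move=> Wu; have [u0 _] := Wlim_bound Wu; have Wu1 := dw_lim Wu.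
have X0 := X_lim Wu; set x := S0inv L0 (xi u) in X0.
have hp : (fun i => spos i (sX (s i (k i)) + 1)) @ FU --> x.
  have -> : (fun i => spos i (sX (s i (k i)) + 1)) = (fun i => spos i (sX (s i (k i))) + hh i).
    by apply/funext => i; rewrite /spos rmorphD /= mulrDl mul1r.
  by rewrite -[x]addr0; apply: cvgD => //; exact: hn_lim.
have hm : (fun i => spos i (sX (s i (k i)) - 1)) @ FU --> x.
  have -> : (fun i => spos i (sX (s i (k i)) - 1)) = (fun i => spos i (sX (s i (k i))) - hh i).
    by apply/funext => i; rewrite /spos rmorphB /= mulrBl mul1r.
  by rewrite -[x]subr0; apply: cvgB => //; exact: hn_lim.
have l1 := L_lim Wu X0; have l2 := L_lim Wu hp; have l3 := L_lim Wu hm.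
have l4 : (fun i => lcn (hh i) (s i (k i)) (xs i (k i))) @ FU --> ell u x.
  have -> : (fun i => lcn (hh i) (s i (k i)) (xs i (k i))) = (fun i => sL (s i (k i).+1) (sX (s i (k i)))).
    by apply/funext => i; have [bo ->] := stepE i (k i); rewrite /= eqxx.
  exact: (L_lim Wu1 X0).
have [_ Lb] := Lam_bnd bb (S0 L0 x) u0.
have e0 : 0 < ell u x by rewrite mulr_gt0 // powR_gt0; lra.
have -> : rhoc u = ell u x * ell u x * (2 * ell u x * ell u x / (ell u x + ell u x)).
  by rewrite /rhoc -/x; field; rewrite gt_eqF // addr_gt0.
apply: cvgM; first exact: cvgM.
apply: cvgM; first by apply: cvgM => //; apply: cvgM => //; exact: cvg_cst.
by apply: cvgV; [rewrite gt_eqF // addr_gt0|exact: cvgD].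
Qed.

Lemma clock_unif (V0 e : R) : 0 < e -> \forall i \near FU, forall k, W i k <= V0 ->
  `|sJ (s i k.+1) - sJ (s i k) - rr (W i k) * dw i k| <= e * dw i k.
Proof.
move=> e0; apply: (ev_uniform 0%N) => k bad.
have bd : \forall i \near FU, `|W i (k i)| <= V0.
  by apply: filterS bad => i /not_implyP[h _]; rewrite ger0_norm.
have [u Wu _] := ulim_ex bd; have [u0 _] := Wlim_bound Wu.
have h1 := gain_lim Wu.
have h2 : (fun i => rr (W i (k i))) @ FU --> rhoc u.
  by rewrite -[u in rhoc u](max_idPl u0); apply: ulim_comp Wu; exact: rr_cont.
have h3 : (fun i => gain i (k i) - rr (W i (k i))) @ FU --> rhoc u - rhoc u by apply: cvgB.
rewrite subrr in h3.
have [i [/not_implyP[_ h4]]] := filter_ex (filterI bad (cvg_dist h3 e0)).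
rewrite subr0 => h5; apply: h4; rewrite sJS -mulrBl normrM (ger0_norm (dw0 _ _)) ler_wpM2r //.
Qed.

Lemma clock_lim (k : nat -> nat) (u : R) : (fun i => W i (k i)) @ FU --> u ->
  (fun i => sJ (s i (k i))) @ FU --> lrm_clock L0 b Psi Lam u.
Proof.
move=> Wu; have [u0 Wb] := Wlim_bound Wu.
have -> : lrm_clock L0 b Psi Lam u = prim rr u.
  rewrite /lrm_clock /prim u0; apply: eq_Rintegral => v; rewrite inE /= in_itv /= => /andP[v0 _].
  by rewrite /rr (max_idPl v0) rhocE.
have h1 : (fun i => prim rr (W i (k i))) @ FU --> prim rr u.
  apply: ulim_comp Wu; apply: differentiable_continuous; apply/derivable1_diffP.
  by have D := prim_derive u rr_cont; exact: ex_derive.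
apply: ulim_eps => e e0.
(* Two errors [e1] per unit of clock, one from [clock_unif] and one from the oscillation of [rr],
   add up to at most e / 2 below the level u + 1. *)
pose e1 := e / (4 * (u + 1)); have e10 : 0 < e1 by rewrite divr_gt0 // mulr_gt0 //; lra.
have [dd dd0 hd] := unif_cont (u + 1) rr_cont e10.
have e2 : 0 < e / 2 by rewrite divr_gt0.
have dd2 : 0 < dd / 2 by rewrite divr_gt0.
apply: filterS (filterI (filterI Wb (cvg_dist h1 e2)) (filterI (clock_unif (u + 1) e10) (dw_small (u + 1) dd2))).
move=> i [[wb h2] [cu ds]].
suff key : forall k', W i k' <= u + 1 -> `|sJ (s i k') - prim rr (W i k')| <= 2 * e1 * W i k'.
  have := key _ wb; have := ler_distD (prim rr (W i (k i))) (sJ (s i (k i))) (prim rr u).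
  have : 2 * e1 * W i (k i) <= e / 2.
    apply: le_trans (ler_wpM2l _ wb) _; first by rewrite mulr_ge0 // ltW.
    rewrite /e1 (_ : 2 * (e / (4 * (u + 1))) * (u + 1) = e / 2) //.
    by field; rewrite gt_eqF //; lra.
  by move: h2; lra.
elim=> [|k' IH] kV.
  have -> : W i 0%N = 0 by [].
  by rewrite prim0 mulr0 subr0 normr0.
have kV' : W i k' <= u + 1 := le_trans (Wmono i (leqnSn k')) kV.
have {}IH := IH kV'; have c1 := cu k' kV'; have d1 := ds k' kV'.
have wE : W i k'.+1 - W i k' = dw i k' by rewrite WS addrAC subrr add0r.
have := @prim_dist R rr (W i k') (W i k'.+1) (rr (W i k')) e1 rr_cont (Wmono i (leqnSn k')).
rewrite wE => /(_ _)/wrap[].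
  move=> z /andP[z1 z2]; rewrite distrC ltW // hd //; first by rewrite ger0_norm.
  by rewrite distrC ger0_norm ?subr_ge0 //; apply: (near_dd z2 wE d1 (lexx _) dd0).
move=> p1; rewrite WS -/(W i k').
exact: (clock_arith2 IH c1 p1).
Qed.

Local Notation clk := (lrm_clock L0 b Psi Lam).

Lemma rr_gt0 v : 0 < rr v.
Proof.
have [_ Lb] := Lam_bnd bb (xi (Num.max v 0)) (max0 v).
by rewrite /rr /rhoc exprn_gt0 // /ell S0Kinv // mulr_gt0 // powR_gt0; lra.
Qed.

Lemma clkE u : 0 <= u -> clk u = prim rr u.
Proof.
move=> u0; rewrite /lrm_clock /prim u0; apply: eq_Rintegral => v; rewrite inE /= in_itv /= => /andP[v0 _].
by rewrite /rr (max_idPl v0) rhocE.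
Qed.

Lemma prim_rr_cont : continuous (prim rr).
Proof.
move=> u; apply: differentiable_continuous; apply/derivable1_diffP.
by have D := prim_derive u rr_cont; exact: ex_derive.
Qed.

Lemma prim_rr_mono (u v : R) : u < v -> prim rr u < prim rr v.
Proof.
move=> uv; have [c _ Ec] : exists2 c : R, c \in `]u, v[%R & prim rr v - prim rr u = rr c * (v - u).
  apply: (@MVT R (prim rr) rr) => //; first by move=> z _; apply: prim_derive; exact: rr_cont.
  by apply: continuous_subspaceT; exact: prim_rr_cont.
by rewrite -subr_gt0 Ec mulr_gt0 ?subr_gt0 // rr_gt0.
Qed.

(** For the discrete paths the real time is at least q when the clock passes V, and this bound
    survives in the limit. It makes [lrm_time] well defined at every time. *)
Lemma clk_unbounded (C : R) : exists2 V : R, 0 <= V & C <= clk V.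
Proof.
have [q Cq] := nat_above C.
have [V [B [dl [A [m [Vq Aq dl0 A0 ev]]]]]] := good q.
have V0 : 0 <= V by apply: le_trans Vq.
exists V => //; apply: le_trans Cq _.
pose k i := xget 0%N [set k | V <= W i k /\ forall k', (k' < k)%N -> W i k' < V].
have kP : \forall i \near FU, [/\ V <= W i (k i), forall k', (k' < k i)%N -> W i k' < V & q%:R <= sJ (s i (k i))].
  apply: filterS ev => i [_ [_ _ _ [_ _ [k1 hk1] Jq]]].
  have ex : exists k, V <= W i k by exists k1; exact: ltW.
  have [k0 hk0 min0] := ex_minnP ex.
  have [h1 h2] : V <= W i (k i) /\ forall k', (k' < k i)%N -> W i k' < V.
    apply: (xgetPex 0%N (P := [set k | V <= W i k /\ forall k', (k' < k)%N -> W i k' < V])).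
    exists k0; split => // k' kk; rewrite ltNge; apply/negP => /min0; rewrite leqNgt kk //.
  by split => //; exact: Jq.
have Wu : (fun i => W i (k i)) @ FU --> V.
  apply: ulim_eps => e e0; apply: filterS (filterI kP (dw_small V e0)) => i [[h1 h2 _] dk].
  rewrite ger0_norm ?subr_ge0 //; case: (k i) h1 h2 => [|k'] h1 h2.
    by have : W i 0%N = 0 by []; move: h1 => /[swap] ->; lra.
  have lt := h2 k' (ltnSn _); have := dk k' (ltW lt); rewrite WS; lra.
apply: (ulim_ge (clock_lim Wu)); by apply: filterS kP => i [].
Qed.

Lemma clk_inj u v : 0 <= u -> 0 <= v -> clk u = clk v -> u = v.
Proof.
by move=> u0 v0; rewrite !clkE // => h; case: (ltgtP u v) => // /prim_rr_mono; rewrite h ltxx.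
Qed.

Lemma lrm_timeP t : 0 <= t -> 0 <= lrm_time L0 b Psi Lam t /\ clk (lrm_time L0 b Psi Lam t) = t.
Proof.
move=> t0; apply: (xgetPex 0 (P := [set u | 0 <= u /\ clk u = t])).
have [V V0 tV] := clk_unbounded t.
have [u uV uE] : exists2 c : R, c \in `[0, V]%R & prim rr c = t.
  apply: IVT => //; first by apply: continuous_subspaceT; exact: prim_rr_cont.
  by rewrite prim0 -clkE // ge_min t0 /= le_max tV orbT.
move: uV; rewrite in_itv /= => /andP[u0 _].
by exists u; split => //; rewrite clkE.
Qed.

Lemma lrm_time_lim (t : nat -> R) (t1 : R) : (forall i, 0 <= t i) -> t @ FU --> t1 ->
  (fun i => lrm_time L0 b Psi Lam (t i)) @ FU --> lrm_time L0 b Psi Lam t1.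
Proof.
move=> t0 tt; have t10 : 0 <= t1 by apply: (ulim_ge tt); apply: filterS (nny 0) => i _.
have [V V0 tV] := clk_unbounded (t1 + 1).
have bd : \forall i \near FU, `|lrm_time L0 b Psi Lam (t i)| <= V.
  apply: filterS (cvg_dist tt ltr01) => i; rewrite ler_norml lerBlDl => /andP[_ h].
  have [u0 uE] := lrm_timeP (t0 i); rewrite ger0_norm // leNgt; apply/negP => /prim_rr_mono.
  by rewrite -!clkE // uE; lra.
have [u Tu _] := ulim_ex bd.
have u0 : 0 <= u by apply: (ulim_ge Tu); apply: filterS (nny 0) => i _; exact: (lrm_timeP (t0 i)).1.
suff -> : lrm_time L0 b Psi Lam t1 = u by [].
have [v0 vE] := lrm_timeP t10; apply: clk_inj => //; rewrite vE.
have h1 : (fun i => prim rr (lrm_time L0 b Psi Lam (t i))) @ FU --> prim rr u.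
  by apply: ulim_comp Tu; exact: prim_rr_cont.
have h2 : t @ FU --> prim rr u.
  apply: cvg_trans h1; apply: near_eq_cvg; apply: filterS (nny 0) => i _.
  by have [a1 a2] := lrm_timeP (t0 i); rewrite -clkE.
by rewrite clkE //; exact: (ulim_unique tt h2).
Qed.

Local Notation vX i t := (vrjp_X (nn i) L0 (fun k => E (nn i) k (w i)) (fun k => U (nn i) k (w i)) t).
Local Notation vL i t x := (vrjp_L (nn i) L0 (fun k => E (nn i) k (w i)) (fun k => U (nn i) k (w i)) t x).

(** The step under way at time t i has a bounded clock, hence a limit u, and the two jump times
    around t i squeeze the real time of u to the limit t1 of the times t i. So u is the flow time of
    t1, and the limits of positions and profiles at u apply. *)
Lemma path_limit (t x : nat -> R) (Tm : R) : (forall i, 0 <= t i <= Tm) -> (forall i, `|x i| <= Tm) ->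
  (fun i => vX i (t i) - lrm_X L0 b Psi Lam (t i)) @ FU --> (0 : R) /\
  (fun i => vL i (t i) (x i) - lrm_L L0 b Psi Lam (t i) (x i)) @ FU --> (0 : R).
Proof.
move=> tT xT; have t0 i : 0 <= t i by have /andP[] := tT i.
have [t1 tt _] : exists2 l : R, t @ FU --> l & `|l| <= Tm.
  by apply: ulim_ex; apply: filterS (nny 0) => i _; have /andP[a1 a2] := tT i; rewrite ger0_norm.
have [x1 xx _] : exists2 l : R, x @ FU --> l & `|l| <= Tm.
  by apply: ulim_ex; apply: filterS (nny 0) => i _.
have t10 : 0 <= t1 by apply: (ulim_ge tt); apply: filterS (nny 0) => i _.
(* A path that has passed the level V has used a real time of at least q > t i, so the step at time
   t i still has a clock below V. *)
have [q qT] := nat_above (Tm + 1).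
have [V [B [dl [A [m [Vq Aq dl0 A0 ev]]]]]] := good q.
pose k i := xget 0%N [set k | sJ (s i k) <= t i < sJ (s i k.+1)].
have kP : \forall i \near FU, [/\ sJ (s i (k i)) <= t i, t i < sJ (s i (k i).+1), W i (k i) <= V & forall j, 0 <= E (nn i) j (w i)].
  apply: filterS ev => i [_ [E0 _ _ [_ _ [k1 hk1] Jq]]].
  have big : t i < sJ (s i k1).
    by have := Jq k1 (ltW hk1); have /andP[_ h] := tT i; move: qT h; lra.
  have ex : exists k, t i < sJ (s i k) by exists k1.
  have [k0 hk0 min0] := ex_minnP ex.
  have [/andP[h1 h2]] : sJ (s i (k i)) <= t i < sJ (s i (k i).+1) /\ True.
    split => //; apply: (xgetPex 0%N (P := [set k | sJ (s i k) <= t i < sJ (s i k.+1)])).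
    case: k0 hk0 min0 => [|k0] hk0 min0.
      by exfalso; move: hk0; rewrite ltNge t0.
    by exists k0 => /=; rewrite hk0 andbT leNgt; apply/negP => /min0; rewrite ltnn.
  split => //; rewrite leNgt; apply/negP => /ltW /Jq h3.
  by have /andP[_ h] := tT i; move: h1 h3 h qT; lra.
have bd : \forall i \near FU, `|W i (k i)| <= V by apply: filterS kP => i []; rewrite ger0_norm.
have [u Wu _] := ulim_ex bd; have [u0 _] := Wlim_bound Wu.
have Wu1 := dw_lim Wu.
have cu : clk u = t1.
  apply/eqP; rewrite eq_le; apply/andP; split.
    have h : (fun i => sJ (s i (k i)) - t i) @ FU --> clk u - t1 by apply: cvgB => //; exact: clock_lim.
    by rewrite -subr_le0; apply: (ulim_le h); apply: filterS kP => i []; rewrite subr_le0.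
  have h : (fun i => sJ (s i (k i).+1) - t i) @ FU --> clk u - t1 by apply: cvgB => //; exact: (clock_lim Wu1).
  by rewrite -subr_ge0; apply: (ulim_ge h); apply: filterS kP => i [_ h1 _ _]; rewrite subr_ge0 ltW.
have uE : lrm_time L0 b Psi Lam t1 = u.
  by have [a1 a2] := lrm_timeP t10; apply: clk_inj => //; rewrite a2.
have Tl := lrm_time_lim t0 tt; rewrite uE in Tl.
have T0 i : 0 <= lrm_time L0 b Psi Lam (t i) by exact: (lrm_timeP (t0 i)).1.
split.
  have h1 : (fun i => vX i (t i)) @ FU --> S0inv L0 (xi u).
    apply: cvg_trans (X_lim Wu); apply: near_eq_cvg; apply: filterS kP => i [a1 a2 _ a3].
    by rewrite (vrjp_X_at L0pos a3 a1 a2).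
  have h2 : (fun i => lrm_X L0 b Psi Lam (t i)) @ FU --> S0inv L0 (xi u).
    apply: continuous_cvg; first exact: S0inv_cont.
    apply/cvgrPdist_lt => e e0; have [dl' dl'0 hd] := xi_cont cb bb u0 e0.
    by move/cvgrPdist_lt/(_ dl' dl'0) : Tl => Tl; apply: filterS Tl => i; exact: hd.
  have h3 : (fun i => vX i (t i) - lrm_X L0 b Psi Lam (t i)) @ FU --> S0inv L0 (xi u) - S0inv L0 (xi u) by apply: cvgB.
  by rewrite subrr in h3.
pose j i := Num.floor (2 ^+ (nn i) * x i).
have fl i : (j i)%:~R <= 2 ^+ (nn i) * x i < (j i)%:~R + 1.
  by rewrite floor_le_tmp /= -intrD1 floorD1_gt.
have jb i : spos i (j i) <= x i /\ x i < spos i (j i) + hh i.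
  have /andP[f1 f2] := fl i; have p0 : 0 < 2 ^+ nn i :> R by rewrite exprn_gt0.
  rewrite /spos /hn; split; first by rewrite ler_pdivrMr // mulrC.
  by rewrite -(ltr_pM2l p0) mulrDr divff ?gt_eqF // mulrC [X in _ < X + 1]mulrC divfK ?gt_eqF // mulrC.
have jx : (fun i => spos i (j i)) @ FU --> x1.
  apply: ulim_eps => e e0; have e2 : 0 < e / 2 by rewrite divr_gt0.
  apply: filterS (filterI (cvg_dist xx e2) (cvg_dist hn_lim e2)) => i [].
  have [f1 f2] := jb i; rewrite subr0 (gtr0_norm (hn_gt0 _)).
  rewrite !ler_norml => /andP[a1 a2] a3; apply/andP; split; lra.
have jx1 : (fun i => spos i (j i + 1)) @ FU --> x1.
  have -> : (fun i => spos i (j i + 1)) = (fun i => spos i (j i) + hh i).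
    by apply/funext => i; rewrite /spos rmorphD /= mulrDl mul1r.
  by rewrite -[x1]addr0; apply: cvgD => //; exact: hn_lim.
have lim1 (jj : nat -> int) : (fun i => spos i (jj i)) @ FU --> x1 ->
    (fun i => L0 ((jj i)%:~R / 2 ^+ nn i) + vrjp_ell (nn i) L0 (fun k => E (nn i) k (w i)) (fun k => U (nn i) k (w i)) (t i) (jj i))
    @ FU --> ell u x1.
  move=> jjx; apply: ulim_eps => e e0.
  apply: filterS (filterI kP (filterI (cvg_dist (L_lim Wu jjx) e0) (cvg_dist (L_lim Wu1 jjx) e0))) => i.
  move=> [[a1 a2 _ a3] [h1 h2]]; have := vrjp_L_at L0pos a3 a1 a2 (jj i).
  move: h1 h2; rewrite !ler_norml => /andP[b1 b2] /andP[b3 b4] /andP[b5 b6].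
  by apply/andP; split; [apply: le_trans b1 _; rewrite lerD2r|apply: le_trans b4; rewrite lerD2r].
have h1 : (fun i => vL i (t i) (x i)) @ FU --> ell u x1.
  apply: ulim_eps => e e0.
  apply: filterS (filterI (cvg_dist (lim1 _ jx) e0) (cvg_dist (lim1 _ jx1) e0)) => i [].
  rewrite /vrjp_L -/(j i); have /andP[f1 f2] := fl i.
  have p1 : 0 <= 2 ^+ nn i * x i - (j i)%:~R by rewrite subr_ge0.
  have p2 : 0 <= 1 - (2 ^+ nn i * x i - (j i)%:~R) by lra.
  move: (2 ^+ nn i * x i - (j i)%:~R) p1 p2 => th p1 p2.
  by move: (L0 _ + _) (L0 _ + _) => l1 l2 g1 g2; exact: convex_dist.
have h2 : (fun i => lrm_L L0 b Psi Lam (t i) (x i)) @ FU --> ell u x1.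
  rewrite /lrm_L /ell; apply: cvgM; first by apply: ulim_comp xx; exact: L0c.
  have S0l : (fun i => S0 L0 (x i)) @ FU --> S0 L0 x1 by apply: ulim_comp xx; exact: S0_cont.
  have [_ Lb] := Lam_bnd bb (S0 L0 x1) u0.
  have Ll : (fun i => Lam (lrm_time L0 b Psi Lam (t i)) (S0 L0 (x i))) @ FU --> Lam u (S0 L0 x1).
    by apply: (ulim_two _ _ Tl S0l) => // e e0; exact: (Lam_cont bb).
  have -> : (fun i => powR (1 - 2 * Lam (lrm_time L0 b Psi Lam (t i)) (S0 L0 (x i))) (- (1 / 2))) =
     (fun i => (Num.sqrt (1 - 2 * Lam (lrm_time L0 b Psi Lam (t i)) (S0 L0 (x i))))^-1).
    apply/funext => i; rewrite powR_mhalf //; have [_ Li] := Lam_bnd bb (S0 L0 (x i)) (T0 i); lra.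
  rewrite powR_mhalf; last by lra.
  apply: cvgV; first by rewrite gt_eqF // sqrtr_gt0; lra.
  apply: continuous_cvg; first exact: sqrt_continuous.
  by apply: cvgB; [exact: cvg_cst|apply: cvgM => //; exact: cvg_cst].
have h3 : (fun i => vL i (t i) (x i) - lrm_L L0 b Psi Lam (t i) (x i)) @ FU --> ell u x1 - ell u x1 by apply: cvgB.
by rewrite subrr in h3.
Qed.

End identification.

(** * Expectations and elementary inequalities *)

Section expect.
Context {R : realType} d {T : measurableType d} (P : probability T R).
Implicit Types (f g : T -> R) (c M : R).

Definition Ex f : R := Rintegral P setT f.
Definition itg f := P.-integrable setT (EFin \o f).

Lemma itg_bound f M : measurable_fun setT f -> (forall w, `|f w| <= M) -> itg f.
Proof.
move=> mf fM; apply: measurable_bounded_integrable => //.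
  by rewrite (le_lt_trans (probability_le1 _ _)) // ltry.
exists M; split; first exact: num_real.
by move=> x Mx w _; exact: le_trans (fM w) (ltW Mx).
Qed.

Lemma itg_meas f : itg f -> measurable_fun setT f.
Proof. by move=> /integrableP[/measurable_EFinP]. Qed.

Lemma itg_cst c : itg (fun=> c).
Proof. by apply: (@itg_bound _ `|c|). Qed.

Lemma itgD f g : itg f -> itg g -> itg (fun w => f w + g w).
Proof. exact: integrableD. Qed.

Lemma itgB f g : itg f -> itg g -> itg (fun w => f w - g w).
Proof. exact: integrableB. Qed.

Lemma itgZ c f : itg f -> itg (fun w => c * f w).
Proof. by move=> fi; rewrite /itg (_ : EFin \o _ = (fun w => c%:E * (EFin \o f) w)%E) //; exact: integrableZl. Qed.

Lemma itg_dom f g : measurable_fun setT f -> (forall w, `|f w| <= g w) -> itg g -> itg f.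
Proof.
move=> mf fg; apply: le_integrable => //; first exact/measurable_EFinP.
by move=> w _ /=; rewrite lee_fin (le_trans (fg w)) // ler_norm.
Qed.

Lemma ExD f g : itg f -> itg g -> Ex (fun w => f w + g w) = Ex f + Ex g.
Proof. exact: RintegralD. Qed.

Lemma ExB f g : itg f -> itg g -> Ex (fun w => f w - g w) = Ex f - Ex g.
Proof. exact: RintegralB. Qed.

Lemma ExZ c f : itg f -> Ex (fun w => c * f w) = c * Ex f.
Proof. exact: RintegralZl. Qed.

Lemma Ex_cst c : Ex (fun=> c) = c.
Proof.
rewrite /Ex /Rintegral (_ : (\int[P]_w c%:E)%E = c%:E) //.
by transitivity (c%:E * P setT)%E; [exact: integral_cst|rewrite probability_setT mule1].
Qed.

Lemma Ex_le f g : itg f -> itg g -> (forall w, f w <= g w) -> Ex f <= Ex g.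
Proof. by move=> fi gi fg; apply: le_Rintegral. Qed.

Lemma Ex_norm f g : measurable_fun setT f -> itg g -> (forall w, `|f w| <= g w) -> `|Ex f| <= Ex g.
Proof.
move=> mf gi fg; have fi := itg_dom mf fg gi.
apply: le_trans (le_normr_Rintegral measurableT fi) _; apply: Ex_le => //.
exact: integrable_norm.
Qed.

Lemma Ex_norm_le f c : measurable_fun setT f -> (forall w, `|f w| <= c) -> `|Ex f| <= c.
Proof. by move=> mf fc; rewrite -[leRHS]Ex_cst; apply: Ex_norm => //; exact: itg_cst. Qed.

Lemma ExE f : itg f -> (\int[P]_w (f w)%:E)%E = (Ex f)%:E.
Proof. by move=> fi; rewrite /Ex /Rintegral fineK //; exact: integrable_fin_num. Qed.

End expect.

Section elementary.
Context {R : realType}.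
Implicit Types (x y t : R).

Lemma cube_exp x : `|x| ^+ 3 <= 27 * (expR x + expR (- x)).
Proof.
have p y : 0 <= y -> y ^+ 3 <= 27 * expR y.
  move=> y0; have h : y / 3 <= expR (y / 3) by apply: le_trans (expR_ge1Dx _); rewrite lerDr.
  have -> : expR y = expR (y / 3) ^+ 3 by rewrite -expRM_natr; congr expR; field.
  have -> : y ^+ 3 = 27 * (y / 3) ^+ 3 by field.
  by rewrite ler_pM2l // lerXn2r ?nnegrE ?expR_ge0 // divr_ge0.
case: (leP 0 x) => h; first by rewrite ger0_norm //; apply: le_trans (p _ h) _; rewrite ler_pM2l // lerDl expR_ge0.
rewrite ltr0_norm //; apply: le_trans (p _ _) _; first by rewrite oppr_ge0 ltW.
by rewrite ler_pM2l // lerDr expR_ge0.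
Qed.

Lemma expR_norm x : expR `|x| <= expR x + expR (- x).
Proof. by case: (leP 0 x) => h; [rewrite ger0_norm // lerDl expR_ge0|rewrite ltr0_norm // lerDr expR_ge0]. Qed.

(** The difference of the two sides vanishes at 0 with its first derivative, and its second
    derivative exp z + exp(-z) - 2 is a square; the mean value theorem is applied twice. *)
Lemma cosh_ge y : y ^+ 2 <= expR y + expR (- y) - 2.
Proof.
wlog y0 : y / 0 <= y => [hw|].
  case: (leP 0 y) => h; first exact: hw.
  by have := hw (- y); rewrite opprK sqrrN addrC [in X in _ -> _ <= X - _]addrC addrC => -> //; rewrite oppr_ge0 ltW.
have hd (f f' : R -> R) : (forall z : R, is_derive z 1 f (f' z)) -> (forall z : R, 0 <= z -> 0 <= f' z) -> f 0 = 0 ->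
    forall z : R, 0 <= z -> 0 <= f z.
  move=> df f'0 f0 z; rewrite le_eqVlt => /orP[/eqP <-|z0]; first by rewrite f0.
  have cf : {within `[0, z], continuous f} by apply: derivable_within_continuous => u _; have du := df u; exact: ex_derive.
  have [u] := @MVT R f f' 0 z z0 (fun u _ => df u) cf.
  rewrite in_itv /= => /andP[u0 _]; rewrite f0 !subr0 => ->.
  by rewrite mulr_ge0 ?f'0 // ltW.
have d1 (z : R) : is_derive z 1 (fun z : R => expR z - expR (- z) - 2 * z) (expR z + expR (- z) - 2).
  apply: is_derive_eq; rewrite /GRing.scale /=; ring.
have d2 (z : R) : is_derive z 1 (fun z : R => expR z + expR (- z) - 2 - z ^+ 2) (expR z - expR (- z) - 2 * z).
  apply: is_derive_eq; rewrite /GRing.scale /=; ring.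
have c0 (z : R) : 0 <= expR z + expR (- z) - 2.
  rewrite (_ : _ - 2 = (expR (z / 2) - expR (- (z / 2))) ^+ 2) ?sqr_ge0 //.
  have q1 : expR z = expR (z / 2) ^+ 2 by rewrite -expRM_natr; congr expR; field.
  have q2 : expR (- z) = expR (- (z / 2)) ^+ 2 by rewrite -expRM_natr; congr expR; field.
  have q3 : expR (z / 2) * expR (- (z / 2)) = 1 by rewrite -expRD subrr expR0.
  by rewrite q1 q2 sqrrB q3; ring.
rewrite -subr_ge0; apply: (hd _ _ d2) => //; last by rewrite oppr0 expR0; ring.
by move=> z z0; apply: (hd _ _ d1) => //; rewrite oppr0 expR0; ring.
Qed.

Lemma cosh_le y : expR y + expR (- y) - 2 <= y ^+ 2 + `|y| ^+ 3 * expR `|y|.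
Proof.
have -> : expR y + expR (- y) = expR `|y| + expR (- `|y|).
  by case: (leP 0 y) => h; [rewrite ger0_norm|rewrite ltr0_norm // opprK addrC].
rewrite -(real_normK (num_real y)); move: `|y| (normr_ge0 y) => z z0.
have e1 : expR z - 1 <= z * expR z.
  have := expR_ge1Dx (- z); have p := expR_gt0 z; rewrite -(ler_pM2l p) -expRD subrr expR0; lra.
have h1 : expR z + expR (- z) - 2 <= z ^+ 2 * expR z.
  have -> : expR z + expR (- z) - 2 = expR z * (1 - expR (- z)) ^+ 2.
    rewrite sqrrB expr1n mulrDr mulrBr mulr1 expr2 mulrA -expRD subrr expR0 !mul1r.
    by rewrite mulr2n mulrDr -expRD subrr expR0; ring.
  rewrite mulrC ler_wpM2r ?expR_ge0 // lerXn2r ?nnegrE //; last by have := expR_ge1Dx (- z); lra.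
  by rewrite subr_ge0 -expR0 ler_expR oppr_le0.
apply: le_trans h1 _; rewrite -lerBlDl.
have -> : z ^+ 2 * expR z - z ^+ 2 = z ^+ 2 * (expR z - 1) by ring.
by rewrite [z ^+ 3]exprSr -[leRHS]mulrA ler_wpM2l ?exprn_ge0.
Qed.

Lemma cube_cosh t x : 0 < t -> t <= 1 ->
  t ^+ 3 * `|x| ^+ 3 * expR (t * `|x|) <= t ^+ 3 * 54 * (expR (2 * x) + expR (- (2 * x))).
Proof.
move=> t0 t1; rewrite -mulrA -[leRHS]mulrA ler_pM2l ?exprn_gt0 //.
apply: (@le_trans _ _ (27 * (expR x + expR (- x)) * (expR x + expR (- x)))).
  apply: ler_pM; rewrite ?exprn_ge0 ?expR_ge0 ?cube_exp //.
  by apply: le_trans (expR_norm _); rewrite ler_expR ler_piMl.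
have e2 : expR (2 * x) = expR x * expR x by rewrite -expRD; congr expR; ring.
have e3 : expR (- (2 * x)) = expR (- x) * expR (- x) by rewrite -expRD; congr expR; ring.
rewrite e2 e3; have := sqr_ge0 (expR x - expR (- x)); rewrite expr2; nra.
Qed.

Lemma cube_ge_lin x : 0 <= x -> x <= 1 + x ^+ 3.
Proof.
move=> x0; have [h|h] := leP x 1; first by have := exprn_ge0 3 x0; lra.
have : 0 <= x * (x - 1) * (x + 1) by rewrite !mulr_ge0 //; lra.
by rewrite !exprS expr0; lra.
Qed.

Lemma cube_ge_sqr x : 0 <= x -> x ^+ 2 <= 1 + x ^+ 3.
Proof.
move=> x0; have [h|h] := leP x 1.
  have h2 : x ^+ 2 <= 1 by rewrite expr_le1.
  by have := exprn_ge0 3 x0; lra.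
have : 0 <= x ^+ 2 * (x - 1) by rewrite mulr_ge0 ?sqr_ge0 //; lra.
by rewrite !exprS expr0; lra.
Qed.

(** t decreases to 0; the condition t r <= 1 keeps exponential moments in the range of their
    quadratic expansion. *)
Lemma limit_small (a b C r : R) : 0 <= C -> 0 <= r ->
  (forall t : R, 0 < t -> t <= 1 -> t * r <= 1 -> a <= b + t * C) -> a <= b.
Proof.
move=> C0 r0 h; apply/ler_addgt0Pr => e e0.
pose t := Num.min 1 (Num.min (r + 1)^-1 (e / (C + 1))).
have r1 : 0 < r + 1 by lra.
have C1 : 0 < C + 1 by lra.
have t0 : 0 < t by rewrite !lt_min ltr01 invr_gt0 r1 divr_gt0.
have [t1 [t2 t3]] : t <= 1 /\ t <= (r + 1)^-1 /\ t <= e / (C + 1) by rewrite !ge_min !lexx !orbT.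
apply: le_trans (h t t0 t1 _) _.
  by apply: le_trans (ler_wpM2r r0 t2) _; rewrite mulrC ler_pdivrMr // mul1r lerDl.
rewrite lerD2l; apply: le_trans (ler_wpM2r C0 t3) _.
by rewrite mulrAC ler_pdivrMr // ler_pM2l // lerDl.
Qed.

End elementary.

(** * Gaussian moments *)

Section gaussian.
Context {R : realType} d {T : measurableType d} (Q : probability T R).
Local Notation leb := (@lebesgue_measure R).
Local Notation Ex := (Ex Q).
Local Notation itg := (itg Q).

(** Of the centred Gaussian law of variance r only the exponential moments are kept: mean and
    variance follow from them as t tends to 0, and the third absolute moment is bounded by them. *)
Definition gauss (X : T -> R) (r : R) := measurable_fun setT X /\
  forall t : R, (\int[Q]_w (expR (t * X w))%:E = (expR (t ^+ 2 * r / 2))%:E)%E.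

Lemma law_gauss (X : T -> R) (r : R) : measurable_fun setT X -> 0 < r ->
  (forall A, measurable A -> Q (X @^-1` A) = normal_prob 0 (Num.sqrt r) A) -> gauss X r.
Proof.
move=> mX r0 lawX; split => // t.
have s0 : Num.sqrt r != 0 by rewrite gt_eqF // sqrtr_gt0.
pose Xm := isMeasurableFun.Build _ _ _ (measurableTypeR R) _ mX.
pose Xf : {mfun T >-> measurableTypeR R} := HB.pack X Xm.
pose nu : probability (measurableTypeR R) R := distribution Q Xf.
have me : measurable_fun setT (fun x : measurableTypeR R => (expR (t * x))%:E).
  by apply/measurable_EFinP; apply: measurableT_comp => //; exact: measurable_funM.
transitivity (\int[nu]_x (expR (t * x))%:E)%E.
  by rewrite /nu /distribution ge0_integral_pushforward //= => x _; rewrite lee_fin expR_ge0.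
have e0 x : (0 <= (expR (t * x))%:E :> \bar R)%E by rewrite lee_fin expR_ge0.
rewrite (@density_integral R _ _ leb nu _ (measurable_normal_pdf 0 (Num.sqrt r)) (normal_pdf_ge0 0 (Num.sqrt r)) lawX _ me e0).
(* Completing the square moves the mean to t r. *)
have E x : ((expR (t * x))%:E * (normal_pdf 0 (Num.sqrt r) x)%:E =
   (expR (t ^+ 2 * r / 2))%:E * (normal_pdf (t * r) (Num.sqrt r) x)%:E)%E.
  rewrite -!EFinM !normal_pdfE // /normal_fun mulrCA -expRD [in RHS]mulrCA -expRD.
  congr (_ * expR _)%:E; rewrite sqr_sqrtr ?ltW // -mulr_natr; field; rewrite gt_eqF //.
under eq_integral do rewrite E.
rewrite ge0_integralZl //; first by rewrite integral_normal_pdf mule1.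
- by apply/measurable_EFinP; exact: measurable_normal_pdf.
- by move=> x _; rewrite lee_fin normal_pdf_ge0.
Qed.

Variables (X : T -> R) (r : R).
Hypotheses (gX : gauss X r) (r0 : 0 < r).
Let mX : measurable_fun setT X := gX.1.

Let itg_exp (t : R) : itg (fun w => expR (t * X w)).
Proof.
apply/integrableP; split.
  by apply/measurable_EFinP; apply: measurableT_comp => //; exact: measurable_funM.
under eq_integral do rewrite gee0_abs ?lee_fin ?expR_ge0 //.
by rewrite gX.2 ltry.
Qed.

Let Ex_exp (t : R) : Ex (fun w => expR (t * X w)) = expR (t ^+ 2 * r / 2).
Proof. by rewrite /Ex /Rintegral gX.2. Qed.

Let ch (t : R) w := expR (t * X w) + expR (- t * X w).

Let itg_ch (t : R) : itg (ch t). Proof. by apply: itgD. Qed.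
Let Ex_ch (t : R) : Ex (ch t) = 2 * expR (t ^+ 2 * r / 2).
Proof. by rewrite ExD // !Ex_exp sqrrN; ring. Qed.

Lemma gauss_itg_cube : itg (fun w => `|X w| ^+ 3).
Proof.
apply: (@itg_dom _ _ _ _ _ (fun w => 27 * ch 1 w)); last exact: itgZ.
  by apply: measurable_funX; exact: measurableT_comp.
move=> w; rewrite ger0_norm ?exprn_ge0 //; apply: le_trans (cube_exp _) _.
by rewrite /ch mulN1r mul1r.
Qed.

Lemma gauss_itg : itg X.
Proof.
apply: (@itg_dom _ _ _ _ _ (fun w => 1 + `|X w| ^+ 3)) => //; last by apply: itgD; [exact: itg_cst|exact: gauss_itg_cube].
by move=> w; exact: cube_ge_lin.
Qed.

Lemma gauss_itg_sqr : itg (fun w => X w ^+ 2).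
Proof.
apply: (@itg_dom _ _ _ _ _ (fun w => 1 + `|X w| ^+ 3)) => //; first exact: measurable_funX.
  move=> w; rewrite ger0_norm ?sqr_ge0 // -(real_normK (num_real (X w))); exact: cube_ge_sqr.
by apply: itgD; [exact: itg_cst|exact: gauss_itg_cube].
Qed.

Let expb (t : R) : 0 < t -> t <= 1 -> t * r <= 1 -> expR (t ^+ 2 * r / 2) <= 1 + t ^+ 2 * r / 2 + t ^+ 3 * r / 2.
Proof.
move=> t0 t1 tr; have h : t ^+ 2 * r / 2 <= 1 / 2.
  rewrite ler_pM2r // expr2 -mulrA; apply: le_trans (ler_wpM2l (ltW t0) tr) _; lra.
apply: le_trans (expR_le_quad h) _; rewrite lerD2l.
have -> : 2 * (t ^+ 2 * r / 2) ^+ 2 = t ^+ 3 * r / 2 * (t * r) by field.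
rewrite ler_piMr // !mulr_ge0 ?exprn_ge0 ?(ltW t0) ?(ltW r0) //.
Qed.

Lemma gauss_mean : Ex X = 0.
Proof.
have key (Y : T -> R) : itg Y -> (forall t : R, itg (fun w => expR (t * Y w)) /\ Ex (fun w => expR (t * Y w)) = expR (t ^+ 2 * r / 2)) -> Ex Y <= 0.
  move=> iY h; apply: (@limit_small _ _ _ r r); rewrite ?(ltW r0) // => t t0 t1 tr.
  have [i1 e1] := h t; rewrite add0r -(ler_pM2l t0).
  have : Ex (fun w => 1 + t * Y w) <= Ex (fun w => expR (t * Y w)).
    by apply: Ex_le => //; [apply: itgD; [exact: itg_cst|exact: itgZ]|move=> w; exact: expR_ge1Dx].
  rewrite e1 ExD ?ExZ ?Ex_cst //; [|exact: itg_cst|exact: itgZ].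
  have := expb t0 t1 tr; have : t ^+ 3 * r <= t ^+ 2 * r by rewrite ler_pM2r // exprSr ler_piMr ?sqr_ge0.
  rewrite mulrA -expr2; lra.
apply/eqP; rewrite eq_le key //=; last exact: gauss_itg.
have iN : itg (fun w => (-1) * X w) by apply: itgZ; exact: gauss_itg.
have := key _ iN; rewrite ExZ ?mulN1r ?oppr_le0; last exact: gauss_itg.
apply => t; have := itg_exp (- t); have := Ex_exp (- t); rewrite sqrrN.
have -> : (fun w => expR (t * (-1 * X w))) = (fun w => expR (- t * X w)) by apply/funext => w; rewrite mulrA mulrN1.
by [].
Qed.

Lemma gauss_var : Ex (fun w => X w ^+ 2) = r.
Proof.
have i2 := gauss_itg_sqr.
apply/eqP; rewrite eq_le; apply/andP; split.
  apply: (@limit_small _ _ _ r r); rewrite ?(ltW r0) // => t t0 t1 tr.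
  have t20 : 0 < t ^+ 2 by rewrite exprn_gt0.
  rewrite -(ler_pM2l t20) -ExZ //.
  apply: (@le_trans _ _ (Ex (fun w => ch t w - 2))).
    apply: Ex_le; [exact: itgZ|by apply: itgB => //; exact: itg_cst|].
    by move=> w; rewrite -exprMn /ch mulNr; exact: cosh_ge.
  rewrite ExB //; last exact: itg_cst.
  rewrite Ex_cst Ex_ch; have := expb t0 t1 tr.
  have -> : t ^+ 2 * (r + t * r) = t ^+ 2 * r + t ^+ 3 * r by ring.
  lra.
apply: (@limit_small _ _ _ (108 * expR (2 * r)) r); rewrite ?(ltW r0) ?mulr_ge0 ?expR_ge0 // => t t0 t1 tr.
have t20 : 0 < t ^+ 2 by rewrite exprn_gt0.
rewrite -(ler_pM2l t20) mulrDr -ExZ //.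
apply: (@le_trans _ _ (Ex (fun w => ch t w - 2))).
  rewrite ExB //; last exact: itg_cst.
  rewrite Ex_cst Ex_ch; have := expR_ge1Dx (t ^+ 2 * r / 2); lra.
have -> : t ^+ 2 * (t * (108 * expR (2 * r))) = t ^+ 3 * 54 * Ex (ch 2).
  rewrite Ex_ch (_ : 2 ^+ 2 * r / 2 = 2 * r); first by ring.
  by field.
rewrite -ExZ // -ExD; [|exact: itgZ|exact: itgZ].
apply: Ex_le; [by apply: itgB => //; exact: itg_cst|by apply: itgD; exact: itgZ|].
move=> w; rewrite /ch mulNr; apply: le_trans (cosh_le _) _; rewrite exprMn lerD2l.
rewrite normrM exprMn (gtr0_norm t0) mulNr; exact: cube_cosh.
Qed.

(** Scaling to unit variance; 108 is the product of 27 from [cube_exp], 2 for the two exponentials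
    and 2 as a bound for exp(1/2). *)
Lemma gauss_cube : Ex (fun w => `|X w| ^+ 3) <= 108 * (r * Num.sqrt r).
Proof.
have s0 : 0 < Num.sqrt r by rewrite sqrtr_gt0.
pose s := Num.sqrt r.
have ss : s ^+ 2 = r by rewrite sqr_sqrtr // ltW.
apply: (@le_trans _ _ (Ex (fun w => 27 * s ^+ 3 * ch s^-1 w))).
  apply: Ex_le; [exact: gauss_itg_cube|exact: itgZ|move=> w].
  have -> : `|X w| ^+ 3 = s ^+ 3 * `|s^-1 * X w| ^+ 3.
    by rewrite normrM exprMn ger0_norm ?invr_ge0 ?(ltW s0) // mulrA -exprMn divff ?gt_eqF // expr1n mul1r.
  rewrite (_ : 27 * _ * _ = s ^+ 3 * (27 * ch s^-1 w)); last by ring.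
  rewrite ler_pM2l ?exprn_gt0 //; apply: le_trans (cube_exp _) _.
  by rewrite /ch mulNr.
rewrite ExZ // Ex_ch.
have -> : s^-1 ^+ 2 * r / 2 = 1 / 2 by rewrite -ss; field; rewrite gt_eqF.
have -> : s ^+ 3 = r * Num.sqrt r by rewrite exprSr ss.
have : expR (1 / 2 : R) <= 2 by apply: le_trans (expR_le_quad (lexx _)) _; lra.
have : 0 <= r * Num.sqrt r by rewrite mulr_ge0 ?ltW.
move: (r * _) (expR _) => z e z0 e2; have := ler_wpM2l z0 e2; lra.
Qed.

Lemma gauss_abs : Ex (fun w => `|X w|) <= Num.sqrt r.
Proof.
have s0 : 0 < Num.sqrt r by rewrite sqrtr_gt0.
pose s := Num.sqrt r.
have ss : s ^+ 2 = r by rewrite sqr_sqrtr // ltW.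
have i1 : itg (fun w => `|X w|) by apply: integrable_norm; exact: gauss_itg.
apply: (@le_trans _ _ (Ex (fun w => (2 * s)^-1 * X w ^+ 2 + s / 2))).
  apply: Ex_le => //; first by apply: itgD; [apply: itgZ; exact: gauss_itg_sqr|exact: itg_cst].
  move=> w; rewrite -(real_normK (num_real (X w))); move: `|X w| => x.
  have : 0 <= (2 * s)^-1 * (x - s) ^+ 2 by rewrite mulr_ge0 ?sqr_ge0 // invr_ge0 mulr_ge0 // ltW.
  have -> : (2 * s)^-1 * (x - s) ^+ 2 = (2 * s)^-1 * x ^+ 2 + s / 2 - x by field; rewrite gt_eqF.
  by rewrite subr_ge0.
have i2 := gauss_itg_sqr.
rewrite ExD; [|exact: itgZ|exact: itg_cst].
rewrite ExZ // Ex_cst gauss_var.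
have -> : (2 * s)^-1 * r = s / 2 by rewrite -[X in _ * X]ss; field; rewrite gt_eqF.
by rewrite -splitr.
Qed.

End gaussian.

Lemma itg_normr {R : realType} d {T : measurableType d} (P : probability T R) (f : T -> R) :
  itg P f -> itg P (fun w => `|f w|).
Proof. exact: integrable_norm. Qed.

(** * Brownian motion and the heat semigroup *)

Section brownian.
Context {R : realType} d {T : measurableType d} (Q : probability T R) (B : R -> T -> R).
Hypothesis hB : brownian_motion Q B.
Local Notation Ex := (Ex Q).
Local Notation itg := (itg Q).
Implicit Types (r s w x y : R).

Lemma bm_meas r : measurable_fun setT (B r). Proof. by case: hB. Qed.
Lemma bm0 o : B 0 o = 0. Proof. by case: hB => _ []. Qed.

Lemma bm_gauss s r : 0 <= s -> s < r -> gauss Q (fun o => B r o - B s o) (r - s).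
Proof.
move=> s0 sr; apply: law_gauss; [by apply: measurable_funB; exact: bm_meas|by rewrite subr_gt0|].
by case: hB => _ [_ [_ [h _]]] A mA; apply: h.
Qed.

Lemma bm_gauss0 r : 0 < r -> gauss Q (B r) r.
Proof.
move=> r0; have := bm_gauss (lexx 0) r0; rewrite subr0.
by rewrite (_ : (fun o => _) = B r) //; apply/funext => o; rewrite bm0 subr0.
Qed.

Lemma bm_dist r s : 0 <= r -> 0 <= s -> itg (fun o => `|B r o - B s o|) /\ Ex (fun o => `|B r o - B s o|) <= Num.sqrt `|r - s|.
Proof.
have key r' s' : 0 <= s' -> s' < r' -> itg (fun o => `|B r' o - B s' o|) /\ Ex (fun o => `|B r' o - B s' o|) <= Num.sqrt `|r' - s'|.
  move=> s0 sr; have g := bm_gauss s0 sr; have p : 0 < r' - s' by rewrite subr_gt0.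
  rewrite (gtr0_norm p); split; last exact: (gauss_abs g p).
  by apply: itg_normr; exact: (gauss_itg g).
move=> r0 s0; have [h|h|->] := ltgtP r s; [|exact: key|].
  have := key s r r0 h; rewrite distrC; congr (itg _ /\ Ex _ <= _); by apply/funext => o; rewrite distrC.
have -> : (fun o => `|B s o - B s o|) = (fun=> 0) by apply/funext => o; rewrite subrr normr0.
by rewrite Ex_cst sqrtr_ge0; split => //; exact: itg_cst.
Qed.

Section semigroup.
Variables (f : R -> R).
Hypotheses (cf : continuous f) (f01 : forall x, 0 <= f x <= 1).

Let mf : measurable_fun setT f. Proof. exact: continuous_measurable_fun. Qed.

Definition heat r x := Ex (fun o => f (x + B r o)).

Lemma heat_meas r x : measurable_fun setT (fun o => f (x + B r o)).
Proof. by apply: measurableT_comp => //; apply: measurable_funD => //; exact: bm_meas. Qed.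

Lemma heat_itg r x : itg (fun o => f (x + B r o)).
Proof. by apply: (@itg_bound _ _ _ _ _ 1); [exact: heat_meas|move=> o; have /andP[a b] := f01 (x + B r o); rewrite ger0_norm]. Qed.

Lemma heat01 r x : 0 <= heat r x <= 1.
Proof.
apply/andP; split.
  by rewrite -(Ex_cst Q 0); apply: Ex_le; [exact: itg_cst|exact: heat_itg|move=> o; have /andP[] := f01 (x + B r o)].
by rewrite -[leRHS](Ex_cst Q 1); apply: Ex_le; [exact: heat_itg|exact: itg_cst|move=> o; have /andP[] := f01 (x + B r o)].
Qed.

(* Independence of the increments of [B] over [0, w] and [w, w + r]. *)
Lemma heat_semigroup r w x : 0 < r -> 0 < w ->
  (\int[Q]_o (f (x + B (w + r) o))%:E = \int[Q]_o (heat r (x + B w o))%:E)%E.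
Proof.
move=> r0 w0; pose ts := [:: 0; w; w + r].
have [_ [_ [_ [law ind]]]] := hB.
have sts : sorted <%R ts by rewrite /= w0 ltrDl r0.
have pts : all (fun t => 0 <= t) ts by rewrite /= lexx !ltW // addr_gt0.
have indY := ind ts sts pts.
pose Y := (fun i : 'I_(size ts).-1 => fun o => B (nth 0 ts i.+1) o - B (nth 0 ts i) o).
pose i0 : 'I_(size ts).-1 := @Ordinal 2 0 isT.
pose i1 : 'I_(size ts).-1 := @Ordinal 2 1 isT.
pose K : set 'I_(size ts).-1 := [set i0].
have nK : ~ K i1 by move=> /(congr1 val).
pose Xm := isMeasurableFun.Build _ _ _ (measurableTypeR R) _ (bm_meas r).
pose Xf : {mfun T >-> measurableTypeR R} := HB.pack (B r) Xm.
pose nu : probability (measurableTypeR R) R := distribution Q Xf.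
have Ynu A : measurable A -> Q (Y i1 @^-1` A) = nu A.
  move=> mA; rewrite /Y /= law //; [|exact: ltW|by rewrite ltrDl].
  rewrite addrAC subrr add0r /nu /distribution /pushforward /=.
  have := law 0 r (lexx _) r0 A mA; rewrite subr0 => <-.
  by rewrite (_ : (fun o => _) = B r) //; apply/funext => o; rewrite bm0 subr0.
pose past := g_sigma_algebraType (past_gen Y K).
pose G : past * measurableTypeR R -> \bar R := fun z => (f (x + (B w z.1 + z.2)))%:E.
have mG : measurable_fun setT G.
  apply/measurable_EFinP; apply: measurableT_comp => //; apply: measurable_funD => //; apply: measurable_funD; last exact: measurable_snd.
  have mBw : measurable_fun setT (B w : past -> R).
    by have -> : B w = Y i0 by [apply/funext => o; rewrite /Y /= bm0 subr0]; exact: past_Y.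
  exact: (measurableT_comp mBw (measurable_fst (T1 := past) (T2 := measurableTypeR R))).
have G0 z : (0 <= G z)%E by rewrite lee_fin; have /andP[] := f01 (x + (B w z.1 + z.2)).
have [_] := past_step indY nK Ynu mG G0.
rewrite /G /= => e1.
transitivity (\int[Q]_o (f (x + (B w o + Y i1 o)))%:E)%E.
  by apply: eq_integral => o _; rewrite /Y /= [B w o + _]addrC subrK.
rewrite e1; apply: eq_integral => o _.
rewrite /heat -(ExE (heat_itg r (x + B w o))) /nu /distribution ge0_integral_pushforward //=.
- by apply: eq_integral => o' _ /=; rewrite addrA.
- exact: bm_meas.
- have mpo : measurable_fun setT (fun y : measurableTypeR R => (o, y) : past * measurableTypeR R).
    by apply: measurable_fun_pair; [exact: measurable_cst|exact: measurable_id].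
  exact: (measurableT_comp mG mpo).
- by move=> y _; rewrite lee_fin; have /andP[] := f01 (x + (B w o + y)).
Qed.

Variables (f1 f0 : R -> R) (C : R).
Hypotheses (C0 : 0 <= C) (mf1 : measurable_fun setT f1) (f1b : forall x, `|f1 x| <= C) (f0b : forall x, `|f0 x| <= C).
Hypothesis flip : forall x y, `|f x - f y| <= C * `|x - y|.
Hypothesis f0lip : forall x y, `|f0 x - f0 y| <= C * `|x - y|.
Hypothesis taylor : forall x h : R, `|f (x + h) - f x - f1 x * h - f0 x * h ^+ 2 / 2| <= C * `|h| ^+ 3.
Hypothesis mf0 : measurable_fun setT f0.

Definition heat1 r x := Ex (fun o => f1 (x + B r o)).
Definition heat2 r x := Ex (fun o => f0 (x + B r o)).

Let mshift (g : R -> R) r x : measurable_fun setT g -> measurable_fun setT (fun o => g (x + B r o)).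
Proof. by move=> mg; apply: measurableT_comp => //; apply: measurable_funD => //; exact: bm_meas. Qed.

Let itgb (g : R -> R) r x : measurable_fun setT g -> (forall x, `|g x| <= C) -> itg (fun o => g (x + B r o)).
Proof. by move=> mg gC; apply: (@itg_bound _ _ _ _ _ C); [exact: mshift|]. Qed.

Lemma heat2_bound r x : `|heat2 r x| <= C.
Proof. by apply: Ex_norm_le => //; exact: mshift. Qed.

(** Taylor's formula survives averaging over translations, so [heat1] and [heat2] act as the two
    space derivatives of [heat]. *)
Lemma heat_taylor r x h : `|heat r (x + h) - heat r x - heat1 r x * h - heat2 r x * h ^+ 2 / 2| <= C * `|h| ^+ 3.
Proof.
have i1 := itgb r x mf1 f1b; have i2 := itgb r x mf0 f0b; have i3 := heat_itg r x; have i4 := heat_itg r (x + h).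
have -> : heat r (x + h) - heat r x - heat1 r x * h - heat2 r x * h ^+ 2 / 2 =
  Ex (fun o => f (x + h + B r o) - f (x + B r o) - h * f1 (x + B r o) - h ^+ 2 / 2 * f0 (x + B r o)).
  rewrite ExB; [|by apply: itgB; [exact: itgB|exact: itgZ]|exact: itgZ].
  rewrite ExB; [|exact: itgB|exact: itgZ].
  rewrite ExB // !ExZ // /heat /heat1 /heat2; ring.
apply: Ex_norm_le.
  by apply: (@itg_meas _ _ _ Q); apply: itgB; [apply: itgB; [exact: itgB|exact: itgZ]|exact: itgZ].
move=> o; have := taylor (x + B r o) h; rewrite (addrAC x) (mulrC (f1 _)) -(mulrA (f0 _)) (mulrC (f0 _)).
by [].
Qed.

Let heat_gen (g : R -> R) r s x y : measurable_fun setT g -> 0 <= r -> 0 <= s ->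
  (forall x y, `|g x - g y| <= C * `|x - y|) -> itg (fun o => g (x + B r o)) -> itg (fun o => g (y + B s o)) ->
  `|Ex (fun o => g (x + B r o)) - Ex (fun o => g (y + B s o))| <= C * (`|x - y| + Num.sqrt `|r - s|).
Proof.
move=> mg r0 s0 gl i1 i2; rewrite -ExB //.
have [j1 j2] := bm_dist r0 s0.
apply: (@le_trans _ _ (Ex (fun o => C * (`|x - y| + `|B r o - B s o|)))).
  apply: Ex_norm; first by apply: (@itg_meas _ _ _ Q); exact: itgB.
    by apply: itgZ; apply: itgD => //; exact: itg_cst.
  move=> o; apply: le_trans (gl _ _) _; rewrite ler_wpM2l //.
  by rewrite (_ : x + _ - _ = (x - y) + (B r o - B s o)) ?ler_normD //; ring.
rewrite ExZ ?ExD ?Ex_cst ?ler_wpM2l ?lerD2l //; [exact: itg_cst|].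
by apply: itgD => //; exact: itg_cst.
Qed.

Lemma heat_unif r s x y : 0 <= r -> 0 <= s -> `|heat r x - heat s y| <= C * (`|x - y| + Num.sqrt `|r - s|).
Proof. by move=> r0 s0; apply: heat_gen => //; exact: heat_itg. Qed.

Lemma heat2_unif r s x y : 0 <= r -> 0 <= s -> `|heat2 r x - heat2 s y| <= C * (`|x - y| + Num.sqrt `|r - s|).
Proof. by move=> r0 s0; apply: heat_gen => //; exact: itgb. Qed.

Lemma heat0 x : heat 0 x = f x.
Proof.
rewrite /heat (_ : (fun o => _) = (fun=> f x)) ?Ex_cst //.
by apply/funext => o; rewrite bm0 addr0.
Qed.

(** The heat equation in integrated form, from the semigroup property and Taylor's formula in space:
    over the increment of length w the linear term has mean 0, the square has mean w, and the cube
    is at most 108 w^(3/2). *)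
Lemma heat_time r w x : 0 <= r -> 0 <= w ->
  `|heat (r + w) x - heat r x - heat2 r x * w / 2| <= 108 * C * (w * Num.sqrt w).
Proof.
move=> r0; rewrite le_eqVlt => /orP[/eqP <-|w0].
  by rewrite addr0 subrr mulr0 !mul0r subrr normr0 mulr0.
have gw := bm_gauss0 w0.
have i1 := gauss_itg gw; have i2 := gauss_itg_sqr gw; have i3 := gauss_itg_cube gw.
have chat : measurable_fun setT (heat r).
  apply: continuous_measurable_fun => y; apply/cvgrPdist_lt => e e0.
  apply/nbhs_ballP; exists (e / (C + 1)) => /=; first by rewrite divr_gt0 // ltr_wpDl.
  move=> z; rewrite /ball /= => yz; apply: le_lt_trans (heat_unif _ _ r0 r0) _.
  rewrite subrr normr0 sqrtr0 addr0; move: yz; rewrite ltr_pdivlMr ?ltr_wpDl // mulrDr mulr1 mulrC; apply: le_lt_trans.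
  by rewrite lerDl.
have mh : measurable_fun setT (fun o => heat r (x + B w o)) by exact: mshift.
have ih : itg (fun o => heat r (x + B w o)).
  by apply: (@itg_bound _ _ _ _ _ 1) => // o; have /andP[a b] := heat01 r (x + B w o); rewrite ger0_norm.
have E1 : heat (r + w) x = Ex (fun o => heat r (x + B w o)).
  move: r0; rewrite le_eqVlt => /orP[/eqP r0|r0].
    by rewrite -r0 add0r /heat; congr Ex; apply/funext => o; rewrite -/(heat 0 _) heat0.
  by have := heat_semigroup x r0 w0; rewrite addrC /heat /Ex /Rintegral => ->.
have -> : heat (r + w) x - heat r x - heat2 r x * w / 2 =
  Ex (fun o => heat r (x + B w o) - heat r x - heat1 r x * B w o - heat2 r x / 2 * B w o ^+ 2).
  rewrite ExB; [|by apply: itgB; [by apply: itgB => //; exact: itg_cst|exact: itgZ]|exact: itgZ].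
  rewrite ExB; [|by apply: itgB => //; exact: itg_cst|exact: itgZ].
  rewrite ExB //; last exact: itg_cst.
  by rewrite !ExZ // Ex_cst -E1 (gauss_mean gw w0) (gauss_var gw w0); ring.
apply: (@le_trans _ _ (Ex (fun o => C * `|B w o| ^+ 3))).
  apply: Ex_norm; last 2 first.
  - exact: itgZ.
  - by move=> o; have := heat_taylor r x (B w o); rewrite -[heat2 r x * _ / 2]mulrA [_ ^+ 2 / 2]mulrC mulrA.
  apply: (@itg_meas _ _ _ Q); apply: itgB; last exact: itgZ.
  by apply: itgB; [by apply: itgB => //; exact: itg_cst|exact: itgZ].
rewrite ExZ // [108 * C]mulrC -mulrA ler_wpM2l //; exact: (gauss_cube gw w0).
Qed.

(** The Lindeberg step: the martingale moves by h while the remaining time drops by w. Apart from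
    the linear term only h^2 - w counts, whose conditional mean will vanish. The constant sums 1 for
    Taylor in space, 108 for the change of time and 1 for the displacement of [heat2]. *)
Lemma heat_step (a r w x h : R) : 0 <= a -> a <= 1 -> 0 <= w -> w <= r -> w <= a -> `|h| <= a ->
  `|heat (r - w) (x + h) - heat r x - heat1 r x * h - heat2 r x / 2 * (h ^+ 2 - w)| <= 110 * C * Num.sqrt a * (h ^+ 2 + w).
Proof.
move=> a0 a1 w0 wr wa ha.
have rw0 : 0 <= r - w by rewrite subr_ge0.
have e1 := heat_taylor r x h.
have := heat_time (x + h) rw0 w0; rewrite subrK => e2.
have := @heat2_unif (r - w) r (x + h) x rw0 (le_trans w0 wr).
rewrite (_ : x + h - x = h); last by rewrite addrC addKr.
rewrite (_ : r - w - r = - w); last by rewrite addrC addKr.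
rewrite normrN (ger0_norm w0) => e3.
have sa : a <= Num.sqrt a.
  by rewrite -{1}(sqr_sqrtr a0) expr2 ler_piMl ?sqrtr_ge0 // -sqrtr1 ler_wsqrtr.
have sw : Num.sqrt w <= Num.sqrt a by rewrite ler_wsqrtr.
have h2 : 0 <= h ^+ 2 by exact: sqr_ge0.
have s0 := sqrtr_ge0 a.
have g1 : C * `|h| ^+ 3 <= C * Num.sqrt a * h ^+ 2.
  rewrite -mulrA ler_wpM2l // exprS (real_normK (num_real h)) ler_wpM2r //; exact: le_trans ha sa.
have g2 : 108 * C * (w * Num.sqrt w) <= 108 * C * Num.sqrt a * w.
  rewrite (_ : 108 * C * Num.sqrt a * w = 108 * C * (w * Num.sqrt a)); last by ring.
  by rewrite ler_wpM2l ?mulr_ge0 // ler_wpM2l.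
have g3 : `|(heat2 (r - w) (x + h) - heat2 r x) * w / 2| <= C * Num.sqrt a * w.
  rewrite -mulrA normrM [`|w / 2|]ger0_norm ?divr_ge0 //.
  have : C * (`|h| + Num.sqrt w) <= C * (2 * Num.sqrt a) by rewrite ler_wpM2l //; have := le_trans ha sa; lra.
  move=> /(le_trans e3) e4; apply: le_trans (ler_wpM2r (divr_ge0 w0 (ler0n R 2)) e4) _.
  by rewrite le_eqVlt; apply/orP; left; apply/eqP; field.
set D := heat2 (r - w) (x + h) in e2 e3 g3.
have -> : heat (r - w) (x + h) - heat r x - heat1 r x * h - heat2 r x / 2 * (h ^+ 2 - w) =
   (heat r (x + h) - heat r x - heat1 r x * h - heat2 r x * h ^+ 2 / 2)
   - (heat r (x + h) - heat (r - w) (x + h) - D * w / 2) - (D - heat2 r x) * w / 2 by ring.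
apply: le_trans (ler_normB _ _) _; apply: le_trans (lerD (ler_normB _ _) (lexx _)) _.
apply: le_trans (lerD (lerD (le_trans e1 g1) (le_trans e2 g2)) g3) _.
have p1 : 0 <= C * Num.sqrt a * h ^+ 2 by apply: mulr_ge0 => //; exact: mulr_ge0.
have p2 : 0 <= C * Num.sqrt a * w by apply: mulr_ge0 => //; exact: mulr_ge0.
have -> : 110 * C * Num.sqrt a * (h ^+ 2 + w) = 110 * (C * Num.sqrt a * h ^+ 2) + 110 * (C * Num.sqrt a * w) by ring.
have -> : 108 * C * Num.sqrt a * w = 108 * (C * Num.sqrt a * w) by ring.
move: (_ * h ^+ 2) (_ * w) p1 p2 => z1 z2; lra.
Qed.

End semigroup.
End brownian.

(** * Smoothing of Lipschitz functions, measurability in coordinates, signed exponential means *)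

Section smoothing.
Context {R : realType}.
Implicit Types (f : R -> R) (x y h a K C : R).

Lemma derive_addl (x u : R) : is_derive u 1 (fun u : R => x + u) (1 : R).
Proof. by rewrite (_ : (fun u => x + u) = cst x + id) //; apply: is_derive_eq; rewrite add0r. Qed.

Lemma derive_comp_addl f (f' : R) x (u : R) : is_derive (x + u) 1 f f' -> is_derive u 1 (fun u : R => f (x + u)) f'.
Proof.
move=> D; have := @is_derive1_comp _ f (fun u => x + u) u _ _ D (derive_addl x u).
by rewrite mulr1.
Qed.

Lemma mvt_abs f (f' : R -> R) x y : (forall z : R, is_derive z 1 f (f' z)) ->
  exists2 c : R, `|c - x| <= `|y - x| & f y - f x = f' c * (y - x).
Proof.
move=> df.
have cf (a b : R) : {within `[a, b], continuous f}.
  by apply: derivable_within_continuous => u _; have du := df u; exact: ex_derive.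
have [h|h|->] := ltgtP x y.
- have [c] := MVT h (fun u _ => df u) (cf x y); rewrite in_itv /= => /andP[c1 c2] e.
  by exists c => //; rewrite !ger0_norm ?subr_ge0 ?(ltW h) ?(ltW c1) // lerD2r ltW.
- have [c] := MVT h (fun u _ => df u) (cf y x); rewrite in_itv /= => /andP[c1 c2] e.
  exists c; last by rewrite -opprB e -mulrN opprB.
  by rewrite !ler0_norm ?subr_le0 ?(ltW h) ?(ltW c2) // lerN2 lerD2r ltW.
- by exists y => //; rewrite !subrr mulr0.
Qed.

Lemma taylor2 f (f1 f0 : R -> R) C : (forall z : R, is_derive z 1 f (f1 z)) ->
  (forall z : R, is_derive z 1 f1 (f0 z)) -> (forall x y, `|f0 x - f0 y| <= C * `|x - y|) -> 0 <= C ->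
  forall x h, `|f (x + h) - f x - f1 x * h - f0 x * h ^+ 2 / 2| <= C * `|h| ^+ 3.
Proof.
move=> d1 d0 lip C0 x h.
have s1 u : `|f1 (x + u) - f1 x - f0 x * u| <= C * `|u| ^+ 2.
  have [c] := @mvt_abs _ _ x (x + u) d0; rewrite (_ : x + u - x = u) => [cu ->|]; last by rewrite addrC addKr.
  rewrite -mulrBl normrM expr2 mulrA ler_wpM2r //; apply: le_trans (lip _ _) _.
  by rewrite ler_wpM2l.
pose psi u := f (x + u) - f x - f1 x * u - f0 x * u ^+ 2 / 2.
have dpsi (u : R) : is_derive u 1 psi (f1 (x + u) - f1 x - f0 x * u).
  have dc := derive_comp_addl (d1 (x + u)).
  rewrite /psi (_ : (fun u => _) = (fun u : R => f (x + u)) - cst (f x) - f1 x *: id - (f0 x / 2) *: (fun u : R => u ^+ 2)); last first.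
    by apply/funext => z; rewrite !fctE /GRing.scale /=; ring.
  by apply: is_derive_eq; rewrite /GRing.scale /=; field.
have [c] := @mvt_abs _ _ 0 h dpsi; rewrite !subr0 => ch.
have -> : psi 0 = 0 by rewrite /psi addr0 expr0n /= !mulr0 mul0r !subr0 subrr.
rewrite subr0 => e; rewrite -/(psi h) e normrM exprSr mulrA ler_wpM2r //.
apply: le_trans (s1 c) _; rewrite ler_wpM2l // lerXn2r ?nnegrE //.
Qed.

(** The moving average over [x, x + a]; each application gains one derivative. *)
Definition Av a f x := (prim f (x + a) - prim f x) / a.

Section average.
Variables (a K : R) (f : R -> R).
Hypotheses (a0 : 0 < a) (lip : forall x y, `|f x - f y| <= K * `|x - y|).

Lemma lip_cont : continuous f.
Proof.
move=> x; apply/cvgrPdist_lt => e e0; apply/nbhs_ballP.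
have K1 : 0 < `|K| + 1 by rewrite ltr_wpDl.
exists (e / (`|K| + 1)) => /=; first by rewrite divr_gt0.
move=> z; rewrite /ball /= ltr_pdivlMr // => h; apply: le_lt_trans h; apply: le_trans (lip _ _) _.
by rewrite mulrC ler_wpM2l // (le_trans (ler_norm _)) // lerDl ler01.
Qed.
Let cf := lip_cont.

Let dshift (u x : R) : is_derive u 1 (fun u : R => prim f (x + u)) (f (x + u)).
Proof.
exact: derive_comp_addl (prim_derive (x + u) cf).
Qed.

Lemma Av_derive x : is_derive x 1 (Av a f) ((f (x + a) - f x) / a).
Proof.
have d1 : is_derive x 1 (fun u : R => prim f (u + a)) (f (x + a)).
  rewrite (_ : (fun u => _) = (fun u => prim f (a + u))); last by apply/funext => u; rewrite addrC.
  by rewrite addrC; exact: dshift.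
have d2 := prim_derive x cf.
rewrite /Av; apply: is_derive_eq; rewrite /GRing.scale /=; field; by rewrite gt_eqF.
Qed.

Lemma Av_mid x : exists2 c : R, `|c - x| <= a & Av a f x = f c.
Proof.
have [c] := @mvt_abs _ _ x (x + a) (fun z => prim_derive z cf).
rewrite (_ : x + a - x = a); last by rewrite addrC addKr.
rewrite (gtr0_norm a0) => ca e; exists c => //.
by rewrite /Av e mulfK // gt_eqF.
Qed.

Lemma Av_close x : 0 <= K -> `|Av a f x - f x| <= K * a.
Proof.
move=> K0; have [c ca ->] := Av_mid x; apply: le_trans (lip _ _) _.
by rewrite ler_wpM2l.
Qed.

Lemma Av_lip x y : `|Av a f x - Av a f y| <= K * `|x - y|.
Proof.
pose g u := prim f (x + u) - prim f (y + u).
have dg (u : R) : is_derive u 1 g (f (x + u) - f (y + u)).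
  by have d1 := dshift u x; have d2 := dshift u y; rewrite /g; apply: is_derive_eq.
have [c _] := @mvt_abs _ _ 0 a dg; rewrite /g !addr0 subr0 => e.
have -> : Av a f x - Av a f y = f (x + c) - f (y + c).
  apply: (mulIf (lt0r_neq0 a0)); rewrite -e /Av mulrBl !divfK ?gt_eqF //; ring.
by apply: le_trans (lip _ _) _; rewrite (_ : x + c - (y + c) = x - y) //; ring.
Qed.

End average.

(** Averaging twice gives two derivatives, the second one Lipschitz because it is a combination of
    translates of f; each averaging moves the values by at most K a. *)
Lemma smoothing f K a : 0 < a -> 0 <= K -> (forall x y, `|f x - f y| <= K * `|x - y|) ->
  (forall x, 0 <= f x <= 1) -> exists (g g1 g0 : R -> R) C,
  [/\ forall x, 0 <= g x <= 1, forall x, `|g x - f x| <= 2 * K * a, 0 <= C,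
   continuous g /\ continuous g1 /\ continuous g0 &
   [/\ forall x, `|g1 x| <= C, forall x, `|g0 x| <= C, forall x y, `|g x - g y| <= C * `|x - y|,
    forall x y, `|g0 x - g0 y| <= C * `|x - y| &
    forall x h, `|g (x + h) - g x - g1 x * h - g0 x * h ^+ 2 / 2| <= C * `|h| ^+ 3]].
Proof.
move=> a0 K0 lip f01.
pose u := Av a f; pose g := Av a u.
have ul := Av_lip a0 lip; have gl := Av_lip a0 ul.
pose g1 x := (u (x + a) - u x) / a.
pose g0 x := ((f (x + a + a) - f (x + a)) / a - (f (x + a) - f x) / a) / a.
have d1 (x : R) : is_derive x 1 g (g1 x) := Av_derive a0 ul x.
have d0 (x : R) : is_derive x 1 g1 (g0 x).
  have e1 := Av_derive a0 lip x.
  have e2 : is_derive x 1 (fun z : R => u (z + a)) ((f (x + a + a) - f (x + a)) / a).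
    rewrite (_ : (fun z => _) = (fun z => u (a + z))); last by apply/funext => z; rewrite addrC.
    by apply: derive_comp_addl; rewrite addrC; exact: (Av_derive a0 lip (x + a)).
  rewrite /g1 /g0; apply: is_derive_eq; rewrite /GRing.scale /=; field; by rewrite gt_eqF.
have u01 x : 0 <= u x <= 1 by rewrite /u; have [c _ ->] := Av_mid a0 lip x.
have g01 x : 0 <= g x <= 1 by rewrite /g; have [c _ ->] := Av_mid a0 ul x.
pose C := K + 2 * K / a + 4 * K / a ^+ 2.
have p1 : 0 <= 2 * K / a by rewrite divr_ge0 ?mulr_ge0 // ltW.
have p2 : 0 <= 4 * K / a ^+ 2 by rewrite divr_ge0 ?mulr_ge0 ?exprn_ge0 // ltW.
have C0 : 0 <= C by rewrite !addr_ge0.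
have KC : K <= C by rewrite /C; lra.
have lipC (z : R) : 0 <= z -> K * z <= C * z by move=> z0; rewrite ler_wpM2r.
have g0l x y : `|g0 x - g0 y| <= C * `|x - y|.
  have -> : g0 x - g0 y = ((f (x + a + a) - f (y + a + a)) - (f (x + a) - f (y + a)) - ((f (x + a) - f (y + a)) - (f x - f y))) / a ^+ 2.
    by rewrite /g0; field; rewrite gt_eqF.
  rewrite normrM [`|_^-1|]gtr0_norm ?invr_gt0 ?exprn_gt0 // ler_pdivrMr ?exprn_gt0 //.
  have s1 z : `|f (x + z) - f (y + z)| <= K * `|x - y|.
    by apply: le_trans (lip _ _) _; rewrite (_ : x + z - (y + z) = x - y) //; ring.
  have q1 := s1 a; have q2 : `|f (x + a + a) - f (y + a + a)| <= K * `|x - y| by rewrite -!addrA; exact: s1.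
  have q3 := lip x y.
  apply: le_trans (ler_normB _ _) _; apply: le_trans (lerD (ler_normB _ _) (ler_normB _ _)) _.
  have : 4 * K * `|x - y| <= C * `|x - y| * a ^+ 2.
    have -> : 4 * K * `|x - y| = (4 * K / a ^+ 2) * `|x - y| * a ^+ 2 by field; rewrite gt_eqF.
    by rewrite ler_pM2r ?exprn_gt0 // ler_wpM2r // /C; lra.
  by move: q1 q2 q3; lra.
exists g, g1, g0, C; split => //.
- move=> x; have := Av_close a0 ul x K0; have := Av_close a0 lip x K0; rewrite -/u -/g => h1 h2.
  by have := ler_distD (u x) (g x) (f x); lra.
- split; first exact: (lip_cont gl).
  split; last exact: (lip_cont g0l).
  by move=> x; apply: differentiable_continuous; apply/derivable1_diffP; have dd := d0 x; exact: ex_derive.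
split => //.
- move=> x; rewrite /g1 normrM [`|_^-1|]gtr0_norm ?invr_gt0 // ler_pdivrMr //.
  apply: le_trans (ul _ _) _; rewrite (_ : x + a - x = a); last by rewrite addrC addKr.
  by rewrite (gtr0_norm a0) ler_wpM2r // ltW.
- move=> x; rewrite /g0 normrM [`|_^-1|]gtr0_norm ?invr_gt0 // ler_pdivrMr //.
  have t z : `|(f (z + a) - f z) / a| <= K.
    rewrite normrM [`|_^-1|]gtr0_norm ?invr_gt0 // ler_pdivrMr //.
    by apply: le_trans (lip _ _) _; rewrite (_ : z + a - z = a) ?gtr0_norm // addrC addKr.
  apply: le_trans (ler_normB _ _) _; apply: le_trans (lerD (t _) (t _)) _.
  have -> : K + K = 2 * K / a * a by field; rewrite gt_eqF.
  by rewrite ler_pM2r // /C; lra.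
- by move=> x y; apply: le_trans (gl x y) _; exact: lipC.
- exact: (taylor2 d1 d0 g0l C0).
Qed.

End smoothing.

Section coordinates.
Context {R : realType} d {T : measurableType d}.

(** The assumption on [G] is upper semicontinuity in the first p coordinates: the set where G < a is
    a union of cells with rational centres and inverse integer radii, which are countably many and
    coded by [pickle]. *)
Lemma measurable_coords p (G : (nat -> R) -> R) (X : nat -> T -> R) :
  (forall j, measurable_fun setT (X j)) ->
  (forall v (e : R), 0 < e -> exists2 r : R, 0 < r & forall v', (forall j, (j < p)%N -> `|v j - v' j| < r) -> G v' < G v + e) ->
  measurable_fun setT (fun w => G (fun j => X j w)).
Proof.
move=> mX cG; apply: (measurability _ (RGenInftyO.measurableE R)) => //.
move=> /= _ [_ [a ->] <-]; rewrite setTI.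
pose near (y : seq rat) (k : nat) (v : nat -> R) := forall j, (j < p)%N -> `|ratr (nth 0 y j) - v j| < k.+1%:R^-1.
pose cell (y : seq rat) (k : nat) : set T := [set w | near y k (fun j => X j w)].
have mcell' p0 y k : measurable [set w | forall j, (j < p0)%N -> `|ratr (nth 0 y j) - X j w| < k.+1%:R^-1].
  elim: p0 => [|p' IH]; first by rewrite (_ : [set w | _] = setT) //; apply/seteqP; split => w.
  rewrite (_ : [set w | _] = [set w | forall j, (j < p')%N -> `|ratr (nth 0 y j) - X j w| < k.+1%:R^-1] `&`
     [set w | `|ratr (nth 0 y p') - X p' w| < k.+1%:R^-1]).
    apply: measurableI => //.
    have mb : measurable_fun setT (fun w => `|ratr (nth 0 y p') - X p' w| < k.+1%:R^-1).
      apply: measurable_fun_ltr => //; apply: measurableT_comp => //; apply: measurable_funB => //.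
    by have := mb measurableT [set true] I; rewrite setTI.
  apply/seteqP; split => w /= h; first by split; [move=> j jp; apply: h; exact: leqW|exact: h].
  by move=> j; rewrite ltnS leq_eqVlt => /orP[/eqP ->|jp]; [exact: h.2|exact: h.1].
have mcell y k : measurable (cell y k) by exact: mcell'.
pose U (i : nat) : set T := if unpickle i is Some (y, k) then
  (if pselect (forall v, near y k v -> G v < a) then cell y k else set0) else set0.
rewrite (_ : _ @^-1` _ = \bigcup_i U i).
  apply: bigcupT_measurable => i; rewrite /U; case: unpickle => // -[y k].
  by case: (pselect _) => h /=; [exact: mcell|exact: measurable0].
apply/seteqP; split => w.
  rewrite /= in_itv /= => ga.
  have e0 : 0 < a - G (fun j => X j w) by rewrite subr_gt0.
  have [r r0 hr'] := cG (fun j => X j w) _ e0.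
  have hr v' : (forall j, (j < p)%N -> `|X j w - v' j| < r) -> G v' < a by move=> /hr'; rewrite addrC subrK.
  pose k := Num.bound (2 / r).
  have kr : k.+1%:R^-1 < r / 2.
    rewrite -[r / 2]invrK ltf_pV2 ?posrE ?invr_gt0 ?divr_gt0 // invf_div.
    apply: lt_le_trans (archi_boundP (divr_ge0 (ler0n R 2) (ltW r0))) _.
    by rewrite ler_nat leqW.
  have qex j : exists q : rat, `|ratr q - X j w| < k.+1%:R^-1.
    have lt1 : X j w - k.+1%:R^-1 < X j w + k.+1%:R^-1.
      by apply: (@lt_trans _ _ (X j w)); [rewrite gtrBl|rewrite ltrDl]; rewrite invr_gt0.
    have [q] := rat_in_itvoo lt1; rewrite in_itv /= => /andP[q1 q2].
    by exists q; rewrite ltr_distl q1 q2.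
  have [q hq] := choice qex.
  exists (pickle (mkseq q p, k)) => //; rewrite /U pickleK.
  have nth_q j : (j < p)%N -> nth 0 (mkseq q p) j = q j by move=> jp; rewrite nth_mkseq.
  case: (pselect _) => [h0 /=|[]]; first by move=> j jp; rewrite nth_q.
  move=> v hv; apply: hr => j jp; have := hv j jp; have := hq j; rewrite nth_q // distrC => h1 h2.
  apply: le_lt_trans (ler_distD (ratr (q j)) _ _) _.
  have -> : r = r / 2 + r / 2 by rewrite -splitr.
  exact: ltrD (lt_trans h1 kr) (lt_trans h2 kr).
move=> [i _]; rewrite /U; case: unpickle => // -[y k]; case: (pselect _) => // h wc.
by rewrite /= in_itv /=; exact: (h _ wc).
Qed.

End coordinates.

(** The second-order coefficient of [heat] has no sign, unlike the variance factor in
    [exp_int_mart]. For m >= 1 the bracket multiplied by K stays in [-1, 1], so |K| <= 1 keeps the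
    integrand nonnegative. *)
Lemma exp_int_signed {R : realType} (m : R) (f : R -> R) (c K : R) : 1 <= m -> 0 <= c -> `|K| <= 1 ->
  (forall x : R, 0 <= x -> f x <= c * (1 + K * (m / (m + x) ^+ 2 - x / (m + x)))) ->
  (\int[@lebesgue_measure R]_(x in `[0%R, +oo[) ((f x)%:E * (expR (- x))%:E) <= c%:E)%E.
Proof.
move=> m1 c0 K1 fle.
have m0 : 0 < m by exact: lt_le_trans m1.
have mx0 (x : R) : 0 <= x -> 0 < m + x by move=> x0; rewrite ltr_pwDl.
have dmx (x : R) : is_derive x 1 (fun x => m + x) 1 := derive_addl m x.
pose G x := c * (1 - K) + c * K * m * (m + x)^-1.
pose G' x := - (c * K * m / (m + x) ^+ 2).
have -> : c%:E = (G 0)%:E by rewrite /G addr0; congr EFin; field; rewrite gt_eqF.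
have E (x : R) : 0 <= x -> G x - G' x = c * (1 + K * (m / (m + x) ^+ 2 - x / (m + x))).
  by move=> /mx0 p; rewrite /G /G'; field; rewrite gt_eqF.
have frac (x : R) : 0 <= x -> 0 <= x / (m + x) <= 1.
  move=> x0; rewrite divr_ge0 ?(ltW (mx0 _ x0)) //=.
  by rewrite ler_pdivrMr ?mx0 // mul1r lerDr ltW.
have Kb (z : R) : -1 <= z <= 1 -> -1 <= K * z <= 1.
  rewrite -!ler_norml => zb; rewrite normrM.
  by apply: le_trans (ler_pM (normr_ge0 K) (normr_ge0 z) K1 zb) _; rewrite mulr1.
apply: (@le_exp_integral _ f G G' (2 * c)).
- by move=> x x0; rewrite E //; exact: fle.
- move=> x x0; have := dmx x => d1; have nz : m + x != 0 by rewrite gt_eqF ?mx0.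
  rewrite /G /G'; apply: is_derive_eq.
  rewrite /GRing.scale /= add0r -exprVn; field; exact: nz.
- move=> x x0; rewrite /G'; apply: continuousN; apply: continuousM; first exact: cst_continuous.
  apply: continuousV; first by rewrite expf_neq0 // gt_eqF ?mx0.
  rewrite (_ : (fun y : R => (m + y) ^+ 2) = (fun y => (m + y) * (m + y))); last first.
    by apply/funext => y; rewrite expr2.
  by apply: continuousM; apply: continuousD; try exact: cst_continuous; exact: cvg_id.
- move=> x x0; rewrite E // mulr_ge0 //.
  have /andP[f0 f1] := frac x x0.
  have q0 : 0 <= m / (m + x) ^+ 2 by rewrite divr_ge0 ?(ltW m0) // exprn_ge0 // ltW ?mx0.
  have q1 : m / (m + x) ^+ 2 <= 1.
    rewrite ler_pdivrMr ?exprn_gt0 ?mx0 // mul1r expr2.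
    apply: le_trans (ler_peMl (ltW (mx0 x x0)) _); first by rewrite lerDl.
    by apply: le_trans m1 _; rewrite lerDl.
  have zb : -1 <= m / (m + x) ^+ 2 - x / (m + x) <= 1 by apply/andP; split; lra.
  by have /andP[] := Kb _ zb; lra.
- move=> x x0; have /andP[f0 f1] := frac x x0.
  have -> : G x = c * (1 - K * (x / (m + x))) by rewrite /G; field; rewrite gt_eqF ?mx0.
  have /andP[k1 k2] : -1 <= K * (x / (m + x)) <= 1 by apply: Kb; rewrite f1 andbT; lra.
  apply/andP; split; first by rewrite mulr_ge0 //; lra.
  rewrite [2 * c]mulrC -mulrA ler_wpM2l // (@le_trans _ _ (2 * 1)) //; first by lra.
  by rewrite ler_pM2l // -expR0 ler_expR divr_ge0.
Qed.

Section whp_expect.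
Context {R : realType} d {T : measurableType d} (P : probability T R).

Lemma Ex_whp (f : T -> R) (a M e : R) (good : T -> Prop) : measurable_fun setT f -> 0 <= M ->
  whp P e good -> (forall w, `|f w| <= a + M) -> (forall w, good w -> `|f w| <= a) ->
  `|Ex P f| <= a + M * e.
Proof.
move=> mf M0 [Bd [mB PB hB]] fM fa.
have mi : measurable_fun setT (\1_Bd : T -> R) by exact: measurable_indic.
have ii : itg P (\1_Bd) by apply: (@itg_bound _ _ _ _ _ 1) => // w; rewrite indicE normr_nat lern1 leq_b1.
have EB : Ex P (\1_Bd) <= e.
  by rewrite -lee_fin -ExE // integral_indic // setIT.
apply: (@le_trans _ _ (Ex P (fun w => a + M * \1_Bd w))).
  apply: Ex_norm => //; first by apply: itgD; [exact: itg_cst|exact: itgZ].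
  move=> w; rewrite indicE; case: (boolP (w \in Bd)) => h; first by rewrite mulr1.
  by rewrite mulr0 addr0; apply: fa; apply: hB => /mem_set; exact/negP.
rewrite ExD; [|exact: itg_cst|exact: itgZ].
by rewrite Ex_cst ExZ // lerD2l ler_wpM2l.
Qed.

Lemma measurable_prodn m (h : nat -> R -> R) (X : nat -> T -> R) : (forall j, continuous (h j)) ->
  (forall j, measurable_fun setT (X j)) -> measurable_fun setT (fun w => \prod_(j < m) h j (X j w)).
Proof.
move=> ch mX; elim: m => [|m IH].
  by rewrite (_ : (fun w => _) = cst 1) //; apply/funext => w; rewrite big_ord0.
rewrite (_ : (fun w => _) = (fun w => \prod_(j < m) h j (X j w) * h m (X m w))); last by apply/funext => w; rewrite big_ord_recr.
by apply: measurable_funM => //; apply: measurableT_comp => //; exact: continuous_measurable_fun.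
Qed.

End whp_expect.

Lemma prod01 {R : realType} m (h : nat -> R) : (forall j, 0 <= h j <= 1) -> 0 <= \prod_(j < m) h j <= 1.
Proof.
move=> h01; elim: m => [|m /andP[IH1 IH2]]; first by rewrite big_ord0 ler01 lexx.
have /andP[a b] := h01 m; rewrite big_ord_recr /= mulr_ge0 //=.
by apply: le_trans (ler_piMr IH1 b) _.
Qed.

(** * Lindeberg replacement over one stage of the clock *)

Section stage_defs.
Context {R : realType} d {T : measurableType d}.
Variables (E U : nat -> T -> R) (L0 : R -> R) (n A : nat) (dl : R).

(** Half-open, so that at most one stage is on at each step; [sA] of index j then records the
    increment of the martingale made in stage j. *)
Definition stg (j : nat) (x : R) := (j%:R * dl <= x) && (x < j.+1%:R * dl).
Definition sstate k w := st E U (hn n) (chib stg (A * 2 ^ n)%N%:Z) (vinit L0 n) k w.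

(** K steps suffice to pass all p stages, after which their recordings are final. *)
Definition stage_ok (p K : nat) w :=
  (forall k, sW (base E U L0 n k w) < p%:R * dl -> `|sX (base E U L0 n k w)| < (A * 2 ^ n)%N%:Z) /\
  p%:R * dl <= sW (base E U L0 n K w).

End stage_defs.

Section stages.
Context {R : realType} d {T : measurableType d} (P : probability T R).
Variables (E U : nat -> T -> R) (cEU : clocks P E U).
Variables (L0 : R -> R) (L0pos : forall x, 0 < L0 x).
Variables (n A : nat) (c dl : R).
Hypotheses (c0 : 0 < c) (dl0 : 0 < dl) (cL : forall x : R, `|x| <= A%:R -> c <= L0 x).
Implicit Types (k m p : nat) (x : R).
Local Notation base := (base E U L0 n).
Local Notation W k w := (sW (base k w)).
Local Notation Mt k w := (sM (base k w)).
Local Notation Wd := ((A * 2 ^ n)%N%:Z).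
Local Notation stg := (stg dl).
Local Notation s := (sstate E U L0 n A dl).
Local Notation on m k w := (chib stg Wd m (base k w)).
Local Notation ka := (hn n / c ^+ 2).

Let ka0 : 0 < ka. Proof. by rewrite divr_gt0 ?hn_gt0 // exprn_gt0. Qed.

Lemma mstg m : measurable_fun setT (stg m : measurableTypeR R -> bool).
Proof. by apply: measurable_and; [exact: measurable_fun_ler|exact: measurable_fun_ltr]. Qed.

Lemma stg_lt i j x : stg i x -> j%:R * dl <= x -> (j <= i)%N.
Proof.
move=> /andP[_ h1] h2; rewrite leqNgt; apply/negP => ij.
have : x < x by apply: lt_le_trans h1 (le_trans _ h2); rewrite ler_pM2r // ler_nat.
by rewrite ltxx.
Qed.

Lemma stg_uniq i j x : stg i x -> stg j x -> i = j.
Proof.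
move=> h1 h2; apply/eqP; rewrite eqn_leq.
by rewrite (stg_lt h2) ?(stg_lt h1) //; [case/andP: h2|case/andP: h1].
Qed.

Lemma stg_ex m x : 0 <= x -> x < m%:R * dl -> exists2 j, (j < m)%N & stg j x.
Proof.
move=> x0; elim: m => [|m IH]; first by rewrite mul0r ltNge x0.
move=> h; have [h1|h1] := ltP x (m%:R * dl).
  by have [j jm sj] := IH h1; exists j => //; exact: leqW.
by exists m => //; apply/andP; split.
Qed.

Lemma sstate_S k w m : sA (s k.+1 w) m = sA (s k w) m + on m k w * (Mt k.+1 w - Mt k w) /\
  sB (s k.+1 w) m = sB (s k w) m + on m k w * (W k.+1 w - W k w).
Proof.
have [b [-> -> _] mE] := sts_S E U L0pos n stg Wd k w m.
have e1 : Mt k.+1 w - Mt k w = dM (hn n) (base k w) `|E k w| b by rewrite mE addrAC subrr add0r.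
have e2 : W k.+1 w - W k w = dW (hn n) (base k w) `|E k w| by rewrite sW_S addrAC subrr add0r.
by rewrite e1 e2.
Qed.

Lemma on_window k w m : on m k w = 0 \/ [/\ on m k w = 1, stg m (W k w), W k.+1 w - W k w <= ka & `|Mt k.+1 w - Mt k w| <= ka].
Proof.
have vb := valid_base E U L0pos n k w.
have [->|[e c1 c2 c3]] := @chib_window R L0 n stg Wd A c (lexx _) c0 cL m (base k w); first by left.
right; split => //.
- by move: e; rewrite /chib; case: (stg m _) => //= /eqP; rewrite eq_sym oner_eq0.
- rewrite sW_S addrAC subrr add0r; exact: (dW_small c0 vb (normr_ge0 _) c1 c2 c3).
have cl j : c <= lon L0 n j -> c <= sL (base k w) j.
  by move=> h; have /andP[_] := vb.1 j; exact: le_trans.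
have [b [_ _ ->]] := sM_S E U L0pos n k w; rewrite addrAC subrr add0r.
have hh := hn_gt0 (R := R) n; have x0 := normr_ge0 (E k w).
case: b; rewrite /dM ?normrN gtr0_norm ?(ajp_gt0 hh vb x0) ?(ajm_gt0 hh vb x0) //.
  exact: (ajp_le hh vb c0 (cl _ c1) (cl _ c2) x0).
exact: (ajm_le hh vb c0 (cl _ c1) (cl _ c3) x0).
Qed.

Lemma W_step k w : 0 <= W k.+1 w - W k w.
Proof. by rewrite subr_ge0; exact: (sW_le E U L0pos n w (leqnSn k)). Qed.

Lemma stage_B_upper k w m : 0 <= sB (s k w) m /\ sB (s k w) m <= Num.max 0 (W k w - m%:R * dl).
Proof.
elim: k => [|k [IH0 IH]]; first by rewrite /= le_max !lexx.
have [_ ->] := sstate_S k w m; have d0 := W_step k w.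
have [->|[-> /andP[h1 h2] _ _]] := on_window k w m.
  rewrite mul0r addr0; split => //; apply: le_trans IH _.
  rewrite ge_max; apply/andP; split; first by rewrite le_max lexx.
  by rewrite le_max; apply/orP; right; rewrite lerD2r -subr_ge0.
rewrite mul1r addr_ge0 //; split => //; rewrite le_max; apply/orP; right.
by move: IH; rewrite (max_idPr _) ?subr_ge0 //; lra.
Qed.

Lemma stage_B_le k w m : sB (s k w) m <= dl + ka.
Proof.
elim: k => [|k IH]; first by rewrite /= addr_ge0 // ltW.
have [_ ->] := sstate_S k w m.
have [->|[-> /andP[h1 h2] h3 _]] := on_window k w m; first by rewrite mul0r addr0.
rewrite mul1r lerD //; have [_ h4] := stage_B_upper k w m; apply: le_trans h4 _.
rewrite ge_max (ltW dl0) /=; move: h2; rewrite -natr1 mulrDl mul1r; lra.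
Qed.

Lemma stage_before k w m : W k w < m%:R * dl -> sA (s k w) m = 0 /\ sB (s k w) m = 0.
Proof.
elim: k => [//|k IH] h.
have hk : W k w < m%:R * dl by apply: le_lt_trans h; rewrite -subr_ge0 W_step.
have [a1 a2] := IH hk; have [-> ->] := sstate_S k w m.
have [->|[_ /andP[h1 _] _ _]] := on_window k w m; first by rewrite a1 a2 !mul0r !addr0.
by move: hk; rewrite ltNge h1.
Qed.

Lemma stage_sum_on k w m : `|sX (base k w)| < Wd -> W k w < m%:R * dl -> \sum_(j < m) on j k w = 1.
Proof.
move=> win h; have [j0 jm sj] := stg_ex (sW_ge0 E U L0pos n k w) h.
rewrite (bigD1 (Ordinal jm)) //= big1 ?addr0 => [|i /eqP ij]; first by rewrite /chib sj win.
rewrite /chib; case: (boolP (stg i _)) => //= si; exfalso; apply: ij; apply: val_inj; exact: (stg_uniq si sj).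
Qed.

Lemma stage_sum_S k w m : \sum_(j < m) sA (s k.+1 w) j = \sum_(j < m) sA (s k w) j + (\sum_(j < m) on j k w) * (Mt k.+1 w - Mt k w) /\
  \sum_(j < m) sB (s k.+1 w) j = \sum_(j < m) sB (s k w) j + (\sum_(j < m) on j k w) * (W k.+1 w - W k w).
Proof.
rewrite !mulr_suml -!big_split /=; split; apply: eq_bigr => j _; first exact: (sstate_S k w j).1.
exact: (sstate_S k w j).2.
Qed.

(** k is the first step at which the clock is past m dl. Before it exactly one of the first m stages
    is on, afterwards none, so their recordings add up to the martingale and the clock at k; the
    overshoot is that of one step. *)
Lemma stage_time p K w m : stage_ok E U L0 n A dl p K w -> (m <= p)%N -> exists2 k, (k <= K)%N &
  [/\ m%:R * dl <= W k w, forall i, (i < k)%N -> W i w < m%:R * dl, W k w <= m%:R * dl + ka,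
   \sum_(j < m) sA (s K w) j = Mt k w & \sum_(j < m) sB (s K w) j = W k w].
Proof.
move=> [win WK] mp.
have mdl : m%:R * dl <= p%:R * dl by rewrite ler_pM2r // ler_nat.
have aux k : (forall i, (i < k)%N -> W i w < m%:R * dl) ->
    \sum_(j < m) sA (s k w) j = Mt k w /\ \sum_(j < m) sB (s k w) j = W k w.
  elim: k => [|k IH] h.
    by rewrite !big1 //; split => //; exact/esym/S0n0.
  have [a1 a2] := IH (fun i ik => h i (leqW ik)); have hk := h k (ltnSn k).
  have [-> ->] := stage_sum_S k w m; rewrite stage_sum_on //; last by apply: win; exact: lt_le_trans mdl.
  by rewrite a1 a2 !mul1r; split; rewrite addrC subrK.
have main : forall K, m%:R * dl <= W K w -> exists2 k, (k <= K)%N &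
    [/\ m%:R * dl <= W k w, forall i, (i < k)%N -> W i w < m%:R * dl, W k w <= m%:R * dl + ka,
     \sum_(j < m) sA (s K w) j = Mt k w & \sum_(j < m) sB (s K w) j = W k w].
  elim=> [|k IH] h.
    have [a1 a2] := aux 0%N (fun i ik => False_ind _ (Bool.diff_false_true ik)).
    exists 0%N => //; split => //; rewrite (_ : W 0%N w = 0) //.
    by rewrite addr_ge0 ?(ltW ka0) // mulr_ge0 // ltW.
  have [h1|h1] := leP (m%:R * dl) (W k w).
    have [k' k'k [b1 b2 b3 b4 b5]] := IH h1; exists k'; first exact: leqW.
    have off : \sum_(j < m) on j k w = 0.
      rewrite big1 // => j _; rewrite /chib; case: (boolP (stg j _)) => //= sj.
      by have := stg_lt sj h1; rewrite leqNgt ltn_ord.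
    by have [-> ->] := stage_sum_S k w m; rewrite off !mul0r !addr0.
  have hk i : (i < k.+1)%N -> W i w < m%:R * dl.
    by rewrite ltnS => ik; apply: le_lt_trans h1; exact: (sW_le E U L0pos n w ik).
  have [a1 a2] := aux k.+1 hk; exists k.+1 => //; split => //.
  have [j0 jm sj] := stg_ex (sW_ge0 E U L0pos n k w) h1.
  have o1 : on j0 k w = 1 by rewrite /chib sj win // (lt_le_trans h1 mdl).
  have [z0|[_ _ h2 _]] := on_window k w j0; first by move: z0; rewrite o1 => /eqP; rewrite oner_eq0.
  have -> : W k.+1 w = W k w + (W k.+1 w - W k w) by rewrite addrC subrK.
  by rewrite lerD // ltW.
by apply: main; apply: le_trans WK.
Qed.

Lemma stage_B_lower p K w m : stage_ok E U L0 n A dl p K w -> (m < p)%N -> dl - ka <= sB (s K w) m.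
Proof.
move=> ok mp; have [k1 _ [_ _ h1 _ e1]] := stage_time ok (ltnW mp).
have [k2 _ [h2 _ _ _ e2]] := stage_time ok mp.
rewrite big_ord_recr /= e1 in e2.
by move: h2; rewrite -e2 -natr1 mulrDl mul1r; move: h1; lra.
Qed.

Lemma sstate_meas k : mstate (s k : T -> @vst R).
Proof.
pose Y' (i : nat + nat) := match i with inl k => E k | inr k => U k end.
have : mstate (s k : g_sigma_algebraType (past_gen Y' (past_jump k)) -> @vst R) by apply: mst; exact: (mfunc_chib Wd mstg).
have pm := past_measurable_fun cEU.1.
case=> h1 [h2 [h3 [h4 [h5 [h6 [h7 [h8 h9]]]]]]].
split; first by move=> j; exact: pm (h1 j).
split; first by move=> j; exact: pm (h2 j).
split; first by move=> j; exact: pm (h3 j).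
split; first exact: pm h4.
split; first exact: pm h5.
split; first exact: pm h6.
split; first by move=> j; exact: pm (h7 j).
by split => j; [exact: pm (h8 j)|exact: pm (h9 j)].
Qed.

Lemma sstate_A k j : measurable_fun setT (fun w => sA (s k w) j).
Proof. by have [_ [_ [_ [_ [_ [_ [h _]]]]]]] := sstate_meas k. Qed.
Lemma sstate_B k j : measurable_fun setT (fun w => sB (s k w) j).
Proof. by have [_ [_ [_ [_ [_ [_ [_ [h _]]]]]]]] := sstate_meas k. Qed.

Context d' {Om : measurableType d'} (Q : probability Om R) (B : R -> Om -> R).
Hypothesis hB : brownian_motion Q B.
Variables (f f1 f0 : R -> R) (C : R).
Hypotheses (f01 : forall x, 0 <= f x <= 1) (C0 : 0 <= C) (cf : continuous f) (cf1 : continuous f1) (cf0 : continuous f0).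
Hypotheses (f1b : forall x, `|f1 x| <= C) (f0b : forall x, `|f0 x| <= C) (flip : forall x y, `|f x - f y| <= C * `|x - y|).
Hypotheses (f0lip : forall x y, `|f0 x - f0 y| <= C * `|x - y|).
Hypothesis tay : forall x h : R, `|f (x + h) - f x - f1 x * h - f0 x * h ^+ 2 / 2| <= C * `|h| ^+ 3.
Variables (g : nat -> R -> R) (m : nat).
Hypotheses (g01 : forall j x, 0 <= g j x <= 1) (cg : forall j, continuous (g j)).
Local Notation heat := (heat Q B f).
(** Twice the constant of [heat_step]: that error is proportional to h^2 + dW, whose mean is 2 dW,
    so subtracting [eps] times the clock absorbs it. *)
Let eps := 220 * C * Num.sqrt ka.
Hypotheses (ka1 : ka <= 1) (eps1 : eps * (dl + ka) <= 1) (Cka : 111 * C * ka <= 1).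

(** [Y] collects the finished stages and [Dh] is the change of the heat value since the start of
    stage m; dl + ka bounds the duration of the stage, overshoot included. The constant 4 keeps
    [inner] above 2 on reached states, so the maximum with 0 acts only on states that are never
    reached; [sg] will be 1 and -1 to control both signs. *)
Let Y (v : @vst R) := \prod_(j < m) g j (sA v j).
Let Dh (v : @vst R) := heat (Num.max 0 (dl + ka - sB v m)) (sA v m) - heat (dl + ka) 0.
Let inner sg v := 4 + sg * (Y v * Dh v) - eps * sB v m.
Let F sg v := Num.max 0 (inner sg v).

Let eps0 : 0 <= eps. Proof. by rewrite /eps !mulr_ge0 // sqrtr_ge0. Qed.
Let dk0 : 0 < dl + ka. Proof. exact: addr_gt0. Qed.
Let Y01 v : 0 <= Y v <= 1. Proof. by apply: (@prod01 R m (fun j => g j (sA v j))). Qed.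
Let D1 v : `|Dh v| <= 1.
Proof.
have /andP[a1 a2] := heat01 hB cf f01 (Num.max 0 (dl + ka - sB v m)) (sA v m).
have /andP[b1 b2] := heat01 hB cf f01 (dl + ka) 0.
by rewrite ler_norml; apply/andP; split; rewrite /Dh; lra.
Qed.
Let YD1 sg v : `|sg| <= 1 -> `|sg * (Y v * Dh v)| <= 1.
Proof.
move=> s1; have /andP[y0 y1] := Y01 v; rewrite !normrM (ger0_norm y0).
apply: mulr_ile1 => //; first by rewrite mulr_ge0.
exact: mulr_ile1.
Qed.

Let mheat dd (S : measurableType dd) (X1 X2 : S -> R) : measurable_fun setT X1 -> measurable_fun setT X2 ->
  measurable_fun setT (fun w => heat (Num.max 0 (X1 w)) (X2 w)).
Proof.
move=> m1 m2; pose X (j : nat) := if j == 0%N then X1 else X2.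
apply: (@measurable_coords R _ _ 2 (fun v => heat (Num.max 0 (v 0%N)) (v 1%N)) X); first by move=> [|j].
move=> v e e0; pose t := e / (2 * (C + 1)).
have C1 : 0 < 2 * (C + 1) by rewrite mulr_gt0 // ltr_wpDl.
have t0 : 0 < t by rewrite divr_gt0.
exists (Num.min t (t ^+ 2)); first by rewrite lt_min t0 exprn_gt0.
move=> v' h; have := h 0%N isT; have := h 1%N isT; rewrite !lt_min => /andP[h1 _] /andP[_ h0].
have p (z : R) : 0 <= Num.max 0 z by rewrite le_max lexx.
have mx (a b : R) : `|Num.max 0 a - Num.max 0 b| <= `|a - b|.
  case: (leP 0 a) => ha; case: (leP 0 b) => hb; rewrite ?subrr ?normr0 ?subr0 ?sub0r ?normrN //.
    by rewrite (ger0_norm ha) ger0_norm ?subr_ge0; lra.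
  by rewrite (ger0_norm hb) ler0_norm ?subr_le0; lra.
have := heat_unif hB cf f01 C0 flip (v 1%N) (v' 1%N) (p (v 0%N)) (p (v' 0%N)).
have sq : Num.sqrt `|Num.max 0 (v 0%N) - Num.max 0 (v' 0%N)| <= t.
  have tt : t = Num.sqrt (t ^+ 2) by rewrite sqrtr_sqr ger0_norm // ltW.
  by rewrite [leRHS]tt ler_wsqrtr // (le_trans (mx _ _)) // ltW.
have : C * (`|v 1%N - v' 1%N| + Num.sqrt `|Num.max 0 (v 0%N) - Num.max 0 (v' 0%N)|) <= C * (t + t).
  by rewrite ler_wpM2l // lerD // ltW.
have : C * (t + t) < e.
  have -> : e = (2 * (C + 1)) * t by rewrite /t mulrC divfK // gt_eqF.
  by move: t0; lra.
move: (C * (t + t)) (C * _) => z1 z2; rewrite ler_norml => h2 h3 /andP[h4 h5]; lra.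
Qed.

Let mD dd (S : measurableType dd) (v : S -> @vst R) : (forall j, measurable_fun setT (fun w => sA (v w) j)) ->
  (forall j, measurable_fun setT (fun w => sB (v w) j)) -> measurable_fun setT (fun w => Y (v w) * Dh (v w)).
Proof.
move=> mA mB; apply: measurable_funM; first exact: (measurable_prodn m cg mA).
by apply: measurable_funB => //; apply: mheat => //; exact: measurable_funB.
Qed.

Let mF sg : mfunc (F sg).
Proof.
move=> dd S v [_ [_ [_ [_ [_ [_ [hA [hB' _]]]]]]]].
apply: measurable_maxr => //; apply: measurable_funB; last exact: measurable_funM.
by apply: measurable_funD => //; apply: measurable_funM => //; exact: mD.
Qed.

Let F0 sg v : 0 <= F sg v. Proof. by rewrite le_max lexx. Qed.

Let inner_ge sg v : `|sg| <= 1 -> sB v m <= dl + ka -> 2 <= inner sg v.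
Proof.
move=> s1 hb; have := YD1 v s1; rewrite ler_norml => /andP[h1 _].
have : eps * sB v m <= eps * (dl + ka) by rewrite ler_wpM2l.
rewrite /inner; move: eps1; lra.
Qed.

(* The conditional variance of an increment and that of the clock agree exactly after averaging
   over the exponential holding time, so only the third-order terms of [heat_step] remain. *)
Let F_super sg k w : `|sg| <= 1 ->
  (\int[@lebesgue_measure R]_(x in `[0%R, +oo[) ((stepavg (hn n) (chib stg Wd) (F sg) (s k w) x)%:E * (expR (- x))%:E) <= (F sg (s k w))%:E)%E.
Proof.
move=> sg1; have hh := hn_gt0 (R := R) n.
have vs : valid (hn n) (lon L0 n) (s k w) := sts_valid E U L0pos n stg Wd k w.
have ce : core (s k w) = core (base k w) := st_core E U L0 n (chib stg Wd) k w.
have onE j : chib stg Wd j (s k w) = on j k w by exact: chib_core.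
have WE : sW (s k w) = W k w by move: ce; rewrite /core => -[].
have [e|[e c1 c2 c3]] := @chib_window R L0 n stg Wd A c (lexx _) c0 cL m (s k w).
  apply: (@supermart_cst _ (hn n) (lon L0 n) (chib stg Wd) hh) => // x b x0.
  suff -> : F sg (step (hn n) (chib stg Wd) (s k w) x b) = F sg (s k w) by [].
  have Be : sB (step (hn n) (chib stg Wd) (s k w) x b) m = sB (s k w) m by rewrite /= e mul0r addr0.
  have Ae : sA (step (hn n) (chib stg Wd) (s k w) x b) m = sA (s k w) m by rewrite /= e mul0r addr0.
  have De : Dh (step (hn n) (chib stg Wd) (s k w) x b) = Dh (s k w) by rewrite /Dh Be Ae.
  rewrite /F /inner Be De; congr (Num.max 0 (4 + sg * _ - _)).
  (* Stage m is off. If an earlier stage is on, stage m has not begun and [Dh] vanishes; otherwise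
     no factor of [Y] changes. *)
  have [[j jm jon]|noj] := pselect (exists2 j, (j < m)%N & on j k w = 1).
    have sj : stg j (W k w).
      by move: jon; rewrite /chib; case: (stg j _) => //= /eqP; rewrite eq_sym oner_eq0.
    have [a1 a2] : sA (s k w) m = 0 /\ sB (s k w) m = 0.
      apply: stage_before; case/andP: sj => _ h; apply: lt_le_trans h _.
      by rewrite ler_pM2r // ler_nat.
    by rewrite /Dh a1 a2 subr0 (max_idPr (ltW dk0)) subrr !mulr0.
  congr (_ * _); apply: eq_bigr => j _ /=; rewrite onE.
  have [->|[h _ _ _]] := on_window k w j; first by rewrite mul0r addr0.
  by exfalso; apply: noj; exists (j : nat).
have cl j : c <= lon L0 n j -> c <= sL (s k w) j.
  by move=> h; have /andP[_] := vs.1 j; exact: le_trans.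
have /andP[k0 k1] := k0v_le hh vs c0 (cl _ c1) (cl _ c2) (cl _ c3).
have mv1 : 1 <= mv (hn n) (s k w).
  have -> : mv (hn n) (s k w) = (lmv (s k w) + lpv (s k w)) / 2 * lcv (s k w) / hn n.
    by rewrite /mv /kap; field; rewrite gt_eqF.
  rewrite ler_pdivlMr // mul1r; apply: (@le_trans _ _ (c * c)).
    by move: ka1; rewrite ler_pdivrMr ?exprn_gt0 // mul1r expr2.
  apply: ler_pM; rewrite ?(ltW c0) //; last exact: cl.
  by have := cl _ c2; have := cl _ c3; rewrite /lmv /lpv; lra.
have sm : stg m (W k w).
  by move: e; rewrite onE /chib; case: (stg m _) => //= /eqP; rewrite eq_sym oner_eq0.
have Bm : sB (s k w) m <= dl.
  have [_ h] := stage_B_upper k w m; apply: le_trans h _; rewrite ge_max (ltW dl0) /=.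
  by case/andP: sm => _; rewrite -natr1 mulrDl mul1r; lra.
have B0 : 0 <= sB (s k w) m := (stage_B_upper k w m).1.
pose r := dl + ka - sB (s k w) m.
pose x1 := sA (s k w) m.
have rE : Num.max 0 r = r by apply/max_idPr; rewrite /r; move: Bm ka0; lra.
have FE : F sg (s k w) = inner sg (s k w).
  by apply/max_idPr; apply: le_trans (inner_ge sg1 (stage_B_le k w m)).
pose D2 := heat2 Q B f0 r x1; pose H1 := heat1 Q B f1 r x1.
pose y := sg * Y (s k w).
have y1 : `|y| <= 1 by rewrite normrM; have /andP[q1 q2] := Y01 (s k w); rewrite (ger0_norm q1) mulr_ile1.
(* The coefficient of h^2 - dW in the expansion of [F]: the error with h^2 + dW takes the same form
   once [eps] dW has been subtracted. *)
pose th := y * D2 / 2 + 110 * C * Num.sqrt ka.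
have sk1 : Num.sqrt ka <= 1 by rewrite -sqrtr1 ler_wsqrtr.
have thb : `|th| <= 111 * C.
  apply: le_trans (ler_normD _ _) _.
  have h1 : `|y * D2 / 2| <= C.
    have D2b : `|D2| <= C := heat2_bound hB f0b (continuous_measurable_fun cf0) r x1.
    rewrite -mulrA normrM; apply: le_trans (ler_piMl (normr_ge0 _) y1) _.
    by rewrite normrM [`|2^-1|]gtr0_norm ?invr_gt0 //; move: D2b C0; lra.
  have : `|110 * C * Num.sqrt ka| <= 110 * C.
    by rewrite ger0_norm ?mulr_ge0 ?sqrtr_ge0 // ler_piMr // mulr_ge0.
  by move: h1; lra.
have stepF (x : R) b : 0 <= x -> F sg (step (hn n) (chib stg Wd) (s k w) x b) <=
    F sg (s k w) + y * H1 * dM (hn n) (s k w) x b + th * (dM (hn n) (s k w) x b ^+ 2 - dW (hn n) (s k w) x).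
  move=> x0; set h := dM _ _ _ _; set dw := dW _ _ _.
  have dw0 : 0 <= dw := dW_ge0 hh vs x0.
  have dwk : dw <= ka := dW_small c0 vs x0 c1 c2 c3.
  have hk : `|h| <= ka.
    rewrite /h; case: (b); rewrite /dM ?normrN gtr0_norm ?(ajp_gt0 hh vs x0) ?(ajm_gt0 hh vs x0) //.
      exact: (ajp_le hh vs c0 (cl _ c1) (cl _ c2) x0).
    exact: (ajm_le hh vs c0 (cl _ c1) (cl _ c3) x0).
  have dwr : dw <= r by rewrite /r; move: Bm dwk; lra.
  have hs := heat_step hB cf f01 C0 (continuous_measurable_fun cf1) f1b f0b flip f0lip tay (continuous_measurable_fun cf0) x1 (ltW ka0) ka1 dw0 dwr dwk hk.
  have Be : sB (step (hn n) (chib stg Wd) (s k w) x b) m = sB (s k w) m + dw by rewrite /= e mul1r.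
  have Ae : sA (step (hn n) (chib stg Wd) (s k w) x b) m = x1 + h by rewrite /= e mul1r.
  have Ye : Y (step (hn n) (chib stg Wd) (s k w) x b) = Y (s k w).
    apply: eq_bigr => j _ /=; rewrite onE.
    have [->|[_ sj _ _]] := on_window k w j; first by rewrite mul0r addr0.
    by have := stg_uniq sj sm => jm; have := ltn_ord j; rewrite jm ltnn.
  have in0 : 0 <= inner sg (step (hn n) (chib stg Wd) (s k w) x b).
    apply: le_trans (inner_ge sg1 _) => //; rewrite Be; move: Bm dwk; lra.
  rewrite /F (max_idPr in0) -/(F _ _) FE /inner Ye /Dh Be Ae -/r -/x1 rE.
  have -> : dl + ka - (sB (s k w) m + dw) = r - dw by rewrite /r opprD addrA.
  rewrite (max_idPr _) ?subr_ge0 //.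
  set Ha := heat (r - dw) (x1 + h) in hs *; set Hb := heat r x1 in hs *; set Hc := heat (dl + ka) 0.
  have hy : y * (Ha - Hb - H1 * h - D2 / 2 * (h ^+ 2 - dw)) <= 110 * C * Num.sqrt ka * (h ^+ 2 + dw).
    apply: le_trans (ler_norm _) _; rewrite normrM.
    have := ler_pM (normr_ge0 _) (normr_ge0 _) y1 hs; rewrite mul1r; exact.
  rewrite /th /eps; move: hy; rewrite /y; lra.
have p0 := lpv_gt0 vs; have q0 := lmv_gt0 vs.
have Fs0 : 1 <= F sg (s k w) by rewrite FE; apply: le_trans (inner_ge sg1 (stage_B_le k w m)); rewrite ler1n.
have Fp : 0 < F sg (s k w) by exact: lt_le_trans Fs0.
apply: (@exp_int_signed R (mv (hn n) (s k w)) _ _ (th * k0v (hn n) (s k w) / F sg (s k w))) => //.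
  rewrite normrM [`|th * _|]normrM (ger0_norm k0) [`|_^-1|]gtr0_norm ?invr_gt0 // ler_pdivrMr // mul1r; apply: le_trans Fs0.
  by apply: le_trans Cka; apply: ler_pM.
move=> x x0; have s1 := stepF x true x0; have s2 := stepF x false x0.
set Fa := F sg (step _ _ _ _ true) in s1 *; set Fb := F sg (step _ _ _ _ false) in s2 *.
rewrite /dM in s1 s2.
have dc := dM_center hh vs x0.
have v1 := aj_mv hh vs x0; have w1 := dW_mv hh vs x0.
have -> : F sg (s k w) * (1 + th * k0v (hn n) (s k w) / F sg (s k w) * (mv (hn n) (s k w) / (mv (hn n) (s k w) + x) ^+ 2 - x / (mv (hn n) (s k w) + x))) =
   F sg (s k w) + th * (k0v (hn n) (s k w) * (mv (hn n) (s k w) / (mv (hn n) (s k w) + x) ^+ 2) - k0v (hn n) (s k w) * (x / (mv (hn n) (s k w) + x))).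
  by field; rewrite !gt_eqF //; rewrite ltr_pwDl // (lt_le_trans ltr01 mv1).
rewrite -v1 -w1 /stepavg -/Fa -/Fb ler_pdivrMr ?addr_gt0 //.
apply: le_trans (lerD (ler_wpM2l (ltW p0) s1) (ler_wpM2l (ltW q0) s2)) _.
move: dc; move: (ajp _ _ _) (ajm _ _ _) (lpv _) (lmv _) (dW _ _ _) (F sg (s k w)) => ap am lp lm ww FF dc.
rewrite le_eqVlt; apply/orP; left; apply/eqP.
have e1 : lp * ap ^+ 2 + lm * am ^+ 2 = (lm + lp) * (ap * am).
  by rewrite !expr2 mulrA dc mulrA -[lm * am * am]mulrA mulrDl -mulrA [lp * (ap * am)]mulrA dc; ring.
have -> : lp * (FF + y * H1 * ap + th * (ap ^+ 2 - ww)) + lm * (FF + y * H1 * - am + th * ((- am) ^+ 2 - ww)) =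
   (lm + lp) * FF + y * H1 * (lp * ap - lm * am) + th * ((lp * ap ^+ 2 + lm * am ^+ 2) - (lm + lp) * ww) by ring.
by rewrite e1 dc; ring.
Qed.

Lemma stage_super sg k : `|sg| <= 1 -> Ex P (fun w => sg * (Y (s k w) * Dh (s k w))) <= eps * (dl + ka).
Proof.
move=> sg1.
have FE w : F sg (s k w) = inner sg (s k w).
  by apply/max_idPr; apply: le_trans (inner_ge sg1 (stage_B_le k w m)).
have mYD : measurable_fun setT (fun w => Y (s k w) * Dh (s k w)) by apply: mD; [exact: sstate_A|exact: sstate_B].
have i1 : itg P (fun w => sg * (Y (s k w) * Dh (s k w))).
  by apply: (@itg_bound _ _ _ _ _ 1) => [|w]; [exact: measurable_funM|exact: YD1].
have i2 : itg P (fun w => sB (s k w) m).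
  apply: (@itg_bound _ _ _ _ _ (dl + ka)); [exact: sstate_B|move=> w].
  by rewrite ger0_norm ?(stage_B_le k w m) //; exact: (stage_B_upper k w m).1.
have le4 : forall k, (\int[P]_w (F sg (s k w))%:E <= 4%:E)%E.
  elim=> [|k' IH].
    have -> : (\int[P]_w (F sg (s 0%N w))%:E)%E = (\int[P]_w 4%:E)%E.
      apply: eq_integral => w _; congr EFin; rewrite /F /inner /Dh /= subr0 (max_idPr (ltW dk0)) subrr !mulr0 addr0 subr0.
      by apply/max_idPr.
    by rewrite (@ExE _ _ _ P (fun=> 4)) ?Ex_cst //; exact: itg_cst.
  apply: le_trans IH.
  have e1 j : (\int[P]_w (1 * F sg (s j w))%:E = \int[P]_w (F sg (s j w))%:E)%E.
    by apply: eq_integral => w _; rewrite mul1r.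
  rewrite -(e1 k'.+1) -(e1 k').
  exact: (@supermart_le R d T P E U cEU (hn n) (lon L0 n) (chib stg Wd) (vinit L0 n) (hn_gt0 n) (@chib_ge0 R stg Wd) (mfunc_chib Wd mstg) (valid_vinit L0pos n) (F sg) (@mF sg) (fun v _ => F0 sg v) (fun k w => F_super k w sg1) k' (fun=> 1) (measurable_cst _) (fun=> ler01)).
have : Ex P (fun w => inner sg (s k w)) <= 4.
  rewrite -lee_fin -ExE; first by apply: le_trans (le4 k); apply: le_integralT => w; rewrite FE.
  by apply: itgB; [apply: itgD => //; exact: itg_cst|exact: itgZ].
rewrite /inner ExB; [|by apply: itgD => //; exact: itg_cst|exact: itgZ].
rewrite ExD //; last exact: itg_cst.
rewrite Ex_cst (ExZ eps i2).
have : Ex P (fun w => sB (s k w) m) <= dl + ka.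
  by rewrite -[leRHS](Ex_cst P); apply: Ex_le => //; [exact: itg_cst|move=> w; exact: stage_B_le].
by move=> /(ler_wpM2l eps0) h1 h2; move: h1 h2; lra.
Qed.

(** At the end of the stage the remaining time dl + ka - sB is at most 2 ka, so the heat value is f
    up to a multiple of sqrt ka; e0 pays for the exceptional event. *)
Lemma stage_smooth p K (e0 : R) : whp P e0 (stage_ok E U L0 n A dl p K) -> (m < p)%N ->
  `|Ex P (fun w => (\prod_(j < m) g j (sA (s K w) j)) * f (sA (s K w) m)) -
    Ex P (fun w => \prod_(j < m) g j (sA (s K w) j)) * heat dl 0| <= eps * (dl + ka) + 3 * C * Num.sqrt ka + e0.
Proof.
move=> ok mp.
have mA := sstate_A K; have mY : measurable_fun setT (fun w => Y (s K w)) by exact: (measurable_prodn m cg mA).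
have mf' : measurable_fun setT (fun w => f (sA (s K w) m)) by apply: measurableT_comp => //; exact: continuous_measurable_fun.
have yb w : `|Y (s K w)| <= 1 by have /andP[q1 q2] := Y01 (s K w); rewrite ger0_norm.
have fb w : `|f (sA (s K w) m)| <= 1 by have /andP[q1 q2] := f01 (sA (s K w) m); rewrite ger0_norm.
have iY : itg P (fun w => Y (s K w)) by exact: (@itg_bound _ _ _ _ _ 1).
have iYf : itg P (fun w => Y (s K w) * f (sA (s K w) m)).
  by apply: (@itg_bound _ _ _ _ _ 1) => [|w]; [exact: measurable_funM|rewrite normrM mulr_ile1].
have mYD : measurable_fun setT (fun w => Y (s K w) * Dh (s K w)) by apply: mD; [exact: sstate_A|exact: sstate_B].
have iYD : itg P (fun w => Y (s K w) * Dh (s K w)).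
  by apply: (@itg_bound _ _ _ _ _ 1) => // w; rewrite normrM mulr_ile1.
rewrite -/Y; set hd := heat dl 0.
have -> : Ex P (fun w => Y (s K w) * f (sA (s K w) m)) - Ex P (fun w => Y (s K w)) * hd =
   Ex P (fun w => Y (s K w) * Dh (s K w)) + Ex P (fun w => Y (s K w) * f (sA (s K w) m) - hd * Y (s K w) - Y (s K w) * Dh (s K w)).
  rewrite ExB //; last by apply: itgB => //; exact: itgZ.
  rewrite ExB //; last exact: itgZ.
  by rewrite ExZ //; ring.
have h1 : `|Ex P (fun w => Y (s K w) * Dh (s K w))| <= eps * (dl + ka).
  have b1 : Ex P (fun w => 1 * (Y (s K w) * Dh (s K w))) <= eps * (dl + ka) by apply: stage_super; rewrite normr1.
  have b2 : Ex P (fun w => (-1) * (Y (s K w) * Dh (s K w))) <= eps * (dl + ka) by apply: stage_super; rewrite normrN1.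
  by rewrite ExZ // in b1; rewrite ExZ // in b2; rewrite ler_norml; apply/andP; split; lra.
apply: le_trans (ler_normD _ _) _; rewrite -addrA lerD //.
have e1 w : Y (s K w) * f (sA (s K w) m) - hd * Y (s K w) - Y (s K w) * Dh (s K w) =
   Y (s K w) * ((f (sA (s K w) m) - heat (Num.max 0 (dl + ka - sB (s K w) m)) (sA (s K w) m)) + (heat (dl + ka) 0 - hd)).
  by rewrite /Dh; ring.
have hk : `|heat (dl + ka) 0 - hd| <= C * Num.sqrt ka.
  have := heat_unif hB cf f01 C0 flip 0 0 (ltW dk0) (ltW dl0).
  by rewrite subrr normr0 add0r addrAC subrr add0r (gtr0_norm ka0).
have pC : 0 <= C * Num.sqrt ka by rewrite mulr_ge0 // sqrtr_ge0.
have := @Ex_whp R d T P (fun w => Y (s K w) * f (sA (s K w) m) - hd * Y (s K w) - Y (s K w) * Dh (s K w)) (3 * C * Num.sqrt ka) 1 e0 _ _ ler01 ok.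
rewrite mul1r; apply.
- by apply: (@itg_meas _ _ _ P); apply: itgB => //; apply: itgB => //; exact: itgZ.
- move=> w; rewrite e1 normrM.
  have b : `|f (sA (s K w) m) - heat (Num.max 0 (dl + ka - sB (s K w) m)) (sA (s K w) m)| <= 1.
    have /andP[q1 q2] := f01 (sA (s K w) m).
    have /andP[q3 q4] := heat01 hB cf f01 (Num.max 0 (dl + ka - sB (s K w) m)) (sA (s K w) m).
    by rewrite ler_norml; apply/andP; split; lra.
  apply: le_trans (ler_piMl (normr_ge0 _) (yb w)) _; apply: le_trans (ler_normD _ _) _.
  by move: b hk pC; lra.
move=> w okw; rewrite e1 normrM.
apply: le_trans (ler_piMl (normr_ge0 _) (yb w)) _; apply: le_trans (ler_normD _ _) _.
have bl := stage_B_lower okw mp; have bu := stage_B_le K w m.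
have q0 : 0 <= dl + ka - sB (s K w) m by rewrite subr_ge0.
rewrite (max_idPr q0).
have := heat_unif hB cf f01 C0 flip (sA (s K w) m) (sA (s K w) m) (lexx 0) q0.
rewrite heat0 // subrr normr0 add0r sub0r normrN (ger0_norm q0) => h2.
have h3 : Num.sqrt (dl + ka - sB (s K w) m) <= 2 * Num.sqrt ka.
  have -> : 2 * Num.sqrt ka = Num.sqrt (4 * ka).
    have -> : 4 * ka = 2 ^+ 2 * ka by congr (_ * _); ring.
    by rewrite [in RHS]sqrtrM ?sqr_ge0 // sqrtr_sqr ger0_norm.
  by rewrite ler_wsqrtr //; move: bl ka0; lra.
by have := ler_wpM2l C0 h3; move: h2 hk; lra.
Qed.

End stages.

(** * From single stages to functions of finitely many increments *)

Section independent_product.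
Context {R : realType} d {Om : measurableType d} (Q : probability Om R).

Lemma indep_prod q (Y : 'I_q -> Om -> R) (X : nat -> Om -> R) (Z : Om -> R) (g : nat -> R -> R) :
  mutually_independent Q Y -> (forall i : 'I_q, Y i = X i) -> measurable_fun setT Z ->
  (forall (i : 'I_q) (A : set R), measurable A -> Q (X i @^-1` A) = Q (Z @^-1` A)) ->
  (forall j x, 0 <= g j x <= 1) -> (forall j, continuous (g j)) ->
  forall m, (m <= q)%N -> Ex Q (fun o => \prod_(j < m) g j (X j o)) = \prod_(j < m) Ex Q (fun o => g j (Z o)).
Proof.
move=> ind YX mZ law g01 cg; elim=> [|m IH] mq.
  by rewrite big_ord0 (_ : (fun o => _) = cst 1) ?Ex_cst //; apply/funext => o; rewrite big_ord0.
rewrite big_ord_recr /= -IH; last exact: ltnW.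
have mg j : measurable_fun setT (g j) by exact: continuous_measurable_fun.
pose im : 'I_q := Ordinal mq; pose K : set 'I_q := [set i | (i < m)%N].
have nK : ~ K im by rewrite /K /= ltnn.
pose Zm := isMeasurableFun.Build _ _ _ (measurableTypeR R) _ mZ.
pose Zf : {mfun Om >-> measurableTypeR R} := HB.pack Z Zm.
pose nu : probability (measurableTypeR R) R := distribution Q Zf.
have Ynu A : measurable A -> Q (Y im @^-1` A) = nu A by move=> mA; rewrite YX law.
pose past := g_sigma_algebraType (past_gen Y K).
pose V (o : Om) := \prod_(j < m) g j (X j o).
have V01 o : 0 <= V o <= 1 by exact: (@prod01 R m (fun j => g j (X j o))).
have mV : measurable_fun setT (V : past -> R).
  rewrite /V; have : forall m', (m' <= m)%N -> measurable_fun setT (fun o : past => \prod_(j < m') g j (X j o)).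
    elim=> [|m' IHm] h; first by rewrite (_ : (fun o => _) = cst 1) //; apply/funext => o; rewrite big_ord0.
    rewrite (_ : (fun o => _) = (fun o => \prod_(j < m') g j (X j o) * g m' (X m' o))); last by apply/funext => o; rewrite big_ord_recr.
    apply: measurable_funM; first by apply: IHm; exact: ltnW.
    apply: measurableT_comp => //.
    have h' : (m' < q)%N by exact: leq_trans (ltnW mq).
    by have := @past_Y R _ _ _ Y K (Ordinal h') h; rewrite YX.
  exact.
pose G : past * measurableTypeR R -> \bar R := fun z => (V z.1 * g m z.2)%:E.
have mG : measurable_fun setT G.
  apply/measurable_EFinP; apply: measurable_funM; first exact: (measurableT_comp mV (measurable_fst (T1 := past) (T2 := measurableTypeR R))).
  exact: (measurableT_comp (mg m) (measurable_snd (T1 := past) (T2 := measurableTypeR R))).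
have G0 z : (0 <= G z)%E.
  by rewrite lee_fin mulr_ge0 //; [have /andP[] := V01 z.1|have /andP[] := g01 m z.2].
have [_ E1] := past_step ind nK Ynu mG G0.
have mVT : measurable_fun setT V by exact: (past_measurable_fun ind mV).
have iV : itg Q V by apply: (@itg_bound _ _ _ _ _ 1) => // o; have /andP[a b] := V01 o; rewrite ger0_norm.
have mgZ : measurable_fun setT (fun o => g m (Z o)) by exact: measurableT_comp.
have igZ : itg Q (fun o => g m (Z o)) by apply: (@itg_bound _ _ _ _ _ 1) => // o; have /andP[a b] := g01 m (Z o); rewrite ger0_norm.
have inner o : (\int[nu]_y G (o, y) = (V o * Ex Q (fun o' => g m (Z o')))%:E)%E.
  rewrite /G /= /nu /distribution ge0_integral_pushforward //=.
  - under eq_integral do rewrite EFinM.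
    rewrite preimage_setT ge0_integralZl //.
    + by rewrite (ExE igZ) EFinM.
    + exact/measurable_EFinP.
    + by move=> o' _; rewrite lee_fin; have /andP[] := g01 m (Z o').
    + by rewrite lee_fin; have /andP[] := V01 o.
  - apply/measurable_EFinP; apply: measurable_funM => //; exact: (mg m).
  - by move=> y _; rewrite lee_fin mulr_ge0 //; [have /andP[] := V01 o|have /andP[] := g01 m y].
apply: (@EFin_inj R).
transitivity (\int[Q]_o G (o, Y im o))%E.
  rewrite -ExE; first by apply: eq_integral => o _; rewrite big_ord_recr /G /= YX.
  rewrite (_ : (fun o => _) = (fun o => V o * g m (X m o))); last by apply/funext => o; rewrite big_ord_recr.
  have mXm : measurable_fun setT (X m) by rewrite -(YX im); exact: ind.1.
  apply: (@itg_bound _ _ _ _ _ 1); first by apply: measurable_funM => //; exact: measurableT_comp.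
  move=> o; have /andP[a1 a2] := V01 o; have /andP[b1 b2] := g01 m (X m o).
  by rewrite ger0_norm ?mulr_ge0 // mulr_ile1.
rewrite E1; under eq_integral do rewrite inner mulrC.
by rewrite (@ExE _ _ _ Q (fun o => _ * V o)) ?ExZ // 1?mulrC //; exact: itgZ.
Qed.

End independent_product.

Section interpolation.
Context {R : realType}.
Variables (hx : R -> R) (a eta M L : R).
Hypotheses (eta0 : 0 < eta) (L0 : 0 <= L) (hM : forall x, `|hx x| <= M) (hL : forall x y, `|hx x - hx y| <= L * `|x - y|).

Definition ramp (z e x : R) := Num.max 0 (Num.min 1 ((x - z) / e)).
Local Notation node l := (a + l%:R * eta).

(** Piecewise linear interpolation written with ramps: x enters only through functions with values
    in [0, 1], and [hx] only through its values at the nodes. Applied to one coordinate, this splits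
    a function of several increments into products. *)
Definition interp N x := hx a + \sum_(l < N) (hx (node l.+1) - hx (node l)) * ramp (node l) eta x.

Lemma ramp01 z e x : 0 <= ramp z e x <= 1.
Proof. by rewrite /ramp le_max lexx /= ge_max ler01 ge_min lexx. Qed.

Lemma ramp_lo z x : x <= z -> ramp z eta x = 0.
Proof.
move=> xz; apply/max_idPl; rewrite ge_min; apply/orP; right.
by rewrite ler_pdivrMr // mul0r subr_le0.
Qed.

Lemma ramp_hi z x : z + eta <= x -> ramp z eta x = 1.
Proof.
move=> xz; rewrite /ramp (min_idPl _); first by apply/max_idPr.
by rewrite ler_pdivlMr // mul1r lerBrDl.
Qed.

Lemma interp_close N x : `|interp N x - hx x| <= 2 * L * eta + (if a <= x <= node N then 0 else 2 * M).
Proof.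
have le0 : 0 <= 2 * L * eta by rewrite !mulr_ge0 // ltW.
have M2 y z : `|hx y - hx z| <= 2 * M.
  by apply: le_trans (ler_normB _ _) _; have := hM y; have := hM z; lra.
have hi N' : node N' <= x -> interp N' x = hx (node N').
  elim: N' => [|N' IH]; first by rewrite /interp big_ord0 mul0r !addr0.
  have nS : node N'.+1 = node N' + eta by rewrite -natr1 mulrDl mul1r addrA.
  rewrite nS => h; rewrite /interp big_ord_recr /= addrA -/(interp N' x) IH; last by apply: le_trans h; rewrite lerDl ltW.
  by rewrite nS ramp_hi // mulr1 addrC subrK.
have [ax|xa] := leP a x; last first.
  rewrite /interp big1 ?addr0 => [|l _]; first by apply: le_trans (M2 _ _) _; rewrite lerDr.
  by rewrite ramp_lo ?mulr0 //; apply: le_trans (ltW xa) _; rewrite lerDl mulr_ge0 // ltW.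
have [xN|Nx] /= := leP x (node N); last by rewrite hi ?(ltW Nx) //; apply: le_trans (M2 _ _) _; rewrite lerDr.
rewrite addr0; elim: N xN => [|N IH] xN.
  by rewrite hi; [rewrite mul0r addr0 in xN *|rewrite mul0r addr0]; rewrite ?(le_anti (introT andP (conj xN ax))) ?subrr ?normr0.
have nS : node N.+1 = node N + eta by rewrite -natr1 mulrDl mul1r addrA.
rewrite /interp big_ord_recr /= addrA -/(interp N x); have [h|h] := leP x (node N).
  by rewrite ramp_lo // mulr0 addr0; exact: IH.
rewrite hi ?(ltW h) //; have /andP[r0 r1] := ramp01 (node N) eta x.
have d1 : `|hx (node N) - hx x| <= L * eta.
  apply: le_trans (hL _ _) _; rewrite ler_wpM2l // distrC ger0_norm ?subr_ge0 ?(ltW h) //.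
  by rewrite lerBlDl -nS.
have d2 : `|(hx (node N.+1) - hx (node N)) * ramp (node N) eta x| <= L * eta.
  rewrite normrM (ger0_norm r0); apply: le_trans (ler_piMr (normr_ge0 _) r1) _.
  by apply: le_trans (hL _ _) _; rewrite nS addrC addKr gtr0_norm.
rewrite addrAC; apply: le_trans (ler_normD _ _) _; apply: le_trans (lerD d1 d2) _.
by rewrite -mulrA; lra.
Qed.

End interpolation.

Section finite_dimensional.
Context {R : realType} d {T : measurableType d} (P : probability T R).
Variables (L0 : R -> R) (L0pos : forall x, 0 < L0 x) (L0c : continuous L0).
Context d' {Om : measurableType d'} (Q : probability Om R) (B : R -> Om -> R).
Hypothesis hB : brownian_motion Q B.
Variables (dl : R) (p : nat).
Hypothesis dl0 : 0 < dl.
Implicit Types (H : (nat -> R) -> R) (e x : R) (f : R -> R).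

Definition incB j o := B (j.+1%:R * dl) o - B (j%:R * dl) o.
Definition sinc (E U : nat -> T -> R) n A K w := fun j => sA (sstate E U L0 n A dl K w) j.

(** The quantifiers follow the dependence of the constants: the window A is chosen after the
    exceptional probability e0, and the threshold on n after A. *)
Definition conv H := forall e, 0 < e -> exists2 e0 : R, 0 < e0 & forall A : nat, exists N, forall n, (N <= n)%N ->
  forall E U, clocks P E U -> forall K, whp P e0 (stage_ok E U L0 n A dl p K) ->
  `|Ex P (fun w => H (sinc E U n A K w)) - Ex Q (fun o => H (incB^~ o))| <= e.

Definition blip H := exists M L : R, [/\ 0 <= M, 0 <= L, forall v, `|H v| <= M &
  forall v v', `|H v - H v'| <= L * \sum_(j < p) `|v j - v' j|].

Definition gok f := (forall x, 0 <= f x <= 1) /\ exists2 K : R, 0 <= K & forall x y, `|f x - f y| <= K * `|x - y|.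

Lemma gok_cont f : gok f -> continuous f.
Proof. by move=> [_ [K _ h]]; exact: (lip_cont h). Qed.

Lemma incB_meas j : measurable_fun setT (incB j).
Proof. by apply: measurable_funB; exact: (bm_meas hB). Qed.

Lemma blip_meas H dd (S : measurableType dd) (X : nat -> S -> R) : blip H ->
  (forall j, measurable_fun setT (X j)) -> measurable_fun setT (fun w => H (X^~ w)).
Proof.
move=> [M [L [M0 L1 _ lip]]] mX; apply: (@measurable_coords _ _ _ p) => // v e e0.
pose r := e / (L * p%:R + 1).
have q1 : 0 < L * p%:R + 1 by rewrite ltr_wpDl // mulr_ge0.
exists r; first by rewrite divr_gt0.
move=> v' h; have le : \sum_(j < p) `|v j - v' j| <= p%:R * r.
  apply: (@le_trans _ _ (\sum_(j < p) r)); last by rewrite sumr_const card_ord mulr_natl.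
  by apply: ler_sum => j _; rewrite ltW // h.
have := lip v v'; rewrite ler_norml => /andP[h1 _].
have : L * (p%:R * r) < e.
  have -> : e = (L * p%:R + 1) * r by rewrite mulrC divfK // gt_eqF.
  by rewrite mulrA mulrDl mul1r ltrDl divr_gt0.
have := ler_wpM2l L1 le; move: h1; lra.
Qed.

Lemma blip_itg H dd (S : measurableType dd) (PS : probability S R) (X : nat -> S -> R) : blip H ->
  (forall j, measurable_fun setT (X j)) -> itg PS (fun w => H (X^~ w)).
Proof. by move=> bH mX; have [M [L [_ _ b _]]] := bH; apply: (@itg_bound _ _ _ _ _ M) => [|w]; [exact: blip_meas|]. Qed.

Lemma sinc_meas E U n A K j : clocks P E U -> measurable_fun setT (fun w => sinc E U n A K w j).
Proof. by move=> cEU; exact: (sstate_A cEU). Qed.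

Lemma blip_cst (c : R) : blip (fun=> c).
Proof. by exists `|c|, 0; split => // v v'; rewrite subrr normr0 mul0r. Qed.

Lemma blip_coord f j : (j < p)%N -> gok f -> blip (fun v => f (v j)).
Proof.
move=> jp [f01 [K K0 lip]]; exists 1, K; split => // [v|v v'].
  by have /andP[a b] := f01 (v j); rewrite ger0_norm.
apply: le_trans (lip _ _) _; rewrite ler_wpM2l // (bigD1 (Ordinal jp)) //= lerDl.
by apply: sumr_ge0.
Qed.

Lemma blip_mul H1 H2 : blip H1 -> blip H2 -> blip (fun v => H1 v * H2 v).
Proof.
move=> [M1 [L1 [M10 L10 b1 l1]]] [M2 [L2 [M20 L20 b2 l2]]].
exists (M1 * M2), (M1 * L2 + L1 * M2); split; rewrite ?addr_ge0 ?mulr_ge0 //.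
  by move=> v; rewrite normrM ler_pM.
move=> v v'; have -> : H1 v * H2 v - H1 v' * H2 v' = H1 v * (H2 v - H2 v') + (H1 v - H1 v') * H2 v' by ring.
apply: le_trans (ler_normD _ _) _; rewrite !normrM mulrDl lerD // -!mulrA; first by rewrite ler_pM.
by rewrite [M2 * _]mulrC mulrA ler_pM.
Qed.

Lemma blip_add H1 H2 : blip H1 -> blip H2 -> blip (fun v => H1 v + H2 v).
Proof.
move=> [M1 [L1 [M10 L10 b1 l1]]] [M2 [L2 [M20 L20 b2 l2]]].
exists (M1 + M2), (L1 + L2); split; rewrite ?addr_ge0 //.
  by move=> v; apply: le_trans (ler_normD _ _) _; rewrite lerD.
move=> v v'; rewrite opprD addrACA mulrDl; apply: le_trans (ler_normD _ _) _; exact: lerD.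
Qed.

Lemma blip_prod i (g : nat -> R -> R) : (forall j, gok (g j)) -> blip (fun v => \prod_(i <= j < p) g j (v j)).
Proof.
move=> gg; suff : forall s : seq nat, all (fun j => j < p)%N s -> blip (fun v => \prod_(j <- s) g j (v j)).
  by apply; apply/allP => j; rewrite mem_index_iota => /andP[].
elim=> [|j s IH] /=; first by move=> _; rewrite (_ : (fun v => _) = (fun=> 1)); [exact: blip_cst|apply/funext => v; rewrite big_nil].
move=> /andP[jp sp]; rewrite (_ : (fun v => _) = (fun v => g j (v j) * \prod_(l <- s) g l (v l))); last by apply/funext => v; rewrite big_cons.
by apply: blip_mul; [exact: (blip_coord jp (gg j))|exact: IH].
Qed.

Lemma conv_add H1 H2 : blip H1 -> blip H2 -> conv H1 -> conv H2 -> conv (fun v => H1 v + H2 v).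
Proof.
move=> b1 b2 c1 c2 e e0; have e2 : 0 < e / 2 by rewrite divr_gt0.
have [r1 r10 h1] := c1 _ e2; have [r2 r20 h2] := c2 _ e2.
exists (Num.min r1 r2); first by rewrite lt_min r10.
move=> A; have [N1 k1] := h1 A; have [N2 k2] := h2 A.
exists (maxn N1 N2) => n; rewrite geq_max => /andP[n1 n2] E U cEU K ok.
have ms := fun j => sinc_meas n A K j cEU.
rewrite !ExD; try exact: blip_itg; try by apply: blip_itg => // j; exact: incB_meas.
have o1 : whp P r1 (stage_ok E U L0 n A dl p K) by apply: whp_le ok => //; rewrite ge_min lexx.
have o2 : whp P r2 (stage_ok E U L0 n A dl p K) by apply: whp_le ok => //; rewrite ge_min lexx orbT.
have := k1 n n1 E U cEU K o1; have := k2 n n2 E U cEU K o2.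
rewrite opprD addrACA => q2 q1; apply: le_trans (ler_normD _ _) _; lra.
Qed.

Lemma conv_scale (c : R) H : blip H -> conv H -> conv (fun v => c * H v).
Proof.
move=> b1 c1 e e0; have c0 : 0 < `|c| + 1 by rewrite ltr_wpDl.
have [r r0 h] := c1 _ (divr_gt0 e0 c0); exists r => // A; have [N k] := h A; exists N => n nN E U cEU K ok.
have ms := fun j => sinc_meas n A K j cEU.
rewrite !ExZ; try exact: blip_itg; try by apply: blip_itg => // j; exact: incB_meas.
have := k n nN E U cEU K ok; rewrite ler_pdivlMr // => q.
by rewrite -mulrBr normrM mulrC; apply: le_trans q; rewrite ler_wpM2l // lerDl ler01.
Qed.

(** The error [phi] is only required to be small in mean under the Brownian law; [conv phi]
    transfers this smallness to the chain. *)
Lemma conv_approx H : blip H -> (forall e, 0 < e -> exists H' phi, [/\ blip H' /\ blip phi, conv H', conv phi,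
  forall v, `|H v - H' v| <= e + phi v & Ex Q (fun o => phi (incB^~ o)) <= e]) -> conv H.
Proof.
move=> bH app e e0; have e6 : 0 < e / 6 by rewrite divr_gt0.
have [H' [phi [[bH' bphi] cH' cphi close small]]] := app _ e6.
have [r1 r10 h1] := cH' _ e6; have [r2 r20 h2] := cphi _ e6.
exists (Num.min r1 r2); first by rewrite lt_min r10.
move=> A; have [N1 k1] := h1 A; have [N2 k2] := h2 A.
exists (maxn N1 N2) => n; rewrite geq_max => /andP[n1 n2] E U cEU K ok.
have ms := fun j => sinc_meas n A K j cEU.
have o1 : whp P r1 (stage_ok E U L0 n A dl p K) by apply: whp_le ok => //; rewrite ge_min lexx.
have o2 : whp P r2 (stage_ok E U L0 n A dl p K) by apply: whp_le ok => //; rewrite ge_min lexx orbT.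
have q1 := k1 n n1 E U cEU K o1; have q2 := k2 n n2 E U cEU K o2.
have gen dd (S : measurableType dd) (PS : probability S R) (X : nat -> S -> R) : (forall j, measurable_fun setT (X j)) ->
    `|Ex PS (fun w => H (X^~ w)) - Ex PS (fun w => H' (X^~ w))| <= e / 6 + Ex PS (fun w => phi (X^~ w)).
  move=> mX; have i1 := blip_itg PS bH mX; have i2 := blip_itg PS bH' mX; have i3 := blip_itg PS bphi mX.
  rewrite -ExB // -[X in _ <= X + _](Ex_cst PS (e / 6)) -ExD //; last exact: itg_cst.
  apply: Ex_norm => //; first by apply: (@itg_meas _ _ _ PS); exact: itgB.
  by apply: itgD => //; exact: itg_cst.
have g1 := gen _ _ P _ ms; have g2 := gen _ _ Q _ incB_meas.
set a1 := Ex P _ in g1 *; set a2 := Ex Q _ in g2 *.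
move: q1 q2 g1 g2 small; rewrite /sinc.
move: (Ex P (fun w => H' _)) (Ex P (fun w => phi _)) (Ex Q (fun w => H' _)) (Ex Q (fun w => phi _)) => z1 z2 z3 z4.
rewrite !ler_norml => /andP[x1 x2] /andP[x3 x4] /andP[x5 x6] /andP[x7 x8] x9.
by apply/andP; split; lra.
Qed.

Lemma law_inc i (A : set R) : measurable A -> Q (incB i @^-1` A) = Q (B dl @^-1` A).
Proof.
move=> mA; have [_ [_ [_ [law _]]]] := hB.
have lt1 : i%:R * dl < i.+1%:R * dl by rewrite ltr_pM2r // ltr_nat.
rewrite /incB law //; last by rewrite mulr_ge0 // ltW.
have -> : i.+1%:R * dl - i%:R * dl = dl by rewrite -natr1 mulrDl mul1r addrAC subrr add0r.
have := law 0 dl (lexx _) dl0 A mA; rewrite subr0 => <-.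
by rewrite (_ : (fun o => _) = B dl) //; apply/funext => o; rewrite (bm0 hB) subr0.
Qed.

Lemma inc_prod (g : nat -> R -> R) : (forall j, gok (g j)) ->
  Ex Q (fun o => \prod_(j < p) g j (incB j o)) = \prod_(j < p) heat Q B (g j) dl 0.
Proof.
move=> gg; pose ts := mkseq (fun i => i%:R * dl) p.+1.
have sz : (size ts).-1 = p by rewrite size_mkseq.
have nth_ts j : (j <= p)%N -> nth 0 ts j = j%:R * dl by move=> jp; rewrite nth_mkseq.
have [_ [_ [_ [_ ind]]]] := hB.
have srt : sorted <%R ts.
  apply/(sortedP 0) => i; rewrite size_mkseq ltnS => ip.
  by rewrite !nth_ts ?(ltnW ip) // ltr_pM2r // ltr_nat.
have pos : all (fun t => 0 <= t) ts by apply/allP => t /mapP[i _ ->]; rewrite mulr_ge0 // ltW.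
have := @indep_prod R _ _ Q _ _ incB (B dl) g (ind ts srt pos) _ (bm_meas hB dl) _ (fun j => (gg j).1) (fun j => gok_cont (gg j)) p.
rewrite sz => /(_ _ _ (leqnn _)) ->.
- by apply: eq_bigr => j _; rewrite /heat; congr Ex; apply/funext => o; rewrite add0r.
- by move=> i; have ip := ltn_ord i; rewrite /incB !nth_ts // ltnW.
- by move=> i A mA; exact: law_inc.
Qed.

(** [stage_smooth] asks for two derivatives, so f is first replaced by a smoothing that is within e
    / 4. [D] collects the constants in front of the powers of h/c^2, and n is taken so large that t
    D is small. *)
Lemma stage_step f (g : nat -> R -> R) m e : gok f -> (forall j, gok (g j)) -> (m < p)%N -> 0 < e ->
  exists2 e0 : R, 0 < e0 & forall A : nat, exists N, forall n, (N <= n)%N ->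
  forall E U, clocks P E U -> forall K, whp P e0 (stage_ok E U L0 n A dl p K) ->
  `|Ex P (fun w => (\prod_(j < m) g j (sinc E U n A K w j)) * f (sinc E U n A K w m)) -
    Ex P (fun w => \prod_(j < m) g j (sinc E U n A K w j)) * heat Q B f dl 0| <= e.
Proof.
move=> gf gg mp e0.
have [f01 [Kf Kf0 flip]] := gf.
pose a := e / (8 * (Kf + 1)).
have Kf1 : 0 < 8 * (Kf + 1) by rewrite mulr_gt0 // ltr_wpDl.
have a0 : 0 < a by rewrite divr_gt0.
have Ka : 2 * Kf * a <= e / 4.
  have -> : e / 4 = 2 * (Kf + 1) * a by rewrite /a; field; rewrite gt_eqF // ltr_wpDl.
  by rewrite ler_pM2r // ler_pM2l // lerDl ler01.
have [h [h1 [h0 [C [h01 hf C0 [ch [ch1 ch0]] [h1b h0b hlip h0lip tay]]]]]] := smoothing a0 Kf0 flip f01.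
exists (e / 8); first by rewrite divr_gt0.
move=> A; have [c /andP[c0 _] cL] := window_lb L0pos L0c A.
pose D := 220 * C * (dl + 1) + 111 * C + 3 * C + 1.
have D0 : 0 < D.
  by rewrite /D ltr_wpDl // !addr_ge0 ?mulr_ge0 // ?addr_ge0 // ltW.
pose t := Num.min 1 (Num.min 1 (e / 8) / D).
have t0 : 0 < t by rewrite lt_min ltr01 divr_gt0 // lt_min ltr01 divr_gt0.
have t1 : t <= 1 by rewrite ge_min lexx.
have tD : t * D <= Num.min 1 (e / 8) by rewrite -ler_pdivlMr // ge_min lexx orbT.
have [tD1 tD2] : t * D <= 1 /\ t * D <= e / 8 by split; apply: le_trans tD _; rewrite ge_min lexx ?orbT.
have [N hN] := @hn_small R (t ^+ 2 * c ^+ 2) (mulr_gt0 (exprn_gt0 2 t0) (exprn_gt0 2 c0)).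
exists N => n nN E U cEU K ok.
have kat : hn n / c ^+ 2 <= t ^+ 2 by rewrite ler_pdivrMr ?exprn_gt0 // ltW // hN.
have ka0 : 0 < hn n / c ^+ 2 :> R by rewrite divr_gt0 ?hn_gt0 // exprn_gt0.
have skt : Num.sqrt (hn n / c ^+ 2) <= t.
  have -> : t = Num.sqrt (t ^+ 2) by rewrite sqrtr_sqr ger0_norm // ltW.
  by rewrite ler_wsqrtr.
have t2t : t ^+ 2 <= t by rewrite expr2 ler_piMl // ltW.
have katt := le_trans kat t2t.
have pD1 : 0 <= 220 * C * (dl + 1) by rewrite !mulr_ge0 // addr_ge0 // ltW.
have ka1 : hn n / c ^+ 2 <= 1 by exact: le_trans t1.
have s0 : 0 <= Num.sqrt (hn n / c ^+ 2 : R) by exact: sqrtr_ge0.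
have parts : 220 * C * (dl + 1) * t + 111 * C * t + 3 * C * t <= t * D.
  by rewrite /D; move: t0; lra.
have q1 : 0 <= 220 * C * (dl + 1) * t by rewrite mulr_ge0 // ltW.
have q2 : 0 <= 111 * C * t by rewrite !mulr_ge0 // ltW.
have q3 : 0 <= 3 * C * t by rewrite !mulr_ge0 // ltW.
have b1 : 220 * C * Num.sqrt (hn n / c ^+ 2) * (dl + hn n / c ^+ 2) <= 220 * C * (dl + 1) * t.
  rewrite -[leRHS]mulrA [(dl + 1) * t]mulrC mulrA; apply: ler_pM; rewrite ?mulr_ge0 //.
  - by rewrite addr_ge0 // ltW.
  - by rewrite ler_wpM2l // mulr_ge0.
  - by rewrite lerD2l.
have b2 : 111 * C * (hn n / c ^+ 2) <= 111 * C * t by rewrite ler_wpM2l // mulr_ge0.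
have b3 : 3 * C * Num.sqrt (hn n / c ^+ 2) <= 3 * C * t by rewrite ler_wpM2l // mulr_ge0.
have key := @stage_smooth R d T P E U cEU L0 L0pos n A c dl c0 dl0 cL _ _ Q B hB h h1 h0 C h01 C0 ch ch1 ch0 h1b h0b hlip h0lip tay g m
   (fun j => (gg j).1) (fun j => gok_cont (gg j)) ka1 _ _ p K (e / 8) ok mp.
have {}key := key (le_trans b1 _) (le_trans b2 _).
have {}key : `|Ex P (fun w => (\prod_(j < m) g j (sinc E U n A K w j)) * h (sinc E U n A K w m)) -
    Ex P (fun w => \prod_(j < m) g j (sinc E U n A K w j)) * heat Q B h dl 0| <= e / 4.
  apply: le_trans (key _ _) _; [by move: parts tD1; lra|by move: parts tD1; lra|].
  by move: b1 b3 parts tD2 q2; lra.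
have ms := fun j => sinc_meas n A K j cEU.
pose Y w := \prod_(j < m) g j (sinc E U n A K w j).
have Y01 w : 0 <= Y w <= 1 by apply: (@prod01 R m (fun j => g j (sinc E U n A K w j))) => j; exact: (gg j).1.
have Yb w : `|Y w| <= 1 by have /andP[u1 u2] := Y01 w; rewrite ger0_norm.
have mY : measurable_fun setT Y by exact: (measurable_prodn m (fun j => gok_cont (gg j)) ms).
have mfh (ff : R -> R) : continuous ff -> measurable_fun setT (fun w => Y w * ff (sinc E U n A K w m)).
  by move=> cff; apply: measurable_funM => //; apply: measurableT_comp => //; exact: continuous_measurable_fun.
have iff (ff : R -> R) : continuous ff -> (forall x, 0 <= ff x <= 1) -> itg P (fun w => Y w * ff (sinc E U n A K w m)).
  move=> cff ff01; apply: (@itg_bound _ _ _ _ _ 1); first exact: mfh.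
  by move=> w; have /andP[u1 u2] := ff01 (sinc E U n A K w m); rewrite normrM mulr_ile1 // ger0_norm.
have cf := gok_cont gf.
have d1 : `|Ex P (fun w => Y w * f (sinc E U n A K w m)) - Ex P (fun w => Y w * h (sinc E U n A K w m))| <= e / 4.
  rewrite -ExB; [|exact: iff|exact: iff]; apply: Ex_norm_le.
    by apply: (@itg_meas _ _ _ P); apply: itgB; exact: iff.
  move=> w; rewrite -mulrBr normrM; apply: le_trans (ler_piMl (normr_ge0 _) (Yb w)) _.
  by rewrite distrC; apply: le_trans Ka.
have d2 : `|heat Q B f dl 0 - heat Q B h dl 0| <= e / 4.
  rewrite /heat -ExB; [|exact: (heat_itg hB)|exact: (heat_itg hB)]; apply: Ex_norm_le.
    by apply: (@itg_meas _ _ _ Q); apply: itgB; exact: (heat_itg hB).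
  by move=> o; rewrite distrC; apply: le_trans Ka.
have EY : `|Ex P Y| <= 1 by apply: Ex_norm_le.
have d3 : `|Ex P Y * (heat Q B f dl 0 - heat Q B h dl 0)| <= e / 4.
  by rewrite normrM; apply: le_trans (ler_piMl (normr_ge0 _) EY) _.
rewrite -/Y in key *; move: d1 d3 key; rewrite mulrBr.
move: (Ex P Y * _) (Ex P Y * _) (Ex P _) (Ex P _) => z1 z2 z3 z4.
by rewrite !ler_norml => /andP[? ?] /andP[? ?] /andP[? ?]; apply/andP; split; lra.
Qed.

(** The last factor is replaced by its Gaussian mean, one stage after the other; the resulting
    product is the Brownian expectation by independence of increments. *)
Lemma conv_prod (g : nat -> R -> R) : (forall j, gok (g j)) -> conv (fun v => \prod_(0 <= j < p) g j (v j)).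
Proof.
move=> gg.
have main : forall m, (m <= p)%N -> forall e, 0 < e -> exists2 e0 : R, 0 < e0 & forall A : nat, exists N, forall n, (N <= n)%N ->
    forall E U, clocks P E U -> forall K, whp P e0 (stage_ok E U L0 n A dl p K) ->
    `|Ex P (fun w => \prod_(j < m) g j (sinc E U n A K w j)) - \prod_(j < m) heat Q B (g j) dl 0| <= e.
  elim=> [|m IH] mp e e0.
    exists 1 => // A; exists 0%N => n _ E U _ K _; rewrite big_ord0 (_ : (fun w => _) = (fun=> 1)).
      by rewrite Ex_cst subrr normr0 ltW.
    by apply/funext => w; rewrite big_ord0.
  have e2 : 0 < e / 2 by rewrite divr_gt0.
  have [r1 r10 h1] := IH (ltnW mp) _ e2; have [r2 r20 h2] := stage_step (gg m) gg mp e2.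
  exists (Num.min r1 r2); first by rewrite lt_min r10.
  move=> A; have [N1 k1] := h1 A; have [N2 k2] := h2 A.
  exists (maxn N1 N2) => n; rewrite geq_max => /andP[n1 n2] E U cEU K ok.
  have o1 : whp P r1 (stage_ok E U L0 n A dl p K) by apply: whp_le ok => //; rewrite ge_min lexx.
  have o2 : whp P r2 (stage_ok E U L0 n A dl p K) by apply: whp_le ok => //; rewrite ge_min lexx orbT.
  have q1 := k1 n n1 E U cEU K o1; have q2 := k2 n n2 E U cEU K o2.
  rewrite (_ : (fun w => \prod_(j < m.+1) _) = (fun w => (\prod_(j < m) g j (sinc E U n A K w j)) * g m (sinc E U n A K w m))); last by apply/funext => w; rewrite big_ord_recr.
  rewrite big_ord_recr /=.
  have /andP[b0 b1] := heat01 hB (gok_cont (gg m)) (gg m).1 dl 0.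
  have q3 : `|(Ex P (fun w => \prod_(j < m) g j (sinc E U n A K w j)) - \prod_(j < m) heat Q B (g j) dl 0) * heat Q B (g m) dl 0| <= e / 2.
    by rewrite normrM (ger0_norm b0); apply: le_trans (ler_piMr (normr_ge0 _) b1) _.
  apply: le_trans (ler_distD (Ex P (fun w => \prod_(j < m) g j (sinc E U n A K w j)) * heat Q B (g m) dl 0) _ _) _.
  by rewrite mulrBl in q3; move: q2 q3; lra.
move=> e e0; have [r r0 h] := main p (leqnn p) e e0; exists r => // A; have [N k] := h A; exists N => n nN E U cEU K ok.
have := k n nN E U cEU K ok; rewrite -(inc_prod gg).
rewrite (_ : (fun w => \prod_(0 <= j < p) _) = (fun w => \prod_(j < p) g j (sinc E U n A K w j))); last by apply/funext => w; rewrite big_mkord.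
by rewrite (_ : (fun o => \prod_(0 <= j < p) _) = (fun o => \prod_(j < p) g j (incB j o))) //; apply/funext => o; rewrite big_mkord.
Qed.

Lemma minr_lip (a b : R) : `|Num.min 1 a - Num.min 1 b| <= `|a - b|.
Proof.
case: (leP 1 a) => ha; case: (leP 1 b) => hb; rewrite ?subrr ?normr0 //.
  by rewrite [leRHS]ger0_norm ?ger0_norm; lra.
by rewrite [leRHS]ler0_norm ?ler0_norm; lra.
Qed.

Lemma maxr_lip (a b : R) : `|Num.max 0 a - Num.max 0 b| <= `|a - b|.
Proof.
case: (leP 0 a) => ha; case: (leP 0 b) => hb; rewrite ?subrr ?normr0 //.
  by rewrite [leRHS]ger0_norm ?ger0_norm; lra.
by rewrite [leRHS]ler0_norm ?ler0_norm; lra.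
Qed.

Lemma gok_one : gok (fun=> 1).
Proof. by split => [x|]; [rewrite ler01 lexx|exists 0 => // x y; rewrite subrr normr0 mul0r]. Qed.

Lemma gok_ramp z e : 0 < e -> gok (ramp z e).
Proof.
move=> e0; split => [x|]; first exact: ramp01.
exists e^-1 => [|x y]; first by rewrite invr_ge0 ltW.
apply: le_trans (maxr_lip _ _) _; apply: le_trans (minr_lip _ _) _.
rewrite -mulrBl normrM mulrC [`|_^-1|]gtr0_norm ?invr_gt0 // ler_wpM2l ?invr_ge0 ?(ltW e0) //.
by rewrite (_ : x - z - (y - z) = x - y) //; ring.
Qed.

Lemma gok_cap (r : R) : 0 < r -> gok (fun x => Num.min 1 (`|x| / r)).
Proof.
move=> r0; split => [x|]; first by rewrite le_min ler01 ge_min lexx divr_ge0 // ltW.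
exists r^-1 => [|x y]; first by rewrite invr_ge0 ltW.
apply: le_trans (minr_lip _ _) _.
rewrite -mulrBl normrM mulrC [`|_^-1|]gtr0_norm ?invr_gt0 // ler_wpM2l ?invr_ge0 ?(ltW r0) //.
exact: ler_dist_dist.
Qed.

Definition upd (v : nat -> R) i x := fun j => if j == i then x else v j.

Lemma blip_upd H i x : blip H -> blip (fun v => H (upd v i x)).
Proof.
move=> [M [L [M0 L1 b l]]]; exists M, L; split => // v v'; apply: le_trans (l _ _) _; rewrite ler_wpM2l //.
by apply: ler_sum => j _; rewrite /upd; case: eqP => // _; rewrite subrr normr0.
Qed.

Lemma conv_sum N (F : nat -> (nat -> R) -> R) : (forall l, blip (F l)) -> (forall l, conv (F l)) ->
  blip (fun v => \sum_(l < N) F l v) /\ conv (fun v => \sum_(l < N) F l v).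
Proof.
move=> bF cF; elim: N => [|N [IH1 IH2]].
  rewrite (_ : (fun v => _) = (fun=> 0)); last by apply/funext => v; rewrite big_ord0.
  split; first exact: blip_cst.
  by move=> e e0; exists 1 => // A; exists 0%N => *; rewrite !Ex_cst subrr normr0 ltW.
rewrite (_ : (fun v => _) = (fun v => \sum_(l < N) F l v + F N v)); last by apply/funext => v; rewrite big_ord_recr.
by split; [exact: blip_add|exact: conv_add].
Qed.

(** Induction on the number i of coordinates on which H depends. Interpolating in the last of them
    turns H into a finite sum of functions of the earlier coordinates times a ramp of this one, and
    the ramp joins the product. Outside [-r, r] the interpolation says nothing, and [cap] bounds the
    loss there. *)
Lemma conv_dep i : (i <= p)%N -> forall H (g : nat -> R -> R), blip H ->
  (forall v v', (forall j, (j < i)%N -> v j = v' j) -> H v = H v') -> (forall j, gok (g j)) ->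
  conv (fun v => H v * \prod_(i <= j < p) g j (v j)).
Proof.
elim: i => [|i IH] ip H g bH dep gg.
  rewrite (_ : (fun v => _) = (fun v => H (fun=> 0) * \prod_(0 <= j < p) g j (v j))).
    by apply: conv_scale; [exact: blip_prod|exact: conv_prod].
  by apply/funext => v; congr (_ * _); exact: dep.
pose G v := \prod_(i.+1 <= j < p) g j (v j).
have bG : blip G by exact: blip_prod.
have G01 v : 0 <= G v <= 1.
  rewrite /G; apply: (big_ind (fun z => 0 <= z <= 1)) => [|x y /andP[a1 a2] /andP[b1 b2]|j _]; first by rewrite ler01 lexx.
    by rewrite mulr_ge0 //= mulr_ile1.
  exact: (gg j).1.
have one f F : gok f -> blip F -> (forall v v', (forall j, (j < i)%N -> v j = v' j) -> F v = F v') ->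
    blip (fun v => F v * (f (v i) * G v)) /\ conv (fun v => F v * (f (v i) * G v)).
  move=> gf bF dF; split; first by apply: blip_mul => //; apply: blip_mul => //; exact: blip_coord.
  pose g' j := if j == i then f else g j.
  have gg' j : gok (g' j) by rewrite /g'; case: eqP.
  have := IH (ltnW ip) F g' bF dF gg'.
  rewrite (_ : (fun v => _) = (fun v => F v * (f (v i) * G v))) //.
  apply/funext => v; rewrite big_ltn // /g' eqxx; congr (_ * (_ * _)).
  by apply: eq_big_nat => j /andP[ij _]; rewrite gtn_eqF.
have [M [L [M0 L1 bM bL]]] := bH.
apply: conv_approx; first exact: blip_mul.
move=> e e0; pose eta := e / (2 * L + 1).
have L21 : 0 < 2 * L + 1 by rewrite ltr_wpDl // mulr_ge0.
have eta0 : 0 < eta by rewrite divr_gt0.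
have Le : 2 * L * eta <= e.
  have -> : e = (2 * L + 1) * eta by rewrite mulrC divfK // gt_eqF.
  by rewrite [leRHS]mulrDl mul1r lerDl (ltW eta0).
(* Makes r so large that 2 M sqrt dl / r <= e, where sqrt dl bounds the mean absolute value of a
   Brownian increment. *)
pose N0 := (Num.bound (2 * M * Num.sqrt dl / (e * eta))).+1.
pose r := N0%:R * eta.
have r0 : 0 < r by rewrite mulr_gt0.
have rM : 2 * M * Num.sqrt dl / r <= e.
  have num0 : 0 <= 2 * M * Num.sqrt dl by rewrite !mulr_ge0 // sqrtr_ge0.
  rewrite ler_pdivrMr // /r mulrCA -ler_pdivrMr ?(mulr_gt0 e0 eta0) //.
  apply: ltW; apply: lt_le_trans (archi_boundP (divr_ge0 num0 (ltW (mulr_gt0 e0 eta0)))) _.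
  by rewrite ler_nat leqnSn.
pose N := (N0 + N0)%N; pose nd (l : nat) : R := - r + l%:R * eta.
have ndN : nd N = r by rewrite /nd /N natrD mulrDl -/r addKr.
pose it v := interp (fun x => H (upd v i x)) (- r) eta N (v i).
have updi v : upd v i (v i) = v by apply/funext => j; rewrite /upd; case: eqP => [->|].
have hL v x y : `|H (upd v i x) - H (upd v i y)| <= L * `|x - y|.
  apply: le_trans (bL _ _) _; rewrite ler_wpM2l // (bigD1 (Ordinal ip)) //= big1 ?addr0 => [|j /eqP ji].
    by rewrite /upd eqxx.
  have -> : upd v i x j = upd v i y j.
    by rewrite /upd; case: eqP => // h; exfalso; apply: ji; exact: val_inj.
  by rewrite subrr normr0.
have close v : `|it v - H v| <= 2 * L * eta + (if - r <= v i <= r then 0 else 2 * M).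
  have := @interp_close R (fun x => H (upd v i x)) (- r) eta M L eta0 L1 (fun x => bM _) (hL v) N (v i).
  by rewrite updi -/(nd N) ndN.
have depu x v v' : (forall j, (j < i)%N -> v j = v' j) -> H (upd v i x) = H (upd v' i x).
  move=> h; apply: dep => j; rewrite ltnS leq_eqVlt /upd => /orP[/eqP ->|ji]; first by rewrite eqxx.
  by rewrite ltn_eqF // h.
pose F0 v := H (upd v i (- r)) * (1 * G v).
pose F1 (l : nat) v := (H (upd v i (nd l.+1)) - H (upd v i (nd l))) * (ramp (nd l) eta (v i) * G v).
have [bF0 cF0] : blip F0 /\ conv F0 by apply: (one (fun=> 1)); [exact: gok_one|exact: blip_upd|exact: depu].
have F1ok l : blip (F1 l) /\ conv (F1 l).
  apply: one; first exact: gok_ramp.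
    rewrite (_ : (fun v => _) = (fun v => H (upd v i (nd l.+1)) + (-1) * H (upd v i (nd l)))); last by apply/funext => v; rewrite mulN1r.
    by apply: blip_add; [exact: blip_upd|apply: blip_mul; [exact: blip_cst|exact: blip_upd]].
  by move=> v v' h; rewrite !(depu _ _ _ h).
have [bS cS] := conv_sum N (fun l => (F1ok l).1) (fun l => (F1ok l).2).
pose cap x := Num.min 1 (`|x| / r).
have gcap : gok cap by exact: gok_cap.
have bcap : blip (fun v => cap (v i)) by exact: (blip_coord ip gcap).
exists (fun v => F0 v + \sum_(l < N) F1 l v), (fun v => 2 * M * cap (v i)); split.
- by split; [exact: blip_add|apply: blip_mul => //; exact: blip_cst].
- exact: conv_add.
- apply: conv_scale => //.
  pose g' j := if j == i then cap else (fun=> 1).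
  have gg' j : gok (g' j) by rewrite /g'; case: eqP => // _; exact: gok_one.
  have := conv_prod gg'; rewrite (_ : (fun v => _) = (fun v => cap (v i))) //.
  apply/funext => v; rewrite big_mkord (bigD1 (Ordinal ip)) //= /g' eqxx big1 ?mulr1 // => j /eqP ji.
  by rewrite ifN //; apply/eqP => h; apply: ji; apply: val_inj.
- move=> v; have -> : F0 v + \sum_(l < N) F1 l v = it v * G v.
    rewrite /F0 /it /interp mul1r mulrDl mulr_suml; congr (_ + _).
    by apply: eq_bigr => l _; rewrite /F1 mulrA.
  have /andP[g0 g1] := G01 v; rewrite -mulrBl normrM (ger0_norm g0); apply: le_trans (ler_piMr (normr_ge0 _) g1) _.
  rewrite distrC; apply: le_trans (close v) _; rewrite lerD //.
  case: ifP => [_|/negbT h]; first by rewrite !mulr_ge0 //; have /andP[] := gcap.1 (v i).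
  rewrite /cap (min_idPl _) ?mulr1 // ler_pdivlMr // mul1r leNgt; apply/negP => h2.
  by move/negP: h; apply; rewrite -ler_norml ltW.
- have lt1 : i.+1%:R * dl - i%:R * dl = dl by rewrite -natr1 mulrDl mul1r addrAC subrr add0r.
  have [i1 i2] := bm_dist hB (mulr_ge0 (ler0n R i.+1) (ltW dl0)) (mulr_ge0 (ler0n R i) (ltW dl0)).
  rewrite lt1 (gtr0_norm dl0) in i2.
  apply: le_trans rM; rewrite -mulrA [_ * r^-1]mulrC.
  have M20 : 0 <= 2 * M by rewrite mulr_ge0.
  rewrite ExZ; last exact: (blip_itg Q bcap incB_meas).
  rewrite ler_wpM2l //; apply: (@le_trans _ _ (Ex Q (fun o => r^-1 * `|incB i o|))).
    apply: Ex_le; [exact: (blip_itg Q bcap incB_meas)|exact: itgZ|move=> o].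
    by rewrite /cap ge_min mulrC lexx orbT.
  by rewrite ExZ // ler_wpM2l // invr_ge0 ltW.
Qed.

Lemma conv_blip H : blip H -> conv H.
Proof.
move=> bH; have := @conv_dep p (leqnn p) H (fun _ _ => 1) bH _ (fun=> gok_one).
rewrite (_ : (fun v => _) = H); last by apply/funext => v; rewrite big_geq ?mulr1.
apply=> v v' h; have [M [L [_ _ _ l]]] := bH.
apply/eqP; rewrite -subr_eq0 -normr_le0; apply: le_trans (l v v') _.
by rewrite big1 ?mulr0 // => j _; rewrite h // subrr normr0.
Qed.

End finite_dimensional.

(** * Dyadic increments of the martingale and the driving path *)

Section first_passage.
Context {R : realType}.

(** First passage of V to the level u, with the default value 0 if the level is never reached. *)
Definition tau (V : nat -> R) (u : R) := xget 0%N [set k | u <= V k /\ forall i, (i < k)%N -> V i < u].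

Lemma tau_eq (V : nat -> R) (u : R) k : u <= V k -> (forall i, (i < k)%N -> V i < u) -> tau V u = k.
Proof.
move=> h1 h2; apply: xget_unique => // k' [h3 h4].
have [lt|lt|//] := ltngtP k' k; first by have := h2 _ lt; rewrite ltNge h3.
by have := h4 _ lt; rewrite ltNge h1.
Qed.

Lemma tauP (V : nat -> R) (u : R) k : u <= V k -> [/\ u <= V (tau V u), forall i, (i < tau V u)%N -> V i < u & (tau V u <= k)%N].
Proof.
move=> h; have ex : exists k, u <= V k by exists k.
have [k0 h0 min0] := ex_minnP ex.
have e : tau V u = k0.
  by apply: tau_eq => // i ik; rewrite ltNge; apply/negP => /min0; rewrite leqNgt ik.
by rewrite e; split => // [i ik|]; [rewrite ltNge; apply/negP => /min0; rewrite leqNgt ik|exact: min0].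
Qed.

End first_passage.

Section increments.
Context {R : realType} (L0 : R -> R) d {T : measurableType d} (E U : nat -> nat -> T -> R).

(** Defined by first passages of the clock, without window and without bound on the number of steps;
    [inc_stage] identifies it with the recordings on good paths. *)
Definition inc n w (dl : R) (j : nat) : R :=
  let V k := sW (base (E n) (U n) L0 n k w) in
  sM (base (E n) (U n) L0 n (tau V (j.+1%:R * dl)) w) - sM (base (E n) (U n) L0 n (tau V (j%:R * dl)) w).

Lemma inc_sum n w dl m : \sum_(j < m) inc n w dl j =
  sM (base (E n) (U n) L0 n (tau (fun k => sW (base (E n) (U n) L0 n k w)) (m%:R * dl)) w).
Proof.
pose f j := sM (base (E n) (U n) L0 n (tau (fun k => sW (base (E n) (U n) L0 n k w)) (j%:R * dl)) w).
rewrite -[RHS]/(f m) -(big_mkord xpredT (fun j => inc n w dl j)) (telescope_sumr f) //.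
suff -> : f 0%N = 0 by rewrite subr0.
rewrite /f mul0r (@tau_eq _ _ _ 0%N) //; exact: S0n0.
Qed.

Lemma inc_stage P n A c (dl : R) p K w : (forall x, 0 < L0 x) -> clocks P (E n) (U n) -> 0 < c -> 0 < dl ->
  (forall x : R, `|x| <= A%:R -> c <= L0 x) ->
  stage_ok (E n) (U n) L0 n A dl p K w -> forall j, (j < p)%N -> inc n w dl j = sinc L0 dl (E n) (U n) n A K w j.
Proof.
move=> L0pos cEU c0 dl0 cL ok j jp.
have key m : (m <= p)%N -> \sum_(j < m) sinc L0 dl (E n) (U n) n A K w j =
   sM (base (E n) (U n) L0 n (tau (fun k => sW (base (E n) (U n) L0 n k w)) (m%:R * dl)) w).
  move=> mp; have [k _ [h1 h2 _ h3 _]] := stage_time L0pos c0 dl0 cL ok mp.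
  by rewrite h3 (tau_eq h1 h2).
have := key _ jp; rewrite big_ord_recr /= (key _ (ltnW jp)) /inc => <-.
by rewrite addrAC subrr add0r.
Qed.

End increments.

Lemma floor_grid {R : realType} (W dl : R) : 0 <= W -> 0 < dl -> exists m : nat, m%:R * dl <= W /\ W < m%:R * dl + dl.
Proof.
move=> W0 d0; have f0 : 0 <= Num.floor (W / dl) by rewrite floor_ge0 divr_ge0 // ltW.
exists `|Num.floor (W / dl)|%N; have -> : `|Num.floor (W / dl)|%N%:R = (Num.floor (W / dl))%:~R :> R by rewrite -[in RHS](gez0_abs f0).
split; first by rewrite -ler_pdivlMr // floor_le_tmp.
by rewrite -[X in _ + X]mul1r -mulrDl -ltr_pdivrMr // -intrD1 floorD1_gt.
Qed.

Lemma three_dist {R : realType} (a b c d' e : R) : `|a - b| <= e / 3 -> `|b - c| <= e / 3 -> `|c - d'| <= e / 3 -> `|a - d'| <= e.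
Proof.
move=> h1 h2 h3; apply: le_trans (ler_distD b _ _) _; have := ler_distD c b d'; lra.
Qed.

Section driving_path.
Context {R : realType} (L0 : R -> R) (L0pos : forall x, 0 < L0 x).
Variables (b : R -> R) (cb : continuous b) (b0 : b 0 = 0).
Context d {T : measurableType d} (E U : nat -> nat -> T -> R) (nn : nat -> nat) (w : nat -> T).
Context (FU : set_system nat) {UF : UltraFilter FU}.
Hypothesis good : forall q : nat, exists (V B dl : R) (A m : nat),
  [/\ q%:R <= V, (q <= A)%N, 0 < dl, (0 < A)%N &
   \forall i \near FU, (m < nn i)%N /\ goodp L0 (E (nn i)) (U (nn i)) q V A m B dl (nn i) (w i)].
Variable sc : nat -> nat.
Hypothesis scy : forall N, \forall i \near FU, (N <= sc i)%N.
Hypothesis incs : forall e : R, 0 < e -> \forall i \near FU,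
  \sum_(j < sc i * 2 ^ sc i) `|inc L0 E U (nn i) (w i) (hn (sc i)) j - (b (j.+1%:R * hn (sc i)) - b (j%:R * hn (sc i)))| <= e.
Local Notation s i k := (base (E (nn i)) (U (nn i)) L0 (nn i) k (w i)).

(** The clock value is compared with the grid point below it: the martingale moves little in between
    by its modulus, at the grid point it is a sum of increments close to those of b, and b is
    continuous. The mesh 2^-(sc i) shrinks while the horizon sc i grows. *)
Lemma driving_limit (k : nat -> nat) (u : R) : 0 <= u ->
  (fun i => sW (s i (k i))) @ FU --> u -> (fun i => sM (s i (k i))) @ FU --> b u.
Proof.
move=> u0 Wu; apply: ulim_eps => e e0; have e3 : 0 < e / 3 by rewrite divr_gt0.
pose q := maxn (Num.bound (u + 2)) (Num.bound (e / 3)^-1).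
have qu : u + 2 <= q%:R.
  apply: ltW; apply: lt_le_trans (archi_boundP (addr_ge0 u0 (ler0n R 2))) _.
  by rewrite ler_nat leq_maxl.
have qe : q.+1%:R^-1 <= e / 3.
  rewrite -[e / 3]invrK lef_pV2 ?posrE ?invr_gt0 //; apply: ltW.
  apply: lt_le_trans (archi_boundP _) _; first by rewrite invr_ge0 ltW.
  by rewrite ler_nat leqW // leq_maxr.
have [V [B' [dl [A [m [qV _ dl0 _ ev]]]]]] := good q.
have [r r0 hr] : exists2 r : R, 0 < r & forall z, `|z - u| < r -> `|b z - b u| <= e / 3.
  have /cvgrPdist_le/(_ _ e3) := @cb u; move=> /nbhs_ballP[r /= r0 h]; exists r => // z zr.
  by rewrite distrC; apply: h; rewrite /ball /= distrC.
pose t := Num.min 1 (Num.min dl (r / 3)).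
have t0 : 0 < t by rewrite !lt_min ltr01 dl0 divr_gt0.
have [t1 [t2 t3]] : t <= 1 /\ t <= dl /\ t <= r / 3 by rewrite !ge_min !lexx !orbT.
have [N hN] := hn_small t0.
apply: filterS (filterI (filterI ev (incs e3)) (filterI (cvg_dist Wu t0) (scy (maxn N q)))) => i [[[_ [_ _ _ [_ modM _ _]]] inci] [Wi]].
rewrite geq_max => /andP[scN scq].
have hdl := hN _ scN; have h0 := hn_gt0 (R := R) (sc i).
have W0 : 0 <= sW (s i (k i)) by exact: sW_ge0.
have [mm [m1 m2]] := floor_grid W0 h0.
have [a1 a2 a3] := @tauP _ (fun k => sW (s i k)) _ _ m1.
set ta := tau _ _ in a1 a2 a3.
have Wu1 : sW (s i (k i)) <= u + 1 by move: Wi; rewrite ler_norml => /andP[_]; move: t1; lra.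
have WV : sW (s i (k i)) < V by move: Wu1 qu qV; lra.
have mono : sW (s i ta) <= sW (s i (k i)) by exact: sW_le.
have d1 : `|sM (s i (k i)) - sM (s i ta)| <= e / 3.
  by apply: le_trans qe; apply: modM => //; move: m2 a1 hdl t2; lra.
have mp : (mm <= sc i * 2 ^ sc i)%N.
  rewrite -(ler_nat R) -(ler_pM2r h0) natrM natrX -mulrA divff ?mulr1 ?expf_neq0 //.
  apply: le_trans m1 _; have : q%:R <= (sc i)%:R :> R by rewrite ler_nat.
  by move: Wu1 qu; lra.
have d2 : `|sM (s i ta) - b (mm%:R * hn (sc i))| <= e / 3.
  rewrite -inc_sum.
  have -> : b (mm%:R * hn (sc i)) = \sum_(j < mm) (b (j.+1%:R * hn (sc i)) - b (j%:R * hn (sc i))).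
    by rewrite -(big_mkord xpredT (fun j => b (j.+1%:R * hn (sc i)) - b (j%:R * hn (sc i)))) (telescope_sumr (fun j => b (j%:R * hn (sc i)))) // mul0r b0 subr0.
  rewrite -sumrB; apply: le_trans (ler_norm_sum _ _ _) _; apply: le_trans inci.
  rewrite -(big_mkord xpredT (fun j => `|inc L0 E U (nn i) (w i) (hn (sc i)) j - (b (j.+1%:R * hn (sc i)) - b (j%:R * hn (sc i)))|)).
  rewrite -[leRHS](big_mkord xpredT (fun j => `|inc L0 E U (nn i) (w i) (hn (sc i)) j - (b (j.+1%:R * hn (sc i)) - b (j%:R * hn (sc i)))|)).
  by rewrite [leRHS](big_cat_nat (leq0n mm) mp) /= lerDl sumr_ge0.
apply: (three_dist d1 d2); apply: hr.
move: Wi; rewrite ler_norml => /andP[w1 w2]; rewrite ltr_norml; apply/andP; split; move: m1 m2 hdl t3 r0; lra.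
Qed.

End driving_path.

(** * The envelope of the test functional *)

Section integrals.
Context {R : realType} d {T : measurableType d} (P : probability T R).
Variables (f : T -> R) (M : R).
Hypothesis fM : forall w, `|f w| <= M.

Let bnd w : - M <= f w <= M. Proof. by rewrite -ler_norml. Qed.

Lemma bounded_integral : exists2 x : R, (\int[P]_w (f w)%:E)%E = x%:E & `|x| <= M.
Proof.
have c (z : R) : (\int[P]_w z%:E)%E = z%:E by rewrite (@ExE _ _ _ P (fun=> z)) ?Ex_cst //; exact: itg_cst.
have h1 : (\int[P]_w (f w)%:E <= M%:E)%E by rewrite -(c M); apply: le_integralT => w; rewrite lee_fin; have /andP[] := bnd w.
have h2 : ((- M)%:E <= \int[P]_w (f w)%:E)%E by rewrite -(c (- M)); apply: le_integralT => w; rewrite lee_fin; have /andP[] := bnd w.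
move: h1 h2; case: (integral _ _ _) => [x| |] //=.
by rewrite !lee_fin => h1 h2; exists x => //; rewrite ler_norml h2.
Qed.

(** Positive and negative parts change places; both have finite integrals, so the difference can be
    reversed. *)
Lemma bounded_integralN : (\int[P]_w (- f w)%:E = - \int[P]_w (f w)%:E)%E.
Proof.
rewrite (_ : (fun w => (- f w)%:E) = (\- (fun w => (f w)%:E))%E) //.
rewrite integralE funeposN funenegN [in RHS]integralE.
have M0 : 0 <= M by apply: le_trans (fM point).
have fin g : (forall w, (0 <= g w)%E) -> (forall w, (g w <= M%:E)%E) -> (\int[P]_w g w)%E \is a fin_num.
  move=> g0 gM; rewrite ge0_fin_numE; last exact: integral_ge0.
  apply: (@le_lt_trans _ _ M%:E); last exact: ltry.
  rewrite -[leRHS](_ : (\int[P]_w M%:E)%E = M%:E); first exact: le_integralT.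
  by rewrite (@ExE _ _ _ P (fun=> M)) ?Ex_cst //; exact: itg_cst.
rewrite fin_num_oppeB 1?addeC //; apply: fin => w; rewrite ?funepos_ge0 ?funeneg_ge0 //.
by rewrite funenegE ge_max -EFinN !lee_fin M0 andbT lerNl; have /andP[] := bnd w.
Qed.

End integrals.

Section envelope.
Context {R : realType} (L0 : R -> R) (L0pos : forall x, 0 < L0 x) (L0c : continuous L0).
Hypothesis S0y : forall C : R, exists A0 : nat, forall A : nat, (A0 <= A)%N -> C <= S0 L0 A%:R.
Hypothesis S0Ny : forall C : R, exists A0 : nat, forall A : nat, (A0 <= A)%N -> S0 L0 (- A%:R) <= C.
Context d {T : measurableType d} (P : probability T R) (E U : nat -> nat -> T -> R).
Hypothesis hEU : forall n, clocks P (E n) (U n).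
Context d' {Om : measurableType d'} (Q : probability Om R) (B : R -> Om -> R) (Psi Lam : R -> R -> Om -> R).
Hypothesis hB : brownian_motion Q B.
Hypothesis hflow : forall w, bass_burdzy (fun u => B u w) (fun u y => Psi u y w) (fun u y => Lam u y w).

Definition Zn n w : @pathspace R := (vrjp_X n L0 (fun k => E n k w) (fun k => U n k w),
                 vrjp_L n L0 (fun k => E n k w) (fun k => U n k w)).
Definition Zl w : @pathspace R := (lrm_X L0 (fun u => B u w) (fun u y => Psi u y w) (fun u y => Lam u y w),
               lrm_L L0 (fun u => B u w) (fun u y => Psi u y w) (fun u y => Lam u y w)).

Variables (F : @pathspace R -> R) (M : R).
Hypotheses (FM : forall z, `|F z| <= M) (Fc : lu_continuous F).
Variables (Vq Bq dq : nat -> R) (Aq mq Nq : nat -> nat).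
Hypothesis data : forall q, [/\ q%:R <= Vq q, (q <= Aq q)%N, 0 < dq q, (0 < Aq q)%N &
  forall n, (Nq q <= n)%N -> (mq q < n)%N].

(** The scale n is asked only for the accuracies it can afford. Every q is included eventually, so
    one set serves all accuracies. *)
Definition Gset n w := forall q, (maxn (Nq q) q <= n)%N ->
  goodp L0 (E n) (U n) q (Vq q) (Aq q) (mq q) (Bq q) (dq q) n w.

Local Notation pp N := (N * 2 ^ N)%N.
Local Notation inc n w N := (inc L0 E U n w (hn N)).

(* [env N] is the Lipschitz upper envelope of [F] seen as a function of the dyadic increments. *)
Definition pen N (v : nat -> R) n w := F (Zn n w) - N%:R * \sum_(j < pp N) `|inc n w N j - v j|.
(** The value - M keeps the supremum meaningful when no sample point is good. *)
Definition eset N v : set R := [set x | x = - M \/ exists n w, [/\ (N <= n)%N, Gset n w & x = pen N v n w]].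
Definition env N v := sup (eset N v).

Let F_le z : F z <= M. Proof. by have := FM z; rewrite ler_norml => /andP[]. Qed.
Let F_ge z : - M <= F z. Proof. by have := FM z; rewrite ler_norml => /andP[]. Qed.
Let M0 : 0 <= M. Proof. exact: le_trans (FM (fun=> 0, fun _ _ => 0)). Qed.

Lemma eset_ne N v : eset N v !=set0. Proof. by exists (- M); left. Qed.

Lemma pen_le N v n w : pen N v n w <= F (Zn n w).
Proof. by rewrite gerBl mulr_ge0 // sumr_ge0. Qed.

Lemma eset_ub N v : ubound (eset N v) M.
Proof.
move=> x [->|[n [w [_ _ ->]]]]; first by move: M0; lra.
exact: le_trans (pen_le _ _ _ _) (F_le _).
Qed.

Lemma env_le N v : env N v <= M.
Proof. exact: ge_sup (eset_ne N v) (@eset_ub N v). Qed.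

Lemma env_mem N v x : eset N v x -> x <= env N v.
Proof. by apply: ub_le_sup; exists M; exact: eset_ub. Qed.

Lemma env_ge N v : - M <= env N v. Proof. by apply: env_mem; left. Qed.

Lemma env_blip N : blip (pp N) (env N).
Proof.
exists M, N%:R; split => //.
  by move=> v; rewrite ler_norml env_le env_ge.
have half v v' : env N v <= env N v' + N%:R * \sum_(j < pp N) `|v j - v' j|.
  have s0 : 0 <= N%:R * \sum_(j < pp N) `|v j - v' j| by rewrite mulr_ge0 // sumr_ge0.
  apply: ge_sup; first exact: eset_ne.
  move=> x [->|[n [w [Nn Gw ->]]]]; first by rewrite -[- M]addr0 lerD // env_ge.
  have h : pen N v' n w <= env N v' by apply: env_mem; right; exists n, w.
  rewrite -lerBlDr; apply: le_trans h; rewrite /pen -addrA lerD2l -opprD lerN2 -mulrDr ler_wpM2l //.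
  rewrite -big_split /=; apply: ler_sum => j _.
  by rewrite addrC; apply: le_trans (ler_distD (v j) _ _) _; rewrite addrC.
move=> v v'; rewrite ler_norml; apply/andP; split; last by rewrite lerBlDl half.
rewrite lerNl opprB lerBlDl; under eq_bigr do rewrite distrC; exact: half.
Qed.

(* If the envelope stayed above the limit, the maximising paths would have increments converging
   to those of the Brownian path, hence converge to the limit process. *)
Lemma env_limsup o (e : R) : 0 < e -> exists N0, forall N, (N0 <= N)%N -> env N ((incB B (hn N))^~ o) <= F (Zl o) + e.
Proof.
move=> e0; apply: contrapT => /forallNP bad.
have ex k : exists y : nat * nat * T, [/\ (k <= y.1.1)%N, (y.1.1 <= y.1.2)%N, Gset y.1.2 y.2 &
    F (Zl o) + e < pen y.1.1 ((incB B (hn y.1.1))^~ o) y.1.2 y.2].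
  have /existsNP[N /not_implyP[kN /negP]] := bad k; rewrite -ltNge => lt.
  have [x [->|[n [w [Nn Gw ->]]]] xl] := sup_gt (eset_ne _ _) lt.
    by exfalso; move: xl (F_ge (Zl o)); lra.
  by exists (N, n, w).
have [y hy] := choice ex.
pose sc i := (y i).1.1; pose nn i := (y i).1.2; pose w i := (y i).2.
have [FU [UF sub]] := @ultraFilterLemma nat \oo _.
have big N : \forall i \near FU, (N <= i)%N by apply: sub; exists N.
have scy N : \forall i \near FU, (N <= sc i)%N.
  by apply: filterS (big N) => i Ni; have [h _ _ _] := hy i; exact: leq_trans h.
have nny N : \forall i \near FU, (N <= nn i)%N.
  by apply: filterS (scy N) => i Ni; have [_ h _ _] := hy i; exact: leq_trans h.
have good q : exists (V B dl : R) (A m : nat), [/\ q%:R <= V, (q <= A)%N, 0 < dl, (0 < A)%N &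
   \forall i \near FU, (m < nn i)%N /\ goodp L0 (E (nn i)) (U (nn i)) q V A m B dl (nn i) (w i)].
  have [d1 d2 d3 d4 d5] := data q.
  exists (Vq q), (Bq q), (dq q), (Aq q), (mq q); split => //.
  apply: filterS (nny (maxn (Nq q) q)) => i ni; have [_ _ Gw _] := hy i; split; last exact: Gw.
  by apply: d5; apply: leq_trans ni; exact: leq_maxl.
have cB : continuous (fun u => B u o) by case: hB => _ [_ []].
have B0 : B 0 o = 0 by exact: bm0 hB o.
have incs (e' : R) : 0 < e' -> \forall i \near FU,
   \sum_(j < pp (sc i)) `|inc (nn i) (w i) (sc i) j - (B (j.+1%:R * hn (sc i)) o - B (j%:R * hn (sc i)) o)| <= e'.
  (* The penalty cannot exceed the range 2 M of F, so the sum of distances is at most 2 M / sc i. *)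
  move=> e'0; pose N := (Num.bound (2 * M / e')).+1.
  apply: filterS (scy N) => i Ni; have [_ _ _ h] := hy i.
  set S := \sum_(j < _) _; rewrite /pen -/(sc i) -/(nn i) -/(w i) in h.
  have {h} : F (Zl o) + e < F (Zn (nn i) (w i)) - (sc i)%:R * S by exact: h.
  have Np : 0 < (sc i)%:R :> R by rewrite ltr0n; exact: leq_trans Ni.
  have Nb : 2 * M / e' <= (sc i)%:R.
    apply: ltW; apply: lt_le_trans (archi_boundP _) _; first by rewrite divr_ge0 ?mulr_ge0 // ltW.
    by rewrite ler_nat; apply: leq_trans Ni.
  rewrite ler_pdivrMr // in Nb.
  have := F_le (Zn (nn i) (w i)); have := F_ge (Zl o) => h1 h2 h3.
  by rewrite -(ler_pM2l Np); move: h1 h2 h3 Nb e0; lra.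
have HM := @driving_limit R L0 L0pos _ cB B0 d T E U nn w FU UF good sc scy incs.
have [Tm [dl [Tm0 [dl0 hF]]]] := Fc (Zl o) e0.
have PL := @path_limit R L0 L0pos L0c S0y S0Ny _ _ _ cB (hflow o) d T E U nn w FU UF nny good HM.
have unif : \forall i \near FU, forall tx : R * R, 0 <= tx.1 <= Tm -> `|tx.2| <= Tm ->
    `|(Zl o).1 tx.1 - (Zn (nn i) (w i)).1 tx.1| < dl /\ `|(Zl o).2 tx.1 tx.2 - (Zn (nn i) (w i)).2 tx.1 tx.2| < dl.
  apply: (ev_uniform (0, 0)) => tx badtx.
  (* Default values put the chosen pairs in the compact range for all i; a pair at which the
     estimate fails lies in that range and is unchanged. *)
  pose t i := if 0 <= (tx i).1 <= Tm then (tx i).1 else 0.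
  pose x i := if `|(tx i).2| <= Tm then (tx i).2 else 0.
  have tT i : 0 <= t i <= Tm by rewrite /t; case: ifP => //; rewrite lexx (ltW Tm0).
  have xT i : `|x i| <= Tm by rewrite /x; case: ifP => //; rewrite normr0 (ltW Tm0).
  have dl2 : 0 < dl / 2 by rewrite divr_gt0.
  have [l1 l2] := PL t x Tm tT xT.
  have [i [b1 [b2 b3]]] := filter_ex (filterI badtx (filterI (cvg_dist l1 dl2) (cvg_dist l2 dl2))).
  apply: b1 => h1 h2; move: b2 b3; rewrite !subr0 /t /x h1 h2 => b2 b3.
  by rewrite distrC [X in _ /\ X < _]distrC; split; [apply: le_lt_trans b2 _|apply: le_lt_trans b3 _]; lra.
have [i ui] := filter_ex unif.
have : `|F (Zl o) - F (Zn (nn i) (w i))| < e by apply: hF => t x h1 h2; exact: (ui (t, x)).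
have [_ _ _ h] := hy i; have := pen_le (sc i) ((incB B (hn (sc i)))^~ o) (nn i) (w i).
by rewrite ltr_norml => h1 /andP[h2 h3]; move: h h1 h2; rewrite -/(sc i) -/(nn i) -/(w i); lra.
Qed.

(** Fatou's lemma for the nonnegative functions M - env N: with [env_limsup], the lower limit of the
    means of the envelopes is at most the mean of F at the limit process, so some N is good
    enough. *)
Lemma env_expect (x e : R) : (\int[Q]_o (F (Zl o))%:E)%E = x%:E -> 0 < e ->
  exists N, Ex Q (fun o => env N ((incB B (hn N))^~ o)) <= x + e.
Proof.
move=> Fx e0; apply: contrapT => /forallNP bad.
pose g N o := env N ((incB B (hn N))^~ o).
have ig N : itg Q (g N) by apply: (blip_itg Q (env_blip N)) => j; exact: (incB_meas hB).
have mg N := itg_meas (ig N).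
pose u N o := (M - g N o)%:E.
have mu N : measurable_fun setT (u N) by apply/measurable_EFinP; exact: measurable_funB.
have u0 N o : (0 <= u N o)%E by rewrite lee_fin subr_ge0 env_le.
have u2 N o : (u N o <= (2 * M)%:E)%E by rewrite lee_fin; have := env_ge N ((incB B (hn N))^~ o); rewrite /g; lra.
pose l o := limn_einf (u^~ o).
have lb o (a : \bar R) N0 : (forall N, (N0 <= N)%N -> (a <= u N o)%E) -> (a <= l o)%E.
  move=> h; rewrite /l limn_einf_lim; apply: lime_ge; first exact: is_cvg_einfs.
  exists N0 => // n /= n0; apply: le_ereal_inf_tmp => _ [k /= nk <-]; apply: h; exact: leq_trans nk.
have l0 o : (0 <= l o)%E by apply: (lb o _ 0%N).
have l2 o : (l o <= (2 * M)%:E)%E.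
  rewrite /l limn_einf_lim; apply: lime_le; first exact: is_cvg_einfs.
  apply: nearW => n; apply: le_trans (u2 n o); apply: ereal_inf_lbound; exists n => //=.
have lF o : l o = (fine (l o))%:E by move: (l0 o) (l2 o); case: (l o).
have ml : measurable_fun setT l.
  rewrite /l /limn_einf; apply: measurableT_comp => //.
  by apply: measurable_fun_limn_esup => n; apply: measurableT_comp.
have mr : measurable_fun setT (fine \o l) by apply: measurableT_comp.
have ir : itg Q (fine \o l).
  apply: (@itg_bound _ _ _ _ _ (2 * M)) => // o.
  by rewrite ger0_norm -lee_fin -lF.
have lFZ o : M - fine (l o) <= F (Zl o).
  apply/ler_addgt0Pr => e' e'0; have [N0 h] := env_limsup o e'0.
  have : ((M - F (Zl o) - e')%:E <= l o)%E.
    by apply: (lb o _ N0) => N /h h'; rewrite lee_fin; move: h'; rewrite /g; lra.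
  by rewrite lF lee_fin; lra.
have h1 : M - Ex Q (fine \o l) <= x.
  have i1 : itg Q (fun o => M - fine (l o)) by apply: itgB => //; exact: itg_cst.
  rewrite -lee_fin -Fx -[X in X - _](Ex_cst Q M) -ExB //; last exact: itg_cst.
  by rewrite -(ExE i1); apply: le_integralT => o; rewrite lee_fin; exact: lFZ.
have fat := @fatou _ _ _ Q setT measurableT u mu (fun n o _ => u0 n o).
have e1 : (\int[Q]_o limn_einf (u^~ o) = (Ex Q (fine \o l))%:E)%E.
  by rewrite -ExE //; apply: eq_integral => o _; rewrite -/(l o) lF.
have e2 N : (\int[Q]_o u N o = (M - Ex Q (g N))%:E)%E.
  rewrite /u (@ExE _ _ _ Q (fun o => M - g N o)); last by apply: itgB => //; exact: itg_cst.
  by rewrite ExB ?Ex_cst //; exact: itg_cst.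
have h2 : (limn_einf (fun n => \int[Q]_o u n o) <= (M - (x + e))%:E)%E.
  rewrite limn_einf_lim; apply: lime_le; first exact: is_cvg_einfs.
  apply: nearW => n; apply: (@le_trans _ _ (\int[Q]_o u n o)%E); first by apply: ereal_inf_lbound; exists n => //=.
  by rewrite e2 lee_fin; move/negP: (bad n); rewrite -ltNge /g; lra.
by have := le_trans fat h2; rewrite e1 lee_fin; lra.
Qed.

End envelope.

(** * Measurability of jump times, and a uniform number of steps *)

Section measurability.
Context {R : realType} d {T : measurableType d} (P : probability T R).
Variables (E U : nat -> T -> R) (cEU : clocks P E U).
Variables (L0 : R -> R) (L0pos : forall x, 0 < L0 x) (n : nat).

Let mE k : measurable_fun setT (E k). Proof. exact: (cEU.1.1 (inl k)). Qed.
Let mU k : measurable_fun setT (U k). Proof. exact: (cEU.1.1 (inr k)). Qed.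

Lemma run_meas (a : nat -> T -> R) k : (forall k, measurable_fun setT (a k)) ->
  mstate (fun w => run (hn n) (@chi0 R) (vinit L0 n) (fun i => a i w) (fun i => U i w) k).
Proof.
move=> ma; elim: k => [|k IH]; first exact: mstate_cst.
pose s w := run (hn n) (@chi0 R) (vinit L0 n) (fun i => a i w) (fun i => U i w) k.
have mch m : mfunc (@chi0 R m) by move=> d' T' s' _; exact: measurable_cst.
rewrite (_ : (fun w => _) = (fun w => if U k w * (lmv (s w) + lpv (s w)) < lpv (s w)
   then step (hn n) (@chi0 R) (s w) (a k w) true else step (hn n) (@chi0 R) (s w) (a k w) false)); last first.
  by apply/funext => w /=; rewrite -/(s w); case: ifP.
apply: mstate_if; [|exact: mstep|exact: mstep].
apply: measurable_fun_ltr; last exact: (mfunc_sLX 1 IH).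
by apply: measurable_funM => //; apply: measurable_funD; [exact: (mfunc_sLX (-1) IH)|exact: (mfunc_sLX 1 IH)].
Qed.

Lemma base_W_meas k : measurable_fun setT (fun w => sW (base E U L0 n k w)).
Proof.
have ma i : measurable_fun setT (fun w => `|E i w|) by exact: measurableT_comp.
by have [_ [_ [_ [h _]]]] := @run_meas (fun i w => `|E i w|) k ma.
Qed.

Lemma jump_meas k : measurable_fun setT (fun w => vrjp_jump n L0 (fun i => E i w) (fun i => U i w) k).
Proof.
have [_ [_ [_ [_ [h _]]]]] := @run_meas E k mE.
rewrite (_ : (fun w => _) = (fun w => sJ (run (hn n) (@chi0 R) (vinit L0 n) (fun i => E i w) (fun i => U i w) k))) //.
apply/funext => w; rewrite /vrjp_jump; have := vrjp_run L0 n (fun i => E i w) (fun i => U i w) k.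
by case: vrjp_state => -[x l] J [].
Qed.

Lemma tmax_meas (Tm : R) : measurable [set w | (vrjp_tmax n L0 (fun k => E k w) (fun k => U k w) <= Tm%:E)%E].
Proof.
rewrite (_ : [set w | _] = \bigcap_k [set w | vrjp_jump n L0 (fun i => E i w) (fun i => U i w) k <= Tm]).
  apply: bigcapT_measurable => k.
  have mb : measurable_fun setT (fun w => vrjp_jump n L0 (fun i => E i w) (fun i => U i w) k <= Tm).
    by apply: measurable_fun_ler => //; exact: jump_meas.
  by have := mb measurableT [set true] I; rewrite setTI.
apply/seteqP; split => w /=.
  move=> h k _ /=; rewrite -lee_fin; apply: le_trans h; apply: ereal_sup_ubound; by exists k.
by move=> h; apply: ge_ereal_sup => _ [k _ <-]; rewrite lee_fin; exact: h.
Qed.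

(** The events that V has not been passed by step K decrease to an event contained in the
    exceptional set; continuity from above gives one K at the cost of e2. *)
Lemma hit_time (V e1 e2 : R) : 0 < e2 -> whp P e1 (fun w => exists k, V < sW (base E U L0 n k w)) ->
  exists K, whp P (e1 + e2) (fun w => V < sW (base E U L0 n K w)).
Proof.
move=> e20 [Bd [mB PB hB]].
pose D k : set T := [set w | sW (base E U L0 n k w) <= V].
have mD k : measurable (D k).
  have mb : measurable_fun setT (fun w => sW (base E U L0 n k w) <= V) by apply: measurable_fun_ler => //; exact: base_W_meas.
  by have := mb measurableT [set true] I; rewrite setTI.
have mI : measurable (\bigcap_k D k) by exact: bigcapT_measurable.
have DB : \bigcap_k D k `<=` Bd.
  move=> w h; apply: contrapT => /hB[k]; rewrite ltNge => /negP; apply; exact: h.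
have lt : (P (\bigcap_k D k) < (e1 + e2)%:E)%E.
  apply: (@le_lt_trans _ _ e1%:E); last by rewrite lte_fin ltrDl.
  by apply: le_trans PB; apply: le_measure; rewrite ?inE.
have D0 : (P (D 0%N) < +oo)%E by rewrite (le_lt_trans (probability_le1 _ _)) // ltry.
have dec : {homo D : n m / (n <= m)%N >-> (m <= n)%O}.
  move=> k1 k2 k12; apply/subsetPset => w /=; rewrite /D /= => h.
  by apply: le_trans h; exact: (sW_le E U L0pos n w k12).
have [K _ hK] := nonincreasing_cvg_mu D0 mD mI dec (open_ereal_lt' lt).
exists K, (D K); split; [exact: mD| |].
  by apply: ltW; exact: (hK K (leqnn K)).
by move=> w /negP; rewrite -ltNge.
Qed.

End measurability.

Lemma half_pow_sum {R : realType} (e : R) n : 0 <= e -> \sum_(q < n) e / 2 ^+ q.+1 <= e.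
Proof.
move=> e0; have := half_sum (R := R) n => h.
have -> : \sum_(q < n) e / 2 ^+ q.+1 = e / 2 * \sum_(q < n) (2 ^+ q)^-1.
  by rewrite mulr_sumr; apply: eq_bigr => q _; rewrite exprS invfM mulrA.
apply: le_trans (ler_wpM2l (divr_ge0 e0 (ler0n R 2)) h) _.
by rewrite divfK.
Qed.

(** * Non-explosion and convergence in law *)

Section convergence.
Context {R : realType} (L0 : R -> R) (L0pos : forall x, 0 < L0 x) (L0c : continuous L0).
Hypothesis S0y : forall C : R, exists A0 : nat, forall A : nat, (A0 <= A)%N -> C <= S0 L0 A%:R.
Hypothesis S0Ny : forall C : R, exists A0 : nat, forall A : nat, (A0 <= A)%N -> S0 L0 (- A%:R) <= C.
Context d {T : measurableType d} (P : probability T R) (E U : nat -> nat -> T -> R).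
Hypothesis hEU : forall n, clocks P (E n) (U n).

(** On a good path the clock passes V at a jump time of at least q > Tm, so the explosion time
    exceeds Tm. *)
Lemma tmax_cvg (Tm : R) : (fun n => P [set w | (vrjp_tmax n L0 (fun k => E n k w) (fun k => U n k w) <= Tm%:E)%E]) @ \oo --> 0%E.
Proof.
apply/fine_cvgP; split; first by apply: nearW => n; exact: fin_num_measure (tmax_meas (hEU n) L0 n Tm).
apply/cvgrPdist_le => e e0.
pose q := Num.bound `|Tm|.
have qT : Tm < q%:R by apply: le_lt_trans (ler_norm _) _; exact: archi_boundP.
have [V [B [dl [A [m [N [qV qA _ _ h]]]]]]] := good_whp P L0pos L0c S0y S0Ny q e0.
exists N => // n /= /h[_ /(_ _ _ (hEU n)) [Bd [mB PB hB]]].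
rewrite sub0r normrN ger0_norm ?fine_ge0 //.
have mt := tmax_meas (hEU n) L0 n Tm.
rewrite -lee_fin fineK; last exact: fin_num_measure.
apply: le_trans PB; apply: le_measure; rewrite ?inE // => w /= tw.
apply: contrapT => /hB[E0 _ _ [_ _ [k Vk] Jq]].
have := le_trans (ereal_sup_ubound _) tw => /(_ (vrjp_jump n L0 (fun k => E n k w) (fun k => U n k w) k)%:E) h1.
have {h1} : vrjp_jump n L0 (fun k => E n k w) (fun k => U n k w) k <= Tm by rewrite -lee_fin; apply: h1; exists k.
rewrite (vrjp_jumpE L0 n (U n) E0 k) leNgt => /negP; apply.
by apply: lt_le_trans qT _; apply: Jq; exact: ltW.
Qed.

Context d' {Om : measurableType d'} (Q : probability Om R) (B : R -> Om -> R) (Psi Lam : R -> R -> Om -> R).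
Hypothesis hB : brownian_motion Q B.
Hypothesis hflow : forall w, bass_burdzy (fun u => B u w) (fun u y => Psi u y w) (fun u y => Lam u y w).
Local Notation Zn := (Zn L0 E U).
Local Notation Zl := (Zl L0 B Psi Lam).

(** A good path belongs to the supremum defining the envelope, with penalty 0 at its own increments,
    so F is at most the envelope there. The envelope is bounded and Lipschitz in finitely many
    increments, hence its mean converges to the Brownian one, which a suitable N brings near the
    mean of F at the limit. *)
Lemma expect_limsup (F : @pathspace R -> R) (M : R) : (forall z, `|F z| <= M) -> lu_continuous F ->
  forall x e : R, (\int[Q]_o (F (Zl o))%:E)%E = x%:E -> 0 < e ->
  exists N, forall n, (N <= n)%N -> (\int[P]_w (F (Zn n w))%:E <= (x + e)%:E)%E.
Proof.
move=> FM Fc x e Fx e0.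
have M0 : 0 <= M by exact: le_trans (FM (fun=> 0, fun _ _ => 0)).
have M1 : 0 < 8 * (M + 1) by rewrite mulr_gt0 // ltr_wpDl.
pose eps := e / (8 * (M + 1)).
have eps0 : 0 < eps by rewrite divr_gt0.
have Meps : 2 * M * eps <= e / 4.
  have -> : e / 4 = 2 * (M + 1) * eps by rewrite /eps; field; rewrite gt_eqF // ltr_wpDl.
  by rewrite ler_pM2r // ler_pM2l // lerDl ler01.
(* Accuracy q may fail with probability eps / 2^(q+1), so that all accuracies together cost at most
   eps. *)
have eq0 q : 0 < eps / 2 ^+ q.+1 by rewrite divr_gt0 // exprn_gt0.
have ex q : exists y : R * R * R * nat * nat * nat, let: (V, Bb, dl, A, m, N) := y in
   [/\ q%:R <= V, (q <= A)%N, 0 < dl, (0 < A)%N &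
   forall n, (N <= n)%N -> (m < n)%N /\ forall E U, clocks P E U -> whp P (eps / 2 ^+ q.+1) (goodp L0 E U q V A m Bb dl n)].
  by have [V [Bb [dl [A [m [N h]]]]]] := good_whp P L0pos L0c S0y S0Ny q (eq0 q); exists (V, Bb, dl, A, m, N).
have [y hy] := choice ex.
pose Vq q := (y q).1.1.1.1.1; pose Bq q := (y q).1.1.1.1.2; pose dq q := (y q).1.1.1.2.
pose Aq q := (y q).1.1.2; pose mq q := (y q).1.2; pose Nq q := (y q).2.
have hq q : [/\ q%:R <= Vq q, (q <= Aq q)%N, 0 < dq q, (0 < Aq q)%N &
   forall n, (Nq q <= n)%N -> (mq q < n)%N /\ forall E U, clocks P E U -> whp P (eps / 2 ^+ q.+1) (goodp L0 E U q (Vq q) (Aq q) (mq q) (Bq q) (dq q) n)].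
  by have := hy q; rewrite /Vq /Bq /dq /Aq /mq /Nq; case: (y q) => [[[[[? ?] ?] ?] ?] ?].
have data q : [/\ q%:R <= Vq q, (q <= Aq q)%N, 0 < dq q, (0 < Aq q)%N & forall n, (Nq q <= n)%N -> (mq q < n)%N].
  by have [h1 h2 h3 h4 h5] := hq q; split => // n /h5[].
pose G n w := Gset L0 E U Vq Bq dq Aq mq Nq n w.
have whpG n : whp P eps (G n).
  have := @whp_all R d T P n.+1 (fun q => eps / 2 ^+ q.+1) (fun q w => (maxn (Nq q) q <= n)%N ->
     goodp L0 (E n) (U n) q (Vq q) (Aq q) (mq q) (Bq q) (dq q) n w) _.
  move=> /(_ _)/wrap[].
    move=> q _; have [nq|/negbTE nq] := boolP (maxn (Nq q) q <= n)%N; last first.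
      by exists set0; split => //; rewrite measure0 lee_fin ltW.
    have [_ _ _ _ h5] := hq q; move: nq; rewrite geq_max => /andP[/h5[_ /(_ _ _ (hEU n))] wq _].
    by apply: whp_le wq.
  apply: whp_le; first by apply: half_pow_sum; exact: ltW.
  move=> w h q nq; apply: h => //; rewrite ltnS; apply: leq_trans nq; exact: leq_maxr.
have e4 : 0 < e / 4 by rewrite divr_gt0.
have [N hN] := @env_expect R L0 L0pos L0c S0y S0Ny d T E U d' Om Q B Psi Lam hB hflow F M FM Fc Vq Bq dq Aq mq Nq data x (e / 4) Fx e4.
pose env := env L0 E U F M Vq Bq dq Aq mq Nq N.
pose pN := (N * 2 ^ N)%N.
have benv : blip pN env by exact: (env_blip L0 E U FM Vq Bq dq Aq mq Nq N).
have hN0 := hn_gt0 (R := R) N.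
have [r1 r10 hc] := conv_blip P L0pos L0c hB hN0 benv e4.
pose r := Num.min r1 eps.
have r0 : 0 < r by rewrite lt_min r10.
have r3 : 0 < r / 3 by rewrite divr_gt0.
(* A further good event, of accuracy N, provides the window A and a clock level V beyond the horizon
   N of the grid. *)
have [V [Bb [dl [A [m [N1 [NV NA dl0 A0 hg]]]]]]] := good_whp P L0pos L0c S0y S0Ny N r3.
have [c /andP[c0 _] cL] := window_lb L0pos L0c A.
have [N2 h2] := hc A.
exists (maxn N (maxn N1 N2)) => n; rewrite !geq_max => /and3P[nN nN1 nN2].
have [_ /(_ _ _ (hEU n)) gw] := hg n nN1.
have pV : pN%:R * hn N <= V.
  by rewrite /pN natrM natrX /hn -mulrA divff ?mulr1 // expf_neq0.
have [K hK] : exists K, whp P (r / 3 + r / 3) (fun w => V < sW (base (E n) (U n) L0 n K w)).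
  apply: (hit_time (hEU n) L0pos r3); apply: whp_le gw => // w [_ _ _ [_ _ hk _]]; exact: hk.
have ok : whp P r (stage_ok (E n) (U n) L0 n A (hn N) pN K).
  apply: whp_le (whpI gw hK); first by lra.
  move=> w [[_ win _ _] hk]; split; last by apply: le_trans pV (ltW hk).
  by move=> k hk'; apply: win; apply: ltW; exact: lt_le_trans pV.
have ok1 : whp P r1 (stage_ok (E n) (U n) L0 n A (hn N) pN K) by apply: whp_le ok => //; rewrite ge_min lexx.
have cv := h2 n nN2 (E n) (U n) (hEU n) K ok1.
pose si w := sinc L0 (hn N) (E n) (U n) n A K w.
have isi : itg P (fun w => env (si w)).
  by apply: (blip_itg P benv) => j; exact: (sinc_meas L0 (hn N) n A K j (hEU n)).
have [B1 [mB1 PB1 hB1]] := whpG n; have [B2 [mB2 PB2 hB2]] := ok.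
have i1 : itg P (\1_B1) by apply: (@itg_bound _ _ _ _ _ 1) => [|w]; [exact: measurable_indic|rewrite indicE normr_nat lern1 leq_b1].
have i2 : itg P (\1_B2) by apply: (@itg_bound _ _ _ _ _ 1) => [|w]; [exact: measurable_indic|rewrite indicE normr_nat lern1 leq_b1].
have E1 : Ex P (\1_B1) <= eps by rewrite -lee_fin -ExE // integral_indic // setIT.
have E2 : Ex P (\1_B2) <= eps by rewrite -lee_fin -ExE // integral_indic // setIT; apply: le_trans PB2 _; rewrite lee_fin ge_min lexx orbT.
have envM v : - M <= env v by exact: (env_ge L0 E U FM Vq Bq dq Aq mq Nq N v).
have pt w : F (Zn n w) <= env (si w) + 2 * M * (\1_B1 w + \1_B2 w).
  have FMw : F (Zn n w) <= M by have := FM (Zn n w); rewrite ler_norml => /andP[].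
  rewrite !indicE; case: (boolP (w \in B1)) => b1.
    have := envM (si w); case: (w \in B2) => /=; lra.
  case: (boolP (w \in B2)) => b2; first by have := envM (si w) => /=; lra.
  rewrite /= addr0 mulr0 addr0.
  have Gw : G n w by apply: hB1 => /mem_set; exact/negP.
  have okw : stage_ok (E n) (U n) L0 n A (hn N) pN K w by apply: hB2 => /mem_set; exact/negP.
  have incE := inc_stage L0pos (hEU n) c0 hN0 cL okw.
  apply: (@env_mem R L0 d T E U F M FM Vq Bq dq Aq mq Nq N (si w)); right; exists n, w; split => //.
  rewrite /pen big1 ?mulr0 ?subr0 // => j _.
  by rewrite incE ?ltn_ord // subrr normr0.
apply: (@le_trans _ _ (\int[P]_w (env (si w) + 2 * M * (\1_B1 w + \1_B2 w))%:E)%E).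
  by apply: le_integralT => w; rewrite lee_fin.
have i12 : itg P (fun w => \1_B1 w + \1_B2 w) by exact: itgD.
rewrite (@ExE _ _ _ P (fun w => env (si w) + 2 * M * (\1_B1 w + \1_B2 w))); last by apply: itgD => //; exact: itgZ.
rewrite lee_fin ExD //; last exact: itgZ.
rewrite ExZ // ExD //.
have h3 : 2 * M * (Ex P (\1_B1) + Ex P (\1_B2)) <= 2 * M * (eps + eps) by rewrite ler_wpM2l ?mulr_ge0 // lerD.
have h4 : Ex P (fun w => env (si w)) <= Ex Q (fun o => env ((incB B (hn N))^~ o)) + e / 4.
  by move: cv; rewrite ler_norml => /andP[_]; rewrite lerBlDl addrC.
have h5 : Ex Q (fun o => env ((incB B (hn N))^~ o)) <= x + e / 4 by exact: hN.
move: h3 h4 h5 Meps; move: (Ex P _) (Ex Q _) (2 * M * (Ex _ _ + _)) => z1 z2 z3; rewrite mulrDr; lra.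
Qed.

(** The upper bound for F and the one for - F enclose the limit. *)
Lemma law_cvg : converges_in_law P Zn Q Zl.
Proof.
move=> F [M FM] Fc _.
have [x Fx xM] := bounded_integral Q (fun o => FM (Zl o)).
have ex n : exists y : R, (\int[P]_w (F (Zn n w))%:E)%E = y%:E.
  by have [z hz _] := bounded_integral P (fun w => FM (Zn n w)); exists z.
have [y hy] := choice ex.
rewrite Fx; apply/fine_cvgP; split; first by apply: nearW => n; rewrite hy.
apply/cvgrPdist_le => e e0.
have [N1 h1] := expect_limsup FM Fc Fx e0.
have FMN z : `|- F z| <= M by rewrite normrN.
have FcN : lu_continuous (fun z => - F z).
  move=> z e' e'0; have [Tm [dl [T0 [dl0 h]]]] := Fc z e' e'0.
  exists Tm, dl; split => //; split => // z' hz'; rewrite -opprD normrN; exact: h.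
have FxN : (\int[Q]_o (- F (Zl o))%:E)%E = (- x)%:E by rewrite (bounded_integralN Q (fun o => FM (Zl o))) Fx.
have [N2 h2] := expect_limsup FMN FcN FxN e0.
exists (maxn N1 N2) => // n /=; rewrite geq_max => /andP[n1 n2].
have := h1 n n1; have := h2 n n2.
rewrite (bounded_integralN P (fun w => FM (Zn n w))) hy -EFinN !lee_fin => a1 a2.
by rewrite /= ?hy /= ler_norml; apply/andP; split; lra.
Qed.

End convergence.

Theorem mainTheorem1 (R : realType) (L0 : R -> R)
  (hL0cont : continuous L0) (hL0pos : forall x, 0 < L0 x)
  (hL0right : (\int[@lebesgue_measure R]_(x in `[0%R, +oo[) ((L0 x) ^-2)%:E = +oo)%E)
  (hL0left : (\int[@lebesgue_measure R]_(x in `]-oo, 0%R]) ((L0 x) ^-2)%:E = +oo)%E)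
  (* randomness driving the VRJPs, scale n *)
  (d : measure_display) (T : measurableType d) (P : probability T R)
  (E U : nat -> nat -> T -> R) (hEU : forall n, clocks P (E n) (U n))
  (* driving Brownian motion, Bass--Burdzy flow and occupation densities *)
  (d' : measure_display) (Om : measurableType d') (Q : probability Om R)
  (B : R -> Om -> R) (Psi Lam : R -> R -> Om -> R)
  (hB : brownian_motion Q B)
  (hPsi_adapted : forall y, adapted_to B (fun u => Psi u y))
  (hflow : forall w, bass_burdzy (fun u => B u w) (fun u y => Psi u y w)
                                 (fun u y => Lam u y w)) :
  (forall Tm : R,
     (fun n => P [set w | (vrjp_tmax n L0 (fun k => E n k w) (fun k => U n k w)
                           <= Tm%:E)%E]) @ \oo --> 0%E)
  /\
  converges_in_law P
    (fun n w => (vrjp_X n L0 (fun k => E n k w) (fun k => U n k w),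
                 vrjp_L n L0 (fun k => E n k w) (fun k => U n k w)))
    Q
    (fun w => (lrm_X L0 (fun u => B u w) (fun u y => Psi u y w) (fun u y => Lam u y w),
               lrm_L L0 (fun u => B u w) (fun u y => Psi u y w) (fun u y => Lam u y w))).
Proof.
have S0y := S0_pinfty hL0pos hL0cont hL0right; have S0Ny := S0_ninfty hL0pos hL0cont hL0left.
split; first exact: tmax_cvg.
exact: law_cvg.
Qed.
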